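(* Let $(V,\mathcal Y(z),c,\rho)$ be a graded vertex operator coalgebra with $V_0\nsubseteq\ker c$, $V_2\nsubseteq\ker\rho$ and $\dim C(V)<\infty$. Then $\mathcal L$ (defined in the context) is a functor from the category of $C(V)$-comodules to the category of admissible $V$-comodules such that $\Omega\circ\mathcal L=\mathrm{Id}$, where $\Omega(\mathcal M)=M_0$. Furthermore, $\mathcal L$ sends simple objects to simple objects.
   Context: Conventions: all vector spaces are over $\mathbb C$; $\otimes=\otimes_{\mathbb C}$; $W^*=\mathrm{Hom}(W,\mathbb C)$ and $(\cdot,\cdot)$ is the natural pairing; $\tau(v\otimes w)=w\otimes v$; $V\otimes\mathbb C=\mathbb C\otimes V=V$; $\mathrm{Res}_z$ is the coefficient of $z^{-1}$; $(z_1+z_2)^n=\sum_{i\ge0}\binom{n}{i}z_1^{n-i}z_2^i$; $\delta(x)=\sum_{n\in\mathbb Z}x^n$. Vertex coalgebra: a triple $(V,\mathcal Y(z),c)$ with $V$ a vector space and linear maps $c:V\to\mathbb C$, $\mathcal Y(z):V\to V\otimes V[[z,z^{-1}]]$, $\mathcal Y(z)v=\sum_{k\in\mathbb Z}\Delta_k(v)z^{-k-1}$, such that for all $v\in V$: (i) each $\Delta_k(v)$ is a finite sum (an element of $V\otimes V$) and $\Delta_k(v)=0$ for $k\ll0$; (ii) $(c\otimes\mathrm{Id}_V)\mathcal Y(z)v=v$, $(\mathrm{Id}_V\otimes c)\mathcal Y(z)v\in V[[z]]$ and $\lim_{z\to0}(\mathrm{Id}_V\otimes c)\mathcal Y(z)v=v$;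 (iii) (Jacobi identity) on $V$, $z_0^{-1}\delta(\frac{z_1-z_2}{z_0})(\mathrm{Id}_V\otimes \mathcal Y(z_2))\mathcal Y(z_1)-z_0^{-1}\delta(\frac{z_2-z_1}{-z_0})(\tau\otimes\mathrm{Id}_V)(\mathrm{Id}_V\otimes \mathcal Y(z_1))\mathcal Y(z_2)=z_1^{-1}\delta(\frac{z_2+z_0}{z_1})(\mathcal Y(z_0)\otimes\mathrm{Id}_V)\mathcal Y(z_2)$. It is graded if $V=\oplus_{s\in\mathbb Z}V_s$ with $\dim V_s<\infty$, $V_s=0$ for $s\ll0$, and $\Delta_k(V_s)\subseteq (V\otimes V)_{s+k+1}$, where $(V\otimes V)_t=\oplus_s V_{t-s}\otimes V_s$. Graded vertex operator coalgebra $(V,\mathcal Y(z),c,\rho)$: a graded vertex coalgebra with a linear map $\rho:V\to\mathbb C$ such that, writing $(\rho\otimes\mathrm{Id}_V)\mathcal Y(z)=\sum_{k\in\mathbb Z}L(k)z^{k-2}$, one has $L(k)\in\mathrm{End}(V)$, $[L(k),L(j)]=(k-j)L(k+j)+\frac{k^3-k}{12}\delta_{k+j,0}d$ for some $d\in\mathbb C$, $V_s$ is the eigenspace of $L(0)$ with eigenvalue $s$, and $(L(1)\otimes\mathrm{Id}_V)\mathcal Y(z)=\frac{d}{dz}\mathcal Y(z)$. Convention for $L(0)$-powers: $z^{L(0)}$ and $(1+z)^{L(0)}$ act on $V_s$ as $z^s$ and $(1+z)^s=\sum_{i\ge0}\binom{s}{i}z^i$. Possibly infinite sums in expressions $\mathrm{Res}_z(\varphi(z)^{L(0)}\cdots\otimes\mathrm{Id})\mathcal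 Y(z)v$ (or with $\mathcal Y_{\mathcal M}$) are read componentwise in the bihomogeneous components. Weak $V$-comodule: a vector space $\mathcal M$ with a linear map $\mathcal Y_{\mathcal M}(z)=\sum_{k\in\mathbb Z}\Delta_{\mathcal M,k}z^{-k-1}:\mathcal M\to V\otimes\mathcal M[[z,z^{-1}]]$ such that (i) $\Delta_{\mathcal M,k}(m)$ is a finite sum and vanishes for $k\ll0$; (ii) $(c\otimes\mathrm{Id}_{\mathcal M})\mathcal Y_{\mathcal M}(z)m=m$; (iii) $z_0^{-1}\delta(\frac{z_1-z_2}{z_0})(\mathrm{Id}_V\otimes \mathcal Y_{\mathcal M}(z_2))\mathcal Y_{\mathcal M}(z_1)-z_0^{-1}\delta(\frac{z_2-z_1}{-z_0})(\tau\otimes\mathrm{Id}_{\mathcal M})(\mathrm{Id}_V\otimes \mathcal Y_{\mathcal M}(z_1))\mathcal Y_{\mathcal M}(z_2)=z_1^{-1}\delta(\frac{z_2+z_0}{z_1})(\mathcal Y(z_0)\otimes\mathrm{Id}_{\mathcal M})\mathcal Y_{\mathcal M}(z_2)$; (iv) writing $(\rho\otimes\mathrm{Id}_{\mathcal M})\mathcal Y_{\mathcal M}(z)=\sum_kL(k)z^{k-2}$, the $L(k)\in\mathrm{End}(\mathcal M)$ satisfy the Virasoro relations above; (v) $(L(1)\otimes\mathrm{Id}_{\mathcal M})\mathcal Y_{\mathcal M}(z)=\frac{d}{dz}\mathcal Y_{\mathcal M}(z)=\mathcal Y_{\mathcal M}(z)L(1)-(\mathrm{Id}_V\otimes L(1))\mathcal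 Y_{\mathcal M}(z)$. It is admissible if $\mathcal M=\oplus_{t\in\mathbb N}M_t$ with $\Delta_{\mathcal M,k}(M_t)\subseteq\oplus_{s\in\mathbb N}V_{t+k+1-s}\otimes M_s$. An admissible sub comodule is a subspace that is itself an admissible $V$-comodule under the restricted coaction; $\mathcal M$ is simple if it has no nontrivial admissible sub comodule. A $V$-comodule homomorphism $\psi:\mathcal M^1\to\mathcal M^2$ is a linear map with $(\mathrm{Id}\otimes\psi)\mathcal Y_{\mathcal M^1}(z)=\mathcal Y_{\mathcal M^2}(z)\psi$. $C(V)=\mathrm{Span}\{v\in V\mid \mathrm{Res}_z(\frac{(1+z)^{L(0)}}{z^2}\otimes \mathrm{Id}_V)\mathcal Y(z)v=0\}$; when $\dim C(V)<\infty$ it is a coassociative coalgebra with $\Delta(v)=\mathrm{Res}_z(\frac{(1+z)^{L(0)}}{z}\otimes \mathrm{Id}_V)\mathcal Y(z)v$ and counit $c|_{C(V)}$. The functor $\Omega$ sends an admissible $V$-comodule $\mathcal M$ to $M_0$ with the $C(V)$-coaction $\Delta_{M_0}(m)=\mathrm{Res}_z(z^{L(0)-1}\otimes\mathrm{Id}_{\mathcal M})\mathcal Y_{\mathcal M}(z)m$, and a homomorphism to its restriction to degree $0$. Dual vertex operator algebra (known, when $V_0\nsubseteq\ker c$, $V_2\nsubseteq\ker\rho$): $V'=\oplus_sV_s^*$ with $\mathbf 1=c|_{V_0}$, $\omega=\rho|_{V_2}$, $(Y(f,z)g,v)=(f\otimes g,\mathcal Y(z)v)$; $f\in V_s^*$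 has weight $\mathrm{wt} f=s$. Its Zhu algebra is $A(V')=V'/O(V')$, $O(V')=\mathrm{Span}\{\mathrm{Res}_z\frac{(1+z)^{\mathrm{wt} f}}{z^2}Y(f,z)g\}$, with product $f*g=\mathrm{Res}_z\frac{(1+z)^{\mathrm{wt} f}}{z}Y(f,z)g$; restriction of functionals to $C(V)$ induces a surjective algebra homomorphism $\Phi:A(V')\to C(V)^*$. Construction of $\mathcal L(M)$: for a left $C(V)$-comodule $(M,\Delta_M)$, $\Delta_M(m)=\sum m'\otimes m''$, $M^*$ is a left $C(V)^*$-module by $(f m^* )(m)=\sum f(m')m^*(m'')$, hence an $A(V')$-module via $\Phi$. Let $\widehat{V'}=V'\otimes\mathbb C[t,t^{-1}]/D(V'\otimes\mathbb C[t,t^{-1}])$, $D=L(-1)\otimes1+1\otimes\frac{d}{dt}$, the $\mathbb Z$-graded Lie algebra with $[f\otimes t^m,g\otimes t^n]=\sum_{i\ge0}\binom mi (f_ig)\otimes t^{m+n-i}$, $\deg(f\otimes t^m)=\mathrm{wt} f-m-1$, decomposed as $\widehat{V'}(-)\oplus\widehat{V'}(0)\oplus\widehat{V'}(+)$ (negative, zero, positive degree). $f\otimes t^{\mathrm{wt} f-1}\mapsto f+O(V')$ is a Lie algebra epimorphism $\widehat{V'}(0)\to A(V')$, so $M^*$ is a $\widehat{V'}(0)$-module; let $\widehat{V'}(-)$ act by $0$. Set $U(M^* )=\mathcal U(\widehat{V'})\otimes_{\mathcal U(\widehat{V'}(0)+\widehat{V'}(-))}M^*$, $J=\{x\in U(M^*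 )\mid\langle m^{**},fx\rangle=0\ \forall m^{**}\in M^{**},f\in\mathcal U(\widehat{V'})\}$ (elements of $M^{**}$ are extended to $U(M^* )$ by zero in positive degrees), and $L(M^* )=U(M^* )/J$, an admissible $V'$-module with $Y_{M^*}(f,z)=\sum_k(f\otimes t^k)z^{-k-1}$ and $L(M^* )_0=M^*$. Its restricted dual $L(M^* )'=\oplus_s(L(M^* )_s)^*$ is a $V$-comodule with $(\mathcal Y(z)n^*,f\otimes n)=(n^*,Y_{M^*}(f,z)n)$, and $M\subseteq M^{**}=L(M^* )_0^*\subseteq L(M^* )'$. Let $\mathcal W(M)$ be the smallest sub comodule of $L(M^* )'$ containing $M$, $\mathcal J$ the maximal sub comodule of $\mathcal W(M)$ intersecting $M$ trivially, and $\mathcal L(M)=\mathcal W(M)/\mathcal J$. On morphisms: a $C(V)$-comodule map $\psi:M^1\to M^2$ gives an $A(V')$-module map $\psi^*:(M^2)^*\to(M^1)^*$, hence a $V'$-module map $L((M^2)^* )\to L((M^1)^* )$ and, dually, a $V$-comodule map $\psi^{**}:L((M^1)^* )'\to L((M^2)^* )'$ extending $\psi$; $\mathcal L(\psi):\mathcal L(M^1)\to\mathcal L(M^2)$ is the map induced by $\psi^{**}$. *)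

(* Defs.v *)
From HB Require Import structures.
From mathcomp Require Import all_boot all_order all_algebra.
From mathcomp Require Import generic_quotient ring_quotient.
From mathcomp Require Import mathcomp_extra boolp classical_sets functions.
From mathcomp Require Import cardinality fsbigop.
From mathcomp Require Import reals complex finmap.
From mathcomp Require Import monalg.

Set Implicit Arguments.
Unset Strict Implicit.
Unset Printing Implicit Defensive.

Import Order.TTheory GRing.Theory Num.Theory.
Local Open Scope quotient_scope.
Local Open Scope classical_set_scope.
Local Open Scope ring_scope.

Section LinearAlgebra.
Variable K : numFieldType.

Section Span.
Variable V : lmodType K.

Definition is_subspace (S : set V) : Prop :=
  S 0 /\ forall (a : K) x y, S x -> S y -> S (a *: x + y).

Definition span (S : set V) : set V := smallest is_subspace S.

Definition fin_dim (S : set V) : Prop :=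
  exists e : seq V, S = span [set v | v \in e].

Lemma span_is_subspace S : is_subspace (span S).
Proof.
split=> [T [[T0 _] _]|a x y Sx Sy T TS]; first exact: T0.
by have [[_ TD] _] := TS; exact: TD (Sx T TS) (Sy T TS).
Qed.

Lemma span_gen S : S `<=` span S.
Proof. by move=> x Sx T /= [_ ST]; exact: ST. Qed.

Lemma span_id S : is_subspace S -> span S = S.
Proof. exact: smallest_id. Qed.

Lemma span_sub S T : is_subspace T -> S `<=` T -> span S `<=` T.
Proof. exact: smallest_sub. Qed.

Definition span_pred (S : set V) : {pred V} := fun x => `[< span S x >].

Lemma span_predP S x : reflect (span S x) (x \in span_pred S).
Proof. by apply: (iffP (asboolP _)). Qed.

Fact span_pred_submod S : submod_closed (span_pred S).
Proof.
have [S0 SD] := span_is_subspace S.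
split; first exact/span_predP.
by move=> a x y /span_predP Sx /span_predP Sy; apply/span_predP; exact: SD.
Qed.
HB.instance Definition _ S :=
  GRing.isSubmodClosed.Build K V (span_pred S) (span_pred_submod S).

(* The linear span of [S], as a vector space. *)
Record subsp (S : set V) := Subsp { subval : V; _ : subval \in span_pred S }.
HB.instance Definition _ S := [isSub for @subval S].
HB.instance Definition _ S := [Choice of subsp S by <:].
HB.instance Definition _ S := [SubChoice_isSubLmodule of subsp S by <:].

(* [v] seen in [subsp S]; only meaningful for [v] in the span of [S]. *)
Definition tosub (S : set V) (v : V) : subsp S := insubd 0 v.

Lemma tosubK S v : span S v -> subval (tosub S v) = v.
Proof. by move=> Sv; apply: insubdK; apply/span_predP. Qed.

(* The quotient of [V] by the linear span of [S]. *)
Definition quotby (S : set V) : Type := Quotient.quot (span_pred S).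
HB.instance Definition _ S := GRing.Zmodule.on (quotby S).

Section QuotBy.
Variable S : set V.

Definition cls (v : V) : quotby S := \pi_(Quotient.quot (span_pred S)) v.
Definition rep (x : quotby S) : V :=
  repr (x : Quotient.quot (span_pred S)).

Lemma repK x : cls (rep x) = x. Proof. exact: reprK. Qed.

Lemma clsP x y : cls x = cls y <-> span S (x - y).
Proof.
rewrite (rwP eqP) /cls -Quotient.idealrBE; split; first by move/span_predP.
by move/span_predP.
Qed.

Lemma clsD x y : cls (x + y) = cls x + cls y.
Proof. exact: (raddfD (\pi_(Quotient.quot (span_pred S)))). Qed.

Lemma span_reps (v : V) : span S (rep (cls v) - v).
Proof. by apply/clsP; rewrite repK. Qed.

Definition qscale (a : K) (x : quotby S) : quotby S := cls (a *: rep x).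

Lemma clsZ a x : cls (a *: x) = qscale a (cls x).
Proof.
have [S0 SD] := span_is_subspace S.
apply/esym/clsP; rewrite -scalerBr -[_ *: _]addr0.
exact: SD (span_reps x) S0.
Qed.

Fact qscaleA a b x : qscale a (qscale b x) = qscale (a * b) x.
Proof. by rewrite -[x]repK -!clsZ scalerA. Qed.
Fact qscale1 x : qscale 1 x = x.
Proof. by rewrite -[x]repK -!clsZ scale1r. Qed.
Fact qscaleDr a x y : qscale a (x + y) = qscale a x + qscale a y.
Proof. by rewrite -[x]repK -[y]repK -clsD -!clsZ scalerDr clsD. Qed.
Fact qscaleDl x a b : qscale (a + b) x = qscale a x + qscale b x.
Proof. by rewrite -[x]repK -!clsZ scalerDl clsD. Qed.
HB.instance Definition _ := GRing.Zmodule_isLmodule.Build K (quotby S)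
  qscaleA qscale1 qscaleDr qscaleDl.

Lemma cls_is_linear : linear cls.
Proof. by move=> a x y; rewrite clsD clsZ. Qed.
HB.instance Definition _ := GRing.isLinear.Build K V (quotby S) *:%R cls
  cls_is_linear.

End QuotBy.

(* [f] descends to [quotby S] as [f \o rep] when it kills [S]. *)
Lemma linear_repE (S : set V) (W : lmodType K) (f : V -> W) v :
  linear f -> (forall x, S x -> f x = 0) -> f (rep (cls S v)) = f v.
Proof.
move=> lf fS; pose kf := [set x | f x = 0].
have f0 : f 0 = 0.
  by have := lf (-1) 0 0; rewrite scaler0 addr0 scaleN1r addNr.
have sk : is_subspace kf.
  by split=> // a x y; rewrite /kf /= lf => -> ->; rewrite scaler0 add0r.
have := span_sub sk fS (@span_reps S v); rewrite /kf /= addrC.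
rewrite -scaleN1r lf => /eqP; rewrite scaleN1r addrC subr_eq0.
by move/eqP.
Qed.

End Span.

Arguments cls {V} S v.

(* The linear extension of [h : X -> U] to the free space on [X]. *)
Definition flift (X : choiceType) (U : lmodType K) (h : X -> U)
    (g : {malg K[X]}) : U :=
  \sum_(x <- msupp g) mcoeff x g *: h x.

Definition fgen (X : choiceType) (x : X) : {malg K[X]} := mkmalgU x 1.

Section FreeLift.
Variables (X : choiceType) (U : lmodType K) (h : X -> U).

Lemma fliftEw (d : {fset X}) (g : {malg K[X]}) : (msupp g `<=` d)%fset ->
  flift h g = \sum_(x <- d) mcoeff x g *: h x.
Proof.
move=> le; rewrite /flift; apply: big_fset_incl le _ => x _ /mcoeff_outdom ->.
by rewrite scale0r.
Qed.

Lemma flift_linear : linear (flift h).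
Proof.
move=> a g1 g2; pose d := (msupp (a *: g1 + g2) `|` (msupp g1 `|` msupp g2))%fset.
rewrite (@fliftEw d) ?fsubsetUl//.
rewrite (@fliftEw d g1); last first.
  by rewrite (fsubset_trans (fsubsetUl _ (msupp g2))) ?fsubsetUr.
rewrite (@fliftEw d g2); last first.
  by rewrite (fsubset_trans (fsubsetUr (msupp g1) _)) ?fsubsetUr.
rewrite scaler_sumr -big_split /=; apply: eq_bigr => x _.
by rewrite mcoeffD mcoeffZ scalerDl scalerA.
Qed.

Lemma flift_gen x : flift h (fgen x) = h x.
Proof.
by rewrite (fliftEw (msuppU_le)) big_seq_fset1 mcoeffUU scale1r.
Qed.

End FreeLift.

Section Tensor.
Variables V W : lmodType K.

Definition tens_rel : set {malg K[(V * W)%type]} :=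
  [set z | exists (a : K) (v v' : V) (w : W),
     z = fgen (a *: v + v', w) - a *: fgen (v, w) - fgen (v', w)] `|`
  [set z | exists (a : K) (v : V) (w w' : W),
     z = fgen (v, a *: w + w') - a *: fgen (v, w) - fgen (v, w')].

Definition tens : Type := quotby tens_rel.
HB.instance Definition _ := GRing.Lmodule.on tens.

Definition tpure (v : V) (w : W) : tens := cls tens_rel (fgen (v, w)).

(* The linear map on the tensor product induced by a bilinear map [b]. *)
Definition tlift (U : lmodType K) (b : V -> W -> U) (x : tens) : U :=
  flift (fun p => b p.1 p.2) (rep x).

(* The subspace A (x) B of V (x) W. *)
Definition tsub (A : set V) (B : set W) : set tens :=
  span [set z | exists v w, [/\ A v, B w & z = tpure v w]].

Lemma tpure_linearl w : linear (tpure^~ w).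
Proof.
move=> a v v' /=; rewrite /tpure -linearP; apply/clsP; apply: span_gen; left.
by exists a, v, v', w; rewrite opprD addrA.
Qed.

Lemma tpure_linearr v : linear (tpure v).
Proof.
move=> a w w' /=; rewrite /tpure -linearP; apply/clsP; apply: span_gen; right.
by exists a, v, w, w'; rewrite opprD addrA.
Qed.

Section Universal.
Variables (U : lmodType K) (b : V -> W -> U).
Hypotheses (bl : forall w, linear (b^~ w)) (br : forall v, linear (b v)).

Let bf (p : V * W) := b p.1 p.2.

Let bf_rel z : tens_rel z -> flift bf z = 0.
Proof.
pose F : {linear {malg K[(V * W)%type]} -> U} :=
  HB.pack (flift bf) (GRing.isLinear.Build _ _ _ *:%R _ (flift_linear bf)).
rewrite -[flift bf]/(F : _ -> _).
case=> [[a [v [v' [w ->]]]]|[a [v [w [w' ->]]]]];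
  rewrite !linearB linearZ /= !flift_gen /bf /=.
  by have /= -> := bl w a v v'; rewrite (addrC (a *: _)) addrK subrr.
by rewrite br (addrC (a *: _)) addrK subrr.
Qed.

Lemma tlift_pure v w : tlift b (tpure v w) = b v w.
Proof.
by rewrite /tlift linear_repE ?flift_gen//; exact: flift_linear.
Qed.

Lemma tlift_linear : linear (tlift b).
Proof.
move=> a x y; rewrite -[x]repK -[y]repK /tlift -[_ + _]linearP.
by rewrite !linear_repE//; do ?exact: flift_linear.
Qed.

End Universal.

End Tensor.

Arguments tpure {V W}.

Section TensorMaps.
Variables V V' W W' : lmodType K.

Definition tmap (f : V -> V') (g : W -> W') : tens V W -> tens V' W' :=
  tlift (fun v w => tpure (f v) (g w)).

Definition tcontrl (f : V -> K) : tens V W -> W := tlift (fun v w => f v *: w).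

Definition tcontrr (g : W -> K) : tens V W -> V := tlift (fun v w => g w *: v).

Definition tpair (f : V -> K) (g : W -> K) : tens V W -> K :=
  tlift (U := K^o) (fun v w => f v * g w).

End TensorMaps.

Section TensorMapsTheory.
Variables V V' W W' : lmodType K.

Lemma tmap_pure (f : V -> V') (g : W -> W') v w : linear f -> linear g ->
  tmap f g (tpure v w) = tpure (f v) (g w).
Proof.
move=> lf lg; rewrite /tmap tlift_pure // => [{}w a x y|{}v a x y].
  by rewrite lf tpure_linearl.
by rewrite lg tpure_linearr.
Qed.

Lemma tmap_linear (f : V -> V') (g : W -> W') : linear f -> linear g ->
  linear (tmap f g).
Proof.
move=> lf lg; apply: tlift_linear => [w a x y|v a x y].
  by rewrite lf tpure_linearl.
by rewrite lg tpure_linearr.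
Qed.

Lemma tcontrl_linear (f : V -> K) : scalar f -> linear (@tcontrl V W f).
Proof.
move=> sf; apply: tlift_linear => [w a x y|v a x y].
  by rewrite sf scalerDl scalerA.
by rewrite scalerDr !scalerA mulrC.
Qed.

Lemma tpair_pure (f : V -> K) (g : W -> K) v w : scalar f -> scalar g ->
  tpair f g (tpure v w) = f v * g w.
Proof.
move=> sf sg; rewrite /tpair tlift_pure // => [{}w a x y|{}v a x y].
  by rewrite sf mulrDl -mulrA.
by rewrite sg mulrDr mulrCA.
Qed.

Lemma tpair_scalar (f : V -> K) (g : W -> K) : scalar f -> scalar g ->
  scalar (@tpair V W f g).
Proof.
move=> sf sg.
apply: (@tlift_linear V W K^o (fun v w => f v * g w)) => [w a x y|v a x y].
  by rewrite sf mulrDl -mulrA.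
by rewrite sg mulrDr mulrCA.
Qed.

End TensorMapsTheory.

Definition tassoc (V1 V2 W : lmodType K) :
    tens (tens V1 V2) W -> tens V1 (tens V2 W) :=
  tlift (fun x w => tlift (fun v1 v2 => tpure v1 (tpure v2 w)) x).

Definition tflip12 (V1 V2 W : lmodType K) :
    tens V1 (tens V2 W) -> tens V2 (tens V1 W) :=
  tlift (fun v1 y => tlift (fun v2 w => tpure v2 (tpure v1 w)) y).

Section Gradings.
Variables (I : choiceType) (V : lmodType K) (G : I -> set V).

Definition decomposes (v : V) (x : I -> V) : Prop :=
  [/\ forall s, G s (x s), finite_set [set s | x s != 0] &
      v = \sum_(s \in [set: I]) x s].

Definition direct_sum : Prop :=
  (forall s, is_subspace (G s)) /\ forall v, exists! x, decomposes v x.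

(* The projection onto the component of index [s]. *)
Definition gproj (s : I) (v : V) : V := xget (fun=> 0) (decomposes v) s.

End Gradings.

Section Duals.
Variable V : lmodType K.

Definition functional : set (V -> K^o) := [set f | scalar f].

Definition dual : Type := subsp functional.
HB.instance Definition _ := GRing.Lmodule.on dual.

(* The restricted dual of a graded space, that is, the direct sum of the duals
   of its graded components: a family of functionals on the components, almost
   all zero, is a functional vanishing on almost all components. *)
Definition rfunctional (I : choiceType) (G : I -> set V) : set (V -> K^o) :=
  [set f | scalar f /\ finite_set [set s | exists2 v, G s v & f v != 0]].

Definition rdual (I : choiceType) (G : I -> set V) : Type :=
  subsp (rfunctional G).
HB.instance Definition _ I G := GRing.Lmodule.on (@rdual I G).

(* The component (V_s)^* of the restricted dual. *)
Definition rdual_grade (I : choiceType) (G : I -> set V) (s : I) :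
    set (rdual G) :=
  [set f | forall r, r != s -> forall v, G r v -> subval f v = 0].

(* [f], as an element of the (restricted) dual; only meaningful when [f] is
   linear (and vanishes on almost all components). *)
Definition mkdual (f : V -> K) : dual := tosub functional (f : V -> K^o).
Definition mkrdual (I : choiceType) (G : I -> set V) (f : V -> K) : rdual G :=
  tosub (rfunctional G) (f : V -> K^o).

Lemma functional_is_subspace : is_subspace functional.
Proof.
split=> [a x y|a f g sf sg b x y] /=; first by rewrite mulr0 addr0.
rewrite !fctE sf sg !scalerDr mulrDr addrACA.
by rewrite /GRing.scale /= !mulrA (mulrC a b).
Qed.

Lemma rfunctional_is_subspace (I : choiceType) (G : I -> set V) :
  is_subspace (rfunctional G).
Proof.
have [f0 fD] := functional_is_subspace; split.
  split=> //; apply: (@sub_finite_set _ _ set0) => // s [v _] /=.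
  by rewrite eqxx.
move=> a f g [sf ff] [sg fg]; split; first exact: fD.
have fin : finite_set ([set s | exists2 v, G s v & f v != 0] `|`
    [set s | exists2 v, G s v & g v != 0]) by rewrite finite_setU.
apply: sub_finite_set fin => s [v Gv /= nz].
have [fv0|fv0] := eqVneq (f v) 0; last by left; exists v.
right; exists v => //; apply: contra nz => /eqP gv0.
by rewrite !fctE /= gv0 fv0 scaler0 addr0.
Qed.

Lemma dualP (f : dual) : scalar (subval f).
Proof.
by case: f => f /= /span_predP; rewrite span_id//; exact: functional_is_subspace.
Qed.

Lemma rdualP (I : choiceType) (G : I -> set V) (f : rdual G) :
  rfunctional G (subval f).
Proof.
by case: f => f /= /span_predP; rewrite span_id//; exact: rfunctional_is_subspace.
Qed.

End Duals.

(* The binomial coefficient [n (n-1) ... (n-i+1) / i!] of an integer [n]. *)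
Definition zbin (n : int) (i : nat) : K :=
  (\prod_(j < i) (n%:~R - j%:R)) / i`!%:R.

End LinearAlgebra.

Arguments cls {K V} S v.
Arguments tpure {K V W}.
Arguments tosub {K V} S v.
Arguments zbin {K}.

Section VertexCoalgebras.
Variable K : numFieldType.

(* A field [Y(z) x = \sum_k D k x z^{-k-1}] is given by its modes
   [D : int -> M -> V (x) M].  [jacobi DV DM x] is the coefficient of
   [z0^{-l-1} z1^{-m-1} z2^{-n-1}], for all [l], [m], [n], in
     z0^{-1} delta((z1 - z2)/z0) (Id (x) YM(z2)) YM(z1) x
     - z0^{-1} delta((z2 - z1)/(- z0)) (tau (x) Id) (Id (x) YM(z1)) YM(z2) x
     = z1^{-1} delta((z2 + z0)/z1) (Y(z0) (x) Id) YM(z2) x,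
   binomials being expanded in nonnegative powers of their second term:
     z0^{-1} delta((z1 - z2)/z0)
       = \sum_l \sum_(i >= 0) (-1)^i 'C(l, i) z0^{-l-1} z1^{l-i} z2^i,
     z0^{-1} delta((z2 - z1)/(- z0))
       = \sum_l \sum_(i >= 0) (-1)^(l+i) 'C(l, i) z0^{-l-1} z2^{l-i} z1^i,
     z1^{-1} delta((z2 + z0)/z1)
       = \sum_m \sum_(i >= 0) 'C(m, i) z1^{-m-1} z2^{m-i} z0^i.
   The sums over [i] have finite support as soon as [DM k x = 0] for k << 0. *)
Definition jacobi (V M : lmodType K) (DV : int -> V -> tens V V)
    (DM : int -> M -> tens V M) (x : M) : Prop :=
  forall l m n : int,
    \sum_(i \in [set: nat]) ((-1) ^+ i * zbin l i) *:
        tmap id (DM (n + i%:Z)) (DM (m + l - i%:Z) x)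
    - \sum_(i \in [set: nat]) ((-1) ^ (l + i%:Z) * zbin l i) *:
        tflip12 (tmap id (DM (m + i%:Z)) (DM (n + l - i%:Z) x))
    = \sum_(i \in [set: nat]) zbin m i *:
        tassoc (tmap (DV (l + i%:Z)) id (DM (m + n - i%:Z) x)).

(* [L(k)], where (rho (x) Id) Y(z) = \sum_k L(k) z^{k-2}. *)
Definition vir (V M : lmodType K) (rho : V -> K) (D : int -> M -> tens V M)
    (k : int) (x : M) : M :=
  tcontrl rho (D (1 - k) x).

Definition virasoro (M : lmodType K) (L : int -> M -> M) (d : K) : Prop :=
  forall (k j : int) (x : M),
    L k (L j x) - L j (L k x) =
    (k - j)%:~R *: L (k + j) x
    + (if k + j == 0 then (k ^+ 3 - k)%:~R / 12%:R * d else 0) *: x.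

(* The component of degree [t] of V (x) M, an index [s] of the grading of [M]
   having degree [deg s]. *)
Definition tens_grade (V M : lmodType K) (GV : int -> set V) (I : Type)
    (deg : I -> int) (GM : I -> set M) (t : int) : set (tens V M) :=
  span [set z | exists s x y,
          [/\ GV (t - deg s) x, GM s y & z = tpure x y]].

Record is_vertex_coalgebra (V : lmodType K) (D : int -> V -> tens V V)
    (c : V -> K) : Prop := IsVertexCoalgebra {
  vc_linear : forall k, linear (D k);
  vc_counit_linear : scalar c;
  vc_truncation : forall v, exists N : int, forall k, k < N -> D k v = 0;
  vc_counitl : forall k v, tcontrl c (D k v) = if k == -1 then v else 0;
  vc_counitr : forall k v, 0 <= k -> tcontrr c (D k v) = 0;
  vc_counitr_lim : forall v, tcontrr c (D (-1) v) = v;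
  vc_jacobi : forall v, jacobi D D v }.

Record is_graded (V : lmodType K) (D : int -> V -> tens V V)
    (G : int -> set V) : Prop := IsGraded {
  gr_direct_sum : direct_sum G;
  gr_fin_dim : forall s, fin_dim (G s);
  gr_bounded : exists N : int, forall s, s < N -> G s = [set 0];
  gr_degree : forall k s v, G s v -> tens_grade G id G (s + k + 1) (D k v) }.

Record is_conformal (V : lmodType K) (D : int -> V -> tens V V)
    (G : int -> set V) (rho : V -> K) (d : K) : Prop := IsConformal {
  cf_linear : scalar rho;
  cf_virasoro : virasoro (vir rho D) d;
  cf_eigenspace : forall s, G s = [set v | vir rho D 0 v = s%:~R *: v];
  cf_derivative : forall k v,
    tmap (vir rho D 1) id (D k v) = - k%:~R *: D (k - 1) v }.

(* Graded vertex operator coalgebras. *)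
Record gvoc : Type := Gvoc {
  voc_space :> lmodType K;
  comode : int -> voc_space -> tens voc_space voc_space;
  counit : voc_space -> K;
  rho : voc_space -> K;
  grade : int -> set voc_space;
  charge : K;
  voc_vertex : is_vertex_coalgebra comode counit;
  voc_graded : is_graded comode grade;
  voc_conformal : is_conformal comode grade rho charge }.

Section Comodules.
Variable V : gvoc.

Local Notation L := (vir (@rho V) (@comode V)).
Local Notation P := (gproj (@grade V)).

(* The data of an admissible V-comodule, without its axioms. *)
Record precomod : Type := Precomod {
  pc_space :> lmodType K;
  pc_mode : int -> pc_space -> tens V pc_space;
  pc_grade : nat -> set pc_space }.

Record is_weak_comodule (M : lmodType K) (D : int -> M -> tens V M) : Prop :=
  IsWeakComodule {
  wc_linear : forall k, linear (D k);
  wc_truncation : forall x, exists N : int, forall k, k < N -> D k x = 0;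
  wc_counit : forall k x,
    tcontrl (@counit V) (D k x) = if k == -1 then x else 0;
  wc_jacobi : forall x, jacobi (@comode V) D x;
  wc_virasoro : virasoro (vir (@rho V) D) (charge V);
  wc_derivative : forall k x, tmap (L 1) id (D k x) = - k%:~R *: D (k - 1) x;
  wc_commutator : forall k x,
    - k%:~R *: D (k - 1) x =
    D k (vir (@rho V) D 1 x) - tmap id (vir (@rho V) D 1) (D k x) }.

Record is_admissible (N : precomod) : Prop := IsAdmissible {
  ad_weak : is_weak_comodule (@pc_mode N);
  ad_direct_sum : direct_sum (@pc_grade N);
  ad_degree : forall k t x, pc_grade t x ->
    tens_grade (@grade V) Posz (@pc_grade N) (t%:Z + k + 1) (pc_mode k x) }.

Definition is_comod_hom (N1 N2 : precomod) (psi : N1 -> N2) : Prop :=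
  linear psi /\
  forall k x, tmap id psi (pc_mode k x) = pc_mode k (psi x).

(* A subspace [A] with the restricted coaction; [pc_mode k x] is the element
   of V (x) A with image [pc_mode k x] in V (x) N, when there is one. *)
Definition sub_precomod (N : precomod) (A : set N) : precomod :=
  @Precomod (subsp A)
    (fun k x => xget 0 [set y | tmap id (@subval _ _ A) y
                                 = pc_mode k (subval x)])
    (fun t => [set x | pc_grade t (subval x)]).

Definition is_admissible_sub (N : precomod) (A : set N) : Prop :=
  [/\ is_subspace A,
      forall k x, A x -> tsub setT A (pc_mode k x) &
      is_admissible (sub_precomod A)].

Definition quot_precomod (N : precomod) (A : set N) : precomod :=
  @Precomod (quotby A)
    (fun k x => tmap id (cls A) (pc_mode k (rep x)))
    (fun t => cls A @` pc_grade t).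

Definition is_simple_comod (N : precomod) : Prop :=
  forall A : set N, is_admissible_sub A -> A = [set 0] \/ A = setT.

(* The bihomogeneous component of degrees [s], [t] of
   Res_z ((1+z)^{L(0)} / z^j (x) Id) Y(z) v. *)
Definition zhu_res (j : nat) (s t : int) (v : V) : tens V V :=
  \sum_(i \in [set: nat])
     zbin s i *: tmap (P s) (P t) (comode (i%:Z - j%:Z) v).

Definition CV : set V :=
  span [set v | forall s t, zhu_res 2 s t v = 0].

(* Left comodules over the coalgebra [CV], whose coproduct
   Res_z ((1+z)^{L(0)} / z (x) Id) Y(z) has bihomogeneous components
   [zhu_res 1 s t]; coassociativity is stated on these components. *)
Record ccomod : Type := Ccomod {
  cc_space :> lmodType K;
  cc_coact : cc_space -> tens V cc_space;
  cc_linear : linear cc_coact;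
  cc_range : forall m, tsub CV setT (cc_coact m);
  cc_coassoc : forall (s t : int) m,
    tassoc (tmap (zhu_res 1 s t) id (cc_coact m)) =
    tmap (P s) (tmap (P t) id) (tmap id cc_coact (cc_coact m));
  cc_counit : forall m, tcontrl (@counit V) (cc_coact m) = m }.

Definition is_ccomod_hom (M1 M2 : ccomod) (psi : M1 -> M2) : Prop :=
  linear psi /\
  forall m, tmap id psi (cc_coact m) = cc_coact (psi m).

Definition is_simple_ccomod (M : ccomod) : Prop :=
  forall A : set M, is_subspace A ->
    (forall m, A m -> tsub CV A (cc_coact m)) -> A = [set 0] \/ A = setT.

(* [iota] is an isomorphism from the C(V)-comodule [M] onto Omega(N), which is
   the degree 0 part of [N] with the coaction
   Res_z (z^{L(0)-1} (x) Id) Y(z), here compared on bihomogeneous components: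
   z^{L(0)} being z^s on V_s, only the mode s - 1 contributes. *)
Definition is_Omega (N : precomod) (M : ccomod) (iota : M -> N) : Prop :=
  [/\ linear iota, injective iota, range iota = pc_grade 0 &
      forall (m : M) (s : int) (t : nat),
        tmap (P s) (gproj (@pc_grade N) t) (tmap id iota (cc_coact m)) =
        tmap (P s) (gproj (@pc_grade N) t) (pc_mode (s - 1) (iota m))].

(* The dual vertex operator algebra V', of which only the products, the
   operator L(-1) and the weights are needed. *)
Definition dualV : Type := rdual (@grade V).
HB.instance Definition _ := GRing.Lmodule.on dualV.

Definition wt_space (s : int) : set dualV := @rdual_grade _ _ _ (@grade V) s.

(* [f_k g], where (Y(f, z) g, v) = (f (x) g, Y(z) v). *)
Definition vprod (f : dualV) (k : int) (g : dualV) : dualV :=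
  mkrdual _ (fun v => tpair (subval f) (subval g) (comode k v)).

(* L(-1) on V' is the transpose of L(1): the conformal vector is [rho] and
   (Y(rho, z) f, v) = (f, (rho (x) Id) Y(z) v). *)
Definition vtrans (f : dualV) : dualV :=
  mkrdual _ (fun v => subval f (L 1 v)).

Lemma vprodE f k g v :
  subval (vprod f k g) v = tpair (subval f) (subval g) (comode k v).
Proof.
rewrite /vprod /mkrdual tosubK //; apply: span_gen.
have [sf ff] := rdualP f; have [sg fg] := rdualP g.
have st := tpair_scalar sf sg.
split=> [a x y|]; first by rewrite (vc_linear (voc_vertex V)) st.
have := finite_image (fun p : int * int => p.1 + p.2 - k - 1)
  (finite_setX ff fg).
apply: sub_finite_set => s [x Gx]; apply: contraPP => nS.
suff : [set z | tpair (subval f) (subval g) z = 0] (comode k x).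
  by move=> /= ->; rewrite eqxx.
have [_ _ _ /(_ k s x Gx)] := voc_graded V.
move: (comode k x); apply: span_sub.
  split=> [|a y z /= y0 z0]; last by rewrite st y0 z0 mulr0 addr0.
  by have /= := st (-1) 0 0; rewrite scaler0 addr0 mulN1r addNr.
move=> z [r [y [y' [Gy Gy' ->]]]] /=; rewrite tpair_pure //.
have [->|fy] := eqVneq (subval f y) 0; first by rewrite mul0r.
have [->|gy] := eqVneq (subval g y') 0; first by rewrite mulr0.
exfalso; apply: nS; exists (s + k + 1 - r, r) => /=.
  by split; [exists y|exists y'].
by rewrite subrK addrAC !addrK.
Qed.

Lemma vir_linear k : linear (L k).
Proof.
move=> a x y; rewrite /vir (vc_linear (voc_vertex V)).
exact: tcontrl_linear (cf_linear (voc_conformal V)) _ _ _.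
Qed.

Lemma vir1_grade s v : grade s v -> grade (s - 1) (L 1 v).
Proof.
rewrite !(cf_eigenspace (voc_conformal V)) /= => Lv.
have := cf_virasoro (voc_conformal V) 0 1 v.
have -> : L 1 (L 0 v) = s%:~R *: L 1 v.
  have := vir_linear 1 s%:~R v 0; rewrite Lv addr0 => ->.
  have := vir_linear 1 (-1) 0 0; rewrite scaler0 addr0 scaleN1r addNr => ->.
  by rewrite addr0.
rewrite add0r sub0r /= scale0r addr0 => /eqP; rewrite subr_eq => /eqP ->.
by rewrite -scalerDl intrB mulrNz addrC.
Qed.

Lemma vtransE f v : subval (vtrans f) v = subval f (L 1 v).
Proof.
rewrite /vtrans /mkrdual tosubK //; apply: span_gen.
have [sf ff] := rdualP f.
split=> [a x y|]; first by rewrite vir_linear sf.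
apply: sub_finite_set (finite_image (fun s => s + 1) ff) => s [x Gx fx].
by exists (s - 1); rewrite ?subrK//; exists (L 1 x) => //; exact: vir1_grade.
Qed.

(* The Lie algebra hat V' = V' (x) C[t, t^-1] / D (V' (x) C[t, t^-1]). *)
Definition laurent : Type := {malg K[int]}.
HB.instance Definition _ := GRing.Lmodule.on laurent.

Definition tpow (n : int) : laurent := fgen K n.

Definition ddt : laurent -> laurent := flift (fun n => n%:~R *: tpow (n - 1)).

Definition hatD (x : tens dualV laurent) : tens dualV laurent :=
  tmap vtrans id x + tmap id ddt x.

Definition hatV : Type := quotby (range hatD).
HB.instance Definition _ := GRing.Lmodule.on hatV.

(* The class of f (x) t^k. *)
Definition hgen (f : dualV) (k : int) : hatV :=
  cls (range hatD) (tpure f (tpow k)).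

(* [f (x) t^m, g (x) t^n] *)
Definition hbracket (f : dualV) (m : int) (g : dualV) (n : int) : hatV :=
  \sum_(i \in [set: nat]) zbin m i *: hgen (vprod f i%:Z g) (m + n - i%:Z).

Definition hat_grade (d : int) : set hatV :=
  span [set x | exists s f k,
          [/\ wt_space s f, s - k - 1 = d & x = hgen f k]].

(* The universal enveloping algebra of hat V': words in hat V', modulo
   multilinearity and xy - yx = [x, y] for the generators x, y. *)
Definition env_rel : set {malg K[seq hatV]} :=
  [set z | exists (u w : seq hatV) (a : K) (x y : hatV),
     z = fgen K (u ++ a *: x + y :: w) - a *: fgen K (u ++ x :: w)
         - fgen K (u ++ y :: w)] `|`
  [set z | exists (u w : seq hatV) (f g : dualV) (m n : int),
     z = fgen K (u ++ hgen f m :: hgen g n :: w)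
         - fgen K (u ++ hgen g n :: hgen f m :: w)
         - fgen K (u ++ hbracket f m g n :: w)].

Definition env : Type := quotby env_rel.
HB.instance Definition _ := GRing.Lmodule.on env.

Definition eword (u : seq hatV) : env := cls env_rel (fgen K u).

Definition emul (a b : env) : env :=
  flift (fun u => flift (fun w => eword (u ++ w)) (rep b)) (rep a).

Section Construction.
Variable M : ccomod.

Definition dualM : Type := dual M.
HB.instance Definition _ := GRing.Lmodule.on dualM.

(* The action of A(V') on M^*: the map A(V') -> C(V)^* is the restriction of
   functionals and (f mu)(m) = \sum f(m') mu(m''). *)
Definition dact (f : dualV) (mu : dualM) : dualM :=
  mkdual (fun m => tpair (subval f) (subval mu) (cc_coact m)).

Lemma dactE f mu m :
  subval (dact f mu) m = tpair (subval f) (subval mu) (cc_coact m).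
Proof.
rewrite /dact /mkdual tosubK //; apply: span_gen => a x y.
have [sf _] := rdualP f.
by rewrite cc_linear; exact: tpair_scalar sf (dualP mu) _ _ _.
Qed.

(* U(M^* ), induced from the subalgebra of degree <= 0, on which f (x) t^{s-1}
   with f of weight s acts as the class of f in A(V'), and elements of negative
   degree act as 0. *)
Definition ind_rel : set (tens env dualM) :=
  [set z | exists (a : env) (s : int) (f : dualV) (mu : dualM),
     wt_space s f /\
     z = tpure (emul a (eword [:: hgen f (s - 1)])) mu - tpure a (dact f mu)]
  `|`
  [set z | exists (a : env) (s k : int) (f : dualV) (mu : dualM),
     [/\ wt_space s f, s - k - 1 < 0 &
         z = tpure (emul a (eword [:: hgen f k])) mu]].

Definition indM : Type := quotby ind_rel.
HB.instance Definition _ := GRing.Lmodule.on indM.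

Definition ipure (a : env) (mu : dualM) : indM := cls ind_rel (tpure a mu).

Definition eact (a : env) (x : indM) : indM :=
  cls ind_rel (tmap (emul a) id (rep x)).

Definition ind_grade (d : int) : set indM :=
  span [set x | exists (hs : seq (hatV * int)) (mu : dualM),
          [/\ forall h, h \in hs -> hat_grade h.2 h.1,
              \sum_(h <- hs) h.2 = d &
              x = ipure (eword [seq h.1 | h <- hs]) mu]].

(* An element of M^** extended by zero in positive degrees is the same as a
   functional [phi] on U(M^* ) vanishing in positive degrees. *)
Definition ind_rad : set indM :=
  [set x | forall phi : indM -> K, scalar phi ->
     (forall d, 0 < d -> forall y, ind_grade d y -> phi y = 0) ->
     forall a, phi (eact a x) = 0].

(* L(M^* ), an admissible V'-module. *)
Definition LM : Type := quotby ind_rad.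
HB.instance Definition _ := GRing.Lmodule.on LM.

Definition LM_grade (t : nat) : set LM := cls ind_rad @` ind_grade t%:Z.

(* The mode [f_k] of Y(f, z), that is, the action of f (x) t^k. *)
Definition LM_mode (f : dualV) (k : int) (x : LM) : LM :=
  cls ind_rad (eact (eword [:: hgen f k]) (rep x)).

Definition LM_top (mu : dualM) : LM := cls ind_rad (ipure (eword [::]) mu).

(* L(M^* )' with its V-comodule structure. *)
Definition LMd : Type := rdual LM_grade.
HB.instance Definition _ := GRing.Lmodule.on LMd.

Definition LMd_coact_spec (k : int) (n : LMd) : set (tens V LMd) :=
  [set x | forall (f : dualV) (y : LM),
     tpair (subval f) (fun phi : LMd => subval phi y) x
     = subval n (LM_mode f k y)].

Definition LMd_precomod : precomod :=
  @Precomod LMd (fun k n => xget 0 (LMd_coact_spec k n))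
    (fun t => @rdual_grade _ _ _ LM_grade t).

(* The image of [m] under M <= M^** = L(M^* )_0^* <= L(M^* )'. *)
Definition M_emb_spec (m : M) : set LMd :=
  [set phi | (forall mu, subval phi (LM_top mu) = subval mu m) /\
     @rdual_grade _ _ _ LM_grade 0%N phi].

Definition M_emb (m : M) : LMd := xget 0 (M_emb_spec m).

(* W(M) *)
Definition calW : set LMd :=
  smallest (@is_admissible_sub LMd_precomod) (range M_emb).

Definition calW_precomod : precomod := @sub_precomod LMd_precomod calW.

(* The sum of the sub comodules of W(M) which intersect M trivially. *)
Definition calJ : set calW_precomod :=
  span (\bigcup_(A in [set A : set calW_precomod |
      is_admissible_sub A /\
      forall x, A x -> range M_emb (subval x) -> x = 0]) A).

Definition calL : precomod := @quot_precomod calW_precomod calJ.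

Definition calL_unit (m : M) : calL := cls calJ (tosub calW (M_emb m)).

End Construction.

Section Morphisms.
Variables (M1 M2 : ccomod) (psi : M1 -> M2).

Definition dual_map (mu : dualM M2) : dualM M1 :=
  mkdual (fun m => subval mu (psi m)).

(* The map L((M2)^* ) -> L((M1)^* ) induced by psi^*. *)
Definition ind_map (x : indM M2) : indM M1 :=
  cls (@ind_rel M1) (tmap id dual_map (rep x)).

Definition LM_map (x : LM M2) : LM M1 := cls (@ind_rad M1) (ind_map (rep x)).

(* psi^** *)
Definition LMd_map (n : LMd M1) : LMd M2 :=
  mkrdual _ (fun x => subval n (LM_map x)).

Definition calL_map (x : calL M1) : calL M2 :=
  cls (@calJ M2) (tosub (@calW M2) (LMd_map (subval (rep x)))).

Lemma dual_mapE mu m : linear psi -> subval (dual_map mu) m = subval mu (psi m).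
Proof.
move=> lpsi; rewrite /dual_map /mkdual tosubK //; apply: span_gen => a x y.
by rewrite lpsi; exact: (dualP mu).
Qed.

End Morphisms.

(* The definition of [calL] is meaningful: the coaction on L(M^* )' and the
   embedding of M exist, W(M) is a sub comodule, there is a largest sub comodule
   of W(M) intersecting M trivially, and psi^** exists and induces a map
   between the quotients. *)
Record calL_well_defined : Prop := CalLWellDefined {
  wd_coact : forall (M : ccomod) (k : int) (n : LMd M),
    LMd_coact_spec k n (@pc_mode (LMd_precomod M) k n);
  wd_emb : forall (M : ccomod) (m : M), M_emb_spec m (M_emb m);
  wd_W : forall M : ccomod, @is_admissible_sub (LMd_precomod M) (@calW M);
  wd_J : forall M : ccomod, is_admissible_sub (@calJ M);
  wd_J_cap : forall (M : ccomod) (x : calW_precomod M),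
    calJ x -> range (@M_emb M) (subval x) -> x = 0;
  wd_ind_map : forall (M1 M2 : ccomod) (psi : M1 -> M2), is_ccomod_hom psi ->
    forall a mu, ind_map psi (ipure a mu) = ipure a (dual_map psi mu);
  wd_LM_map : forall (M1 M2 : ccomod) (psi : M1 -> M2), is_ccomod_hom psi ->
    forall x, LM_map psi (cls (@ind_rad M2) x) = cls _ (ind_map psi x);
  wd_LMd_map : forall (M1 M2 : ccomod) (psi : M1 -> M2), is_ccomod_hom psi ->
    forall n y, subval (LMd_map psi n) y = subval n (LM_map psi y);
  wd_map_W : forall (M1 M2 : ccomod) (psi : M1 -> M2), is_ccomod_hom psi ->
    forall n, calW n -> calW (LMd_map psi n);
  wd_map_J : forall (M1 M2 : ccomod) (psi : M1 -> M2), is_ccomod_hom psi ->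
    forall x, calJ x -> calJ (tosub (@calW M2) (LMd_map psi (subval x))) }.

End Comodules.

End VertexCoalgebras.

Arguments counit {K} g.
Arguments rho {K} g.
Arguments grade {K} g.
Arguments CV {K} V.

(* Main.v *)
From HB Require Import structures.
From mathcomp Require Import all_boot all_order all_algebra.
From mathcomp Require Import mathcomp_extra boolp classical_sets functions.
From mathcomp Require Import cardinality fsbigop.
From mathcomp Require Import reals complex finmap.
From mathcomp Require Import monalg zify ring.
Require Import Defs.

Set Implicit Arguments.
Unset Strict Implicit.
Unset Printing Implicit Defensive.

Import Order.TTheory GRing.Theory Num.Theory.
Local Open Scope classical_set_scope.
Local Open Scope ring_scope.

(** The comodule $\mathcal L(M)$ is built by transposition from the module
    $L(M^\ast)$ over the dual vertex algebra $V^\prime$; most of the work is to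
    show that $L(M^\ast)$ is a graded module whose degree $0$ part is $M^\ast$.

    Elements $f \otimes g \otimes y$ of the duals detect zero in tensor products,
    so the Jacobi identity of a coaction is equivalent to the Borcherds
    identities for the transposed modes ([borch_of_jacobi], [jacobi_of_borch]).
    Applied to $V$ this makes $V^\prime$ a vertex algebra with vacuum $c$ and
    conformal vector $\rho$ ([vprod_borch], [vprod_omg]), hence
    $\widehat{V^\prime}$ a Lie algebra ([hbr_anti], [hbr_jacobi]).
    Coassociativity of a $C(V)$-coaction on $M$ says that $V^\prime$ acts on
    $M^\ast$ through the Zhu product ([dact_star]); with skew symmetry this is
    an action of the degree $0$ part of $\widehat{V^\prime}$
    ([dact_commutator]).

    To control the induced module $U(M^\ast)$ one computes the degree $0$
    component of a word applied to $M^\ast$ by moving letters of negative degree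
    to the right ([vev]). This respects the defining relations
    ([vev_commutator], [vev_rcons_zero], [vev_rcons_neg]), so it is a projection
    $U(M^\ast) \to M^\ast$. Nothing lives in negative degree and degree $0$ is
    exactly $M^\ast$ ([word_nonpos]); the radical $J$ consists of the vectors all
    of whose translates project to zero ([ind_radP]), and the quotient is graded
    ([qgrade_ds]).

    On $L(M^\ast)$ the commutator formula holds by construction, and it remains
    to prove associativity ([borch_all]). The span of the associators is a
    submodule ([assoc_adjoint]). Its projection to degree $0$ vanishes, because
    creation operators never reach degree $0$, and on $M^\ast$ itself an
    associator measures the failure of the Zhu product to act by composition
    ([assoc_E], [assoc_top]). A submodule projecting to zero is zero, so
    associators vanish. Finite dimension of the $V_s$ gives the coaction on the
    restricted dual ([rd_spec_ex]), and transposing gives its axioms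
    ([rd_admissible]).

    Operators of degree $0$ on $M^\ast$ coming from words are transposes of
    operators on $M$ ([vevM_transpose]). Hence the functionals on $L(M^\ast)$ all
    of whose transposed words restrict in degree $0$ to elements of $M$ form a
    sub comodule; it contains $\mathcal W(M)$, whose degree $0$ part is therefore
    $M$ ([calW_grade0]). Sub comodules are graded, so those meeting $M$ trivially
    have no degree $0$ part and their sum does not either ([calJ_grade0]): the
    degree $0$ part of $\mathcal L(M)$ is $M$ with its coaction ([calL_Omega]).
    All maps induced by $\psi$ are determined by $\psi^\ast$ on words, and
    graded maps of comodules respect $\mathcal W$ and $\mathcal J$, which gives
    functoriality. Finally, the degree $0$ part of a sub comodule of
    $\mathcal L(M)$ is a sub comodule of $M$ ([top_subcomodule]); when it is all
    of $M$ the sub comodule is everything, since $M$ generates, and when it is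
    zero the sub comodule is zero, since $\mathcal J$ was divided out. *)

(** * Linear maps, subspaces and functionals *)

Section LinearMaps.
Variable K : numFieldType.

Section OneMap.
Variables (U W : lmodType K) (f : U -> W).
Hypothesis lf : linear f.

Lemma lin0 : f 0 = 0.
Proof. by have := lf (-1) 0 0; rewrite scaler0 addr0 scaleN1r addNr. Qed.

Lemma linZ a x : f (a *: x) = a *: f x.
Proof. by have := lf a x 0; rewrite lin0 !addr0. Qed.

Lemma linD x y : f (x + y) = f x + f y.
Proof. by have := lf 1 x y; rewrite !scale1r. Qed.

Lemma linN x : f (- x) = - f x.
Proof. by rewrite -scaleN1r linZ scaleN1r. Qed.

Lemma linB x y : f (x - y) = f x - f y.
Proof. by rewrite linD linN. Qed.

Lemma lin_sum I (r : seq I) (P : pred I) (F : I -> U) :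
  f (\sum_(i <- r | P i) F i) = \sum_(i <- r | P i) f (F i).
Proof. exact: (big_morph f linD lin0). Qed.

End OneMap.

Lemma lin_comp (U W X : lmodType K) (f : U -> W) (g : W -> X) :
  linear f -> linear g -> linear (g \o f).
Proof. by move=> lf lg a x y; rewrite /= lf lg. Qed.

Lemma lin_id (U : lmodType K) : linear (@id U).
Proof. by []. Qed.

Lemma lin_sumf (U W : lmodType K) I (r : seq I) (P : pred I) (F : I -> U -> W) :
  (forall i, P i -> linear (F i)) -> linear (fun x => \sum_(i <- r | P i) F i x).
Proof.
move=> lF a x y; rewrite scaler_sumr -big_split /=.
by apply: eq_bigr => i Pi; rewrite lF.
Qed.

Lemma lin_scale (U W : lmodType K) (c : K) (f : U -> W) :
  linear f -> linear (fun x => c *: f x).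
Proof. by move=> lf a x y; rewrite lf scalerDr !scalerA mulrC. Qed.

Lemma lin_add (U W : lmodType K) (f g : U -> W) :
  linear f -> linear g -> linear (fun x => f x + g x).
Proof. by move=> lf lg a x y; rewrite lf lg scalerDr addrACA. Qed.

Lemma lin_opp (U W : lmodType K) (f : U -> W) :
  linear f -> linear (fun x => - f x).
Proof. by move=> lf a x y; rewrite lf opprD scalerN. Qed.

Lemma lin_sub (U W : lmodType K) (f g : U -> W) :
  linear f -> linear g -> linear (fun x => f x - g x).
Proof. by move=> lf lg; apply: lin_add => //; exact: lin_opp. Qed.

Lemma sub_ker (U W : lmodType K) (f : U -> W) :
  linear f -> is_subspace [set x | f x = 0].
Proof.
move=> lf; split=> [|a x y /= x0 y0]; first exact: lin0.
by rewrite lf x0 y0 scaler0 addr0.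
Qed.

Lemma sub_eq (U W : lmodType K) (f g : U -> W) :
  linear f -> linear g -> is_subspace [set x | f x = g x].
Proof.
move=> lf lg; split=> [|a x y /= e1 e2]; first by rewrite /= !lin0.
by rewrite lf lg e1 e2.
Qed.

Lemma sub_preim (U W : lmodType K) (f : U -> W) (A : set W) :
  linear f -> is_subspace A -> is_subspace [set x | A (f x)].
Proof.
move=> lf [A0 AD]; split=> [|a x y /= e1 e2]; first by rewrite /= lin0.
by rewrite lf; exact: AD.
Qed.

Lemma sub_im (U W : lmodType K) (f : U -> W) (A : set U) :
  linear f -> is_subspace A -> is_subspace (f @` A).
Proof.
move=> lf [A0 AD]; split=> [|a x y [x' Ax <-] [y' Ay <-]].
  by exists 0; rewrite ?lin0.
by exists (a *: x' + y'); rewrite ?lf//; exact: AD.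
Qed.

Lemma sub_set0 (U : lmodType K) : is_subspace [set (0 : U)].
Proof. by split=> // a x y -> ->; rewrite /= scaler0 addr0. Qed.

Lemma sub_setT (U : lmodType K) : is_subspace [set: U].
Proof. by []. Qed.

Lemma sub_bigcap (U : lmodType K) I (D : set I) (A : I -> set U) :
  (forall i, D i -> is_subspace (A i)) -> is_subspace (\bigcap_(i in D) A i).
Proof.
move=> sA; split=> [i Di|a x y Ax Ay i Di]; first by case: (sA i Di).
by case: (sA i Di) => _; apply; [exact: Ax|exact: Ay].
Qed.

Section Subspace.
Variables (U : lmodType K) (A : set U).
Hypothesis sA : is_subspace A.

Lemma ss0 : A 0. Proof. by case: sA. Qed.
Lemma ssZ a x : A x -> A (a *: x).
Proof. by case: sA => A0 AD Ax; rewrite -[_ *: _]addr0; exact: AD. Qed.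
Lemma ssD x y : A x -> A y -> A (x + y).
Proof. by case: sA => A0 AD Ax Ay; rewrite -[x]scale1r; exact: AD. Qed.
Lemma ssN x : A x -> A (- x).
Proof. by rewrite -scaleN1r; exact: ssZ. Qed.
Lemma ssB x y : A x -> A y -> A (x - y).
Proof. by move=> Ax /ssN; exact: ssD. Qed.
Lemma ss_sum I (r : seq I) (P : pred I) (F : I -> U) :
  (forall i, P i -> A (F i)) -> A (\sum_(i <- r | P i) F i).
Proof. by move=> AF; apply: big_ind => //; [exact: ss0|exact: ssD]. Qed.
End Subspace.

Lemma span_ss (U : lmodType K) (S : set U) : is_subspace (span S).
Proof. exact: span_is_subspace. Qed.

Lemma span_mono (U : lmodType K) (S T : set U) : S `<=` T -> span S `<=` span T.
Proof.
move=> ST; apply: span_sub; first exact: span_ss.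
by move=> x Sx; apply: span_gen; exact: ST.
Qed.

Lemma span_lin (U W : lmodType K) (f : U -> W) (S : set U) (A : set W) :
  linear f -> is_subspace A -> (forall x, S x -> A (f x)) ->
  forall x, span S x -> A (f x).
Proof. by move=> lf sA SA; apply: span_sub => //; exact: sub_preim. Qed.

Lemma cls_lin (U : lmodType K) (S : set U) : linear (cls S).
Proof. exact: cls_is_linear. Qed.

Lemma subval_lin (U : lmodType K) (S : set U) : linear (@subval K U S).
Proof. by []. Qed.

Lemma subval_inj (U : lmodType K) (S : set U) : injective (@subval K U S).
Proof. exact: val_inj. Qed.

Lemma subval_in (U : lmodType K) (S : set U) (x : subsp S) : span S (subval x).
Proof. by case: x => x /= /span_predP. Qed.

Lemma subvalA (U : lmodType K) (A : set U) (x : subsp A) :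
  is_subspace A -> A (subval x).
Proof. by move=> sA; have := subval_in x; rewrite span_id. Qed.

Lemma cls0P (U : lmodType K) (S : set U) x : cls S x = 0 <-> span S x.
Proof. by rewrite -(lin0 (@cls_lin U S)) clsP subr0. Qed.

Lemma cls_ind (U : lmodType K) (S : set U) (P : quotby S -> Prop) :
  (forall x, P (cls S x)) -> forall y, P y.
Proof. by move=> H y; rewrite -[y]repK. Qed.

(** By Zorn, a subspace containing [A] and maximal for avoiding [x] has
    codimension one. *)
Lemma functional_sep (U : lmodType K) (A : set U) (x : U) : is_subspace A ->
  ~ A x -> exists f : U -> K, [/\ scalar f, forall y, A y -> f y = 0 & f x = 1].
Proof.
move=> sA nAx.
pose P (X : set U) := ~ span (A `|` X) x.
have [F FP tF|B [PB maxB]] := @Zorn_bigcup U P.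
  pose T := [set y | A y \/ exists2 X, F X & span (A `|` X) y].
  have sT : is_subspace T.
    split; first by left; exact: ss0.
    move=> a y z [Ay|[X FX Xy]] [Az|[Y FY Yz]].
    - by left; case: sA => _; apply.
    - by right; exists Y => //; case: (span_ss (A `|` Y)) => _; apply => //;
        apply: span_gen; left.
    - by right; exists X => //; case: (span_ss (A `|` X)) => _; apply => //;
        apply: span_gen; left.
    - have [XY|YX] := tF _ _ FX FY.
        right; exists Y => //; case: (span_ss (A `|` Y)) => _; apply => //.
        by apply: span_mono Xy; exact: setUS.
      right; exists X => //; case: (span_ss (A `|` X)) => _; apply => //.
      by apply: span_mono Yz; exact: setUS.
  move=> xF; have : T x.
    apply: span_sub xF => // y [Ay|[X FX Xy]]; first by left.
    by right; exists X => //; apply: span_gen; right.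
  by case=> // -[X FX]; exact: FP.
pose C := span (A `|` B).
have sC : is_subspace C by exact: span_ss.
have dec v : exists a, C (v - a *: x).
  apply: contrapT => nv.
  have PBv : P (B `|` [set v]).
    move=> xv; apply: nv.
    have [a Cxa] : exists a, C (x - a *: v).
      have sT : is_subspace [set y | exists a, C (y - a *: v)].
        split; first by exists 0; rewrite scale0r subr0; exact: ss0.
        move=> b y z [a Ca] [a' Ca']; exists (b * a + a').
        rewrite scalerDl -scalerA opprD addrACA -scalerBr.
        by case: sC => _; apply.
      apply: (span_sub sT _ xv) => y [Ay|[By|->]].
      - by exists 0; rewrite scale0r subr0; apply: span_gen; left.
      - by exists 0; rewrite scale0r subr0; apply: span_gen; right.
      - by exists 1; rewrite scale1r subrr; exact: ss0.
    have [a0|a0] := eqVneq a 0.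
      by case: PB; move: Cxa; rewrite a0 scale0r subr0.
    exists a^-1; rewrite -opprB; apply: (ssN sC).
    have := ssZ sC a^-1 Cxa; rewrite scalerBr scalerA mulVf// scale1r //.
  have [e|ne] := pselect (B `|` [set v] = B).
    apply: nv; exists 0; rewrite scale0r subr0.
    by apply: span_gen; right; rewrite -e; right.
  apply: maxB PBv; split=> [b Bb|sB]; first by left.
  by apply: ne; apply/seteqP; split=> // b Bb; left.
pose f v := xget 0 [set a | C (v - a *: x)].
have fP v : C (v - f v *: x).
  by rewrite /f; case: xgetP => [a _ //|]; case: (dec v) => a Ca /(_ a).
have fU v a : C (v - a *: x) -> f v = a.
  move=> Ca; apply/eqP; rewrite -subr_eq0; apply/negP => /negP ne.
  case: PB; have := ssB sC Ca (fP v); rewrite opprB addrC addrA subrK -scalerBl.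
  by move/(ssZ sC (f v - a)^-1); rewrite scalerA mulVf// scale1r.
exists f; split=> [a u v|y Ay|].
- apply: fU; rewrite scalerDl -scalerA opprD addrACA -scalerBr.
  by case: sC => _; apply.
- by apply: fU; rewrite scale0r subr0; apply: span_gen; left.
- by apply: fU; rewrite scale1r subrr; exact: ss0.
Qed.

Lemma functional_neq0 (U : lmodType K) (x : U) :
  (forall f : U -> K, scalar f -> f x = 0) -> x = 0.
Proof.
move=> H; apply: contrapT => nx.
have [f [sf _ f1]] := functional_sep (sub_set0 U) nx.
by have := H f sf; rewrite f1 => /eqP; rewrite oner_eq0.
Qed.

Lemma sc_lin (U : lmodType K) (f : U -> K) : scalar f -> linear (f : U -> K^o).
Proof. by []. Qed.

Section ScalarMaps.
Variables (U : lmodType K) (f : U -> K).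
Hypothesis sf : scalar f.

Lemma sc0 : f 0 = 0. Proof. exact: lin0 (sc_lin sf). Qed.
Lemma scD x y : f (x + y) = f x + f y. Proof. exact: linD (sc_lin sf) x y. Qed.
Lemma scN x : f (- x) = - f x. Proof. exact: linN (sc_lin sf) x. Qed.
Lemma scZ a x : f (a *: x) = a * f x. Proof. exact: linZ (sc_lin sf) a x. Qed.
Lemma sc_sum I (r : seq I) (P : pred I) (F : I -> U) :
  f (\sum_(i <- r | P i) F i) = \sum_(i <- r | P i) f (F i).
Proof. exact: (big_morph f scD sc0). Qed.
End ScalarMaps.

Lemma functional_eq (U : lmodType K) (x y : U) :
  (forall f : U -> K, scalar f -> f x = f y) -> x = y.
Proof.
move=> H; apply/eqP; rewrite -subr_eq0; apply/eqP/functional_neq0 => f sf.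
by rewrite scD// scN// H// subrr.
Qed.

(** The list need not come from a basis a priori: a generator already in the
    span of the others is skipped, and a new one is split off by a functional. *)
Lemma dual_basis (U : lmodType K) (A : set U) : is_subspace A -> fin_dim A ->
  exists s : seq ((U -> K) * U), [/\ forall p, p \in s -> scalar p.1,
    forall p, p \in s -> A p.2 & forall v, A v -> v = \sum_(p <- s) p.1 v *: p.2].
Proof.
move=> _ [e ->] {A}; elim: e => [|x e [s [ss As vs]]].
  exists [::]; split=> // v; rewrite big_nil => Sv.
  have : [set 0 : U] v by apply: span_sub Sv; [exact: sub_set0|].
  by [].
have mono : span [set v | v \in e] `<=` span [set v | v \in x :: e].
  by apply: span_mono => v /= ve; rewrite inE ve orbT.
have [xe|nxe] := pselect (span [set v | v \in e] x).
  have -> : span [set v | v \in x :: e] = span [set v | v \in e].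
    apply/seteqP; split=> //; apply: span_sub; first exact: span_ss.
    by move=> v /=; rewrite inE => /orP[/eqP ->|ve] //; exact: span_gen.
  by exists s.
have [f [sf fe fx]] := functional_sep (@span_ss _ _) nxe.
pose h v := v - f v *: x.
have lh : linear h.
  by move=> a u v; rewrite /h (sf a u v) scalerDl -scalerA opprD addrACA scalerBr.
exists ((f, x) :: [seq (p.1 \o h, p.2) | p <- s]); split.
- move=> p; rewrite inE => /orP[/eqP ->//|/mapP[q qs ->]] a u v /=.
  by rewrite lh (ss _ qs).
- move=> p; rewrite inE => /orP[/eqP ->|/mapP[q qs ->]] /=.
    by apply: span_gen; rewrite /= mem_head.
  exact: mono (As _ qs).
- move=> v Sv; rewrite big_cons big_map /= -(vs (h v)) /h ?subrKC//.
  apply: (span_lin lh (@span_ss _ _) _ Sv) => y /=.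
  rewrite inE => /orP[/eqP ->|ye]; rewrite /h.
    by rewrite fx scale1r subrr; exact: ss0 (@span_ss _ _).
  by rewrite fe ?scale0r ?subr0; exact: span_gen.
Qed.

End LinearMaps.

(** Linear identities between vectors are checked on all functionals, where
    they become ring identities. *)
Ltac modring := let phi := fresh "phi" in let S := fresh "S" in
  apply: functional_eq => phi S; rewrite ?(scD S, scN S, scZ S, sc0 S); ring.

(** * Tensor products *)

Section FiniteSums.
Variables (K : numFieldType) (U : lmodType K).

Lemma fsum_seq (I : choiceType) (r : seq I) (F : I -> U) : uniq r ->
  (forall i, i \notin r -> F i = 0) ->
  \sum_(i \in [set: I]) F i = \sum_(i <- r) F i.
Proof.
move=> ur F0; rewrite (fsbigE r)//; last by move=> i _; exact: F0.
by apply: eq_bigl => i; rewrite in_setT.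
Qed.

Lemma fsum_ord (n : nat) (F : nat -> U) : (forall i, (n <= i)%N -> F i = 0) ->
  \sum_(i \in [set: nat]) F i = \sum_(i < n) F i.
Proof.
move=> F0; rewrite (@fsum_seq _ (iota 0 n)) ?iota_uniq//.
  by rewrite -(big_mkord xpredT F) /index_iota subn0.
by move=> i; rewrite mem_iota add0n /= -leqNgt => /F0.
Qed.

Lemma finite_seq (I : choiceType) (A : set I) : finite_set A ->
  exists r : seq I, uniq r /\ forall i, A i <-> i \in r.
Proof.
move=> fA; exists (fset_set A); split; first exact: fset_uniq.
move=> i; split=> [Ai|]; rewrite in_fset_set//; first exact: mem_set.
exact: set_mem.
Qed.

Lemma seq_finite (I : choiceType) (r : seq I) (A : set I) :
  (forall i, A i -> i \in r) -> finite_set A.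
Proof.
move=> H; apply: (@sub_finite_set _ _ [set` r]); first by move=> i /H.
by apply: sub_finite_set (finite_fset [fset x | x in r]%fset) => i /=; rewrite inE.
Qed.

End FiniteSums.

Section TensorFacts.
Variable K : numFieldType.

Lemma malg_sum (X : choiceType) (g : {malg K[X]}) :
  g = \sum_(x <- msupp g) mcoeff x g *: fgen K x.
Proof.
rewrite {1}[g]monalgE; apply: eq_bigr => x _; apply/malgP => k.
by rewrite mcoeffZ !mcoeffU mulr_natr.
Qed.

Section TwoSpaces.
Variables V W : lmodType K.

Lemma tens_seqP (z : tens V W) :
  exists s : seq (V * W), z = \sum_(p <- s) tpure p.1 p.2.
Proof.
rewrite -[z]repK [rep z]malg_sum (lin_sum (@cls_lin _ _ _)).
exists [seq (mcoeff p (rep z) *: p.1, p.2) | p <- msupp (rep z)].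
rewrite big_map; apply: eq_bigr => -[v w] _ /=.
by rewrite (linZ (@cls_lin _ _ _)) (linZ (tpure_linearl w)).
Qed.

Lemma tens_ind (P : set (tens V W)) : is_subspace P ->
  (forall v w, P (tpure v w)) -> forall z, P z.
Proof.
move=> sP Pp z; have [s ->] := tens_seqP z.
by apply: (ss_sum sP) => p _.
Qed.

Lemma tens_ext (U : lmodType K) (f g : tens V W -> U) : linear f -> linear g ->
  (forall v w, f (tpure v w) = g (tpure v w)) -> forall z, f z = g z.
Proof. by move=> lf lg e; exact: (tens_ind (sub_eq lf lg) e). Qed.

Lemma tpure0l w : tpure 0 w = 0 :> tens V W.
Proof. exact: (lin0 (@tpure_linearl _ V W w)). Qed.

Lemma tpure0r v : tpure v 0 = 0 :> tens V W.
Proof. exact: (lin0 (@tpure_linearr _ V W v)). Qed.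

Lemma tcontrl_pure (f : V -> K) v w : scalar f ->
  tcontrl f (tpure v w) = f v *: w :> W.
Proof.
move=> sf; rewrite /tcontrl tlift_pure// => [{}w a x y|{}v a x y].
  by rewrite sf scalerDl scalerA.
by rewrite scalerDr !scalerA mulrC.
Qed.

Lemma tcontrr_pure (g : W -> K) v w : scalar g ->
  tcontrr g (tpure v w) = g w *: v :> V.
Proof.
move=> sg; rewrite /tcontrr tlift_pure// => [{}w a x y|{}v a x y].
  by rewrite scalerDr !scalerA mulrC.
by rewrite sg scalerDl scalerA.
Qed.

Lemma tcontrr_linear (g : W -> K) : scalar g -> linear (@tcontrr _ V W g).
Proof.
move=> sg; apply: tlift_linear => [w a x y|v a x y].
  by rewrite scalerDr !scalerA mulrC.
by rewrite sg scalerDl scalerA.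
Qed.

Lemma tpairEl (f : V -> K) (g : W -> K) z : scalar f -> scalar g ->
  tpair f g z = g (tcontrl f z).
Proof.
move=> sf sg; move: z.
apply: (@tens_ext K^o (tpair f g) (fun z => g (tcontrl f z))).
- exact: tpair_scalar.
- by move=> a x y; rewrite (tcontrl_linear sf) sg.
- move=> v w; rewrite tpair_pure// tcontrl_pure//.
  by rewrite (linZ (sc_lin sg)).
Qed.

Lemma tpairEr (f : V -> K) (g : W -> K) z : scalar f -> scalar g ->
  tpair f g z = f (tcontrr g z).
Proof.
move=> sf sg; move: z.
apply: (@tens_ext K^o (tpair f g) (fun z => f (tcontrr g z))).
- exact: tpair_scalar.
- by move=> a x y; rewrite (tcontrr_linear sg) sf.
- move=> v w; rewrite tpair_pure// tcontrr_pure//.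
  by rewrite (linZ (sc_lin sf)) mulrC.
Qed.

Lemma tsub_seq (B : set V) (A : set W) z : is_subspace A -> tsub B A z ->
  exists s : seq (V * W), (forall p, p \in s -> B p.1 /\ A p.2) /\
    z = \sum_(p <- s) tpure p.1 p.2.
Proof.
move=> sA; move: z; apply: span_sub.
  split=> [|a x y [s [sP ->]] [t [tP ->]]].
    by exists [::]; split=> //; rewrite big_nil.
  exists ([seq (p.1, a *: p.2) | p <- s] ++ t); split.
    move=> p; rewrite mem_cat => /orP[/mapP[q /sP[Bq Aq] ->]|/tP//].
    by split=> //; exact: ssZ.
  rewrite big_cat big_map scaler_sumr; congr (_ + _).
  by apply: eq_bigr => p _; rewrite /= (linZ (tpure_linearr _)).
move=> z [v [w [Bv Aw ->]]]; exists [:: (v, w)]; split; last by rewrite big_seq1.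
by move=> p; rewrite inE => /eqP ->.
Qed.

(** A tensor $v \otimes w$ can be absorbed in a sum of pure tensors whose left
    factors span [v], without new left factors. *)
Lemma tens_absorb (L : seq V) (s : seq (V * W)) (v : V) (w : W) :
  [seq p.1 | p <- s] = L -> span [set u | u \in L] v ->
  exists t : seq (V * W), [seq p.1 | p <- t] = L /\
    \sum_(p <- t) tpure p.1 p.2 = \sum_(p <- s) tpure p.1 p.2 + tpure v w.
Proof.
move=> sL Lv.
pose T := [set u | forall (s : seq (V * W)) w, [seq p.1 | p <- s] = L ->
  exists t : seq (V * W), [seq p.1 | p <- t] = L /\
    \sum_(p <- t) tpure p.1 p.2 = \sum_(p <- s) tpure p.1 p.2 + tpure u w].
suff : T v by apply.
apply: span_sub Lv => {s w sL}.
  split=> [s w sL|a x y Tx Ty s w sL].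
    by exists s; rewrite tpure0l addr0.
  have [t [tL et]] := Tx s (a *: w) sL; have [t' [t'L et']] := Ty t w tL.
  exists t'; split=> //; rewrite et' et (tpure_linearl w) -addrA; congr (_ + _).
  by rewrite (linZ (tpure_linearr _)).
move=> u /= uL s w sL; rewrite -sL in uL *; elim: s uL {sL} => //= p s IH.
rewrite inE => /orP[/eqP ->|/IH [t [tL et]]].
  exists ((p.1, p.2 + w) :: s); split=> //; rewrite !big_cons /=.
  by rewrite (linD (tpure_linearr _)) -!addrA [tpure _ w + _]addrC.
by exists (p :: t); rewrite /= tL !big_cons et addrA.
Qed.

(** After [tens_absorb] the left factors may be taken linearly independent;
    functionals dual to them recover the right factors. *)
Lemma tsub_crit (B : set V) (A : set W) z : is_subspace A -> tsub B setT z ->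
  (forall f : V -> K, scalar f -> A (tcontrl f z)) -> tsub B A z.
Proof.
move=> sA /(tsub_seq (@sub_setT _ _)) [s [sP ->]] {z}.
have [n] := ubnP (size s); elim: n s sP => // n IH [|[v w] s] /= sP; rewrite ltnS.
  by move=> _ _; rewrite big_nil; exact: ss0 (@span_ss _ _ _).
move=> sn; rewrite big_cons /= => HA.
have sP' p : p \in s -> B p.1 /\ setT p.2 by move=> ps; apply: sP; rewrite inE ps orbT.
have [vs|nvs] := pselect (span [set u | u \in [seq p.1 | p <- s]] v).
  have [t [tL et]] := @tens_absorb _ s v w erefl vs.
  move: HA; rewrite addrC -et; apply: IH; last by rewrite -(size_map fst) tL size_map.
  move=> p pt; have : p.1 \in [seq p.1 | p <- t] by apply: map_f.
  by rewrite tL => /mapP[q qs ->]; exact: sP'.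
have [f [sf f0 fv]] := functional_sep (@span_ss _ _ _) nvs.
have Aw : A w.
  have := HA f sf; rewrite (linD (tcontrl_linear sf)) tcontrl_pure// fv scale1r.
  rewrite (lin_sum (tcontrl_linear sf)) big_seq big1 ?addr0// => p ps.
  rewrite tcontrl_pure// f0 ?scale0r//; apply: span_gen; exact: map_f.
have tvw : tsub B A (tpure v w).
  by apply: span_gen; exists v, w; split=> //; case: (sP (v, w) (mem_head _ _)).
apply: (ssD (@span_ss _ _ _)) => //; apply: IH => // g sg.
have := HA g sg; rewrite (linD (tcontrl_linear sg)) tcontrl_pure//.
by move/(fun h => ssB sA h (ssZ sA (g v) Aw)); rewrite addrC addKr.
Qed.

Lemma tsubT (z : tens V W) : tsub setT setT z.
Proof.
by apply: tens_ind z; [exact: span_ss|move=> v w; apply: span_gen; exists v, w].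
Qed.

Lemma tsubTP (A : set W) z : is_subspace A ->
  tsub setT A z <-> forall f : V -> K, scalar f -> A (tcontrl f z).
Proof.
move=> sA; split=> [Az f sf|]; last by apply: tsub_crit => //; exact: tsubT.
apply: (span_lin (tcontrl_linear sf) sA) Az => _ [v [w [_ Aw ->]]].
by rewrite tcontrl_pure//; exact: ssZ.
Qed.

Lemma tens_eq0 (z : tens V W) :
  (forall f : V -> K, scalar f -> tcontrl f z = 0) -> z = 0.
Proof.
move=> z0; have := (tsubTP z (@sub_set0 _ W)).2 z0.
apply: (span_sub (@sub_set0 _ _)) => _ [v [w [_ -> ->]]]; exact: tpure0r.
Qed.

End TwoSpaces.

Section Maps.
Variables V V' W W' : lmodType K.

Lemma tcontrl_tmap (f : V' -> K) (h : V -> V') (i : W -> W') z :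
  scalar f -> linear h -> linear i ->
  tcontrl f (tmap h i z) = i (tcontrl (fun v => f (h v)) z).
Proof.
move=> sf lh li.
have sfh : scalar (fun v => f (h v)) by move=> a x y; rewrite lh sf.
move: z; apply: (@tens_ext _ _ _ (tcontrl f \o tmap h i)
  (i \o tcontrl (fun v => f (h v)))) => [||v w] /=.
- exact: lin_comp (tmap_linear lh li) (tcontrl_linear sf).
- exact: lin_comp (tcontrl_linear sfh) li.
- by rewrite tmap_pure// !tcontrl_pure// linZ.
Qed.

Lemma tpair_tmap (f : V' -> K) (g : W' -> K) (h : V -> V') (i : W -> W') z :
  scalar f -> scalar g -> linear h -> linear i ->
  tpair f g (tmap h i z) = tpair (fun v => f (h v)) (fun w => g (i w)) z.
Proof.
move=> sf sg lh li.
have sfh : scalar (fun v => f (h v)) by move=> a x y; rewrite lh sf.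
have sgi : scalar (fun v => g (i v)) by move=> a x y; rewrite li sg.
by rewrite !tpairEl// tcontrl_tmap.
Qed.

Lemma tmap_id (z : tens V W) : tmap id id z = z.
Proof.
move: z; apply: (@tens_ext _ _ _ (tmap id id) id) => [||v w] //.
  exact: tmap_linear.
by rewrite tmap_pure.
Qed.

End Maps.

Lemma tmap_comp (V V' V'' W W' W'' : lmodType K) (f : V -> V') (f' : V' -> V'')
    (g : W -> W') (g' : W' -> W'') z :
  linear f -> linear f' -> linear g -> linear g' ->
  tmap f' g' (tmap f g z) = tmap (f' \o f) (g' \o g) z.
Proof.
move=> lf lf' lg lg'; move: z; apply: (@tens_ext _ _ _ (tmap f' g' \o tmap f g)
  (tmap (f' \o f) (g' \o g))) => [||v w] /=.
- exact: lin_comp (tmap_linear lf lg) (tmap_linear lf' lg').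
- by apply: tmap_linear; exact: lin_comp.
- by rewrite !tmap_pure//; exact: lin_comp.
Qed.

Lemma tmap_inj (V W W' : lmodType K) (i : W -> W') : linear i -> injective i ->
  injective (tmap (@id V) i).
Proof.
move=> li ii x y exy; apply/eqP; rewrite -subr_eq0; apply/eqP.
have lt := tmap_linear (@lin_id _ V) li.
apply: tens_eq0 => f sf; apply: ii; rewrite lin0//.
by rewrite -(tcontrl_tmap _ sf (@lin_id _ V) li) linB// exy subrr lin0 //;
  exact: tcontrl_linear.
Qed.

Lemma tmap_cls_eq0 (V W : lmodType K) (A : set W) z : is_subspace A ->
  tmap (@id V) (cls A) z = 0 <-> tsub setT A z.
Proof.
move=> sA; have lt := tmap_linear (@lin_id _ V) (@cls_lin _ _ A); split=> [z0|Az].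
  apply/tsubTP => // f sf; rewrite -[A]span_id// -cls0P.
  by rewrite -(tcontrl_tmap _ sf (@lin_id _ V) (@cls_lin _ _ A)) z0 lin0 //;
    exact: tcontrl_linear.
apply: tens_eq0 => f sf; rewrite tcontrl_tmap//; last exact: cls_lin.
by apply/cls0P; rewrite span_id//; apply: (tsubTP z sA).1.
Qed.

Lemma tmap_subval_ex (V W : lmodType K) (A : set W) z : is_subspace A ->
  tsub setT A z -> exists y, tmap (@id V) (@subval _ _ A) y = z.
Proof.
move=> sA; have lt := tmap_linear (@lin_id _ V) (@subval_lin _ _ A).
move: z; apply: span_sub.
  split=> [|a x y [x' <-] [y' <-]]; first by exists 0; rewrite lin0.
  by exists (a *: x' + y'); rewrite lt.
move=> _ [v [w [_ Aw ->]]]; exists (tpure v (tosub A w)).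
by rewrite tmap_pure ?tosubK ?span_id//; exact: subval_lin.
Qed.

End TensorFacts.

(** * Gradings *)

Section GradingFacts.
Variables (K : numFieldType) (I : choiceType) (V : lmodType K) (G : I -> set V).

Lemma decomposes_seq v x : decomposes G v x ->
  exists r, [/\ uniq r, forall s, s \notin r -> x s = 0 & v = \sum_(s <- r) x s].
Proof.
move=> [_ /finite_seq [r [ur rP]] ->].
have x0 s : s \notin r -> x s = 0.
  by move=> /negP nsr; apply: contrapT => /eqP /rP.
by exists r; split=> //; exact: fsum_seq.
Qed.

Lemma seq_decomposes r x : uniq r -> (forall s, G s (x s)) ->
  (forall s, s \notin r -> x s = 0) -> decomposes G (\sum_(s <- r) x s) x.
Proof.
move=> ur Gx x0; split=> //; last by rewrite (@fsum_seq _ _ _ r).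
apply: (@seq_finite _ r) => s /= /negP xs; apply: contrapT => /negP /x0 e.
by apply: xs; rewrite e.
Qed.

Lemma big_enlarge (r r' : seq I) (x : I -> V) : uniq r -> uniq r' ->
  {subset r <= r'} -> (forall s, s \notin r -> x s = 0) ->
  \sum_(s <- r) x s = \sum_(s <- r') x s.
Proof.
move=> ur ur' rr' x0.
rewrite -(@fsum_seq _ _ _ r)// -(@fsum_seq _ _ _ r')// => s sr'.
by apply: x0; apply: contra sr'; exact: rr'.
Qed.

(** To see that a sum of subspaces is direct it suffices to have, for each
    component, linear maps that vanish on the other components and are jointly
    injective on that one. *)
Lemma direct_sum_sep (W : lmodType K) (Phi : I -> set (V -> W)) :
  (forall s, is_subspace (G s)) ->
  (forall v, span (\bigcup_s G s) v) ->
  (forall s phi, Phi s phi -> linear phi /\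
     forall r v, r != s -> G r v -> phi v = 0) ->
  (forall s v, G s v -> (forall phi, Phi s phi -> phi v = 0) -> v = 0) ->
  direct_sum G.
Proof.
move=> sG spG PhiP Phi0; split=> // v.
have [x xP] : exists x, decomposes G v x.
  apply: (@span_sub _ _ _ [set v | exists x, decomposes G v x]) (spG v).
    split=> [|a u w [x Hx] [y Hy]].
      exists (fun=> 0); have := @seq_decomposes [::] (fun=> 0) isT.
      by rewrite big_nil; apply => // s; exact: ss0.
    have [rx [ux x0 ->]] := decomposes_seq Hx.
    have [ry [uy y0 ->]] := decomposes_seq Hy.
    pose r := undup (rx ++ ry).
    exists (fun s => a *: x s + y s).
    rewrite (@big_enlarge rx r) ?undup_uniq//; last first.
      by move=> s; rewrite mem_undup mem_cat => ->.
    rewrite (@big_enlarge ry r) ?undup_uniq//; last first.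
      by move=> s; rewrite mem_undup mem_cat orbC => ->.
    rewrite scaler_sumr -big_split; apply: seq_decomposes; first exact: undup_uniq.
      by move=> s; case: (sG s) => _; apply; [case: Hx|case: Hy].
    move=> s; rewrite mem_undup mem_cat negb_or => /andP[/x0 -> /y0 ->].
    by rewrite /= scaler0 addr0.
  move=> u [s _ Gu]; exists (fun r => if r == s then u else 0).
  have := @seq_decomposes [:: s] (fun r => if r == s then u else 0) isT.
  rewrite big_seq1 eqxx; apply; first by move=> r; case: eqP => [->|_] //; exact: ss0.
  by move=> r; rewrite inE => /negPf ->.
exists x; split=> // y yP; apply/funext => s.
have H z : decomposes G v z -> forall phi, Phi s phi -> phi v = phi (z s).
  move=> zP phi Pp; have [lp p0] := PhiP _ _ Pp.
  have [r [ur z0 ->]] := decomposes_seq zP.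
  rewrite (lin_sum lp) [in RHS](_ : z s = \sum_(t <- r) if t == s then z s else 0).
    rewrite lin_sum//; apply: eq_bigr => t _; case: eqP => [->//|/eqP ts].
    by rewrite (p0 t)// ?lin0//; case: zP.
  rewrite -big_mkcond; have [sr|nsr] := boolP (s \in r).
    by rewrite -big_filter filter_pred1_uniq// big_seq1.
  by rewrite z0// big1.
apply/eqP; rewrite -subr_eq0; apply/eqP; apply: (Phi0 s).
  by apply: ssB => //; [case: xP|case: yP].
by move=> phi Pp; have [lp _] := PhiP _ _ Pp; rewrite linB// -!H// subrr.
Qed.

Hypothesis ds : direct_sum G.

Lemma grade_ss s : is_subspace (G s).
Proof. by case: ds. Qed.

Lemma gproj_dec v : decomposes G v (fun s => gproj G s v).
Proof.
rewrite (_ : (fun s => _) = xget (fun=> 0) (decomposes G v)); last exact/funext.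
by case: xgetP => [x _ //|]; case: ds => _ /(_ v) [x [xP _]] /(_ x).
Qed.

Lemma gprojE v x : decomposes G v x -> forall s, gproj G s v = x s.
Proof.
move=> xP s; have [_ /(_ v) [y [_ yU]]] := ds.
by rewrite -(yU _ xP) (yU _ (gproj_dec v)).
Qed.

Lemma gproj_in s v : G s (gproj G s v).
Proof. by case: (gproj_dec v). Qed.

Lemma gproj_seq v : exists r, [/\ uniq r,
  forall s, s \notin r -> gproj G s v = 0 & v = \sum_(s <- r) gproj G s v].
Proof. exact: decomposes_seq (gproj_dec v). Qed.

Lemma gproj_big v : exists r : seq I, forall r' : seq I, uniq r' -> {subset r <= r'} ->
  v = \sum_(s <- r') gproj G s v.
Proof.
have [r [ur r0 er]] := gproj_seq v; exists r => r' ur' rr'.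
by rewrite -(@big_enlarge r r').
Qed.

Lemma gproj_id s v : G s v -> gproj G s v = v.
Proof.
move=> Gv; rewrite (@gprojE v (fun r => if r == s then v else 0)) ?eqxx//.
have := @seq_decomposes [:: s] (fun r => if r == s then v else 0) isT.
rewrite big_seq1 eqxx; apply.
  by move=> r; case: eqP => [->|_] //; exact: ss0 (grade_ss _).
by move=> r; rewrite inE => /negPf ->.
Qed.

Lemma gproj_0 r s v : G r v -> r != s -> gproj G s v = 0.
Proof.
move=> Gv rs; rewrite (@gprojE v (fun t => if t == r then v else 0)).
  by rewrite eq_sym (negPf rs).
have := @seq_decomposes [:: r] (fun t => if t == r then v else 0) isT.
rewrite big_seq1 eqxx; apply.
  by move=> t; case: eqP => [->|_] //; exact: ss0 (grade_ss _).
by move=> t; rewrite inE => /negPf ->.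
Qed.

Lemma gproj_lin s : linear (gproj G s).
Proof.
move=> a v w; have [rv [uv v0 ev]] := gproj_seq v.
have [rw [uw w0 ew]] := gproj_seq w.
apply: (@gprojE _ (fun s => a *: gproj G s v + gproj G s w)).
pose r := undup (rv ++ rw).
rewrite {1}ev {1}ew (@big_enlarge rv r) ?undup_uniq//; last first.
  by move=> t; rewrite mem_undup mem_cat => ->.
rewrite (@big_enlarge rw r) ?undup_uniq//; last first.
  by move=> t; rewrite mem_undup mem_cat orbC => ->.
rewrite scaler_sumr -big_split; apply: seq_decomposes; first exact: undup_uniq.
  by move=> t; case: (grade_ss t) => _; apply; exact: gproj_in.
move=> t; rewrite mem_undup mem_cat negb_or => /andP[/v0 -> /w0 ->].
by rewrite /= scaler0 addr0.
Qed.

Lemma grade_ind (P : set V) : is_subspace P -> (forall s v, G s v -> P v) ->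
  forall v, P v.
Proof.
move=> sP GP v; have [r [_ _ ->]] := gproj_seq v.
by apply: ss_sum => // s _; apply: GP; exact: gproj_in.
Qed.

Lemma grade_ext (W : lmodType K) (f g : V -> W) : linear f -> linear g ->
  (forall s v, G s v -> f v = g v) -> forall v, f v = g v.
Proof. by move=> lf lg e; exact: (grade_ind (sub_eq lf lg) e). Qed.

End GradingFacts.

Section TensorGrading.
Variables (K : numFieldType) (I : choiceType) (V M : lmodType K).
Variables (GV : int -> set V) (deg : I -> int) (GM : I -> set M).
Hypotheses (dV : direct_sum GV) (dM : direct_sum GM).

Local Notation PQ s r := (tmap (gproj GV s) (gproj GM r)).

Lemma PQ_lin s r : linear (PQ s r).
Proof. exact: tmap_linear (gproj_lin dV s) (gproj_lin dM r). Qed.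

Lemma PQ_pure s r v w :
  PQ s r (tpure v w) = tpure (gproj GV s v) (gproj GM r w).
Proof. exact: tmap_pure (gproj_lin dV s) (gproj_lin dM r). Qed.

(** The two index lists are found first for pure tensors; enlarging them is
    harmless, so that those of two tensors can be merged. *)
Lemma tens_proj_sum z : exists (A : seq int) (B : seq I),
  z = \sum_(s <- A) \sum_(r <- B) PQ s r z.
Proof.
suff [A [B H]] : exists (A : seq int) (B : seq I), forall A' B', uniq A' ->
    uniq B' -> {subset A <= A'} -> {subset B <= B'} ->
    z = \sum_(s <- A') \sum_(r <- B') PQ s r z.
  exists (undup A), (undup B); apply: H; rewrite ?undup_uniq// => s.
    by rewrite mem_undup.
  by rewrite mem_undup.
move: z; apply: tens_ind => [|v w].
  split=> [|a x y [Ax [Bx Hx]] [Ay [By Hy]]].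
    exists [::], [::] => A B _ _ _ _; rewrite big1// => s _; rewrite big1// => r _.
    exact: lin0 (PQ_lin s r).
  exists (Ax ++ Ay), (Bx ++ By) => A B uA uB AA BB.
  rewrite {1}(Hx A B)//; last 2 first.
  - by move=> s sA; apply: AA; rewrite mem_cat sA.
  - by move=> s sA; apply: BB; rewrite mem_cat sA.
  rewrite {1}(Hy A B)//; last 2 first.
  - by move=> s sA; apply: AA; rewrite mem_cat sA orbT.
  - by move=> s sA; apply: BB; rewrite mem_cat sA orbT.
  rewrite scaler_sumr -big_split; apply: eq_bigr => s _ /=.
  rewrite scaler_sumr -big_split; apply: eq_bigr => r _ /=.
  by rewrite (PQ_lin s r).
have [A HA] := gproj_big dV v; have [B HB] := gproj_big dM w.
exists A, B => A' B' uA uB AA BB.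
rewrite {1}(HA A')// {1}(HB B')// (lin_sum (tpure_linearl _)).
apply: eq_bigr => s _; rewrite (lin_sum (tpure_linearr _)).
by apply: eq_bigr => r _; rewrite PQ_pure.
Qed.

Lemma tens_gradeP t z : tens_grade GV deg GM t z <->
  forall s r, s != t - deg r -> PQ s r z = 0.
Proof.
split=> [zt s r sr|H].
  apply: (span_lin (PQ_lin s r) (@sub_set0 _ _)) zt => _ [r' [x [y [Gx Gy ->]]]].
  rewrite PQ_pure /=; have [e|ne] := eqVneq r' r.
    by rewrite (gproj_0 dV Gx) ?tpure0l// e eq_sym.
  by rewrite (gproj_0 dM Gy) ?tpure0r.
have [A [B ->]] := tens_proj_sum z.
have sg := @span_ss _ _ [set z | exists s x y,
          [/\ GV (t - deg s) x, GM s y & z = tpure x y]].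
apply: (ss_sum sg) => s _; apply: (ss_sum sg) => r _.
have [e|ne] := eqVneq s (t - deg r); last by rewrite H//; exact: ss0 sg.
move: z {H}; apply: (tens_ind (sub_preim (PQ_lin s r) sg)) => v w /=.
rewrite PQ_pure; apply: span_gen; exists r, (gproj GV s v), (gproj GM r w).
by split=> //; rewrite -?e; exact: gproj_in.
Qed.

End TensorGrading.

(** * Binomial identities *)

Section Binomials.
Variable K : numFieldType.
Local Notation zb := (@zbin K).

Lemma natS_neq0 (n : nat) : n.+1%:R != 0 :> K.
Proof. by rewrite pnatr_eq0. Qed.

Lemma zbin0 n : zb n 0 = 1.
Proof. by rewrite /zbin big_ord0 fact0 divr1. Qed.

Lemma zbinS n i : i.+1%:R * zb n i.+1 = (n%:~R - i%:R) * zb n i.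
Proof.
rewrite /zbin big_ord_recr /= factS natrM invfM.
rewrite [_^-1 / _]mulrC !mulrA mulrC !mulrA mulVf ?natS_neq0// mul1r; ring.
Qed.

Lemma zbin_absorb n i : i.+1%:R * zb n i.+1 = n%:~R * zb (n - 1) i.
Proof.
rewrite /zbin big_ord_recl /= factS natrM invfM subr0.
rewrite (eq_bigr (fun j : 'I_i => (n - 1)%:~R - (j : nat)%:R)); last first.
  by move=> j _; rewrite /bump /= intrD natrD /=; ring.
rewrite [_^-1 / _]mulrC !mulrA mulrC !mulrA mulVf ?natS_neq0// mul1r; ring.
Qed.

Lemma zbin1 n : zb n 1 = n%:~R.
Proof. by have := zbinS n 0; rewrite zbin0 mulr1 mul1r subr0. Qed.

Lemma zbin_pascal n i : zb (n + 1) i.+1 = zb n i.+1 + zb n i.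
Proof.
apply: (mulfI (natS_neq0 i)); rewrite zbin_absorb mulrDr zbinS addrK.
by rewrite intrD -mulrDl -natr1; congr (_ * _); ring.
Qed.

Lemma zbin0S i : zb 0 i.+1 = 0.
Proof. by apply: (mulfI (natS_neq0 i)); rewrite zbin_absorb mul0r mulr0. Qed.

Lemma zbinN1 i : zb (-1) i = (-1) ^+ i.
Proof.
elim: i => [|i IH]; first exact: zbin0.
apply: (mulfI (natS_neq0 i)); rewrite zbinS IH exprS -natr1; ring.
Qed.

Lemma zbin_neg n k : zb n k = (-1) ^+ k * zb (k%:Z - n - 1) k.
Proof.
rewrite /zbin mulrA; congr (_ / _).
rewrite (reindex_inj rev_ord_inj) /=.
rewrite -[X in (-1) ^+ X]card_ord -prodr_const -big_split /=.
apply: eq_bigr => i _; rewrite !intrD !intrN natrB //.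
by rewrite -natr1 /=; ring.
Qed.

Lemma zbin_small (i k : nat) : (i < k)%N -> zb i k = 0.
Proof.
by move=> ik; rewrite /zbin (bigD1 (Ordinal ik)) //= subrr !mul0r.
Qed.

Lemma zbin_shift n k :
  (n%:~R + 1 - k%:R) * zb (n + 1) k = (n%:~R + 1) * zb n k.
Proof. by have := zbinS (n + 1) k; rewrite zbin_absorb addrK intrD => <-. Qed.

(** An identity of polynomials in [m], obtained by induction on [r] from the
    recurrences of the two binomials. *)
Lemma zbin_trinomial m (k r : nat) :
  zb m (k + r) * zb (k + r)%N k = zb m k * zb (m - k%:Z) r.
Proof.
elim: r => [|r IH].
  rewrite addn0 zbin0; congr (_ * _).
  by elim: k => [|k IH]; [exact: zbin0|apply: (mulfI (natS_neq0 k));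
    rewrite zbin_absorb (_ : _ - 1 = k%:Z) ?IH//; lia].
apply: (mulfI (natS_neq0 (k + r))); apply: (mulfI (natS_neq0 r)).
have h1 := zbinS m (k + r); have h3 := zbinS (m - k%:Z) r.
have h2 : ((k + r)%N%:~R + 1 - k%:R) * zb (k + r).+1%N k =
    ((k + r)%N%:~R + 1) * zb (k + r)%N k.
  by rewrite -addn1 (PoszD (k + r)%N 1) zbin_shift.
rewrite addnS; transitivity ((r.+1%:R * zb (k + r).+1%N k) *
  ((k + r).+1%:R * zb m (k + r).+1%N)); first by ring.
rewrite h1.
have -> : r.+1%:R = ((k + r)%N%:Z)%:~R + 1 - k%:R :> K.
  by rewrite -pmulrn natrD -natr1; ring.
rewrite h2; transitivity (((k + r)%N%:~R + 1) * (m%:~R - (k + r)%:R) *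
   (zb m (k + r) * zb (k + r)%N k)); first by ring.
rewrite IH; transitivity ((k + r).+1%:R * zb m k *
  ((m - k%:Z)%:~R - r%:R) * zb (m - k%:Z) r).
  by rewrite -natr1 /= intrB !natrD /=; ring.
rewrite -mulrA -h3 -natr1 !natrD; ring.
Qed.

(** Both sides satisfy the Pascal recurrence in [m], which determines them for
    positive and negative [m] from [m = 0]. *)
Lemma vandermonde m n k :
  \sum_(i < k.+1) zb m i * zb n (k - i) = zb (m + n) k.
Proof.
pose S m k := \sum_(i < k.+1) zb m i * zb n (k - i).
rewrite -/(S m k).
have S0 m' : S m' 0 = 1 by rewrite /S big_ord_recl big_ord0 !zbin0 mulr1 addr0.
have SS m' k' : S (m' + 1) k'.+1 = S m' k'.+1 + S m' k'.
  rewrite /S big_ord_recl [in RHS]big_ord_recl /= !zbin0 -addrA; congr (_ + _).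
  rewrite -big_split; apply: eq_bigr => i _ /=.
  by rewrite /bump /= add1n zbin_pascal subSS mulrDl.
have base k' : S 0 k' = zb n k'.
  rewrite /S big_ord_recl zbin0 mul1r subn0 big1 ?addr0// => i _.
  by rewrite lift0 zbin0S mul0r.
elim: m k => [k|m IH k|m IH k].
- by rewrite base add0r.
- elim: k => [|k IHk]; first by rewrite S0 zbin0.
  rewrite -addn1 PoszD SS !IH.
  by rewrite [_ + 1]addrC -addrA [1 + _]addrC zbin_pascal.
- elim: k => [|k IHk]; first by rewrite S0 zbin0.
  have := SS (- m.+1%:Z) k; rewrite IHk.
  have -> : - m.+1%:Z + 1 = - m%:Z by lia.
  rewrite IH => e; have := zbin_pascal (- m.+1%:Z + n) k.
  have -> : - m.+1%:Z + n + 1 = - m%:Z + n by lia.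
  by rewrite e => /addIr ->.
Qed.

(** The form of the Vandermonde identity behind the antisymmetry of the Lie
    bracket. *)
Lemma vandermonde_neg m n q :
  \sum_(i < q.+1) (-1) ^+ i * zb m i * zb (m + n - i%:Z) (q - i) = zb n q.
Proof.
rewrite (zbin_neg n) -(_ : m + (q%:Z - m - n - 1) = q%:Z - n - 1); last by ring.
rewrite -vandermonde mulr_sumr; apply: eq_bigr => -[i /= iq] _.
rewrite ltnS in iq; rewrite (zbin_neg (m + n - i%:Z)).
have -> : (q - i)%N%:Z - (m + n - i%:Z) - 1 = q%:Z - m - n - 1 by lia.
have -> : (-1) ^+ q = (-1) ^+ i * (-1) ^+ (q - i) :> K by rewrite -exprD subnKC.
ring.
Qed.

(** The form of the Vandermonde identity that computes the opposite of the
    product of the Zhu algebra. *)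
Lemma vandermonde_star s t k :
  \sum_(j < k.+1) zb t j * ((-1) ^+ k * zb (k%:Z - s - t) (k - j)) = zb (s - 1) k.
Proof.
rewrite (zbin_neg (s - 1)) (_ : _ - (s - 1) - 1 = t + (k%:Z - s - t)); last by ring.
rewrite -vandermonde mulr_sumr; apply: eq_bigr => j _; ring.
Qed.

Section Sums.
Variable U : lmodType K.

Lemma sum_widen (N M : nat) (F : nat -> U) : (N <= M)%N ->
  (forall i, (N <= i)%N -> F i = 0) -> \sum_(i < M) F i = \sum_(i < N) F i.
Proof.
move=> NM F0; rewrite (big_ord_widen _ F NM) [RHS]big_mkcond /=.
by apply: eq_bigr => i _; case: ltnP => // /F0.
Qed.

Lemma sum_shift1 (N : nat) (F : nat -> U) : F 0%N = 0 -> F N = 0 ->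
  \sum_(i < N) F i = \sum_(i < N) F i.+1.
Proof.
move=> F0 FN; transitivity (\sum_(i < N.+1) F i).
  by rewrite big_ord_recr /= FN addr0.
by rewrite big_ord_recl /= F0 add0r.
Qed.

(** The index of a double sum with finite support can be replaced by its
    antidiagonals. *)
Lemma sum_diag (N : nat) (F : nat -> nat -> U) :
  (forall i j, (N <= i + j)%N -> F i j = 0) ->
  \sum_(i < N) \sum_(j < N) F i j = \sum_(q < N) \sum_(i < q.+1) F i (q - i)%N.
Proof.
move=> F0; transitivity (\sum_(i < N) \sum_(q < N | (i <= q)%N) F i (q - i)%N).
  apply: eq_bigr => -[i iN] _ /=.
  rewrite (@sum_widen (N - i) N) ?leq_subr//; last first.
    by move=> j jN; apply: F0; rewrite -leq_subLR.
  rewrite -(big_mkord xpredT (F i)) -(big_mkord (leq i) (fun q => F i (q - i)%N)).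
  rewrite [RHS](big_cat_nat _ (n := i)) ?(ltnW iN)//= [X in _ = X + _]big1_seq ?add0r.
    have := big_addn 0 N i (leq i) (fun q => F i (q - i)%N); rewrite add0n => ->.
    rewrite big_nat_cond [RHS]big_nat_cond.
    rewrite [RHS]big_mkcondr /= [in RHS]big_mkcond [LHS]big_mkcond.
    by apply: eq_bigr => j _; rewrite andbT leq_addl addnK.
  by move=> q /andP[iq]; rewrite mem_index_iota ltnNge iq.
rewrite (exchange_big_dep xpredT)//=; apply: eq_bigr => -[q qN] _ /=.
rewrite (big_ord_widen _ (fun i => F i (q - i)%N) qN).
by apply: eq_bigl => i; rewrite ltnS.
Qed.

(** The combinatorial core of the Lie Jacobi identity and of the stability of
    associators: both expand an iterated commutator in two ways. *)
Lemma triple_sum (N : nat) m k (X : nat -> nat -> U) :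
  (forall a q, (N <= a + q)%N -> X a q = 0) ->
  \sum_(i < N) \sum_(j < N) (zb m i * zb k j) *:
     (\sum_(a < j.+1) zb j%:Z a *: X a (i + (j - a))%N)
  = \sum_(a < N) \sum_(q < N) (zb k a * zb (m + k - a%:Z) q) *: X a q.
Proof.
move=> X0.
transitivity (\sum_(i < N) \sum_(a < N) \sum_(r < N)
    (zb m i * (zb k a * zb (k - a%:Z) r)) *: X a (i + r)%N).
  apply: eq_bigr => i _; rewrite (@sum_diag N (fun a r =>
     (zb m i * (zb k a * zb (k - a%:Z) r)) *: X a (i + r)%N)); last first.
    by move=> a r ar; rewrite X0 ?scaler0// addnCA (leq_trans ar)// leq_addl.
  apply: eq_bigr => j _; rewrite scaler_sumr; apply: eq_bigr => -[a /= aj] _.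
  rewrite ltnS in aj; rewrite scalerA; congr (_ *: _).
  by rewrite -zbin_trinomial subnKC// mulrA.
rewrite exchange_big; apply: eq_bigr => a _ /=.
rewrite (@sum_diag N (fun i r =>
     (zb m i * (zb k a * zb (k - a%:Z) r)) *: X a (i + r)%N)); last first.
  by move=> i r ir; rewrite X0 ?scaler0// (leq_trans ir)// leq_addl.
apply: eq_bigr => q _; rewrite -addrA -vandermonde mulr_sumr scaler_suml.
apply: eq_bigr => -[i /= iq] _; rewrite ltnS in iq; rewrite subnKC//.
by congr (_ *: _); ring.
Qed.

End Sums.

End Binomials.

(** * Restricted duals *)

Section Truncation.
Variables (K : numFieldType) (I : choiceType) (V : lmodType K) (G : I -> set V).
Hypothesis ds : direct_sum G.

Definition gtrunc (T : pred I) (v : V) : V :=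
  \sum_(s \in [set: I]) (if T s then gproj G s v else 0).

Lemma gtruncE (T : pred I) (r : seq I) v : uniq r ->
  (forall s, s \notin r -> gproj G s v = 0) ->
  gtrunc T v = \sum_(s <- r) (if T s then gproj G s v else 0).
Proof.
by move=> ur r0; rewrite /gtrunc (@fsum_seq _ _ _ r)// => s /r0 ->; case: ifP.
Qed.

Lemma gtrunc_lin T : linear (gtrunc T).
Proof.
move=> a v w; have [rv [_ v0 _]] := gproj_seq ds v.
have [rw [_ w0 _]] := gproj_seq ds w; pose r := undup (rv ++ rw).
have ur : uniq r by exact: undup_uniq.
have rv0 s : s \notin r -> gproj G s v = 0.
  by rewrite mem_undup mem_cat negb_or => /andP[/v0].
have rw0 s : s \notin r -> gproj G s w = 0.
  by rewrite mem_undup mem_cat negb_or => /andP[_ /w0].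
rewrite !(gtruncE T ur)//; last by move=> s sr; rewrite gproj_lin// rv0// rw0// scaler0 addr0.
rewrite scaler_sumr -big_split; apply: eq_bigr => s _ /=.
by case: ifP; rewrite ?gproj_lin// scaler0 addr0.
Qed.

Lemma gtrunc_id (T : pred I) s v : G s v -> gtrunc T v = if T s then v else 0.
Proof.
move=> Gv; rewrite (@gtruncE T [:: s])// ?big_seq1 ?gproj_id//.
by move=> r; rewrite inE => rs; rewrite (gproj_0 ds Gv)// eq_sym.
Qed.

End Truncation.

Section RestrictedDual.
Variables (K : numFieldType) (I : choiceType) (V : lmodType K) (G : I -> set V).
Local Notation D := (rdual G).

Lemma rdual_sc (f : D) : scalar (subval f).
Proof. by case: (rdualP f). Qed.

Lemma rdual_eq (f g : D) : (forall v, subval f v = subval g v) -> f = g.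
Proof. by move=> e; apply: subval_inj; apply/funext. Qed.

Lemma rdual_linE (a : K) (f g : D) v :
  subval (a *: f + g) v = a * subval f v + subval g v.
Proof. by []. Qed.

Lemma rdual_ev_sc v : scalar (fun f : D => subval f v).
Proof. by []. Qed.

Lemma rdual_sumE J (r : seq J) (P : pred J) (F : J -> D) v :
  subval (\sum_(i <- r | P i) F i) v = \sum_(i <- r | P i) subval (F i) v.
Proof. exact: (lin_sum (sc_lin (rdual_ev_sc v))). Qed.

Lemma mkrdualE (g : V -> K) : rfunctional G (g : V -> K^o) ->
  forall v, subval (mkrdual G g) v = g v.
Proof. by move=> rg v; rewrite /mkrdual tosubK//; exact: span_gen. Qed.

Lemma rfunctional_seq (g : V -> K) (r : seq I) : scalar g ->
  (forall s v, s \notin r -> G s v -> g v = 0) -> rfunctional G (g : V -> K^o).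
Proof.
move=> sg g0; split=> //; apply: (@seq_finite _ r) => s [v Gv gv].
by apply: contraNT gv => /g0 ->.
Qed.

Lemma rdual_seq (f : D) : exists r : seq I, uniq r /\
  forall s v, s \notin r -> G s v -> subval f v = 0.
Proof.
have [_ /finite_seq [r [ur rP]]] := rdualP f; exists r; split=> // s v sr Gv.
by apply: contrapT => /eqP fv; move/negP: sr; apply; apply/rP; exists v.
Qed.

Hypothesis ds : direct_sum G.

Lemma rdual_ext (f g : D) : (forall s v, G s v -> subval f v = subval g v) -> f = g.
Proof.
by move=> e; apply: rdual_eq; apply: (grade_ext (W := K^o) ds _ _ e); exact: rdual_sc.
Qed.

Definition rcomp (s : I) (f : D) : D := mkrdual G (fun v => subval f (gproj G s v)).

Lemma rcompE s f v : subval (rcomp s f) v = subval f (gproj G s v).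
Proof.
rewrite mkrdualE//; apply: (@rfunctional_seq _ [:: s]) => [a x y|r w].
  by rewrite gproj_lin// rdual_sc.
rewrite inE => rs Gw; rewrite (gproj_0 ds Gw)//; exact: lin0 (sc_lin (rdual_sc f)).
Qed.

Lemma rcomp_lin s : linear (rcomp s).
Proof. by move=> a f g; apply: rdual_eq => v; rewrite rdual_linE !rcompE. Qed.

Lemma rcomp_grade s f : rdual_grade s (rcomp s f).
Proof.
move=> r rs v Gv; rewrite rcompE (gproj_0 ds Gv)//.
exact: lin0 (sc_lin (rdual_sc f)).
Qed.

Lemma rcomp_id s f : rdual_grade s f -> rcomp s f = f.
Proof.
move=> fs; apply: rdual_ext => r v Gv; rewrite rcompE.
have [<-|rs] := eqVneq r s; first by rewrite gproj_id.
by rewrite (gproj_0 ds Gv)// (fs r rs v Gv); exact: lin0 (sc_lin (rdual_sc f)).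
Qed.

Lemma rcomp_0 r s f : rdual_grade r f -> r != s -> rcomp s f = 0.
Proof.
move=> fr rs; apply: rdual_ext => t v Gv; rewrite rcompE.
have [e|ts] := eqVneq t s.
  by rewrite gproj_id -?e// (fr t)// e eq_sym.
by rewrite (gproj_0 ds Gv)// (lin0 (sc_lin (rdual_sc f))).
Qed.

Lemma rdual_grade_ss s : is_subspace (@rdual_grade _ _ _ G s).
Proof.
split=> [//|a f g fs gs r rs v Gv].
by rewrite rdual_linE (fs r)// (gs r)// mulr0 addr0.
Qed.

(** The component of index [s] of [f] is [f] composed with the projection. *)
Lemma rdual_direct_sum : direct_sum (@rdual_grade _ _ _ G).
Proof.
apply: (@direct_sum_sep _ _ _ _ D (fun s => [set rcomp s])).
- exact: rdual_grade_ss.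
- move=> f; have [r [ur r0]] := rdual_seq f.
  have -> : f = \sum_(s <- r) rcomp s f.
    apply: rdual_ext => t v Gv; rewrite rdual_sumE.
    transitivity (\sum_(s <- r) if s == t then subval f v else 0).
      rewrite -big_mkcond; have [tr|ntr] := boolP (t \in r).
        by rewrite -big_filter filter_pred1_uniq// big_seq1.
      by rewrite (r0 t)// big1.
    apply: eq_bigr => s _; rewrite rcompE.
    case: eqP => [->|/eqP st]; first by rewrite gproj_id.
    by rewrite (gproj_0 ds Gv) 1?eq_sym//; rewrite (lin0 (sc_lin (rdual_sc f))).
  apply: (ss_sum (@span_ss _ _ _)) => s _; apply: span_gen; exists s => //.
  exact: rcomp_grade.
- by move=> s _ ->; split=> [|r f rs fr]; [exact: rcomp_lin|exact: rcomp_0 fr rs].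
- by move=> s f fs /(_ _ erefl); rewrite rcomp_id.
Qed.

Lemma rdual_gprojE s (f : D) v :
  subval (gproj (@rdual_grade _ _ _ G) s f) v = subval f (gproj G s v).
Proof.
rewrite -rcompE; congr (subval _ v).
apply: (grade_ext rdual_direct_sum (gproj_lin rdual_direct_sum s) (rcomp_lin s)).
move=> r g gr; have [e|rs] := eqVneq r s.
  by rewrite (gproj_id rdual_direct_sum) -?e// rcomp_id.
by rewrite (gproj_0 rdual_direct_sum gr)// (rcomp_0 gr).
Qed.

End RestrictedDual.

(** * Finitely supported sums and triple tensor products *)

Section Eventually.

(** A property of the bound at which a sum with finite support is cut. *)
Definition evt (P : nat -> Prop) := exists N0, forall N, (N0 <= N)%N -> P N.

Lemma evt_and (P Q : nat -> Prop) : evt P -> evt Q -> evt (fun N => P N /\ Q N).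
Proof.
move=> [N HN] [M HM]; exists (maxn N M) => k; rewrite geq_max => /andP[? ?].
by split; [exact: HN|exact: HM].
Qed.

Lemma evt_mono (P Q : nat -> Prop) : (forall N, P N -> Q N) -> evt P -> evt Q.
Proof. by move=> PQ [N HN]; exists N => M /HN /PQ. Qed.

Lemma evt_ex P : evt P -> exists N, P N.
Proof. by move=> [N HN]; exists N; exact: HN. Qed.

Lemma evt_ge (n : int) : evt (fun N => forall i : nat, (N <= i)%N -> n <= i%:Z).
Proof. by exists `|n|%N => N nN i Ni; lia. Qed.

Lemma evt_zero (U : nmodType) (c : nat -> int) (n : int) (F : nat -> U) :
  (forall i, n <= c i -> F i = 0) -> (forall i, c i = c 0 + i%:Z) ->
  evt (fun N => forall i, (N <= i)%N -> F i = 0).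
Proof.
move=> F0 cE; apply: evt_mono (evt_ge (n - c 0)) => N H i /H Hi.
by apply: F0; rewrite cE; lia.
Qed.

End Eventually.

Section TripleLift.
Variables (K : numFieldType) (A B C U : lmodType K) (t : A -> B -> C -> U).
Hypotheses (t1 : forall b c, linear (fun a => t a b c))
  (t2 : forall a c, linear (fun b => t a b c)) (t3 : forall a b, linear (t a b)).

Let e a b c : tlift (t a) (tpure b c) = t a b c.
Proof. exact: (tlift_pure (t2 a) (t3 a)). Qed.

Let l a : linear (tlift (t a)).
Proof. exact: (tlift_linear (t2 a) (t3 a)). Qed.

Let l1 z : linear (fun a => tlift (t a) z).
Proof.
move=> k x y; move: z.
apply: (@tens_ext _ _ _ _ (tlift _) (fun z => k *: tlift _ z + tlift _ z)).
- exact: l.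
- by apply: lin_add; [apply: lin_scale|]; exact: l.
- by move=> b c; rewrite !e t1.
Qed.

Lemma tlift3r_lin : linear (tlift (fun a z => tlift (t a) z)).
Proof. exact: (tlift_linear l1 l). Qed.

Lemma tlift3r_pure a b c :
  tlift (fun a z => tlift (t a) z) (tpure a (tpure b c)) = t a b c.
Proof. by rewrite -[RHS]e; exact: (tlift_pure l1 l). Qed.

Let el c a b : tlift (fun a b => t a b c) (tpure a b) = t a b c.
Proof. exact: (tlift_pure (t1^~ c) (t2^~ c)). Qed.

Let ll c : linear (tlift (fun a b => t a b c)).
Proof. exact: (tlift_linear (t1^~ c) (t2^~ c)). Qed.

Let ll1 z : linear (fun c => tlift (fun a b => t a b c) z).
Proof.
move=> k x y; move: z.
apply: (@tens_ext _ _ _ _ (tlift _) (fun z => k *: tlift _ z + tlift _ z)).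
- exact: ll.
- by apply: lin_add; [apply: lin_scale|]; exact: ll.
- by move=> a b; rewrite !el t3.
Qed.

Lemma tlift3l_lin : linear (tlift (fun z c => tlift (fun a b => t a b c) z)).
Proof. exact: (tlift_linear ll ll1). Qed.

Lemma tlift3l_pure a b c :
  tlift (fun z c => tlift (fun a b => t a b c) z) (tpure (tpure a b) c) = t a b c.
Proof. by rewrite -[RHS]el; exact: (tlift_pure ll ll1). Qed.

End TripleLift.

Section TripleTensors.
Variables (K : numFieldType) (V1 V2 W : lmodType K).

Let flip_t (v1 : V1) (v2 : V2) (w : W) : tens V2 (tens V1 W) := tpure v2 (tpure v1 w).
Let flip1 b c : linear (fun a => flip_t a b c).
Proof. by move=> k x y; rewrite /flip_t tpure_linearl tpure_linearr. Qed.
Let flip2 a c : linear (fun b => flip_t a b c).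
Proof. by move=> k x y; rewrite /flip_t tpure_linearl. Qed.
Let flip3 a b : linear (flip_t a b).
Proof. by move=> k x y; rewrite /flip_t !tpure_linearr. Qed.

Lemma tflip12_pure v1 v2 (w : W) :
  tflip12 (tpure v1 (tpure v2 w)) = tpure v2 (tpure v1 w) :> tens V2 (tens V1 W).
Proof. exact: (tlift3r_pure flip1 flip2 flip3). Qed.

Lemma tflip12_lin : linear (@tflip12 _ V1 V2 W).
Proof. exact: (tlift3r_lin flip1 flip2 flip3). Qed.

Let ass_t (v1 : V1) (v2 : V2) (w : W) : tens V1 (tens V2 W) := tpure v1 (tpure v2 w).
Let ass1 b c : linear (fun a => ass_t a b c).
Proof. by move=> k x y; rewrite /ass_t tpure_linearl. Qed.
Let ass2 a c : linear (fun b => ass_t a b c).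
Proof. by move=> k x y; rewrite /ass_t tpure_linearl tpure_linearr. Qed.
Let ass3 a b : linear (ass_t a b).
Proof. by move=> k x y; rewrite /ass_t !tpure_linearr. Qed.

Lemma tassoc_lin : linear (@tassoc _ V1 V2 W).
Proof. exact: (tlift3l_lin ass1 ass2 ass3). Qed.

Lemma tassoc_pure v1 v2 (w : W) :
  tassoc (tpure (tpure v1 v2) w) = tpure v1 (tpure v2 w) :> tens V1 (tens V2 W).
Proof. exact: (tlift3l_pure ass1 ass2 ass3). Qed.

Lemma tens3_ext (U : lmodType K) (f g : tens V1 (tens V2 W) -> U) :
  linear f -> linear g ->
  (forall v1 v2 w, f (tpure v1 (tpure v2 w)) = g (tpure v1 (tpure v2 w))) ->
  forall z, f z = g z.
Proof.
move=> lf lg e; apply: tens_ext => // v1.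
apply: (@tens_ext _ _ _ _ (f \o tpure v1) (g \o tpure v1)) => [||v2 w]; last exact: e.
- exact: lin_comp (tpure_linearr v1) lf.
- exact: lin_comp (tpure_linearr v1) lg.
Qed.

Lemma tens3l_ext (U : lmodType K) (f g : tens (tens V1 V2) W -> U) :
  linear f -> linear g ->
  (forall v1 v2 w, f (tpure (tpure v1 v2) w) = g (tpure (tpure v1 v2) w)) ->
  forall z, f z = g z.
Proof.
move=> lf lg e; apply: tens_ext => // z w; move: z.
apply: (@tens_ext _ _ _ _ (fun z => f (tpure z w)) (fun z => g (tpure z w))) => [||v1 v2]; last exact: e.
- exact: (lin_comp (tpure_linearl w) lf).
- exact: (lin_comp (tpure_linearl w) lg).
Qed.

Variables (f : V1 -> K) (g : V2 -> K) (p : W -> K).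
Hypotheses (sf : scalar f) (sg : scalar g) (sp : scalar p).

Lemma pair_flip z :
  tpair g (tpair f p) (tflip12 z) = tpair f (tpair g p) z.
Proof.
have sgp := tpair_scalar sg sp; have sfp := tpair_scalar sf sp.
move: z; apply: (@tens3_ext K^o (tpair g (tpair f p) \o @tflip12 _ V1 V2 W)
  (tpair f (tpair g p))) => [||v1 v2 w].
- exact: (@lin_comp _ _ _ K^o _ _ tflip12_lin (tpair_scalar sg sfp)).
- exact: tpair_scalar.
- by rewrite /= tflip12_pure !tpair_pure// mulrCA.
Qed.

Lemma pair_assoc z :
  tpair f (tpair g p) (tassoc z) = tpair (tpair f g) p z.
Proof.
have sgp := tpair_scalar sg sp; have sfg := tpair_scalar sf sg.
move: z; apply: (@tens3l_ext K^o (tpair f (tpair g p) \o @tassoc _ V1 V2 W)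
  (tpair (tpair f g) p)) => [||v1 v2 w].
- exact: (@lin_comp _ _ _ K^o _ _ tassoc_lin (tpair_scalar sf sgp)).
- exact: tpair_scalar.
- by rewrite /= tassoc_pure !tpair_pure// mulrA.
Qed.

End TripleTensors.

(** * The dual vertex algebra *)

Section DualAlgebra.
Variables (K : numFieldType) (V : gvoc K).
Local Notation D := (dualV V).
Local Notation L := (vir (@rho K V) (@comode K V)).
Local Notation P := (gproj (@grade K V)).

Lemma dsV : direct_sum (@grade K V).
Proof. exact: gr_direct_sum (voc_graded V). Qed.

Lemma wt_ds : direct_sum (@wt_space K V).
Proof. exact: rdual_direct_sum dsV. Qed.

Lemma dual_ext (f g : D) :
  (forall s v, grade V s v -> subval f v = subval g v) -> f = g.
Proof. exact: rdual_ext dsV f g. Qed.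

Lemma comode_lin k : linear (@comode K V k).
Proof. exact: vc_linear (voc_vertex V) k. Qed.

Lemma rho_sc : scalar (@rho K V).
Proof. exact: cf_linear (voc_conformal V). Qed.

Lemma counit_sc : scalar (@counit K V).
Proof. exact: vc_counit_linear (voc_vertex V). Qed.

Definition ub (f : D) (d : int) := forall r v, d < r -> grade V r v -> subval f v = 0.

Lemma seq_int_max (r : seq int) : exists d : int, forall s, s \in r -> s <= d.
Proof.
elim: r => [|x r [d Hd]]; first by exists 0.
exists (Order.max x d) => s; rewrite inE => /orP[/eqP ->|/Hd sd]; lia.
Qed.

Lemma ub_ex f : exists d, ub f d.
Proof.
have [r [_ r0]] := rdual_seq f; have [d Hd] := seq_int_max r.
exists d => s v ds Gv; apply: (r0 s) => //.
by apply/negP => /Hd; lia.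
Qed.

Lemma low_ex : exists N0 : int, forall s v, s < N0 -> grade V s v -> v = 0.
Proof.
by have [N HN] := gr_bounded (voc_graded V); exists N => s v /HN -> .
Qed.

Lemma ub_low : exists N0 : int, forall f d, ub f d -> d < N0 -> f = 0.
Proof.
have [N HN] := low_ex; exists N => f d fd dN; apply: dual_ext => s v Gv.
have [ds|sd] := ltP d s; first by rewrite (fd s v).
have -> : v = 0 by apply: HN Gv; lia.
by rewrite !(lin0 (sc_lin (rdual_sc _))).
Qed.

(** The coproduct has degree $k + 1$, so [f] and [g] bound the degrees on which
    $f_k g$ can be nonzero. *)
Lemma ub_vprod f g d e k : ub f d -> ub g e -> ub (vprod f k g) (d + e - k - 1).
Proof.
move=> fd ge r v rlt Gv; rewrite vprodE.
have := @gr_degree _ _ _ _ (voc_graded V) k _ _ Gv.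
have st := tpair_scalar (rdual_sc f) (rdual_sc g).
apply: (span_lin (sc_lin st) (@sub_set0 _ K^o)) => _ [s [x [y [Gx Gy ->]]]] /=.
rewrite tpair_pure; [|exact: rdual_sc..].
have [es|se] := ltP e s; first by rewrite (ge s)// mulr0.
rewrite (fd (r + k + 1 - s))// ?mul0r//; lia.
Qed.

Lemma wt_vprod s t (f g : D) k : wt_space s f -> wt_space t g ->
  wt_space (s + t - k - 1) (vprod f k g).
Proof.
move=> fs gt r rne v Gv; rewrite vprodE.
have := @gr_degree _ _ _ _ (voc_graded V) k _ _ Gv.
have st := tpair_scalar (rdual_sc f) (rdual_sc g).
apply: (span_lin (sc_lin st) (@sub_set0 _ K^o)) => _ [u [x [y [Gx Gy ->]]]] /=.
rewrite tpair_pure; [|exact: rdual_sc..].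
have [e|ne] := eqVneq u t; last by rewrite (gt _ ne _ Gy) mulr0.
rewrite (fs (r + k + 1 - u))// ?mul0r//; lia.
Qed.

Lemma vprod_linl k g : linear (fun f : D => vprod f k g).
Proof.
move=> a f f'; apply: rdual_eq => v; rewrite rdual_linE !vprodE.
rewrite !tpairEr; [|exact: rdual_sc..].
exact: rdual_linE.
Qed.

Lemma vprod_linr k f : linear (fun g : D => vprod f k g).
Proof.
move=> a g g'; apply: rdual_eq => v; rewrite rdual_linE !vprodE.
rewrite !tpairEl; [|exact: rdual_sc..].
exact: rdual_linE.
Qed.

Lemma vtrans_lin : linear (@vtrans K V).
Proof. by move=> a f g; apply: rdual_eq => v; rewrite rdual_linE !vtransE. Qed.

Lemma vprod_trunc (f g : D) : exists N : int, forall k, N <= k -> vprod f k g = 0.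
Proof.
have [N HN] := ub_low; have [d fd] := ub_ex f; have [e ge] := ub_ex g.
exists (d + e - N) => k Nk; apply: (HN _ (d + e - k - 1) (ub_vprod fd ge)); lia.
Qed.

(** The weight of a triple product decreases with the sum of the two indices,
    and weights are bounded below. *)
Lemma vprod_trunc2 (f g h : D) : exists N : int, forall i j, N <= i + j ->
  vprod f i (vprod g j h) = 0 /\ vprod (vprod f i g) j h = 0.
Proof.
have [N HN] := ub_low; have [d fd] := ub_ex f; have [e ge] := ub_ex g.
have [c hc] := ub_ex h; exists (d + e + c - N) => i j ij; split.
  by apply: (HN _ _ (ub_vprod fd (ub_vprod ge hc))); lia.
by apply: (HN _ _ (ub_vprod (ub_vprod fd ge) hc)); lia.
Qed.

Lemma wt_vtrans s (f : D) : wt_space s f -> wt_space (s + 1) (vtrans f).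
Proof.
move=> fs r rs v Gv; rewrite vtransE; apply: (fs (r - 1)); first lia.
exact: vir1_grade.
Qed.

(** Here $c \circ L(k)$ is $(\rho \otimes c) \Delta_{1-k}$, and the right counit axiom
    annihilates nonnegative indices. *)
Lemma counit_vir k v : k <= 1 -> counit V (L k v) = 0.
Proof.
move=> k1; rewrite /vir -tpairEl; [|exact: rho_sc|exact: counit_sc].
rewrite tpairEr; [|exact: rho_sc|exact: counit_sc].
rewrite (vc_counitr (voc_vertex V)); last by lia.
exact: (lin0 (sc_lin rho_sc)).
Qed.

Lemma rho_counit v : rho V v = counit V (L 2 v).
Proof.
rewrite /vir -tpairEl; [|exact: rho_sc|exact: counit_sc].
rewrite tpairEr; [|exact: rho_sc|exact: counit_sc].
by rewrite (vc_counitr_lim (voc_vertex V)).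
Qed.

Lemma vir0_grade s v : grade V s v -> L 0 v = s%:~R *: v.
Proof. by rewrite (cf_eigenspace (voc_conformal V)). Qed.

Lemma counit_grade s v : s != 0 -> grade V s v -> counit V v = 0.
Proof.
move=> s0 Gv; have := @counit_vir 0 v isT; rewrite (vir0_grade Gv).
rewrite (linZ (sc_lin counit_sc)) => /eqP.
by rewrite mulf_eq0 intr_eq0 (negPf s0) => /eqP.
Qed.

Lemma rho_grade s v : s != 2 -> grade V s v -> rho V v = 0.
Proof.
move=> s2 Gv; have := cf_virasoro (voc_conformal V) 2 0 v.
rewrite /= scale0r !addr0 (vir0_grade Gv) => /(congr1 (counit V)).
rewrite (linB (sc_lin counit_sc)) (@counit_vir 0)// subr0.
rewrite (linZ (@vir_linear _ V 2)) !(linZ (sc_lin counit_sc)) -rho_counit => e.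
have /eqP : (s - 2)%:~R * rho V v = 0.
  by rewrite intrB mulrBl; apply/eqP; rewrite subr_eq0; apply/eqP; exact: e.
by rewrite mulf_eq0 intr_eq0 subr_eq0 (negPf s2) => /eqP.
Qed.

Definition vac : D := mkrdual (@grade K V) (@counit K V).
Definition omg : D := mkrdual (@grade K V) (@rho K V).

Lemma vacE v : subval vac v = counit V v.
Proof.
rewrite mkrdualE//; apply: (@rfunctional_seq _ _ _ _ _ [:: 0]).
  exact: counit_sc.
by move=> s w; rewrite inE => s0; exact: counit_grade.
Qed.

Lemma omgE v : subval omg v = rho V v.
Proof.
rewrite mkrdualE//; apply: (@rfunctional_seq _ _ _ _ _ [:: 2]).
  exact: rho_sc.
by move=> s w; rewrite inE => s0; exact: rho_grade.
Qed.

Lemma vac_fun : subval vac = @counit K V :> (V -> K).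
Proof. by apply/funext => v; exact: vacE. Qed.
Lemma omg_fun : subval omg = @rho K V :> (V -> K).
Proof. by apply/funext => v; exact: omgE. Qed.

Lemma wt_vac : wt_space 0 vac.
Proof. by move=> r r0 v Gv; rewrite vacE; exact: counit_grade Gv. Qed.

Lemma vprod_vacl k f : vprod vac k f = if k == -1 then f else 0.
Proof.
apply: rdual_eq => v; rewrite vprodE vac_fun tpairEl; last 2 first.
- exact: counit_sc.
- exact: rdual_sc.
rewrite (vc_counitl (voc_vertex V)); case: eqP => // _.
exact: lin0 (sc_lin (rdual_sc f)).
Qed.

Lemma vprod_vacr k f : 0 <= k -> vprod f k vac = 0.
Proof.
move=> k0; apply: rdual_eq => v; rewrite vprodE vac_fun tpairEr; last 2 first.
- exact: rdual_sc.
- exact: counit_sc.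
by rewrite (vc_counitr (voc_vertex V))//; exact: lin0 (sc_lin (rdual_sc f)).
Qed.

Lemma vprod_vacr1 f : vprod f (-1) vac = f.
Proof.
apply: rdual_eq => v; rewrite vprodE vac_fun tpairEr; last 2 first.
- exact: rdual_sc.
- exact: counit_sc.
by rewrite (vc_counitr_lim (voc_vertex V)).
Qed.

Lemma vprod_vtransl (f : D) k g : vprod (vtrans f) k g = - k%:~R *: vprod f (k - 1) g.
Proof.
apply: rdual_eq => v; rewrite -[- _ *: _]addr0 rdual_linE addr0 !vprodE.
have -> : subval (vtrans f) = (fun v => subval f (L 1 v)) :> (V -> K).
  by apply/funext => w; exact: vtransE.
have := @tpair_tmap _ _ _ _ _ (subval f) (subval g) (L 1) id (comode k v)
  (rdual_sc f) (rdual_sc g) (@vir_linear _ V 1) (@lin_id _ _).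
move=> <-; rewrite (cf_derivative (voc_conformal V)).
have st := tpair_scalar (rdual_sc f) (rdual_sc g).
exact: (linZ (sc_lin st)).
Qed.

Lemma omg0 f : vprod omg 0 f = vtrans f.
Proof.
apply: rdual_eq => v; rewrite vprodE omg_fun tpairEl; last 2 first.
- exact: rho_sc.
- exact: rdual_sc.
by rewrite vtransE.
Qed.

(** The Virasoro relations, applied to $\rho = c \circ L(2)$, compute all
    products of the conformal vector with itself. *)
Lemma vprod_omg (n : nat) : vprod omg n omg =
  if n == 0%N then vtrans omg else if n == 1%N then 2%:R *: omg
  else if n == 3%N then (charge V / 2%:R) *: vac else 0.
Proof.
have c_vir k v : counit V (L 2 (L k v)) - counit V (L k (L 2 v)) =
    (2 - k)%:~R * counit V (L (2 + k) v)
    + (if k == -2 then (charge V / 2%:R) * counit V v else 0).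
  rewrite -(linB (sc_lin counit_sc)) (cf_virasoro (voc_conformal V)).
  rewrite counit_sc (linZ (sc_lin counit_sc)); congr (_ + _).
  have -> : (2 + k == 0) = (k == -2) by apply/eqP/eqP; lia.
  case: eqP => _; last by rewrite scale0r.
  rewrite (_ : (2 ^+ 3 - 2)%:~R = 6%:R :> K)//; congr (_ * _).
  rewrite (_ : 12%:R = 6%:R * 2%:R :> K); last by rewrite -natrM.
  by rewrite invfM mulrA divff ?mul1r 1?mulrC// pnatr_eq0.
have E v : subval (vprod omg n omg) v = counit V (L 2 (L (1 - n%:Z) v)).
  rewrite vprodE omg_fun tpairEl; [|exact: rho_sc|exact: rho_sc].
  by rewrite rho_counit /vir (_ : 1 - (1 - n%:Z) = n)//; lia.
apply: rdual_eq => v; rewrite E.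
have := c_vir (1 - n%:Z) v; rewrite (@counit_vir (1 - n%:Z)) ?subr0; last by lia.
move=> ->; case: n E => [|[|[|[|n]]]] E /=.
- rewrite !addr0 vtransE omgE rho_counit.
  have := c_vir 1 v; rewrite (@counit_vir 1)// subr0 => ->.
  by rewrite addr0.
- by rewrite addr0 -[RHS]/(2%:R * subval omg v) omgE rho_counit.
- by rewrite addr0 (@counit_vir 1)// mulr0.
- rewrite (@counit_vir 0)// mulr0 add0r.
  by rewrite -[RHS]/((charge V / 2%:R) * subval vac v) vacE.
- rewrite (@counit_vir) ?mulr0 ?add0r; last by lia.
  by [].
Qed.

End DualAlgebra.

(** * The coefficients of the Jacobi identity *)

Section Modules.
Variables (K : numFieldType) (V : gvoc K) (Y : lmodType K).
Local Notation D := (dualV V).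
Local Notation zb := (@zbin K).
Variable act : D -> int -> Y -> Y.

Lemma sgnD (l : int) (i : nat) : (-1) ^ (l + i%:Z) = (-1) ^ l * (-1) ^+ i :> K.
Proof. by rewrite expfzDr// oppr_eq0 oner_eq0. Qed.

Lemma sgnS (l : int) : (-1) ^ (l + 1) = - (-1) ^ l :> K.
Proof. by rewrite (sgnD l 1) expr1 mulrN1. Qed.

Lemma sgnN1 : (-1) ^ (-1 : int) = -1 :> K.
Proof. by rewrite exprN1 invrN invr1. Qed.

(** The bilinear expression whose vanishing is the coefficient of
    $z_0^{-l-1} z_1^{-m-1} z_2^{-n-1}$ in the Jacobi identity. *)
Definition borch (l m n : int) (f g : D) (y : Y) : Y :=
  \sum_(i \in [set: nat]) ((-1) ^+ i * zb l i) *: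
     act f (m + l - i%:Z) (act g (n + i%:Z) y)
  - \sum_(i \in [set: nat]) ((-1) ^ (l + i%:Z) * zb l i) *:
     act g (n + l - i%:Z) (act f (m + i%:Z) y)
  - \sum_(i \in [set: nat]) zb m i *: act (vprod f (l + i%:Z) g) (m + n - i%:Z) y.

Definition borch_cut N (l m n : int) (f g : D) (y : Y) : Y :=
  \sum_(i < N) ((-1) ^+ i * zb l i) *: act f (m + l - i%:Z) (act g (n + i%:Z) y)
  - \sum_(i < N) ((-1) ^ (l + i%:Z) * zb l i) *:
       act g (n + l - i%:Z) (act f (m + i%:Z) y)
  - \sum_(i < N) zb m i *: act (vprod f (l + i%:Z) g) (m + n - i%:Z) y.

Record restricted : Prop := Restricted {
  act_linl : forall k y, linear (fun f => act f k y);
  act_linr : forall f k, linear (act f k);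
  act_trunc : forall f y, exists N : int, forall k, N <= k -> act f k y = 0 }.

Hypothesis rY : restricted.

Lemma act0l k y : act 0 k y = 0. Proof. exact: lin0 (act_linl rY k y). Qed.
Lemma act0r f k : act f k 0 = 0. Proof. exact: lin0 (act_linr rY f k). Qed.

Lemma act_evt f c y :
  evt (fun N => forall i, (N <= i)%N -> act f (c + i%:Z) y = 0).
Proof.
have [N HN] := act_trunc rY f y.
apply: (@evt_zero _ (fun i => c + i%:Z) N); first by move=> i; exact: HN.
by move=> i; rewrite addr0.
Qed.

Lemma vprod_evt (f g : D) c :
  evt (fun N => forall i, (N <= i)%N -> vprod f (c + i%:Z) g = 0).
Proof.
have [N HN] := vprod_trunc f g.
apply: (@evt_zero _ (fun i => c + i%:Z) N); first by move=> i; exact: HN.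
by move=> i; rewrite addr0.
Qed.

Lemma borchE l m n f g y :
  evt (fun N => borch l m n f g y = borch_cut N l m n f g y).
Proof.
have := evt_and (act_evt g n y) (evt_and (act_evt f m y) (vprod_evt f g l)).
apply: evt_mono => N [H1 [H2 H3]]; rewrite /borch /borch_cut.
rewrite (@fsum_ord _ _ N); last by move=> i /H1 ->; rewrite act0r scaler0.
rewrite (@fsum_ord _ _ N); last by move=> i /H2 ->; rewrite act0r scaler0.
by rewrite (@fsum_ord _ _ N)// => i /H3 ->; rewrite act0l scaler0.
Qed.

Lemma sum_pascal (N : nat) (n : int) (F : nat -> Y) : F N = 0 ->
  \sum_(i < N) zb (n + 1) i *: F i
  = \sum_(i < N) zb n i *: F i + \sum_(i < N) zb n i *: F i.+1.
Proof.
move=> FN; transitivity (\sum_(i < N.+1) zb (n + 1) i *: F i).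
  by rewrite big_ord_recr /= FN scaler0 addr0.
transitivity (\sum_(i < N.+1) zb n i *: F i + \sum_(i < N) zb n i *: F i.+1).
  rewrite big_ord_recl [in RHS]big_ord_recl !zbin0 -addrA; congr (_ + _).
  rewrite -big_split; apply: eq_bigr => i _ /=.
  by rewrite /bump add1n zbin_pascal scalerDl.
by rewrite big_ord_recr /= FN scaler0 addr0.
Qed.

(** The Pascal identity in the first index; it makes commutators and
    associators generate all the other identities. *)
Lemma borch_rec l m n f g y :
  borch (l + 1) m n f g y = borch l (m + 1) n f g y - borch l m (n + 1) f g y.
Proof.
have [N [[-> -> ->] [H1 [H2 H3]]]] : exists N, [/\
    borch (l + 1) m n f g y = borch_cut N (l + 1) m n f g y,
    borch l (m + 1) n f g y = borch_cut N l (m + 1) n f g y &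
    borch l m (n + 1) f g y = borch_cut N l m (n + 1) f g y] /\
    [/\ act g (n + N%:Z) y = 0, act f (m + N%:Z) y = 0 &
        vprod f (l + N%:Z) g = 0].
  have := evt_and (borchE (l + 1) m n f g y) (evt_and (borchE l (m + 1) n f g y)
    (evt_and (borchE l m (n + 1) f g y) (evt_and (act_evt g n y)
    (evt_and (act_evt f m y) (vprod_evt f g l))))).
  move/evt_ex => [N [e1 [e2 [e3 [h1 [h2 h3]]]]]].
  by exists N; split; split=> //; [exact: h1|exact: h2|exact: h3].
rewrite /borch_cut.
pose F1 i := (-1) ^+ i *: act f (m + (l + 1) - i%:Z) (act g (n + i%:Z) y).
pose F2 i := (-1) ^ (l + 1 + i%:Z) *: act g (n + (l + 1) - i%:Z) (act f (m + i%:Z) y).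
pose F3 i := act (vprod f (l + i%:Z) g) (m + 1 + n - i%:Z) y.
have E1 : \sum_(i < N) ((-1) ^+ i * zb (l + 1) i) *:
    act f (m + (l + 1) - i%:Z) (act g (n + i%:Z) y)
  = \sum_(i < N) ((-1) ^+ i * zb l i) *: act f (m + 1 + l - i%:Z) (act g (n + i%:Z) y)
  - \sum_(i < N) ((-1) ^+ i * zb l i) *: act f (m + l - i%:Z) (act g (n + 1 + i%:Z) y).
  transitivity (\sum_(i < N) zb (l + 1) i *: F1 i).
    by apply: eq_bigr => i _; rewrite /F1 scalerA mulrC.
  rewrite sum_pascal; last by rewrite /F1 H1 act0r scaler0.
  rewrite -sumrN; congr (_ + _); apply: eq_bigr => i _; rewrite /F1 scalerA.
    by rewrite mulrC (_ : m + (l + 1) - i%:Z = m + 1 + l - i%:Z)//; lia.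
  rewrite exprS mulrCA mulN1r scaleNr mulrC.
  rewrite (_ : m + (l + 1) - i.+1%:Z = m + l - i%:Z); last by lia.
  by rewrite (_ : n + i.+1%:Z = n + 1 + i%:Z)//; lia.
have E2 : \sum_(i < N) ((-1) ^ (l + 1 + i%:Z) * zb (l + 1) i) *:
    act g (n + (l + 1) - i%:Z) (act f (m + i%:Z) y)
  = \sum_(i < N) ((-1) ^ (l + i%:Z) * zb l i) *: act g (n + l - i%:Z) (act f (m + 1 + i%:Z) y)
  - \sum_(i < N) ((-1) ^ (l + i%:Z) * zb l i) *: act g (n + 1 + l - i%:Z) (act f (m + i%:Z) y).
  transitivity (\sum_(i < N) zb (l + 1) i *: F2 i).
    by apply: eq_bigr => i _; rewrite /F2 scalerA mulrC.
  rewrite sum_pascal; last by rewrite /F2 H2 act0r scaler0.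
  rewrite addrC -sumrN; congr (_ + _); apply: eq_bigr => i _; rewrite /F2 scalerA.
    rewrite (_ : l + 1 + i.+1%:Z = l + i%:Z + 1 + 1); last by lia.
    rewrite !sgnS opprK mulrC (_ : n + (l + 1) - i.+1%:Z = n + l - i%:Z); last by lia.
    by rewrite (_ : m + i.+1%:Z = m + 1 + i%:Z)//; lia.
  rewrite (_ : l + 1 + i%:Z = l + i%:Z + 1); last by lia.
  by rewrite sgnS mulrN scaleNr mulrC (_ : n + (l + 1) - i%:Z = n + 1 + l - i%:Z)//; lia.
have E3 : \sum_(i < N) zb (m + 1) i *: act (vprod f (l + i%:Z) g) (m + 1 + n - i%:Z) y
  = \sum_(i < N) zb m i *: act (vprod f (l + i%:Z) g) (m + (n + 1) - i%:Z) y
  + \sum_(i < N) zb m i *: act (vprod f (l + 1 + i%:Z) g) (m + n - i%:Z) y.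
  rewrite (@sum_pascal N m F3); last by rewrite /F3 H3 act0l.
  congr (_ + _); apply: eq_bigr => i _; rewrite /F3.
    by rewrite (_ : m + 1 + n - i%:Z = m + (n + 1) - i%:Z)//; lia.
  rewrite (_ : l + i.+1%:Z = l + 1 + i%:Z); last by lia.
  by rewrite (_ : m + 1 + n - i.+1%:Z = m + n - i%:Z)//; lia.
rewrite E1 E2 E3; set a := \sum_(i < N) _; set b := \sum_(i < N) _.
set c := \sum_(i < N) _; set d := \sum_(i < N) _; set e := \sum_(i < N) _.
set h := \sum_(i < N) _.
by move: a b c d e h => a b c d e h; modring.
Qed.

Lemma zbin_sub l (i : nat) : (l%:~R - i%:R) * zb l i = l%:~R * zb (l - 1) i.
Proof. by rewrite -zbinS zbin_absorb. Qed.

(** Substituting $Df$ for $f$ lowers an index; so the identities of first index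
    $l - 1$ follow from those of first index $l$. *)
Lemma borch_der l m n f g y :
  (forall f k y, act (vtrans f) k y = - k%:~R *: act f (k - 1) y) ->
  borch l m n (vtrans f) g y =
  - m%:~R *: borch l (m - 1) n f g y - l%:~R *: borch (l - 1) m n f g y.
Proof.
move=> der.
have [N [[-> -> ->] [H1 [H2 H3]]]] : exists N, [/\
    borch l m n (vtrans f) g y = borch_cut N l m n (vtrans f) g y,
    borch l (m - 1) n f g y = borch_cut N l (m - 1) n f g y &
    borch (l - 1) m n f g y = borch_cut N (l - 1) m n f g y] /\
    [/\ act g (n + N%:Z) y = 0, act f (m - 1 + N%:Z) y = 0 &
        vprod f (l - 1 + N%:Z) g = 0].
  have := evt_and (borchE l m n (vtrans f) g y) (evt_and (borchE l (m - 1) n f g y)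
    (evt_and (borchE (l - 1) m n f g y) (evt_and (act_evt g n y)
    (evt_and (act_evt f (m - 1) y) (vprod_evt f g (l - 1)))))).
  move/evt_ex => [N [e1 [e2 [e3 [h1 [h2 h3]]]]]].
  by exists N; split; split=> //; [exact: h1|exact: h2|exact: h3].
rewrite /borch_cut.
have E1 : \sum_(i < N) ((-1) ^+ i * zb l i) *:
    act (vtrans f) (m + l - i%:Z) (act g (n + i%:Z) y)
  = - m%:~R *: (\sum_(i < N) ((-1) ^+ i * zb l i) *:
      act f (m - 1 + l - i%:Z) (act g (n + i%:Z) y))
  - l%:~R *: (\sum_(i < N) ((-1) ^+ i * zb (l - 1) i) *:
      act f (m + (l - 1) - i%:Z) (act g (n + i%:Z) y)).
  rewrite !scaler_sumr -sumrB; apply: eq_bigr => i _; rewrite der !scalerA.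
  rewrite (_ : m - 1 + l - i%:Z = m + l - i%:Z - 1); last by lia.
  rewrite (_ : m + (l - 1) - i%:Z = m + l - i%:Z - 1); last by lia.
  rewrite -scalerBl; congr (_ *: _).
  rewrite [in RHS](mulrCA l%:~R) -zbin_sub intrB intrD -pmulrn; ring.
have E2 : \sum_(i < N) ((-1) ^ (l + i%:Z) * zb l i) *:
    act g (n + l - i%:Z) (act (vtrans f) (m + i%:Z) y)
  = - m%:~R *: (\sum_(i < N) ((-1) ^ (l + i%:Z) * zb l i) *:
      act g (n + l - i%:Z) (act f (m - 1 + i%:Z) y))
  - l%:~R *: (\sum_(i < N) ((-1) ^ (l - 1 + i%:Z) * zb (l - 1) i) *:
      act g (n + (l - 1) - i%:Z) (act f (m + i%:Z) y)).
  pose F i := (i%:R * ((-1) ^ (l + i%:Z) * zb l i)) *: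
    act g (n + l - i%:Z) (act f (m - 1 + i%:Z) y).
  transitivity (- m%:~R *: (\sum_(i < N) ((-1) ^ (l + i%:Z) * zb l i) *:
      act g (n + l - i%:Z) (act f (m - 1 + i%:Z) y)) - \sum_(i < N) F i).
    rewrite scaler_sumr -sumrB; apply: eq_bigr => i _.
    rewrite der (linZ (act_linr rY _ _)) !scalerA /F -scalerBl.
    rewrite (_ : m + i%:Z - 1 = m - 1 + i%:Z); last by lia.
    by congr (_ *: _); rewrite intrD -pmulrn; ring.
  congr (_ - _); rewrite sum_shift1; first last.
  - by rewrite /F H2 act0r scaler0.
  - by rewrite /F mul0r scale0r.
  rewrite scaler_sumr; apply: eq_bigr => i _; rewrite /F scalerA.
  rewrite mulrCA zbin_absorb.
  rewrite (_ : l + i.+1%:Z = l - 1 + i%:Z + 1 + 1); last by lia.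
  rewrite !sgnS opprK (_ : n + l - i.+1%:Z = n + (l - 1) - i%:Z); last by lia.
  rewrite (_ : m - 1 + i.+1%:Z = m + i%:Z); last by lia.
  by rewrite mulrCA.
have E3 : \sum_(i < N) zb m i *: act (vprod (vtrans f) (l + i%:Z) g) (m + n - i%:Z) y
  = - m%:~R *: (\sum_(i < N) zb (m - 1) i *:
      act (vprod f (l + i%:Z) g) (m - 1 + n - i%:Z) y)
  - l%:~R *: (\sum_(i < N) zb m i *:
      act (vprod f (l - 1 + i%:Z) g) (m + n - i%:Z) y).
  pose F i := (i%:R * zb m i) *: act (vprod f (l - 1 + i%:Z) g) (m + n - i%:Z) y.
  transitivity (- (\sum_(i < N) F i) - l%:~R *: (\sum_(i < N) zb m i *:
      act (vprod f (l - 1 + i%:Z) g) (m + n - i%:Z) y)).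
    rewrite scaler_sumr -opprD -big_split -sumrN; apply: eq_bigr => i _ /=.
    rewrite vprod_vtransl (linZ (act_linl rY _ _)) !scalerA /F -scalerDl -scaleNr.
    rewrite (_ : l + i%:Z - 1 = l - 1 + i%:Z); last by lia.
    by congr (_ *: _); rewrite intrD -pmulrn; ring.
  congr (_ - _); rewrite sum_shift1; first last.
  - by rewrite /F H3 act0l scaler0.
  - by rewrite /F mul0r scale0r.
  rewrite scaleNr scaler_sumr; congr (- _); apply: eq_bigr => i _.
  rewrite /F scalerA zbin_absorb.
  rewrite (_ : l - 1 + i.+1%:Z = l + i%:Z); last by lia.
  by rewrite (_ : m + n - i.+1%:Z = m - 1 + n - i%:Z)//; lia.
rewrite E1 E2 E3; set a := \sum_(i < N) _; set b := \sum_(i < N) _.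
set c := \sum_(i < N) _; set d := \sum_(i < N) _; set e := \sum_(i < N) _.
set h := \sum_(i < N) _; move: a b c d e h => a b c d e h.
by move: (m%:~R) (l%:~R) => mm ll; modring.
Qed.

Lemma borchN1E m n f g y : evt (fun N => borch (-1) m n f g y =
  \sum_(i < N) act f (m - 1 - i%:Z) (act g (n + i%:Z) y)
  + \sum_(i < N) act g (n - 1 - i%:Z) (act f (m + i%:Z) y)
  - \sum_(i < N) zb m i *: act (vprod f (-1 + i%:Z) g) (m + n - i%:Z) y).
Proof.
apply: evt_mono (borchE (-1) m n f g y) => N ->; rewrite /borch_cut.
congr (_ - _); rewrite -sumrN; congr (_ + _); apply: eq_bigr => i _.
  by rewrite zbinN1 -expr2 sqrr_sign scale1r.
by rewrite sgnD sgnN1 zbinN1 mulN1r mulNr -expr2 sqrr_sign scaleN1r opprK.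
Qed.

Lemma borch0E m n f g y : evt (fun N => borch 0 m n f g y =
  act f m (act g n y) - act g n (act f m y)
  - \sum_(i < N) zb m i *: act (vprod f i%:Z g) (m + n - i%:Z) y).
Proof.
have := evt_and (evt_ge 1) (borchE 0 m n f g y).
apply: evt_mono => N [N1 ->]; rewrite /borch_cut.
have {N1} : (0 < N)%N by have := N1 N (leqnn N); lia.
case: N => // N _; congr (_ - _ - _).
- rewrite big_ord_recl big1 => [|i _]; last by rewrite zbin0S mulr0 scale0r.
  rewrite addr0 /= expr0 zbin0 mul1r scale1r.
  by congr (act f _ (act g _ y)); lia.
- rewrite big_ord_recl big1 => [|i _]; last by rewrite zbin0S mulr0 scale0r.
  rewrite addr0 /= zbin0 addr0 expr0z mul1r scale1r.
  by congr (act g _ (act f _ y)); lia.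
Qed.

(** The number of terms of a commutator can be chosen independently of the
    modes and of the vector, since it only depends on the products $f_i g$. *)
Lemma comm_cut f g : (forall m n f g y, borch 0 m n f g y = 0) ->
  evt (fun N => forall m n y, act f m (act g n y) = act g n (act f m y) +
    \sum_(i < N) zb m i *: act (vprod f i%:Z g) (m + n - i%:Z) y).
Proof.
move=> com; have [N HN] := vprod_evt f g 0.
exists N => M NM m n y; have [N' HN'] := borch0E m n f g y.
have := HN' (maxn M N') (leq_maxr _ _); rewrite com => /esym/eqP.
rewrite subr_eq add0r subr_eq addrC => /eqP ->; congr (_ + _).
apply: (@sum_widen _ _ M _ (fun i => zb m i *: act (vprod f i%:Z g) (m + n - i%:Z) y)).
  exact: leq_maxl.
move=> i Mi; have := HN i (leq_trans NM Mi) i (leqnn i).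
by rewrite add0r => ->; rewrite act0l scaler0.
Qed.

End Modules.

(** * Transposing the Jacobi identity *)

Section ThreeSums.
Variables (K : numFieldType) (U : lmodType K) (F1 F2 F3 : nat -> U) (N : nat).
Hypotheses (H1 : forall i, (N <= i)%N -> F1 i = 0)
  (H2 : forall i, (N <= i)%N -> F2 i = 0) (H3 : forall i, (N <= i)%N -> F3 i = 0).

Lemma fsum3_cut :
  \sum_(i < N) F1 i - \sum_(i < N) F2 i - \sum_(i < N) F3 i = 0 <->
  \sum_(i \in [set: nat]) F1 i - \sum_(i \in [set: nat]) F2 i =
  \sum_(i \in [set: nat]) F3 i.
Proof.
rewrite (fsum_ord H1) (fsum_ord H2) (fsum_ord H3).
by split=> [/eqP|->]; [rewrite subr_eq0 => /eqP|rewrite subrr].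
Qed.

Lemma sum3_widen N' : (N <= N')%N ->
  \sum_(i < N') F1 i - \sum_(i < N') F2 i - \sum_(i < N') F3 i =
  \sum_(i < N) F1 i - \sum_(i < N) F2 i - \sum_(i < N) F3 i.
Proof. by move=> NN'; rewrite !(@sum_widen _ _ N N'). Qed.

End ThreeSums.

Section SeparationByDual.
Variables (K : numFieldType) (V : gvoc K) (M : lmodType K).
Local Notation D := (dualV V).

Lemma trivial_ds : direct_sum (fun _ : unit => [set: M]).
Proof.
apply: (@direct_sum_sep _ _ _ _ M (fun _ => [set id])) => //.
- by move=> v; apply: span_gen; exists tt.
- by move=> [] _ ->; split=> // -[].
- by move=> s v _ /(_ _ erefl).
Qed.

(** A tensor has finitely many nonzero homogeneous components, on which any
    functional agrees with an element of the restricted dual. *)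
Lemma dual_enough (A : set M) (z : tens V M) : is_subspace A ->
  (forall f : D, A (tcontrl (subval f) z)) ->
  forall F : V -> K, scalar F -> A (tcontrl F z).
Proof.
move=> sA H F sF; have [S [T ->]] := tens_proj_sum (@dsV _ V) trivial_ds z.
rewrite (lin_sum (tcontrl_linear sF)); apply: (ss_sum sA) => s _.
rewrite (lin_sum (tcontrl_linear sF)); apply: (ss_sum sA) => t _.
rewrite tcontrl_tmap//; last 2 first.
- exact: (gproj_lin (@dsV _ V)).
- exact: (gproj_lin trivial_ds).
rewrite (gproj_id trivial_ds)//.
have rF : rfunctional (@grade K V) ((fun v => F (gproj (@grade K V) s v)) : V -> K^o).
  apply: (@rfunctional_seq _ _ _ _ _ [:: s]) => [a x y|r v].
    by rewrite (gproj_lin (@dsV _ V)) sF.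
  by rewrite inE => rs Gv; rewrite (gproj_0 (@dsV _ V) Gv)// (sc0 sF).
have := H (mkrdual (@grade K V) (fun v => F (gproj (@grade K V) s v))).
congr (A (tcontrl _ z)); apply/funext => v; exact: mkrdualE.
Qed.

Lemma tens_dual_eq0 (z : tens V M) :
  (forall f : D, tcontrl (subval f) z = 0) -> z = 0.
Proof.
by move=> H; apply: tens_eq0; exact: (dual_enough (@sub_set0 _ M) H).
Qed.

Lemma tens_dual_eq (z z' : tens V M) :
  (forall f : D, tcontrl (subval f) z = tcontrl (subval f) z') -> z = z'.
Proof.
move=> H; apply/eqP; rewrite -subr_eq0; apply/eqP/tens_dual_eq0 => f.
by rewrite (linB (tcontrl_linear (rdual_sc f))) H subrr.
Qed.

Lemma tsub_dual (B : set V) (A : set M) (z : tens V M) : is_subspace A ->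
  tsub B setT z -> (forall f : D, A (tcontrl (subval f) z)) -> tsub B A z.
Proof. by move=> sA zB H; apply: tsub_crit => //; exact: dual_enough. Qed.

Lemma tsubT_dual (A : set M) (z : tens V M) : is_subspace A ->
  tsub setT A z <-> forall f : D, A (tcontrl (subval f) z).
Proof.
move=> sA; split=> [H f|]; last by apply: tsub_dual => //; exact: tsubT.
exact: ((tsubTP z sA).1 H _ (rdual_sc f)).
Qed.

End SeparationByDual.

Section DualBorcherds.
Variables (K : numFieldType) (V : gvoc K) (M Y : lmodType K).
Local Notation D := (dualV V).
Local Notation zb := (@zbin K).
Variables (DM : int -> M -> tens V M) (act : D -> int -> Y -> Y) (pr : Y -> M -> K).
Hypotheses (DMlin : forall k, linear (DM k))
  (DMtrunc : forall x, exists N : int, forall k, k < N -> DM k x = 0)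
  (rY : restricted act) (pr_sc : forall y, scalar (pr y))
  (pr_lin : forall x, scalar (pr^~ x))
  (pr_act : forall f k y x, pr (act f k y) x = tpair (subval f) (pr y) (DM k x)).

Definition jac_cut N (l m n : int) (x : M) : tens V (tens V M) :=
  \sum_(i < N) ((-1) ^+ i * zb l i) *: tmap id (DM (n + i%:Z)) (DM (m + l - i%:Z) x)
  - \sum_(i < N) ((-1) ^ (l + i%:Z) * zb l i) *:
      tflip12 (tmap id (DM (m + i%:Z)) (DM (n + l - i%:Z) x))
  - \sum_(i < N) zb m i *:
      tassoc (tmap (@comode _ V (l + i%:Z)) id (DM (m + n - i%:Z) x)).

Let DM_evt x c : evt (fun N => forall i, (N <= i)%N -> DM (c - i%:Z) x = 0).
Proof.
have [N HN] := DMtrunc x; apply: evt_mono (evt_ge (c - N + 1)) => k Hk i /Hk ki.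
by apply: HN; lia.
Qed.

Let zero_l k c : c *: tmap id (DM k) (0 : tens V M) = 0.
Proof. by rewrite (lin0 (tmap_linear (@lin_id _ V) (DMlin k))) scaler0. Qed.

Let zero_m k c : c *: tflip12 (tmap id (DM k) (0 : tens V M)) = 0.
Proof.
rewrite (lin0 (tmap_linear (@lin_id _ V) (DMlin k))).
by rewrite (lin0 (@tflip12_lin _ _ _ _)) scaler0.
Qed.

Let zero_r k c : c *: tassoc (tmap (@comode _ V k) id (0 : tens V M)) = 0.
Proof.
rewrite (lin0 (tmap_linear (@comode_lin _ V k) (@lin_id _ M))).
by rewrite (lin0 (@tassoc_lin _ _ _ _)) scaler0.
Qed.

Let tails l m n x : evt (fun N => [/\
  forall i, (N <= i)%N -> ((-1) ^+ i * zb l i) *: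
    tmap id (DM (n + i%:Z)) (DM (m + l - i%:Z) x) = 0,
  forall i, (N <= i)%N -> ((-1) ^ (l + i%:Z) * zb l i) *:
      tflip12 (tmap id (DM (m + i%:Z)) (DM (n + l - i%:Z) x)) = 0 &
  forall i, (N <= i)%N -> zb m i *:
      tassoc (tmap (@comode _ V (l + i%:Z)) id (DM (m + n - i%:Z) x)) = 0]).
Proof.
have := evt_and (DM_evt x (m + l)) (evt_and (DM_evt x (n + l)) (DM_evt x (m + n))).
apply: evt_mono => N [H1 [H2 H3]]; split=> i Ni.
- by rewrite (H1 i Ni); exact: zero_l.
- by rewrite (H2 i Ni); exact: zero_m.
- by rewrite (H3 i Ni); exact: zero_r.
Qed.

Lemma jac_cutP x : jacobi (@comode _ V) DM x <->
  forall l m n, evt (fun N => jac_cut N l m n x = 0).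
Proof.
split=> J l m n.
  apply: evt_mono (tails l m n x) => N [H1 H2 H3].
  by apply/(fsum3_cut H1 H2 H3); exact: J.
have /evt_ex [N [JN [H1 H2 H3]]] := evt_and (J l m n) (tails l m n x).
exact/(fsum3_cut H1 H2 H3).
Qed.

Lemma pair_jac_cut N l m n (f g : D) y x :
  tpair (subval f) (tpair (subval g) (pr y)) (jac_cut N l m n x) =
  pr (borch_cut act N l m n f g y) x.
Proof.
have sf := rdual_sc f; have sg := rdual_sc g.
have sgy := tpair_scalar sg (pr_sc y); have sfg := tpair_scalar sf sg.
have S := tpair_scalar sf sgy; have Sx := pr_lin x.
have pa (e : D) k : (fun m => tpair (subval e) (pr y) (DM k m)) = pr (act e k y).
  by apply/funext => z; rewrite pr_act.
rewrite /jac_cut /borch_cut !(scD S, scN S) !(scD Sx, scN Sx) !(sc_sum S) !(sc_sum Sx).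
congr (_ - _ - _); apply: eq_bigr => i _; rewrite (scZ S) (scZ Sx); congr (_ * _).
- by rewrite tpair_tmap//= pa pr_act.
- have sfy := tpair_scalar sf (pr_sc y).
  by rewrite pair_flip// tpair_tmap//= pa pr_act.
- rewrite pair_assoc// tpair_tmap//; last exact: comode_lin.
  rewrite pr_act; congr (tpair _ _ _); apply/funext => v.
  by rewrite vprodE.
Qed.

(** Pairing the three sides of the Jacobi identity with $f \otimes g \otimes y$
    turns them into compositions of transposed modes. *)
Lemma borch_of_jacobi : (forall y, (forall x, pr y x = 0) -> y = 0) ->
  (forall x, jacobi (@comode _ V) DM x) ->
  forall l m n f g y, borch act l m n f g y = 0.
Proof.
move=> sepY J l m n f g y; apply: sepY => x.
have /jac_cutP/(_ l m n) Jx := J x.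
have /evt_ex [N [-> JN]] := evt_and (borchE rY l m n f g y) Jx.
rewrite -pair_jac_cut JN.
exact: sc0 (tpair_scalar (rdual_sc f) (tpair_scalar (rdual_sc g) (pr_sc y))).
Qed.

Lemma tens_pair_eq (z z' : tens V M) :
  (forall x, (forall y, pr y x = 0) -> x = 0) ->
  (forall (f : D) y, tpair (subval f) (pr y) z = tpair (subval f) (pr y) z') ->
  z = z'.
Proof.
move=> sepM H; apply: tens_dual_eq => f; apply/eqP; rewrite -subr_eq0; apply/eqP.
apply: sepM => y; rewrite (scD (pr_sc y)) (scN (pr_sc y)).
by rewrite -!tpairEl ?H ?subrr//; exact: rdual_sc.
Qed.

(** Conversely the tensors $f \otimes g \otimes y$ detect zero, and the number of
    terms of the Jacobi identity does not depend on them. *)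
Lemma jacobi_of_borch : (forall x, (forall y, pr y x = 0) -> x = 0) ->
  (forall l m n f g y, borch act l m n f g y = 0) ->
  forall x, jacobi (@comode _ V) DM x.
Proof.
move=> sepM B x; apply/jac_cutP => l m n.
have [N HN] : exists N, forall N', (N <= N')%N ->
    jac_cut N' l m n x = jac_cut N l m n x.
  have /evt_ex [N [H1 H2 H3]] := tails l m n x.
  by exists N => N' NN'; exact: (sum3_widen H1 H2 H3 NN').
exists N => N' /HN ->; apply: tens_dual_eq0 => f.
apply: tens_dual_eq0 => g; apply: sepM => y.
have sgy := tpair_scalar (rdual_sc g) (pr_sc y).
rewrite -tpairEl; [|exact: rdual_sc|exact: pr_sc].
rewrite -tpairEl; [|exact: rdual_sc|exact: sgy].
have [N1 HN1] := borchE rY l m n f g y.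
rewrite -(HN _ (leq_maxl N N1)) pair_jac_cut -HN1 ?leq_maxr// B.
exact: sc0 (pr_lin x).
Qed.

End DualBorcherds.

(** * Skew symmetry and associators *)

Section DualVertexAlgebra.
Variables (K : numFieldType) (V : gvoc K).
Local Notation D := (dualV V).
Local Notation zb := (@zbin K).
Local Notation vp := (@vprod K V).

Lemma vprod_restricted : restricted vp.
Proof.
split=> [k g|f k|f g]; [exact: vprod_linl|exact: vprod_linr|exact: vprod_trunc].
Qed.

Lemma comode_trunc (v : V) : exists N : int, forall k, k < N -> comode k v = 0.
Proof. exact: vc_truncation (voc_vertex V) v. Qed.

Lemma vprod_borch l m n f g h : borch vp l m n f g h = 0.
Proof.
apply: (borch_of_jacobi (@comode_lin _ V) comode_trunc vprod_restricted
  (pr := fun f : D => subval f)).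
- exact: rdual_sc.
- exact: rdual_ev_sc.
- by move=> f' k g' v; exact: vprodE.
- by move=> y y0; apply: rdual_eq => v; rewrite y0.
- exact: vc_jacobi (voc_vertex V).
Qed.

Lemma vprodr0 f k : vp f k 0 = 0.
Proof. exact: act0r vprod_restricted _ _. Qed.

Lemma vprod_comm f g : evt (fun N => forall m n y,
  vp f m (vp g n y) = vp g n (vp f m y) +
    \sum_(i < N) zb m i *: vp (vp f i%:Z g) (m + n - i%:Z) y).
Proof. by apply: (comm_cut vprod_restricted) => *; exact: vprod_borch. Qed.

(** Commutation with a mode of nonnegative index is a finite sum whose length
    does not depend on the arguments. *)
Lemma vprod_comm_nat f g (j : nat) n y :
  vp f j (vp g n y) = vp g n (vp f j y) +
    \sum_(i < j.+1) zb j i *: vp (vp f i%:Z g) (j%:Z + n - i%:Z) y.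
Proof.
have [N HN] := vprod_comm f g; rewrite (HN (maxn N j.+1)) ?leq_maxl//.
congr (_ + _); apply: (@sum_widen _ _ j.+1 (maxn N j.+1)
  (fun i => zb j i *: vp (vp f i%:Z g) (j%:Z + n - i%:Z) y)).
  exact: leq_maxr.
by move=> i ji; rewrite zbin_small ?scale0r.
Qed.

(** $Df = \omega_0 f$, so that this is the commutator of $\omega_0$ with $f_k$. *)
Lemma vprod_vtransr f k g :
  vp f k (vtrans g) = vtrans (vp f k g) + k%:~R *: vp f (k - 1) g.
Proof.
have := vprod_comm_nat (omg V) f 0 k g; rewrite !omg0 => ->.
rewrite big_ord1 zbin0 scale1r omg0 vprod_vtransl.
by rewrite add0r subr0 scaleNr addrNK.
Qed.

(** The vector $D^i u / i!$. *)
Definition ddiv (i : nat) (u : D) : D := vp u (-1 - i%:Z) (vac V).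

Lemma ddiv0 u : ddiv 0 u = u.
Proof. by rewrite /ddiv subr0 vprod_vacr1. Qed.

Lemma ddivS i u : i.+1%:R *: ddiv i.+1 u = ddiv i (vtrans u).
Proof.
rewrite /ddiv vprod_vtransl (_ : -1 - i.+1%:Z = -1 - i%:Z - 1); last by lia.
rewrite -intrN pmulrn (_ : - (-1 - i%:Z) = i.+1)//; lia.
Qed.

Lemma ddiv_lin i : linear (ddiv i).
Proof. exact: vprod_linl. Qed.

Lemma sgn_sq (l : int) : (-1) ^ l * (-1) ^ l = 1 :> K.
Proof.
rewrite -expfzDr ?oppr_eq0 ?oner_eq0// (_ : l + l = 2 * l); last by lia.
by rewrite -exprz_exp -exprnP sqrrN expr1n exp1rz.
Qed.

(** Skew symmetry is the Borcherds identity for $f$, $g$ and the vacuum, with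
    $m = -1$ and $n = 0$. *)
Lemma skew f g l : evt (fun N =>
  vp g l f = - (-1) ^ l *: \sum_(i < N) (-1) ^+ i *: ddiv i (vp f (l + i%:Z) g)).
Proof.
have := evt_and (evt_ge 1) (borchE vprod_restricted l (-1) 0 f g (vac V)).
apply: evt_mono => N [N1]; rewrite vprod_borch /borch_cut.
have {N1} : (0 < N)%N by have := N1 N (leqnn N); lia.
case: N => // N _.
rewrite big1 => [|i _]; last first.
  by rewrite (@vprod_vacr _ _ (0 + i%:Z))// vprodr0 scaler0.
rewrite big_ord_recl big1 => [|i _]; last first.
  by rewrite vprod_vacr ?vprodr0 ?scaler0//= /bump; lia.
rewrite -[nat_of_ord ord0]/0%N !addr0 zbin0 mulr1 ?subr0 !add0r vprod_vacr1.
set S := \sum_(i < N.+1) _ => /esym/eqP.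
rewrite subr_eq0 eqr_oppLR => /eqP e.
have -> : vp g l f = (-1) ^ l *: ((-1) ^ l *: vp g l f).
  by rewrite scalerA sgn_sq scale1r.
rewrite e scalerN scaleNr; congr (- (_ *: _)).
by apply: eq_bigr => i _; rewrite zbinN1.
Qed.

End DualVertexAlgebra.

Section Associators.
Variables (K : numFieldType) (V : gvoc K) (Y : lmodType K).
Local Notation D := (dualV V).
Local Notation zb := (@zbin K).
Local Notation vp := (@vprod K V).
Variable act : D -> int -> Y -> Y.
Hypotheses (rY : restricted act)
  (com : forall m n f g y, borch act 0 m n f g y = 0)
  (der : forall f k y, act (vtrans f) k y = - k%:~R *: act f (k - 1) y).
Local Notation B := (borch act).

(** When commutators vanish the recurrence in the first index says that an
    associator depends only on the sum of the other two. *)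
Lemma assoc_shift m n f g y : B (-1) m n f g y = B (-1) 0 (m + n) f g y.
Proof.
have S m' n' : B (-1) (m' + 1) n' f g y = B (-1) m' (n' + 1) f g y.
  have := borch_rec rY (-1) m' n' f g y; rewrite addNr com => /esym/eqP.
  by rewrite subr_eq0 => /eqP.
elim: m n => [|m IH|m IH] n; first by rewrite add0r.
  rewrite (_ : m.+1%:Z = m%:Z + 1) ?S ?IH; last by lia.
  by rewrite (_ : m%:Z + (n + 1) = m%:Z + 1 + n)//; lia.
have := S (- m.+1%:Z) (n - 1).
rewrite (_ : - m.+1%:Z + 1 = - m%:Z); last by lia.
rewrite IH subrK => <-.
by rewrite (_ : - m%:Z + (n - 1) = - m.+1%:Z + n)//; lia.
Qed.

(** Commutators ($l = 0$) and associators ($l = -1$) imply all the identities: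
    the recurrence gives $l > 0$ and the derivation $D$ gives $l < -1$. *)
Lemma borch_all : (forall n f g y, B (-1) 0 n f g y = 0) ->
  forall l m n f g y, B l m n f g y = 0.
Proof.
move=> A; elim=> [|l IH|l IH] m n f g y; first exact: com.
  by rewrite (_ : l.+1%:Z = l%:Z + 1) ?(borch_rec rY) ?IH ?subrr//; lia.
case: l IH => [|l] IH; first by rewrite (assoc_shift m n) A.
have := borch_der rY (- l.+1%:Z) m n f g y der.
rewrite !IH scaler0 add0r => /eqP; rewrite eq_sym oppr_eq0 scaler_eq0 intr_eq0.
by case/orP => // /eqP; rewrite (_ : - l.+1%:Z - 1 = - l.+2%:Z)//; lia.
Qed.

End Associators.

(** * Stability of the associators *)

Section AssociatorsAreStable.
Variables (K : numFieldType) (V : gvoc K) (Y : lmodType K).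
Local Notation D := (dualV V).
Local Notation zb := (@zbin K).
Local Notation vp := (@vprod K V).
Variable act : D -> int -> Y -> Y.
Hypotheses (rY : restricted act)
  (com : forall m n f g y, borch act 0 m n f g y = 0).
Local Notation B := (borch act).

Lemma evt_forall_lt (J : nat) (P : nat -> nat -> Prop) :
  (forall j, evt (P j)) -> evt (fun N => forall j, (j < J)%N -> P j N).
Proof.
move=> HP; elim: J => [|J IH]; first by exists 0%N.
apply: evt_mono (evt_and IH (HP J)) => N [H1 H2] j.
by rewrite ltnS leq_eqVlt => /orP[/eqP ->|/H1].
Qed.

Lemma evt_le (n : nat) : evt (fun N => (n <= N)%N).
Proof. by exists n. Qed.

(** The normally ordered product of $f$ and $g$ minus the mode of $f_{-1} g$. *)
Lemma assocE p f g y : evt (fun N => B (-1) 0 p f g y =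
  \sum_(i < N) act f (-1 - i%:Z) (act g (p + i%:Z) y)
  + \sum_(i < N) act g (p - 1 - i%:Z) (act f i%:Z y)
  - act (vp f (-1) g) p y).
Proof.
apply: evt_mono (evt_and (evt_le 1) (borchN1E rY 0 p f g y)) => N [N1 ->].
congr (_ + _ - _); try by apply: eq_bigr => i _; rewrite !add0r.
case: N N1 => // N _; rewrite big_ord_recl big1 => [|i _].
  by rewrite zbin0 scale1r -[nat_of_ord ord0]/0%N !addr0 add0r ?subr0.
by rewrite zbin0S scale0r.
Qed.

Lemma mode_commutator2 h k f g (J : nat) :
  (forall m n y, act h m (act f n y) = act f n (act h m y) +
    \sum_(i < J) zb m i *: act (vp h i%:Z f) (m + n - i%:Z) y) ->
  (forall m n y, act h m (act g n y) = act g n (act h m y) +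
    \sum_(i < J) zb m i *: act (vp h i%:Z g) (m + n - i%:Z) y) ->
  forall a b y, act h k (act f a (act g b y)) = act f a (act g b (act h k y)) +
    \sum_(j < J) zb k j *: (act (vp h j%:Z f) (k + a - j%:Z) (act g b y)
                            + act f a (act (vp h j%:Z g) (k + b - j%:Z) y)).
Proof.
move=> Cf Cg a b y; rewrite Cf Cg (linD (act_linr rY f a)) -addrA; congr (_ + _).
rewrite (lin_sum (act_linr rY f a)) -big_split; apply: eq_bigr => j _ /=.
by rewrite (linZ (act_linr rY f a)) -scalerDr addrC.
Qed.

(** The terms coming from the product $f_{-1} g$ recombine by [triple_sum]. *)
Lemma assoc_triple h f g k p (J : nat) y :
  (forall a q : nat, (J <= a + q)%N -> vp (vp h a%:Z f) (q%:Z - 1) g = 0) ->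
  \sum_(j < J) zb k j *: act (\sum_(a < j.+1) zb j a *:
      vp (vp h a%:Z f) (j%:Z - 1 - a%:Z) g) (k + p - j%:Z) y
  = \sum_(j < J) zb k j *: (\sum_(q < J) zb (k - j%:Z) q *:
      act (vp (vp h j%:Z f) (-1 + q%:Z) g) (k - j%:Z + p - q%:Z) y).
Proof.
move=> X0.
pose X a q := act (vp (vp h a%:Z f) (q%:Z - 1) g) (k + p - a%:Z - q%:Z) y.
have X0' a q : (J <= a + q)%N -> X a q = 0.
  by move=> /X0; rewrite /X => ->; exact: act0l.
have := @triple_sum K Y J 0 k X X0'.
have -> : \sum_(a < J) \sum_(q < J) (zb k a * zb (0 + k - a%:Z) q) *: X a q =
    \sum_(j < J) zb k j *: (\sum_(q < J) zb (k - j%:Z) q *: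
      act (vp (vp h j%:Z f) (-1 + q%:Z) g) (k - j%:Z + p - q%:Z) y).
  apply: eq_bigr => a _; rewrite scaler_sumr; apply: eq_bigr => q _.
  rewrite scalerA add0r /X (addrC _ (-1)); congr (_ *: act _ _ _); lia.
move=> <-; case: (posnP J) => [->|J0]; first by rewrite !big_ord0.
rewrite [RHS](bigD1 (Ordinal J0)) //= [X in _ = _ + X]big1 => [|[[|i] iJ] // _]; last first.
  by apply: big1 => j _; rewrite zbin0S mul0r scale0r.
rewrite addr0; apply: eq_bigr => -[j /= jJ] _; rewrite zbin0 mul1r; congr (_ *: _).
rewrite (lin_sum (act_linl rY _ y)); apply: eq_bigr => -[a /= aj] _.
rewrite (linZ (act_linl rY _ y)) /X; congr (_ *: _); rewrite add0n.
rewrite (_ : j%:Z - 1 - a%:Z = (j - a)%N%:Z - 1); last by lia.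
by rewrite (_ : k + p - a%:Z - (j - a)%N%:Z = k + p - j%:Z)//; lia.
Qed.

(** A mode acts on the associators as a derivation up to binomial
    coefficients; hence their span is a submodule. *)
Lemma assoc_adjoint h k f g p y : exists J : nat,
  act h k (B (-1) 0 p f g y) = B (-1) 0 p f g (act h k y) +
  \sum_(j < J) zb k j *: (B (-1) 0 (k - j%:Z + p) (vp h j%:Z f) g y +
                          B (-1) 0 (k + p - j%:Z) f (vp h j%:Z g) y).
Proof.
have [J [Cf Cg Cw X0]] : exists J : nat, [/\
  forall m n y, act h m (act f n y) = act f n (act h m y) +
    \sum_(i < J) zb m i *: act (vp h i%:Z f) (m + n - i%:Z) y,
  forall m n y, act h m (act g n y) = act g n (act h m y) +
    \sum_(i < J) zb m i *: act (vp h i%:Z g) (m + n - i%:Z) y,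
  forall m n y, act h m (act (vp f (-1) g) n y) = act (vp f (-1) g) n (act h m y) +
    \sum_(i < J) zb m i *: act (vp h i%:Z (vp f (-1) g)) (m + n - i%:Z) y &
  forall a q : nat, (J <= a + q)%N -> vp (vp h a%:Z f) (q%:Z - 1) g = 0].
  have [N HN] := vprod_trunc2 h f g.
  have /evt_ex [J [H1 [H2 [H3 H4]]]] := evt_and (comm_cut rY h f com)
    (evt_and (comm_cut rY h g com) (evt_and (comm_cut rY h (vp f (-1) g) com)
    (evt_ge (N + 1)))).
  exists J; split=> // a q /H4 Naq.
  by case: (HN a%:Z (q%:Z - 1)) => //; lia.
exists J.
have S j : B (-1) 0 (k - j%:Z + p) (vp h j%:Z f) g y =
    B (-1) (k - j%:Z) p (vp h j%:Z f) g y.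
  by rewrite (assoc_shift rY com (k - j%:Z)).
under [X in _ = _ + X]eq_bigr => j _ do rewrite S.
have /evt_ex [N [-> [-> [H3 [H4 JN]]]]] := evt_and (assocE p f g y)
  (evt_and (assocE p f g (act h k y)) (evt_and
  (evt_forall_lt J (fun j => borchN1E rY (k - j%:Z) p (vp h j%:Z f) g y))
  (evt_and (evt_forall_lt J (fun j => assocE (k + p - j%:Z) f (vp h j%:Z g) y))
    (evt_le J)))).
under [X in _ = _ + X]eq_bigr => j _.
  rewrite (H3 j (ltn_ord j)) (H4 j (ltn_ord j)).
  rewrite (@sum_widen _ _ J N (fun i => zb (k - j%:Z) i *:
    act (vp (vp h j%:Z f) (-1 + i%:Z) g) (k - j%:Z + p - i%:Z) y) JN); last first.
    move=> i Ji; rewrite addrC X0 ?act0l ?scaler0//.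
    by rewrite (leq_trans Ji)// leq_addl.
  over.
(* the two halves of the normally ordered product, then the mode of the product *)
have E1 : \sum_(i < N) act h k (act f (-1 - i%:Z) (act g (p + i%:Z) y)) =
  \sum_(i < N) act f (-1 - i%:Z) (act g (p + i%:Z) (act h k y)) +
  \sum_(j < J) zb k j *: (
    \sum_(i < N) act (vp h j%:Z f) (k - j%:Z - 1 - i%:Z) (act g (p + i%:Z) y) +
    \sum_(i < N) act f (-1 - i%:Z) (act (vp h j%:Z g) (k + p - j%:Z + i%:Z) y)).
  under eq_bigr => i _ do rewrite (mode_commutator2 k Cf Cg).
  rewrite big_split /=; congr (_ + _); rewrite exchange_big; apply: eq_bigr => j _ /=.
  rewrite -scaler_sumr; congr (_ *: _); rewrite big_split; congr (_ + _).
    by apply: eq_bigr => i _; congr (act _ _ _); lia.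
  by apply: eq_bigr => i _; congr (act f _ (act _ _ _)); lia.
have E2 : \sum_(i < N) act h k (act g (p - 1 - i%:Z) (act f i%:Z y)) =
  \sum_(i < N) act g (p - 1 - i%:Z) (act f i%:Z (act h k y)) +
  \sum_(j < J) zb k j *: (
    \sum_(i < N) act (vp h j%:Z g) (k + p - j%:Z - 1 - i%:Z) (act f i%:Z y) +
    \sum_(i < N) act g (p - 1 - i%:Z) (act (vp h j%:Z f) (k - j%:Z + i%:Z) y)).
  under eq_bigr => i _ do rewrite (mode_commutator2 k Cg Cf).
  rewrite big_split /=; congr (_ + _); rewrite exchange_big; apply: eq_bigr => j _ /=.
  rewrite -scaler_sumr; congr (_ *: _); rewrite big_split; congr (_ + _).
    by apply: eq_bigr => i _; congr (act _ _ _); lia.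
  by apply: eq_bigr => i _; congr (act g _ (act _ _ _)); lia.
have E3 : act h k (act (vp f (-1) g) p y) = act (vp f (-1) g) p (act h k y) +
  (\sum_(j < J) zb k j *: act (vp f (-1) (vp h j%:Z g)) (k + p - j%:Z) y +
  \sum_(j < J) zb k j *: (\sum_(q < J) zb (k - j%:Z) q *:
      act (vp (vp h j%:Z f) (-1 + q%:Z) g) (k - j%:Z + p - q%:Z) y)).
  rewrite Cw; congr (_ + _); rewrite -assoc_triple// -big_split.
  apply: eq_bigr => j _ /=; rewrite vprod_comm_nat -scalerDr; congr (_ *: _).
  by rewrite (linD (act_linl rY _ y)).
rewrite !(linB (act_linr rY h k)) !(linD (act_linr rY h k)) !(lin_sum (act_linr rY h k)).
rewrite E1 E2 E3.
under [X in _ = _ + X]eq_bigr => j _ do rewrite !scalerDr !scalerN.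
rewrite !big_split /= !sumrN.
have sp (F G : 'I_J -> Y) : \sum_(j < J) zb k j *: (F j + G j) =
    \sum_(j < J) zb k j *: F j + \sum_(j < J) zb k j *: G j.
  by rewrite -big_split; apply: eq_bigr => j _; rewrite scalerDr.
rewrite !sp.
set a1 := \sum_(i < N) _; set a2 := \sum_(i < J) _; set a3 := \sum_(i < J) _.
set a4 := \sum_(i < N) _; set a5 := \sum_(i < J) _; set a6 := \sum_(i < J) _.
set a7 := \sum_(i < J) _; set a8 := \sum_(i < J) _.
move: a1 a2 a3 a4 a5 a6 a7 a8 (act _ p _) => a1 a2 a3 a4 a5 a6 a7 a8 a9.
modring.
Qed.

End AssociatorsAreStable.

(** * The Lie algebra of modes *)

Section QuotientLift.
Variables (K : numFieldType) (W U : lmodType K) (S : set W) (f : W -> U).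
Hypotheses (lf : linear f) (fS : forall x, S x -> f x = 0).

Lemma qlift_cls x : f (rep (cls S x)) = f x.
Proof. exact: linear_repE lf fS. Qed.

Lemma qlift_lin : linear (fun x : quotby S => f (rep x)).
Proof.
move=> a x y; transitivity (f (a *: rep x + rep y)); last exact: lf.
by rewrite -[RHS]qlift_cls (@cls_lin _ _ S) !repK.
Qed.

End QuotientLift.

Section TensorDerivation.
Variables (K : numFieldType) (A B U : lmodType K) (d : A -> A) (e : B -> B).
Variable b : A -> B -> U.
Hypotheses (ld : linear d) (le : linear e) (bl : forall p, linear (b^~ p))
  (br : forall f, linear (b f)) (bd : forall f p, b (d f) p + b f (e p) = 0).

Lemma tder_lin : linear (fun z : tens A B => tmap d id z + tmap id e z).
Proof. by apply: lin_add; apply: tmap_linear. Qed.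

Lemma tder_pure f p :
  tmap d id (tpure f p) + tmap id e (tpure f p) = tpure (d f) p + tpure f (e p) :> tens A B.
Proof. by rewrite !tmap_pure. Qed.

Lemma tder_lift_eq0 z : tlift b (tmap d id z + tmap id e z) = 0.
Proof.
have lt := tlift_linear bl br; move: z.
apply: (tens_ind (sub_ker (lin_comp tder_lin lt))) => f p.
by rewrite /mkset /comp tder_pure (linD lt) !(tlift_pure bl br) bd.
Qed.

End TensorDerivation.

Section HatSpace.
Variables (K : numFieldType) (V : gvoc K).
Local Notation D := (dualV V).
Local Notation H := (hatV V).
Local Notation hg := (@hgen K V).

Lemma laurent_ind (P : set (laurent K)) : is_subspace P ->
  (forall k, P (tpow K k)) -> forall p, P p.
Proof.
move=> sP Pk p; rewrite [p]malg_sum; apply: (ss_sum sP) => k _.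
by apply: (ssZ sP); exact: Pk.
Qed.

Lemma ddt_lin : linear (@ddt K).
Proof. exact: flift_linear. Qed.

Lemma ddt_tpow n : ddt (tpow K n) = n%:~R *: tpow K (n - 1).
Proof. exact: flift_gen. Qed.

Lemma hg_lin k : linear (fun f => hg f k).
Proof.
exact: (lin_comp (tpure_linearl (tpow K k)) (@cls_lin _ _ (range (@hatD K V)))).
Qed.

Lemma hg_vtrans f k : hg (vtrans f) k = - k%:~R *: hg f (k - 1).
Proof.
have lc := @cls_lin _ _ (range (@hatD K V)).
have := tder_pure (@vtrans_lin K V) ddt_lin f (tpow K k).
rewrite ddt_tpow => e.
have : cls (range (@hatD K V)) (tpure (vtrans f) (tpow K k)
    + tpure f (k%:~R *: tpow K (k - 1))) = 0.
  apply/cls0P; apply: span_gen; exists (tpure f (tpow K k)) => //; exact: e.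
rewrite (linD lc) => /eqP; rewrite addr_eq0 => /eqP.
rewrite (linZ (tpure_linearr f)) (linZ lc) => h.
by rewrite scaleNr; exact: h.
Qed.

Lemma hat_ind (P : set H) : is_subspace P -> (forall f k, P (hg f k)) ->
  forall x, P x.
Proof.
move=> sP Pg; apply: cls_ind => z; move: z.
have lc := @cls_lin _ _ (range (@hatD K V)).
apply: (tens_ind (sub_preim lc sP)) => f p; move: p.
exact: (laurent_ind (sub_preim (lin_comp (tpure_linearr f) lc) sP) (Pg f)).
Qed.

Definition hlift (U : lmodType K) (F : D -> int -> U) (x : H) : U :=
  tlift (fun f p => flift (F f) p) (rep x).

Section Lift.
Variables (U : lmodType K) (F : D -> int -> U).
Hypotheses (Fl : forall k, linear (F^~ k))
  (Fd : forall f k, F (vtrans f) k = - k%:~R *: F f (k - 1)).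

Let bl p : linear (fun f => flift (F f) p).
Proof.
move=> a f g; rewrite /flift scaler_sumr -big_split; apply: eq_bigr => k _ /=.
by rewrite Fl scalerDr !scalerA mulrC.
Qed.

Let br f : linear (flift (F f)). Proof. exact: flift_linear. Qed.

Let bd f p : flift (F (vtrans f)) p + flift (F f) (ddt p) = 0.
Proof.
move: p; apply: (laurent_ind (sub_ker (lin_add (br (vtrans f))
  (lin_comp ddt_lin (br f))))) => k.
by rewrite /mkset /comp ddt_tpow (linZ (br f)) !flift_gen Fd scaleNr addNr.
Qed.

Let kill z : range (@hatD K V) z -> tlift (fun f p => flift (F f) p) z = 0.
Proof. by move=> [w _ <-]; exact: (tder_lift_eq0 (@vtrans_lin K V) ddt_lin bl br bd). Qed.

Lemma hlift_gen f k : hlift F (hg f k) = F f k.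
Proof.
rewrite /hlift /hgen (qlift_cls (tlift_linear bl br) kill).
by rewrite (tlift_pure bl br) flift_gen.
Qed.

Lemma hlift_lin : linear (hlift F).
Proof. exact: (qlift_lin (tlift_linear bl br) kill). Qed.

End Lift.

End HatSpace.

(** The Lie bracket only depends on the universal property of the space
    spanned by the modes $f \otimes t^k$. *)
Section HatLieAlgebra.
Variables (K : numFieldType) (V : gvoc K) (H : lmodType K).
Local Notation D := (dualV V).
Local Notation zb := (@zbin K).
Local Notation vp := (@vprod K V).
Variables (hg : D -> int -> H).
Variable lift : forall U : lmodType K, (D -> int -> U) -> H -> U.
Hypotheses (hg_lin : forall k, linear (fun f => hg f k))
  (hg_vtrans : forall f k, hg (vtrans f) k = - k%:~R *: hg f (k - 1))
  (hat_ind : forall P : set H, is_subspace P -> (forall f k, P (hg f k)) -> forall x, P x).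
Hypothesis lift_gen : forall (U : lmodType K) (F : D -> int -> U),
  (forall k, linear (F^~ k)) ->
  (forall f k, F (vtrans f) k = - k%:~R *: F f (k - 1)) ->
  forall f k, lift F (hg f k) = F f k.
Hypothesis lift_lin : forall (U : lmodType K) (F : D -> int -> U),
  (forall k, linear (F^~ k)) ->
  (forall f k, F (vtrans f) k = - k%:~R *: F f (k - 1)) -> linear (lift F).

Let hext (U : lmodType K) (F G : H -> U) : linear F -> linear G ->
  (forall f k, F (hg f k) = G (hg f k)) -> forall x, F x = G x.
Proof. by move=> lF lG e; exact: (hat_ind (sub_eq lF lG) e). Qed.

Definition hb (f : D) (m : int) (g : D) (n : int) : H :=
  \sum_(i \in [set: nat]) zb m i *: hg (vp f i%:Z g) (m + n - i%:Z).

Lemma hbE N (f : D) m g n : (forall i : nat, (N <= i)%N -> vp f i g = 0) ->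
  hb f m g n = \sum_(i < N) zb m i *: hg (vp f i%:Z g) (m + n - i%:Z).
Proof.
move=> H0; apply: fsum_ord => i /H0 ->.
by rewrite (lin0 (hg_lin _)) scaler0.
Qed.

Lemma vprod_nat_evt (f g : D) :
  evt (fun N => forall i : nat, (N <= i)%N -> vp f i%:Z g = 0).
Proof.
apply: evt_mono (vprod_evt f g 0) => N H0 i /H0; by rewrite add0r.
Qed.

Lemma hb_linr (f : D) m n : linear (fun g => hb f m g n).
Proof.
move=> a g g'.
have /evt_ex [N [H1 [H2 H3]]] := evt_and (vprod_nat_evt f (a *: g + g'))
  (evt_and (vprod_nat_evt f g) (vprod_nat_evt f g')).
rewrite !(@hbE N)// scaler_sumr -big_split; apply: eq_bigr => i _ /=.
by rewrite vprod_linr hg_lin scalerDr !scalerA mulrC.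
Qed.

Lemma hb_linl m (g : D) n : linear (fun f => hb f m g n).
Proof.
move=> a f f'.
have /evt_ex [N [H1 [H2 H3]]] := evt_and (vprod_nat_evt (a *: f + f') g)
  (evt_and (vprod_nat_evt f g) (vprod_nat_evt f' g)).
rewrite !(@hbE N)// scaler_sumr -big_split; apply: eq_bigr => i _ /=.
by rewrite vprod_linl hg_lin scalerDr !scalerA mulrC.
Qed.

(** The bracket respects the derivative relation in each argument, by comparing
    binomial coefficients of consecutive indices. *)
Lemma hb_derl (f : D) m g n :
  hb (vtrans f) m g n = - m%:~R *: hb f (m - 1) g n.
Proof.
have /evt_ex [N [H1 [H2 H3]]] := evt_and (vprod_nat_evt (vtrans f) g)
  (evt_and (vprod_nat_evt f g) (vprod_evt f g (-1))).
rewrite (@hbE N)// (@hbE N)//.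
pose F i := (i%:R * zb m i) *: hg (vp f (-1 + i%:Z) g) (m + n - i%:Z).
transitivity (- \sum_(i < N) F i).
  rewrite -sumrN; apply: eq_bigr => i _; rewrite vprod_vtransl (linZ (hg_lin _)).
  by rewrite /F scalerA -scaleNr -pmulrn (addrC (-1)); congr (_ *: _); ring.
rewrite scaleNr scaler_sumr; congr (- _); rewrite sum_shift1; first last.
- by rewrite /F H3 ?(lin0 (hg_lin _)) ?scaler0.
- by rewrite /F mul0r scale0r.
apply: eq_bigr => i _; rewrite /F zbin_absorb scalerA.
rewrite (_ : -1 + i.+1%:Z = i%:Z); last by lia.
by rewrite (_ : m + n - i.+1%:Z = m - 1 + n - i%:Z)//; lia.
Qed.

Lemma hb_derr (f : D) m g n :
  hb f m (vtrans g) n = - n%:~R *: hb f m g (n - 1).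
Proof.
have /evt_ex [N [H1 [H2 H3]]] := evt_and (vprod_nat_evt f (vtrans g))
  (evt_and (vprod_nat_evt f g) (vprod_evt f g (-1))).
rewrite (@hbE N)// (@hbE N)//.
pose F i := (i%:R * zb m i) *: hg (vp f (-1 + i%:Z) g) (m + n - i%:Z).
transitivity (- (\sum_(i < N) ((m + n - i%:Z)%:~R * zb m i) *:
    hg (vp f i%:Z g) (m + n - i%:Z - 1)) + \sum_(i < N) F i).
  rewrite -sumrN -big_split; apply: eq_bigr => i _ /=.
  rewrite vprod_vtransr (linD (hg_lin _)) (linZ (hg_lin _)) hg_vtrans /F.
  rewrite scalerDr !scalerA (addrC (-1)) -scaleNr -pmulrn.
  by congr (_ *: _ + _ *: _); ring.
rewrite [X in _ + X]sum_shift1; first last.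
- by rewrite /F H3 ?(lin0 (hg_lin _)) ?scaler0.
- by rewrite /F mul0r scale0r.
rewrite scaler_sumr -sumrN -big_split; apply: eq_bigr => i _ /=.
rewrite /F zbinS (_ : -1 + i.+1%:Z = i%:Z); last by lia.
rewrite (_ : m + n - i.+1%:Z = m + n - i%:Z - 1); last by lia.
rewrite (_ : m + (n - 1) - i%:Z = m + n - i%:Z - 1); last by lia.
by rewrite -scaleNr -scalerDl scalerA; congr (_ *: _); rewrite intrB intrD -pmulrn; ring.
Qed.

Definition adh (f : D) (m : int) (y : H) : H := lift (fun g n => hb f m g n) y.

Lemma adh_gen f m g n : adh f m (hg g n) = hb f m g n.
Proof.
apply: lift_gen => [k|f' k]; [exact: hb_linr|exact: hb_derr].
Qed.

Lemma adh_lin f m : linear (adh f m).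
Proof.
apply: lift_lin => [k|f' k]; [exact: hb_linr|exact: hb_derr].
Qed.

(** The bracket, extended from generators in each argument by the universal
    property. *)
Definition hbr (x y : H) : H := lift (fun f m => adh f m y) x.

Let adh_linl m y : linear (fun f => adh f m y).
Proof.
move=> a f f'; move: y.
apply: (hext (F := adh (a *: f + f') m)
  (G := fun y => a *: adh f m y + adh f' m y)) => [||g n].
- exact: adh_lin.
- by apply: lin_add; [apply: lin_scale|]; exact: adh_lin.
- by rewrite !adh_gen hb_linl.
Qed.

Let adh_der f m y : adh (vtrans f) m y = - m%:~R *: adh f (m - 1) y.
Proof.
move: y; apply: (hext (F := adh (vtrans f) m)
  (G := fun y => - m%:~R *: adh f (m - 1) y)) => [||g n].
- exact: adh_lin.
- by apply: lin_scale; exact: adh_lin.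
- by rewrite !adh_gen hb_derl.
Qed.

Lemma hbr_genl f m y : hbr (hg f m) y = adh f m y.
Proof. by apply: lift_gen. Qed.

Lemma hbr_linl y : linear (hbr^~ y).
Proof. by apply: lift_lin. Qed.

Lemma hbr_gen f m g n : hbr (hg f m) (hg g n) = hb f m g n.
Proof. by rewrite hbr_genl adh_gen. Qed.

Lemma hbr_linr x : linear (hbr x).
Proof.
move=> a y z; move: x; apply: (hext (F := hbr^~ (a *: y + z))
  (G := fun x => a *: hbr x y + hbr x z)) => [||f m].
- exact: hbr_linl.
- by apply: lin_add; [apply: lin_scale|]; exact: hbr_linl.
- by rewrite !hbr_genl adh_lin.
Qed.

Lemma skew_nat (f g : D) : evt (fun N => forall l : nat, vp g l f =
  - (-1) ^+ l *: \sum_(i < N) (-1) ^+ i *: ddiv i (vp f (l + i)%N%:Z g)).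
Proof.
apply: evt_mono (vprod_nat_evt f g) => N H0 l.
have [M HM] := skew f g l; rewrite (HM (maxn N M)) ?leq_maxr//.
congr (_ *: _).
apply: (@sum_widen _ _ N (maxn N M)
  (fun i => (-1) ^+ i *: ddiv i (vp f (l + i)%N%:Z g))); first exact: leq_maxl.
move=> i Ni; rewrite H0 ?(lin0 (@ddiv_lin _ _ _)) ?scaler0//.
by rewrite (leq_trans Ni)// leq_addl.
Qed.

(** The derivative relation iterated: in the Lie algebra $D^i u / i!$ is a
    multiple of a mode of $u$. *)
Lemma hg_ddiv i u p : hg (ddiv i u) p = ((-1) ^+ i * zb p i) *: hg u (p - i%:Z).
Proof.
elim: i u p => [|i IH] u p; first by rewrite ddiv0 zbin0 mul1r scale1r subr0.
apply: (scalerI (natS_neq0 K i)); rewrite -(linZ (hg_lin _)) ddivS IH hg_vtrans.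
rewrite !scalerA (_ : p - i%:Z - 1 = p - i.+1%:Z); last by lia.
congr (_ *: _); rewrite exprS [RHS]mulrCA zbinS intrB -pmulrn; ring.
Qed.

(** Skew symmetry of the products, in which the derivatives are turned into
    modes, and [vandermonde_neg]. *)
Lemma hbr_anti x y : hbr x y = - hbr y x.
Proof.
move: x; apply: (hext (F := hbr^~ y) (G := fun x => - hbr y x)) => [||f m].
- exact: hbr_linl.
- by apply: lin_opp; exact: hbr_linr.
move: y; apply: (hext (F := hbr (hg f m)) (G := fun y => - hbr y (hg f m))) => [||g n].
- exact: hbr_linr.
- by apply: lin_opp; exact: hbr_linl.
rewrite !hbr_gen.
have /evt_ex [N [H1 [H2 H3]]] := evt_and (vprod_nat_evt f g)
  (evt_and (vprod_nat_evt g f) (skew_nat f g)).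
rewrite (@hbE N)// (@hbE N)//.
transitivity (\sum_(i < N) \sum_(j < N) ((-1) ^+ i * zb n i *
    zb (m + n - i%:Z) j) *: hg (vp f (i + j)%N%:Z g) (m + n - i%:Z - j%:Z)); last first.
  rewrite -sumrN; apply: eq_bigr => i _; rewrite H3 -scalerN.
  rewrite (linZ (hg_lin _)) (lin_sum (hg_lin _)) -scaleNr opprK !scaler_sumr.
  apply: eq_bigr => j _; rewrite (linZ (hg_lin _)) hg_ddiv !scalerA.
  rewrite (addrC n m); congr (_ *: _).
  transitivity ((-1) ^+ i * zb n i * zb (m + n - i%:Z) j * ((-1) ^+ j * (-1) ^+ j)).
    by rewrite -expr2 sqrr_sign mulr1.
  ring.
rewrite (@sum_diag _ _ N (fun i j => ((-1) ^+ i * zb n i *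
    zb (m + n - i%:Z) j) *: hg (vp f (i + j)%N%:Z g) (m + n - i%:Z - j%:Z))); last first.
  by move=> i j /H1 ->; rewrite (lin0 (hg_lin _)) scaler0.
apply: eq_bigr => q _; rewrite -(vandermonde_neg K n m q) scaler_suml.
apply: eq_bigr => -[i /= iq] _; rewrite ltnS in iq.
rewrite subnKC// (addrC n m); congr (_ *: hg _ _); lia.
Qed.

(** On generators, the commutator formula for $f_i (g_j h)$ and [triple_sum]. *)
Lemma hbr_jacobi x y z : hbr x (hbr y z) = hbr (hbr x y) z + hbr y (hbr x z).
Proof.
move: x; apply: (hext (F := fun x => hbr x (hbr y z))
  (G := fun x => hbr (hbr x y) z + hbr y (hbr x z))) => [||f m].
- exact: hbr_linl.
- apply: lin_add; [exact: (lin_comp (hbr_linl y) (hbr_linl z))|].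
  exact: (lin_comp (hbr_linl z) (hbr_linr y)).
move: y; apply: (hext (F := fun y => hbr (hg f m) (hbr y z))
  (G := fun y => hbr (hbr (hg f m) y) z + hbr y (hbr (hg f m) z))) => [||g n].
- exact: (lin_comp (hbr_linl z) (hbr_linr _)).
- apply: lin_add; [exact: (lin_comp (hbr_linr _) (hbr_linl z))|exact: hbr_linl].
move: z; apply: (hext (F := fun z => hbr (hg f m) (hbr (hg g n) z))
  (G := fun z => hbr (hbr (hg f m) (hg g n)) z + hbr (hg g n) (hbr (hg f m) z)))
  => [||h p].
- exact: (lin_comp (hbr_linr _) (hbr_linr _)).
- apply: lin_add; [exact: hbr_linr|exact: (lin_comp (hbr_linr _) (hbr_linr _))].
rewrite !hbr_gen.
have /evt_ex [N [Hfg [Hfh [Hgh [T1 T2]]]]] : evt (fun N =>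
    (forall i : nat, (N <= i)%N -> vp f i%:Z g = 0) /\
    (forall i : nat, (N <= i)%N -> vp f i%:Z h = 0) /\
    (forall i : nat, (N <= i)%N -> vp g i%:Z h = 0) /\
    (forall i j : nat, (N <= i + j)%N ->
       vp f i%:Z (vp g j%:Z h) = 0 /\ vp (vp f i%:Z g) j%:Z h = 0) /\
    (forall i j : nat, (N <= i + j)%N -> vp g i%:Z (vp f j%:Z h) = 0)).
  have [N1 HN1] := vprod_trunc2 f g h; have [N2 HN2] := vprod_trunc2 g f h.
  have := evt_and (vprod_nat_evt f g) (evt_and (vprod_nat_evt f h)
    (evt_and (vprod_nat_evt g h) (evt_and (evt_ge N1) (evt_ge N2)))).
  apply: evt_mono => N [? [? [? [G1 G2]]]].
  split=> //; split=> //; split=> //; split=> i j ij.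
    by apply: HN1; have := G1 _ ij; lia.
  by case: (HN2 i%:Z j%:Z) => //; have := G2 _ ij; lia.
have E1 (f1 g1 h1 : D) m1 n1 p1 : (forall i : nat, (N <= i)%N -> vp g1 i%:Z h1 = 0) ->
    (forall i j : nat, (N <= i + j)%N -> vp f1 i%:Z (vp g1 j%:Z h1) = 0) ->
    hbr (hg f1 m1) (hb g1 n1 h1 p1) = \sum_(i < N) \sum_(j < N)
      (zb m1 i * zb n1 j) *: hg (vp f1 i%:Z (vp g1 j%:Z h1)) (m1 + n1 + p1 - i%:Z - j%:Z).
  move=> Z1 Z2; rewrite (@hbE N)// (lin_sum (hbr_linr _)) exchange_big.
  apply: eq_bigr => j _ /=; rewrite (linZ (hbr_linr _)) hbr_gen (@hbE N).
    rewrite scaler_sumr; apply: eq_bigr => i _; rewrite scalerA mulrC.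
    by congr (_ *: hg _ _); lia.
  by move=> i Ni; apply: Z2; rewrite (leq_trans Ni)// leq_addr.
rewrite (E1 f g h) => //; last by move=> i j /T1 [].
rewrite (E1 g f h) //; apply/eqP; rewrite -subr_eq; apply/eqP.
rewrite [X in _ - X = _](_ : _ = \sum_(i < N) \sum_(j < N)
      (zb m i * zb n j) *: hg (vp g j%:Z (vp f i%:Z h)) (m + n + p - i%:Z - j%:Z)); last first.
  rewrite exchange_big; apply: eq_bigr => i _; apply: eq_bigr => j _ /=.
  by rewrite mulrC (addrC m n); congr (_ *: hg _ _); lia.
pose X a q := hg (vp (vp f a%:Z g) q%:Z h) (m + n + p - a%:Z - q%:Z).
have X0 a q : (N <= a + q)%N -> X a q = 0.
  by move=> /T1 [_]; rewrite /X => ->; rewrite (lin0 (hg_lin _)).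
transitivity (\sum_(j < N) \sum_(i < N) (zb n j * zb m i) *:
     (\sum_(a < i.+1) zb i%:Z a *: X a (j + (i - a))%N)).
  rewrite [RHS]exchange_big -sumrN -big_split; apply: eq_bigr => i _ /=.
  rewrite -sumrN -big_split; apply: eq_bigr => j _ /=.
  rewrite vprod_comm_nat (linD (hg_lin _)) scalerDr addrAC subrr add0r mulrC.
  congr (_ *: _).
  rewrite (lin_sum (hg_lin _)); apply: eq_bigr => -[a /= ai] _.
  rewrite (linZ (hg_lin _)) /X; congr (_ *: hg (vp _ _ _) _); lia.
rewrite (triple_sum n m X0) (@hbE N)// (lin_sum (hbr_linl _)).
apply: eq_bigr => a _; rewrite (linZ (hbr_linl _)) hbr_gen (@hbE N); last first.
  by move=> i Ni; case: (T1 a i) => //; rewrite (leq_trans Ni)// leq_addl.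
rewrite scaler_sumr; apply: eq_bigr => q _; rewrite scalerA (addrC n m) /X.
by congr (_ *: hg _ _); lia.
Qed.

End HatLieAlgebra.

(** * Projecting words to degree zero *)

Section LetterDerivations.
Variables (K : numFieldType) (H N : lmodType K) (br : H -> H -> H).
Hypotheses (br_linl : forall y, linear (br^~ y)) (br_linr : forall x, linear (br x))
  (br_jac : forall x y z, br x (br y z) = br (br x y) z + br y (br x z)).
Implicit Types (u v w : seq H) (F : seq H -> N).

Fixpoint ders (h : H) (w : seq H) : seq (seq H) :=
  if w is x :: w' then (br h x :: w') :: [seq x :: v | v <- ders h w'] else [::].

Lemma size_ders h w v : v \in ders h w -> size v = size w.
Proof.
elim: w v => //= x w IH v; rewrite inE => /orP[/eqP -> //|/mapP[v' /IH e ->]].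
by rewrite /= e.
Qed.

Definition dsum F h w : N := \sum_(v <- ders h w) F v.

Lemma dsum_nil F h : dsum F h [::] = 0.
Proof. exact: big_nil. Qed.

Lemma dsum_cons F h x w :
  dsum F h (x :: w) = F (br h x :: w) + dsum (fun v => F (x :: v)) h w.
Proof. by rewrite /dsum big_cons big_map. Qed.

Lemma dsum_cat F h u w : dsum F h (u ++ w) =
  dsum (fun v => F (v ++ w)) h u + dsum (fun v => F (u ++ v)) h w.
Proof.
elim: u F => [|x u IH] F; first by rewrite dsum_nil add0r.
by rewrite /= !dsum_cons IH addrA.
Qed.

Lemma eq_dsum F G h w : (forall v, size v = size w -> F v = G v) ->
  dsum F h w = dsum G h w.
Proof. by move=> e; apply: eq_big_seq => v /size_ders; exact: e. Qed.

Lemma dsumD F G h w : dsum (fun v => F v + G v) h w = dsum F h w + dsum G h w.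
Proof. exact: big_split. Qed.

Lemma dsumZ a F h w : dsum (fun v => a *: F v) h w = a *: dsum F h w.
Proof. by rewrite /dsum scaler_sumr. Qed.

Lemma dsum0 h w : dsum (fun=> 0) h w = 0.
Proof. exact: big1. Qed.

Definition multilinear F (k : nat) := forall u w a x y,
  (size u + size w).+1 = k ->
  F (u ++ (a *: x + y) :: w) = a *: F (u ++ x :: w) + F (u ++ y :: w).

Lemma multilinear_cons F k x :
  multilinear F k.+1 -> multilinear (fun v => F (x :: v)) k.
Proof. by move=> mF u w a y z e; rewrite -!cat_cons mF//= addSn e. Qed.

Lemma dsum_linear F w a h h' : multilinear F (size w) ->
  dsum F (a *: h + h') w = a *: dsum F h w + dsum F h' w.
Proof.
elim: w F => [|x w IH] F mF; first by rewrite !dsum_nil scaler0 addr0.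
rewrite !dsum_cons IH; last exact: multilinear_cons.
have mF0 : forall b y z, F ((b *: y + z) :: w) = b *: F (y :: w) + F (z :: w).
  by move=> b y z; have := mF [::] w b y z erefl.
by rewrite br_linl mF0; modring.
Qed.

Lemma dsum_h0 F w : multilinear F (size w) -> dsum F 0 w = 0.
Proof.
move=> mF; have := @dsum_linear F w (-1) 0 0 mF.
by rewrite scaler0 addr0 scaleN1r addNr.
Qed.

Lemma dsum_multilinear F k h : multilinear F k -> multilinear (dsum F h) k.
Proof.
move=> mF u w a x y e.
rewrite !dsum_cat !dsum_cons.
have -> : dsum (fun v => F (v ++ (a *: x + y) :: w)) h u =
    a *: dsum (fun v => F (v ++ x :: w)) h u + dsum (fun v => F (v ++ y :: w)) h u.
  by rewrite -dsumZ -dsumD; apply: eq_dsum => v sv; rewrite mF// sv.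
have -> : dsum (fun v => F (u ++ (a *: x + y) :: v)) h w =
    a *: dsum (fun v => F (u ++ x :: v)) h w + dsum (fun v => F (u ++ y :: v)) h w.
  by rewrite -dsumZ -dsumD; apply: eq_dsum => v sv; rewrite mF// sv.
by rewrite br_linr mF//; modring.
Qed.

(** Bracketing letters is an action of the Lie algebra on words, by the Jacobi
    identity. *)
Lemma dsum_commutator F x y w : multilinear F (size w) ->
  dsum (dsum F y) x w - dsum (dsum F x) y w = dsum F (br y x) w.
Proof.
elim: w F => [|a w IH] F mF; first by rewrite !dsum_nil subrr.
have mF' : multilinear (fun v => F (a :: v)) (size w) by exact: multilinear_cons.
have E s t : dsum (dsum F s) t (a :: w) = F (br s (br t a) :: w)
    + dsum (fun v => F (br t a :: v)) s w + dsum (fun v => F (br s a :: v)) t w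
    + dsum (dsum (fun v => F (a :: v)) s) t w.
  rewrite [LHS]dsum_cons dsum_cons -!addrA; congr (_ + (_ + _)).
  by rewrite -dsumD; apply: eq_dsum => v _; rewrite dsum_cons.
rewrite !E dsum_cons -(IH _ mF').
have -> : F (br (br y x) a :: w) = F (br y (br x a) :: w) - F (br x (br y a) :: w).
  have := mF [::] w (-1) (br x (br y a)) (br y (br x a)) erefl.
  by rewrite /= !scaleN1r (br_jac y) addrCA addNr addr0 addrC => ->.
modring.
Qed.

End LetterDerivations.

Section DerivationDegree.
Variables (K : numFieldType) (H N : lmodType K) (br : H -> H -> H) (G : int -> set H).
Hypothesis G_br : forall d e x y, G d x -> G e y -> G (d + e) (br x y).

Lemma dsum_degree (S : set N) (F : seq H -> N) (hs : seq (H * int)) e h d :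
  is_subspace S -> \sum_(x <- hs) x.2 + e = d ->
  (forall ks : seq (H * int), (forall x, x \in ks -> G x.2 x.1) ->
    \sum_(x <- ks) x.2 = d -> size ks = size hs -> S (F [seq x.1 | x <- ks])) ->
  G e h -> (forall x, x \in hs -> G x.2 x.1) -> S (dsum br F h [seq x.1 | x <- hs]).
Proof.
move=> sS + + Gh; elim: hs F d => [|x hs IH] F d; first by rewrite dsum_nil => _ _ _; exact: ss0.
rewrite big_cons => ed F0 Ghs; rewrite /= dsum_cons.
have Gx : G x.2 x.1 by apply: Ghs; exact: mem_head.
have Ghs' : forall y, y \in hs -> G y.2 y.1 by move=> y yhs; apply: Ghs; rewrite inE yhs orbT.
apply: (ssD sS).
  apply: (F0 ((br h x.1, e + x.2) :: hs)) => //; last by rewrite big_cons -ed /=; ring.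
  by move=> y; rewrite inE => /orP[/eqP -> /=|]; [exact: G_br|exact: Ghs'].
apply: (IH _ (d - x.2)) => //; first by rewrite -ed; ring.
move=> ks Gks kd sk; apply: (F0 (x :: ks)); last by rewrite /= sk.
  by move=> y; rewrite inE => /orP[/eqP ->|/Gks].
by rewrite big_cons kd; ring.
Qed.

End DerivationDegree.

(** The degree $0$ part of a graded Lie algebra acts on [N] by [z], the negative
    part is to act by zero, and one induces. The component in [N] of a word
    applied to a vector of [N] can be computed without a basis of the enveloping
    algebra; that it respects all relations shows that the induced module does
    not collapse in degree $0$. *)
Section VacuumExpectation.
Variables (K : numFieldType) (H N : lmodType K) (br : H -> H -> H).
Variables (G : int -> set H) (neg : H -> H) (z : H -> N -> N).
Hypotheses (br_linl : forall y, linear (br^~ y)) (br_linr : forall x, linear (br x))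
  (br_anti : forall x y, br x y = - br y x)
  (br_jac : forall x y z, br x (br y z) = br (br x y) z + br y (br x z))
  (G_ind : forall P : set H, is_subspace P ->
     (forall d x, G d x -> P x) -> forall x, P x)
  (G_br : forall d e x y, G d x -> G e y -> G (d + e) (br x y))
  (neg_lin : linear neg) (neg_id : forall d x, d < 0 -> G d x -> neg x = x)
  (neg_0 : forall d x, 0 <= d -> G d x -> neg x = 0)
  (z_linl : forall n, linear (fun x => z x n)) (z_linr : forall x, linear (z x))
  (z_0 : forall d x n, d != 0 -> G d x -> z x n = 0)
  (z_br : forall x y n, G 0 x -> G 0 y -> z x (z y n) = z y (z x n) + z (br x y) n).

Local Notation dsum := (@dsum K H N br).

Fixpoint vev_fuel (k : nat) (w : seq H) (n : N) : N :=
  if w is h :: w' then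
    if k is k'.+1 then
      z h (vev_fuel k' w' n) + dsum (fun v => vev_fuel k' v n) (neg h) w'
    else 0
  else n.

(** The component in $N$ of the word [w] applied to [n] in the induced module:
    a letter of negative degree is commuted to the right, where it kills [n],
    and a letter of positive degree on the left contributes nothing. *)
Definition vev (w : seq H) (n : N) : N := vev_fuel (size w) w n.

Lemma vev_cons h w n :
  vev (h :: w) n = z h (vev w n) + dsum (fun v => vev v n) (neg h) w.
Proof.
by rewrite /vev /=; congr (_ + _); apply: eq_dsum => v ->.
Qed.

Lemma z0r x : z x 0 = 0. Proof. exact: lin0 (z_linr x). Qed.

Lemma vev_linear w : linear (vev w).
Proof.
have [k] := ubnP (size w); elim: k w => // k IH [|h w] /= wk a m n //.
rewrite !vev_cons IH// z_linr.
have -> : dsum (vev^~ (a *: m + n)) (neg h) w =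
    a *: dsum (vev^~ m) (neg h) w + dsum (vev^~ n) (neg h) w.
  by rewrite -dsumZ -dsumD; apply: eq_dsum => v sv; rewrite IH// sv.
modring.
Qed.

Lemma vev_multilinear k n : multilinear (vev^~ n) k.
Proof.
elim/ltn_ind: k => k IH [|h u] w a x y /= e; rewrite !vev_cons.
  rewrite z_linl neg_lin dsum_linear//; first by modring.
  by apply: IH; rewrite -e.
have k1 : (k.-1 < k)%N by rewrite -e.
have e' : (size u + size w).+1 = k.-1 by rewrite -e.
rewrite (IH _ k1 u w a x y e') z_linr.
have := @dsum_multilinear _ _ _ br br_linr (vev^~ n) k.-1 (neg h) (IH _ k1) u w a x y e'.
by move=> ->; modring.
Qed.

Lemma vev_lin u w n : linear (fun x => vev (u ++ x :: w) n).
Proof. by move=> a x y; exact: (@vev_multilinear (size u + size w).+1 n u w a x y erefl). Qed.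

Lemma dsum_vev0 w n : dsum (vev^~ n) 0 w = 0.
Proof. by apply: dsum_h0 => //; exact: vev_multilinear. Qed.

Lemma vev_pos d x w n : 0 < d -> G d x -> vev (x :: w) n = 0.
Proof.
move=> d0 Gx; rewrite vev_cons (z_0 _ _ Gx) ?(neg_0 _ Gx)//; [|lia..].
by rewrite dsum_vev0 addr0.
Qed.

Lemma vev_zero x w n : G 0 x -> vev (x :: w) n = z x (vev w n).
Proof. by move=> Gx; rewrite vev_cons (neg_0 _ Gx)// dsum_vev0 addr0. Qed.

Lemma vev_neg d x w n : d < 0 -> G d x -> vev (x :: w) n = dsum (vev^~ n) x w.
Proof.
by move=> d0 Gx; rewrite vev_cons (z_0 _ _ Gx) ?(neg_id _ Gx) ?add0r//; lia.
Qed.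

Let comm_sym x y w n :
  vev (x :: y :: w) n = vev (y :: x :: w) n + vev (br x y :: w) n ->
  vev (y :: x :: w) n = vev (x :: y :: w) n + vev (br y x :: w) n.
Proof.
by move=> ->; rewrite (br_anti y) (linN (vev_lin [::] w n)) addrK.
Qed.

Let comm_pos d e x y w n : 0 < d -> G d x -> G e y ->
  vev (x :: y :: w) n = vev (y :: x :: w) n + vev (br x y :: w) n.
Proof.
move=> d0 Gx Gy; rewrite (vev_pos _ _ d0 Gx) vev_cons (vev_pos _ _ d0 Gx) z0r add0r.
rewrite dsum_cons (@eq_dsum _ _ _ br _ (fun=> 0)); last by move=> v _; exact: vev_pos Gx.
rewrite dsum0 addr0; have [e0|e0] := ltP e 0.
  by rewrite (neg_id e0 Gy) (br_anti x) (linN (vev_lin [::] w n)) subrr.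
rewrite (neg_0 e0 Gy) (lin0 (br_linl x)) (lin0 (vev_lin [::] w n)) add0r.
by rewrite (@vev_pos (d + e))//; [lia|exact: G_br].
Qed.

Let comm_zero e x y w n : e <= 0 -> G 0 x -> G e y ->
  vev (x :: y :: w) n = vev (y :: x :: w) n + vev (br x y :: w) n.
Proof.
move=> e0 Gx Gy; rewrite (vev_zero _ _ Gx).
have [e1|e1] := eqVneq e 0.
  rewrite e1 in Gy; rewrite !(vev_zero _ _ Gy) (vev_zero _ _ Gx).
  by rewrite z_br// (@vev_zero (br x y))//; have := G_br Gx Gy; rewrite addr0.
have e2 : e < 0 by lia.
rewrite !(vev_neg _ _ e2 Gy) dsum_cons.
rewrite (@eq_dsum _ _ _ br (fun v => vev (x :: v) n) (fun v => z x (vev v n))); last first.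
  by move=> v _; rewrite (vev_zero _ _ Gx).
rewrite (br_anti x) (linN (vev_lin [::] w n)) addrAC subrr add0r.
exact: (lin_sum (z_linr x)).
Qed.

Let comm_neg d e x y w n : d < 0 -> e < 0 -> G d x -> G e y ->
  vev (x :: y :: w) n = vev (y :: x :: w) n + vev (br x y :: w) n.
Proof.
move=> d0 e0 Gx Gy; rewrite (vev_neg _ _ d0 Gx) (vev_neg _ _ e0 Gy) !dsum_cons.
rewrite (@eq_dsum _ _ _ br (fun v => vev (y :: v) n) (dsum (vev^~ n) y)); last first.
  by move=> v _; rewrite (vev_neg _ _ e0 Gy).
rewrite (@eq_dsum _ _ _ br (fun v => vev (x :: v) n) (dsum (vev^~ n) x)); last first.
  by move=> v _; rewrite (vev_neg _ _ d0 Gx).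
have := dsum_commutator br_jac x y (@vev_multilinear (size w) n).
have Gyx := G_br Gy Gx; have d1 : e + d < 0 by lia.
by rewrite -(vev_neg _ _ d1 Gyx) => <-; modring.
Qed.

Let comm_nil x y w n :
  vev (x :: y :: w) n = vev (y :: x :: w) n + vev (br x y :: w) n.
Proof.
move: x; apply: (G_ind (sub_eq (vev_lin [::] (y :: w) n)
  (lin_add (vev_lin [:: y] w n) (lin_comp (br_linl y) (vev_lin [::] w n))))).
move=> d x Gx; move: y; apply: (G_ind (sub_eq (vev_lin [:: x] w n)
  (lin_add (vev_lin [::] (x :: w) n) (lin_comp (br_linr x) (vev_lin [::] w n))))).
move=> e y Gy; rewrite /mkset /comp /=.
have [d0|d0] := ltP 0 d; first exact: comm_pos Gx Gy.
have [e0|e0] := ltP 0 e; first by apply: comm_sym; exact: comm_pos Gy Gx.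
have [d1|d1] := eqVneq d 0; first by rewrite d1 in Gx; exact: comm_zero Gx Gy.
have [e1|e1] := eqVneq e 0.
  by rewrite e1 in Gy; apply: comm_sym; exact: comm_zero Gy Gx.
by apply: comm_neg Gx Gy; lia.
Qed.

(** On two leading letters the relation is checked according to the signs of
    their degrees, using the action of the degree $0$ part and, for two negative
    ones, [dsum_commutator]. Deeper in the word the recursion preserves it. *)
Lemma vev_commutator u x y w n :
  vev (u ++ x :: y :: w) n = vev (u ++ y :: x :: w) n + vev (u ++ br x y :: w) n.
Proof.
have [k] := ubnP (size u); elim: k u x y w => // k IH u x y w; rewrite ltnS => uk.
case: u uk => [_|h u /= uk]; first exact: comm_nil.
rewrite !vev_cons (IH u x y w uk) (linD (z_linr h)) !dsum_cat !dsum_cons.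
set c := neg h.
have -> : dsum (fun v => vev (v ++ [:: x, y & w]) n) c u =
    dsum (fun v => vev (v ++ [:: y, x & w]) n) c u +
    dsum (fun v => vev (v ++ br x y :: w) n) c u.
  by rewrite -dsumD; apply: eq_dsum => v sv; rewrite IH// sv.
have -> : dsum (fun v => vev (u ++ [:: x, y & v]) n) c w =
    dsum (fun v => vev (u ++ [:: y, x & v]) n) c w +
    dsum (fun v => vev (u ++ br x y :: v) n) c w.
  by rewrite -dsumD; apply: eq_dsum => v sv; rewrite IH.
rewrite (IH u (br c x) y w uk) (IH u x (br c y) w uk) (br_jac c x y).
by rewrite (linD (vev_lin u w n)); modring.
Qed.

(** The recursion only replaces the last letter by brackets of it with letters
    of negative degree. *)
Lemma vev_rcons_neg d u h n : d < 0 -> G d h -> vev (rcons u h) n = 0.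
Proof.
have [k] := ubnP (size u); elim: k u d h => // k IH u d h; rewrite ltnS => uk d0 Gh.
case: u uk => [_|x u /= uk].
  by rewrite /= vev_cons dsum_nil (z_0 _ _ Gh) ?addr0//; lia.
rewrite vev_cons (IH u d h uk d0 Gh) z0r add0r -cats1 dsum_cat dsum_cons dsum_nil addr0.
rewrite (@eq_dsum _ _ _ br _ (fun=> 0)) ?dsum0 ?add0r; last first.
  by move=> v sv; rewrite cats1; apply: (IH v d h) => //; rewrite sv.
move: x; apply: (G_ind (sub_ker (lin_comp neg_lin (lin_comp (br_linl h) (vev_lin u [::] n))))).
move=> e x Gx; rewrite /mkset /comp /=; have [e0|e0] := ltP e 0.
  rewrite (neg_id e0 Gx) cats1; apply: (IH u (e + d)) => //; [lia|exact: G_br].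
by rewrite (neg_0 e0 Gx) (lin0 (br_linl h)) (lin0 (vev_lin u [::] n)).
Qed.

Lemma vev_rcons_zero u h n : G 0 h -> vev (rcons u h) n = vev u (z h n).
Proof.
move=> Gh; have [k] := ubnP (size u); elim: k u => // k IH u; rewrite ltnS => uk.
case: u uk => [_|x u /= uk].
  by rewrite /= vev_cons dsum_nil addr0.
rewrite !vev_cons (IH u uk) -cats1 dsum_cat dsum_cons dsum_nil addr0; congr (_ + _).
rewrite (@eq_dsum _ _ _ br _ (vev^~ (z h n))); last by move=> v sv; rewrite cats1 IH// sv.
rewrite -[RHS]addr0; congr (_ + _).
move: x; apply: (G_ind (sub_ker (lin_comp neg_lin (lin_comp (br_linl h) (vev_lin u [::] n))))).
move=> e x Gx; rewrite /mkset /comp /=; have [e0|e0] := ltP e 0.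
  rewrite (neg_id e0 Gx) cats1; apply: (@vev_rcons_neg (e + 0)); [lia|exact: G_br].
by rewrite (neg_0 e0 Gx) (lin0 (br_linl h)) (lin0 (vev_lin u [::] n)).
Qed.

(** A vacuum expectation is a polynomial in the operators of degree $0$. *)
Lemma vev_closed (P : set (N -> N)) : P id -> P (fun=> 0) ->
  (forall f g, P f -> P g -> P (f \o g)) -> (forall f g, P f -> P g -> P (fun n => f n + g n)) ->
  (forall x, P (z x)) -> forall w, P (vev w).
Proof.
move=> P1 P0 Pc Pa Pz w; have [k] := ubnP (size w).
elim: k w => // k IH [|h w] /= wk; first exact: P1.
have -> : vev (h :: w) = fun n => z h (vev w n) + dsum (vev^~ n) (neg h) w.
  by apply/funext => n; exact: vev_cons.
apply: (Pa _ _); first exact: (Pc (z h) (vev w) (Pz h) (IH _ wk)).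
have {}wk v : v \in ders br (neg h) w -> (size v < k)%N by move/size_ders ->.
rewrite /dsum; elim: (ders br (neg h) w) wk => [|v s IHs] vk.
  by rewrite (_ : (fun n => _) = fun=> 0)//; apply/funext => n; rewrite big_nil.
have -> : (fun n => \sum_(v <- v :: s) vev v n) = fun n => vev v n + \sum_(v <- s) vev v n.
  by apply/funext => n; rewrite big_cons.
apply: (Pa _ _); first by apply: IH; apply: vk; exact: mem_head.
by apply: IHs => u us; apply: vk; rewrite inE us orbT.
Qed.

Local Notation homog hs := (forall h, h \in hs -> G h.2 h.1).
Local Notation wdeg hs := (\sum_(h <- hs) h.2).
Implicit Types hs : seq (H * int).

Lemma vev_degree hs n : homog hs -> wdeg hs != 0 -> vev [seq x.1 | x <- hs] n = 0.
Proof.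
have [k] := ubnP (size hs); elim: k hs => // k IH hs; rewrite ltnS => hk.
case: hs hk => [|x hs /= hk Ghs]; first by rewrite big_nil.
rewrite big_cons => d0; rewrite vev_cons.
have Gx : G x.2 x.1 by apply: Ghs; exact: mem_head.
have Ghs' : homog hs by move=> y yhs; apply: Ghs; rewrite inE yhs orbT.
have -> : z x.1 (vev [seq x.1 | x <- hs] n) = 0.
  have [x0|x0] := eqVneq x.2 0; last exact: z_0 Gx.
  by rewrite IH// ?z0r//; move: d0; rewrite x0 add0r.
rewrite add0r; have [x0|x0] := ltP x.2 0; last by rewrite (neg_0 x0 Gx) dsum_vev0.
rewrite (neg_id x0 Gx).
apply: (dsum_degree G_br (sub_set0 N) erefl _ Gx Ghs') => ks Gks kd sk.
by apply: IH => //; rewrite ?sk ?kd// addrC.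
Qed.

End VacuumExpectation.

(** * The module over the Zhu algebra *)

Section SumsOfLinearMaps.
Variables (K : numFieldType) (W U : lmodType K) (F : nat -> W -> U).

Lemma lin_fsum : (forall i, linear (F i)) ->
  (forall x, evt (fun N => forall i, (N <= i)%N -> F i x = 0)) ->
  linear (fun x => \sum_(i \in [set: nat]) F i x).
Proof.
move=> lF F0 a x y.
have /evt_ex [N [H1 [H2 H3]]] := evt_and (F0 (a *: x + y)) (evt_and (F0 x) (F0 y)).
rewrite (fsum_ord H1) (fsum_ord H2) (fsum_ord H3) scaler_sumr -big_split.
by apply: eq_bigr => i _; rewrite lF.
Qed.

Lemma sum_two (N : nat) (f : nat -> U) : (forall i, f i.+2 = 0) ->
  \sum_(i < N.+2) f i = f 0%N + f 1%N.
Proof.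
move=> f0; rewrite big_ord_recl big_ord_recl big1 ?addr0// => i _.
exact: f0.
Qed.

End SumsOfLinearMaps.

Section ZhuModule.
Variables (K : numFieldType) (V : gvoc K).
Local Notation D := (dualV V).
Local Notation zb := (@zbin K).
Local Notation vp := (@vprod K V).
Local Notation P := (gproj (@grade K V)).

(** Only the component of [v] of degree $s + t - k - 1$ contributes to the one of
    $\Delta_k(v)$ of degrees $s$, $t$. *)
Lemma zhu_cut (j : nat) (s t : int) (v : V) : evt (fun N => forall i, (N <= i)%N ->
  tmap (P s) (P t) (comode (i%:Z - j%:Z) v) = 0).
Proof.
have lP k : linear (fun v => tmap (P s) (P t) (comode k v)).
  exact: (lin_comp (@comode_lin _ V k) (PQ_lin (@dsV _ V) (@dsV _ V) s t)).
have [r [_ _ ->]] := gproj_seq (@dsV _ V) v.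
have [d Hd] := seq_int_max [seq s + t - x - 1 + j%:Z | x <- r].
apply: evt_mono (evt_ge (d + 1)) => N HN i /HN di.
rewrite (lin_sum (lP _)) big_seq big1// => x xr.
have Gx : grade V x (P x v) by exact: (gproj_in (@dsV _ V)).
have dg := @gr_degree _ _ _ _ (voc_graded V) (i%:Z - j%:Z) _ _ Gx.
apply: ((tens_gradeP id (@dsV _ V) (@dsV _ V) _ _).1 dg).
have : s + t - x - 1 + j%:Z <= d by apply: Hd; exact: (map_f (fun x => s + t - x - 1 + j%:Z)).
by move=> h; apply/eqP; lia.
Qed.

Lemma zhu_res_lin j s t : linear (@zhu_res _ V j s t).
Proof.
apply: lin_fsum => [i|v]; first apply: lin_scale.
  exact: (lin_comp (@comode_lin _ V _) (PQ_lin (@dsV _ V) (@dsV _ V) s t)).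
by apply: evt_mono (zhu_cut j s t v) => N H i /H ->; exact: scaler0.
Qed.

Lemma wt_proj s (f : D) : wt_space s f -> (fun v => subval f (P s v)) = subval f :> (V -> K).
Proof.
move=> fs; apply/funext => v.
by rewrite -(rcompE (@dsV _ V)) (rcomp_id (@dsV _ V)).
Qed.

Lemma vprodB_evt (f g : D) (j : nat) :
  evt (fun N => forall i : nat, (N <= i)%N -> vp f (i%:Z - j%:Z) g = 0).
Proof.
apply: evt_mono (vprod_evt f g (- j%:Z)) => N H i /H; by rewrite addrC.
Qed.

(** The star product of the Zhu algebra for [j = 1], the elements of $O(V')$
    for [j = 2]. *)
Lemma zhu_pair N j s t (f g : D) v : wt_space s f -> wt_space t g ->
  (forall i : nat, (N <= i)%N -> vp f (i%:Z - j%:Z) g = 0) ->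
  tpair (subval f) (subval g) (zhu_res j s t v) =
  subval (\sum_(i < N) zb s i *: vp f (i%:Z - j%:Z) g) v.
Proof.
move=> fs gt vN; have S := tpair_scalar (rdual_sc f) (rdual_sc g).
have [M HM] := zhu_cut j s t v.
rewrite /zhu_res (@fsum_ord _ _ (maxn M N)); last first.
  by move=> i Mi; rewrite (HM M (leqnn _))// ?scaler0// (leq_trans (leq_maxl _ _) Mi).
rewrite (sc_sum S) rdual_sumE.
rewrite -(@sum_widen K K^o N (maxn M N) (fun i => subval (zb s i *: vp f (i%:Z - j%:Z) g) v)); first last.
- by move=> i /vN ->; rewrite scaler0.
- exact: leq_maxr.
apply: eq_bigr => i _; rewrite (scZ S) (tpair_tmap (comode _ v) (rdual_sc f) (rdual_sc g)
  (gproj_lin (@dsV _ V) s) (gproj_lin (@dsV _ V) t)) (wt_proj fs) (wt_proj gt).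
by rewrite -vprodE.
Qed.

(** The defining condition of $C(V)$, paired with $f \otimes c$, where only two
    terms survive. *)
Lemma zhu_O s (f : D) v : wt_space s f -> CV V v ->
  subval (vtrans f + s%:~R *: f) v = 0.
Proof.
move=> fs; set u := vtrans f + _.
apply: (span_sub (sub_ker (sc_lin (rdual_sc u)))) => {}v /(_ s 0) zv.
have /evt_ex [N [H2 N2]] := evt_and (vprodB_evt f (vac V) 2) (evt_le 2).
have := zhu_pair v fs (@wt_vac _ V) H2.
rewrite zv (sc0 (tpair_scalar (rdual_sc f) (rdual_sc _))).
case: N N2 {H2} => [//|[//|N]] _.
rewrite (@sum_two K D N (fun i => zb s i *: vp f (i%:Z - 2%:Z) (vac V))); last first.
  by move=> i; rewrite vprod_vacr ?scaler0//; lia.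
rewrite zbin0 scale1r zbin1.
have -> : vp f (0%N%:Z - 2%:Z) (vac V) = vtrans f.
  by have := ddivS 0 f; rewrite scale1r ddiv0 => <-.
have -> : vp f (1%N%:Z - 2%:Z) (vac V) = f by exact: vprod_vacr1.
by move=> e; exact: esym e.
Qed.

Variable M : ccomod V.
Local Notation N := (dualM M).
Local Notation dact := (@dact K V M).

Lemma dualM_eq (mu nu : N) : (forall m, subval mu m = subval nu m) -> mu = nu.
Proof. by move=> e; apply: subval_inj; apply/funext. Qed.

Lemma dualM_sc (mu : N) : scalar (subval mu).
Proof. exact: dualP. Qed.

Lemma dact_linl mu : linear (fun f => dact f mu).
Proof.
move=> a f g; apply: dualM_eq => m.
rewrite -[RHS]/(a * subval (dact f mu) m + subval (dact g mu) m) !dactE.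
rewrite !tpairEr; [|exact: rdual_sc|exact: dualM_sc|exact: rdual_sc|exact: dualM_sc
  |exact: rdual_sc|exact: dualM_sc].
exact: rdual_linE.
Qed.

Lemma dact_linr f : linear (dact f).
Proof.
move=> a mu nu; apply: dualM_eq => m.
rewrite -[RHS]/(a * subval (dact f mu) m + subval (dact f nu) m) !dactE.
rewrite !tpairEl; [|exact: rdual_sc|exact: dualM_sc|exact: rdual_sc|exact: dualM_sc
  |exact: rdual_sc|exact: dualM_sc].
by [].
Qed.

(** The coaction has its left factor in $C(V)$, so only the restriction of $f$
    to $C(V)$ matters. *)
Lemma dact_O f mu : (forall v, CV V v -> subval f v = 0) -> dact f mu = 0.
Proof.
move=> f0; apply: dualM_eq => m; rewrite dactE.
have S := tpair_scalar (rdual_sc f) (dualM_sc mu).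
apply: (span_lin (sc_lin S) (@sub_set0 _ K^o)) (cc_range m) => _ [v [w [Cv _ ->]]] /=.
by rewrite (tpair_pure _ _ (rdual_sc f) (dualM_sc mu)) f0// mul0r.
Qed.

Lemma dact_vtrans s f mu : wt_space s f ->
  dact (vtrans f) mu = - s%:~R *: dact f mu.
Proof.
move=> fs; have := @dact_O (vtrans f + s%:~R *: f) mu (fun v => zhu_O fs).
rewrite (linD (dact_linl mu)) (linZ (dact_linl mu)) => /eqP.
by rewrite addr_eq0 scaleNr => /eqP.
Qed.

Lemma dact_ddiv i w u mu : wt_space w u ->
  dact (ddiv i u) mu = zb (- w) i *: dact u mu.
Proof.
elim: i w u => [|i IH] w u uw; first by rewrite ddiv0 zbin0 scale1r.
apply: (scalerI (natS_neq0 K i)); rewrite -(linZ (dact_linl mu)) ddivS.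
rewrite (IH (w + 1)) ?(dact_vtrans mu uw) ?scalerA; last exact: wt_vtrans.
by rewrite zbin_absorb intrN opprD mulrC.
Qed.

Lemma dact_vac mu : dact (vac V) mu = mu.
Proof.
apply: dualM_eq => m; rewrite dactE vac_fun (tpairEl _ (@counit_sc _ V) (dualM_sc mu)).
by rewrite cc_counit.
Qed.

(** Coassociativity of the coaction, whose component at degrees $s$, $t$ is
    paired with $f \otimes g$: the action turns the Zhu product into composition. *)
Lemma dact_star s t f g : wt_space s f -> wt_space t g ->
  evt (fun k => forall mu, dact f (dact g mu) =
    \sum_(i < k) zb s i *: dact (vp f (i%:Z - 1) g) mu).
Proof.
move=> fs gt; apply: evt_mono (vprodB_evt f g 1) => k Hk mu; apply: dualM_eq => m.
have sf := rdual_sc f; have sg := rdual_sc g; have sm := dualM_sc mu.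
have sgm := tpair_scalar sg sm; have S := tpair_scalar sf sgm.
have sfg := tpair_scalar sf sg.
have /(congr1 (tpair (subval f) (tpair (subval g) (subval mu)))) := cc_coassoc s t m.
rewrite (pair_assoc sf sg sm) (tpair_tmap _ sfg sm (zhu_res_lin 1 s t) (@lin_id _ _)).
rewrite (tpair_tmap _ sf sgm (gproj_lin (@dsV _ V) s)
  (tmap_linear (gproj_lin (@dsV _ V) t) (@lin_id _ _))) (wt_proj fs).
have -> : (fun w => tpair (subval g) (subval mu) (tmap (P t) id w)) =
    tpair (subval g) (subval mu).
  apply/funext => w.
  by rewrite (tpair_tmap _ sg sm (gproj_lin (@dsV _ V) t) (@lin_id _ _)) (wt_proj gt).
rewrite (tpair_tmap _ sf sgm (@lin_id _ _) (@cc_linear _ _ M)) => e.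
rewrite dactE.
have -> : subval (dact g mu) = (fun m => tpair (subval g) (subval mu) (cc_coact m)) :> (M -> K).
  by apply/funext => w; rewrite dactE.
rewrite -[LHS]e.
have -> : \sum_(i < k) zb s i *: dact (vp f (i%:Z - 1) g) mu =
    dact (\sum_(i < k) zb s i *: vp f (i%:Z - 1) g) mu.
  rewrite (lin_sum (dact_linl mu)); apply: eq_bigr => i _.
  by rewrite (linZ (dact_linl mu)).
rewrite dactE; congr (tpair _ _ _); apply/funext => v.
exact: zhu_pair.
Qed.

Lemma skew_pred (f g : D) : evt (fun k => forall j : nat, vp g (j%:Z - 1) f =
  (-1) ^+ j *: \sum_(i < k) (-1) ^+ i *: ddiv i (vp f ((j + i)%N%:Z - 1) g)).
Proof.
apply: evt_mono (vprodB_evt f g 1) => k H0 j.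
have [m Hm] := skew f g (j%:Z - 1); rewrite (Hm (maxn k m)) ?leq_maxr//.
have -> : - (-1) ^ (j%:Z - 1) = (-1) ^+ j :> K.
  by rewrite -sgnS subrK.
congr (_ *: _).
rewrite -(@sum_widen _ _ k (maxn k m)
  (fun i => (-1) ^+ i *: ddiv i (vp f ((j + i)%N%:Z - 1) g))) ?leq_maxl//.
  apply: eq_bigr => i _.
  by rewrite (_ : j%:Z - 1 + i%:Z = (j + i)%N%:Z - 1)//; lia.
move=> i ki; rewrite H0 ?(lin0 (@ddiv_lin _ _ _)) ?scaler0//.
by rewrite (leq_trans ki)// leq_addl.
Qed.

(** Skew symmetry rewrites $g_{j-1} f$ in terms of the $f_{i-1} g$ and of
    derivatives, which act as scalars by [dact_ddiv]. *)
Lemma dact_star_rev s t f g : wt_space s f -> wt_space t g ->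
  evt (fun k => forall mu, dact g (dact f mu) =
    \sum_(i < k) zb (s - 1) i *: dact (vp f (i%:Z - 1) g) mu).
Proof.
move=> fs gt; have := evt_and (dact_star gt fs) (evt_and (skew_pred f g) (vprodB_evt f g 1)).
apply: evt_mono => k [E [S Z]] mu; rewrite E.
pose F j i := (zb t j * ((-1) ^+ (j + i) * zb ((j + i)%N%:Z - s - t) i)) *:
  dact (vp f ((j + i)%N%:Z - 1) g) mu.
transitivity (\sum_(j < k) \sum_(i < k) F j i).
  apply: eq_bigr => j _; rewrite S (linZ (dact_linl mu)) (lin_sum (dact_linl mu)).
  rewrite !scaler_sumr; apply: eq_bigr => i _; rewrite (linZ (dact_linl mu)).
  rewrite (dact_ddiv i mu (wt_vprod (k := (j + i)%N%:Z - 1) fs gt)) !scalerA /F exprD.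
  rewrite (_ : - (s + t - ((j + i)%N%:Z - 1) - 1) = (j + i)%N%:Z - s - t); last by lia.
  by congr (_ *: _); ring.
rewrite (@sum_diag _ _ k F); last first.
  by move=> i j ij; rewrite /F Z// (lin0 (dact_linl mu)) scaler0.
apply: eq_bigr => q _; rewrite -(vandermonde_star K s t q) scaler_suml.
by apply: eq_bigr => -[i /= iq] _; rewrite /F subnKC.
Qed.

(** The two preceding expressions differ by a Pascal identity. *)
Lemma dact_commutator s t f g : wt_space s f -> wt_space t g ->
  evt (fun k => forall mu, dact f (dact g mu) = dact g (dact f mu) +
    \sum_(i < k) zb (s - 1) i *: dact (vp f i%:Z g) mu).
Proof.
move=> fs gt; have := evt_and (dact_star fs gt)
  (evt_and (dact_star_rev fs gt) (vprodB_evt f g 1)).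
apply: evt_mono => k [E1 [E2 Z]] mu; rewrite E1 E2.
have := @sum_pascal K _ k (s - 1) (fun i => dact (vp f (i%:Z - 1) g) mu).
rewrite subrK => ->; last by rewrite Z// (lin0 (dact_linl mu)).
congr (_ + _); apply: eq_bigr => i _.
by rewrite (_ : i.+1%:Z - 1 = i%:Z)//; lia.
Qed.

End ZhuModule.

(** * The grading of the Lie algebra of modes *)

Section HatGrading.
Variables (K : numFieldType) (V : gvoc K) (H : lmodType K).
Local Notation D := (dualV V).
Local Notation zb := (@zbin K).
Local Notation vp := (@vprod K V).
Variables (hg : D -> int -> H).
Variable lift : forall U : lmodType K, (D -> int -> U) -> H -> U.
Hypotheses (hg_lin : forall k, linear (fun f => hg f k))
  (hg_vtrans : forall f k, hg (vtrans f) k = - k%:~R *: hg f (k - 1))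
  (hat_ind : forall P : set H, is_subspace P -> (forall f k, P (hg f k)) -> forall x, P x).
Hypothesis lift_gen : forall (U : lmodType K) (F : D -> int -> U),
  (forall k, linear (F^~ k)) ->
  (forall f k, F (vtrans f) k = - k%:~R *: F f (k - 1)) ->
  forall f k, lift F (hg f k) = F f k.
Hypothesis lift_lin : forall (U : lmodType K) (F : D -> int -> U),
  (forall k, linear (F^~ k)) ->
  (forall f k, F (vtrans f) k = - k%:~R *: F f (k - 1)) -> linear (lift F).

Local Notation br := (hbr hg lift).

Definition hdeg (d : int) : set H := span [set x | exists s f k,
  [/\ wt_space s f, s - k - 1 = d & x = hg f k]].

Lemma hdeg_gen s f k : wt_space s f -> hdeg (s - k - 1) (hg f k).
Proof. by move=> fs; apply: span_gen; exists s, f, k. Qed.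

Lemma hdeg_ss d : is_subspace (hdeg d). Proof. exact: span_ss. Qed.

Lemma hdeg_ind (P : set H) : is_subspace P -> (forall d x, hdeg d x -> P x) ->
  forall x, P x.
Proof.
move=> sP GP; apply: hat_ind => // f k; move: f.
apply: (grade_ind (@wt_ds _ V) (sub_preim (hg_lin k) sP)) => s f fs.
exact: (GP _ _ (hdeg_gen (k := k) fs)).
Qed.

Lemma hdeg_br d e x y : hdeg d x -> hdeg e y -> hdeg (d + e) (br x y).
Proof.
move=> Gx Gy; have lr := hbr_linr hg_lin hg_vtrans hat_ind lift_gen lift_lin.
have ll := hbr_linl hg_lin hg_vtrans hat_ind lift_gen lift_lin.
apply: (span_lin (ll y) (hdeg_ss _)) Gx => _ [s [f [k [fs <- ->]]]].
apply: (span_lin (lr _) (hdeg_ss _)) Gy => _ [t [g [l [gt <- ->]]]].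
rewrite (hbr_gen hg_lin hg_vtrans hat_ind lift_gen lift_lin).
have /evt_ex [N N0] := vprod_nat_evt f g.
rewrite (hbE hg_lin k l N0); apply: (ss_sum (hdeg_ss _)) => i _.
apply: (ssZ (hdeg_ss _)); have := hdeg_gen (k := k + l - i%:Z) (wt_vprod (k := i%:Z) fs gt).
by rewrite (_ : s + t - i%:Z - 1 - (k + l - i%:Z) - 1 = s - k - 1 + (t - l - 1))//; lia.
Qed.

(** $D$ raises the weight by one, hence intertwines the truncations at
    neighbouring bounds. *)
Lemma gtrunc_vtrans (k : int) (f : D) :
  gtrunc (@wt_space K V) (fun s => s < k + 1) (vtrans f) =
  vtrans (gtrunc (@wt_space K V) (fun s => s < k) f).
Proof.
move: f; apply: (grade_ext (@wt_ds _ V)) => [||s f fs].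
- exact: (lin_comp (@vtrans_lin K V) (gtrunc_lin (@wt_ds _ V) _)).
- exact: (lin_comp (gtrunc_lin (@wt_ds _ V) _) (@vtrans_lin K V)).
rewrite (gtrunc_id (@wt_ds _ V) _ (wt_vtrans fs)) (gtrunc_id (@wt_ds _ V) _ fs).
rewrite (_ : (s + 1 < k + 1) = (s < k)); last by lia.
by case: ifP => // _; rewrite (lin0 (@vtrans_lin K V)).
Qed.

Lemma gproj_vtrans (k : int) (f : D) :
  gproj (@wt_space K V) (k + 1) (vtrans f) = vtrans (gproj (@wt_space K V) k f).
Proof.
move: f; apply: (grade_ext (@wt_ds _ V)) => [||s f fs].
- exact: (lin_comp (@vtrans_lin K V) (gproj_lin (@wt_ds _ V) _)).
- exact: (lin_comp (gproj_lin (@wt_ds _ V) _) (@vtrans_lin K V)).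
have [e|ne] := eqVneq s k.
  by rewrite -e (gproj_id (@wt_ds _ V) fs) (gproj_id (@wt_ds _ V) (wt_vtrans fs)).
rewrite (gproj_0 (@wt_ds _ V) fs ne) (gproj_0 (@wt_ds _ V) (wt_vtrans fs)).
  by rewrite (lin0 (@vtrans_lin K V)).
by apply: contra_neq ne => h; lia.
Qed.

Definition hneg (x : H) : H :=
  lift (fun f k => hg (gtrunc (@wt_space K V) (fun s => s < k + 1) f) k) x.

Let hneg_hyps :
  (forall k, linear (fun f => hg (gtrunc (@wt_space K V) (fun s => s < k + 1) f) k)) /\
  (forall f k, hg (gtrunc (@wt_space K V) (fun s => s < k + 1) (vtrans f)) k =
    - k%:~R *: hg (gtrunc (@wt_space K V) (fun s => s < k - 1 + 1) f) (k - 1)).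
Proof.
split=> [k|f k]; first exact: (lin_comp (gtrunc_lin (@wt_ds _ V) _) (hg_lin k)).
by rewrite gtrunc_vtrans hg_vtrans subrK.
Qed.

Lemma hneg_lin : linear hneg.
Proof. by case: hneg_hyps => h1 h2; exact: lift_lin. Qed.

Lemma hneg_gen s f k : wt_space s f ->
  hneg (hg f k) = if s < k + 1 then hg f k else 0.
Proof.
move=> fs; case: hneg_hyps => h1 h2; rewrite /hneg lift_gen//.
rewrite (gtrunc_id (@wt_ds _ V) _ fs).
by case: ifP => // _; exact: lin0 (hg_lin k).
Qed.

Lemma hneg_id d x : d < 0 -> hdeg d x -> hneg x = x.
Proof.
move=> d0 Gx; apply: (span_sub (sub_eq hneg_lin (@lin_id _ H)) _ Gx).
move=> _ [s [f [k [fs e ->]]]]; rewrite /mkset (hneg_gen k fs) ifT//; lia.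
Qed.

Lemma hneg_0 d x : 0 <= d -> hdeg d x -> hneg x = 0.
Proof.
move=> d0 Gx; apply: (span_sub (sub_ker hneg_lin) _ Gx).
move=> _ [s [f [k [fs e ->]]]]; rewrite /mkset (hneg_gen k fs) ifF//; lia.
Qed.

Variables (N : lmodType K) (da : D -> N -> N).
Hypotheses (da_linl : forall mu, linear (fun f => da f mu))
  (da_linr : forall f, linear (da f))
  (da_vtrans : forall s f mu, wt_space s f -> da (vtrans f) mu = - s%:~R *: da f mu)
  (da_comm : forall s t f g, wt_space s f -> wt_space t g ->
    evt (fun k => forall mu, da f (da g mu) = da g (da f mu) +
      \sum_(i < k) zb (s - 1) i *: da (vp f i%:Z g) mu)).

(** The action on [N] of the degree $0$ part. *)
Definition hzero (x : H) (mu : N) : N :=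
  lift (fun f k => da (gproj (@wt_space K V) (k + 1) f) mu) x.

Let hzero_hyps mu :
  (forall k, linear (fun f => da (gproj (@wt_space K V) (k + 1) f) mu)) /\
  (forall f k, da (gproj (@wt_space K V) (k + 1) (vtrans f)) mu =
    - k%:~R *: da (gproj (@wt_space K V) (k - 1 + 1) f) mu).
Proof.
split=> [k|f k]; first exact: (lin_comp (gproj_lin (@wt_ds _ V) _) (da_linl mu)).
rewrite gproj_vtrans subrK; apply: da_vtrans.
exact: (gproj_in (@wt_ds _ V)).
Qed.

Lemma hzero_linl mu : linear (fun x => hzero x mu).
Proof. by case: (hzero_hyps mu) => h1 h2; exact: lift_lin. Qed.

Lemma hzero_gen s f k mu : wt_space s f ->
  hzero (hg f k) mu = if s == k + 1 then da f mu else 0.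
Proof.
move=> fs; case: (hzero_hyps mu) => h1 h2; rewrite /hzero lift_gen//.
have [e|ne] := eqVneq s (k + 1); first by rewrite -e (gproj_id (@wt_ds _ V)).
by rewrite (gproj_0 (@wt_ds _ V) fs ne) (lin0 (da_linl mu)).
Qed.

Lemma hzero_linr x : linear (hzero x).
Proof.
move=> a mu nu; move: x; apply: (hdeg_ind (sub_eq (hzero_linl _)
  (lin_add (lin_scale a (hzero_linl mu)) (hzero_linl nu)))) => d.
apply: (span_sub (sub_eq (hzero_linl _)
  (lin_add (lin_scale a (hzero_linl mu)) (hzero_linl nu)))) => _ [s [f [k [fs e ->]]]].
rewrite /mkset !(hzero_gen _ _ fs); case: ifP => _; first exact: da_linr.
by rewrite scaler0 addr0.
Qed.

Lemma hzero_0 d x mu : d != 0 -> hdeg d x -> hzero x mu = 0.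
Proof.
move=> d0 Gx; apply: (span_sub (sub_ker (hzero_linl mu)) _ Gx).
move=> _ [s [f [k [fs e ->]]]]; rewrite /mkset (hzero_gen _ _ fs) ifF//.
by apply/negP => /eqP h; move/eqP: d0; lia.
Qed.

Lemma hzero_br x y mu : hdeg 0 x -> hdeg 0 y ->
  hzero x (hzero y mu) = hzero y (hzero x mu) + hzero (br x y) mu.
Proof.
move=> Gx Gy; have lr := hbr_linr hg_lin hg_vtrans hat_ind lift_gen lift_lin.
have ll := hbr_linl hg_lin hg_vtrans hat_ind lift_gen lift_lin.
apply: (span_sub (sub_eq (hzero_linl (hzero y mu))
  (lin_add (lin_comp (hzero_linl mu) (hzero_linr y))
    (lin_comp (ll y) (hzero_linl mu)))) _ Gx) => _ [s [f [k [fs e ->]]]].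
apply: (span_sub (sub_eq (lin_comp (hzero_linl mu) (hzero_linr (hg f k)))
  (lin_add (hzero_linl (hzero (hg f k) mu))
    (lin_comp (lr (hg f k)) (hzero_linl mu)))) _ Gy) => _ [t [g [l [gt e' ->]]]].
rewrite /mkset /comp (hbr_gen hg_lin hg_vtrans hat_ind lift_gen lift_lin).
rewrite !(hzero_gen _ _ fs) !(hzero_gen _ _ gt).
have -> : s == k + 1 by apply/eqP; lia.
have -> : t == l + 1 by apply/eqP; lia.
have /evt_ex [n [n0 ->]] := evt_and (vprod_nat_evt f g) (da_comm fs gt).
rewrite (hbE hg_lin k l n0) (lin_sum (hzero_linl mu)); congr (_ + _).
apply: eq_bigr => i _; rewrite (linZ (hzero_linl mu)).
rewrite (hzero_gen _ _ (wt_vprod (k := i%:Z) fs gt)) ifT; last by apply/eqP; lia.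
by rewrite (_ : k = s - 1)//; lia.
Qed.

End HatGrading.

(** * Modules induced from the subalgebra of nonpositive degree *)

Section WordAlgebra.
Variables (K : numFieldType) (H B : lmodType K) (ew : seq H -> B).
Variable com : H -> H -> H -> Prop.
Variable lift : forall U : lmodType K, (seq H -> U) -> B -> U.

(** Functions of words that factor through the tensor algebra. *)
Definition word_linear (U : lmodType K) (F : seq H -> U) : Prop :=
  forall u w, linear (fun x => F (u ++ x :: w)).

(** Compatibility with the relations $xy - yx = b$ for [com x y b]. *)
Definition word_commutes (U : lmodType K) (F : seq H -> U) : Prop :=
  forall u w x y b, com x y b ->
    F (u ++ x :: y :: w) = F (u ++ y :: x :: w) + F (u ++ b :: w).

Hypotheses (ew_lin : word_linear ew) (ew_com : word_commutes ew).
Hypothesis B_ind : forall P : set B, is_subspace P -> (forall u, P (ew u)) -> forall b, P b.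
Hypothesis lift_gen : forall (U : lmodType K) (F : seq H -> U),
  word_linear F -> word_commutes F -> forall u, lift F (ew u) = F u.
Hypothesis lift_lin : forall (U : lmodType K) (F : seq H -> U),
  word_linear F -> word_commutes F -> linear (lift F).

(** The product of an algebra presented by words is determined by the universal
    property, used twice. *)
Definition wmul (a b : B) : B := lift (fun u => lift (fun w => ew (u ++ w)) b) a.

Let inner_lin u : word_linear (fun w => ew (u ++ w)).
Proof. by move=> v w a x y; rewrite !catA ew_lin. Qed.

Let inner_com u : word_commutes (fun w => ew (u ++ w)).
Proof. by move=> v w x y b c; rewrite !catA (ew_com _ _ c). Qed.

Let inner_linear u : linear (lift (fun w => ew (u ++ w))).
Proof. exact: lift_lin (inner_lin u) (inner_com u). Qed.

Let inner_word u w : lift (fun w => ew (u ++ w)) (ew w) = ew (u ++ w).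
Proof. exact: lift_gen (inner_lin u) (inner_com u) _. Qed.

Let outer_lin b : word_linear (fun u => lift (fun w => ew (u ++ w)) b).
Proof.
move=> u w a x y; move: b; apply: (B_ind (sub_eq (inner_linear _)
  (lin_add (lin_scale a (inner_linear (u ++ x :: w))) (inner_linear (u ++ y :: w))))) => v.
by rewrite /mkset !inner_word -!catA !cat_cons; exact: ew_lin.
Qed.

Let outer_com b : word_commutes (fun u => lift (fun w => ew (u ++ w)) b).
Proof.
move=> u w x y z c; move: b; apply: (B_ind (sub_eq (inner_linear _)
  (lin_add (inner_linear (u ++ y :: x :: w)) (inner_linear (u ++ z :: w))))) => v.
by rewrite /mkset !inner_word -!catA !cat_cons; exact: ew_com.
Qed.

Lemma wmul_linl b : linear (wmul^~ b).
Proof. exact: lift_lin (outer_lin b) (outer_com b). Qed.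

Lemma wmul_wordl u b : wmul (ew u) b = lift (fun w => ew (u ++ w)) b.
Proof. exact: (lift_gen (outer_lin b) (outer_com b)). Qed.

Lemma wmul_word u w : wmul (ew u) (ew w) = ew (u ++ w).
Proof. by rewrite wmul_wordl inner_word. Qed.

Lemma wmul_linr a : linear (wmul a).
Proof.
move=> k b b'; move: a; apply: (B_ind (sub_eq (wmul_linl _)
  (lin_add (lin_scale k (wmul_linl b)) (wmul_linl b')))) => u.
by rewrite /mkset !wmul_wordl; exact: inner_linear.
Qed.

Lemma wmul_assoc a b c : wmul a (wmul b c) = wmul (wmul a b) c.
Proof.
move: a; apply: (B_ind (sub_eq (wmul_linl _) (lin_comp (wmul_linl b) (wmul_linl c)))) => u.
move: b; apply: (B_ind (sub_eq (lin_comp (wmul_linl c) (wmul_linr (ew u)))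
  (lin_comp (wmul_linr (ew u)) (wmul_linl c)))) => v.
move: c; apply: (B_ind (sub_eq (lin_comp (wmul_linr (ew v)) (wmul_linr (ew u)))
  (wmul_linr (wmul (ew u) (ew v))))) => w.
by rewrite /mkset /comp !wmul_word catA.
Qed.

Section InducedModule.
Variables (N T : lmodType K) (tp : B -> N -> T).
Variable tl : forall U : lmodType K, (B -> N -> U) -> T -> U.
Variable tm : (B -> B) -> T -> T.
Hypotheses (tp_linl : forall n, linear (tp^~ n)) (tp_linr : forall b, linear (tp b)).
Hypothesis T_ind : forall P : set T, is_subspace P -> (forall b n, P (tp b n)) ->
  forall z, P z.
Hypothesis tl_pure : forall (U : lmodType K) (F : B -> N -> U),
  (forall n, linear (F^~ n)) -> (forall b, linear (F b)) ->
  forall b n, tl F (tp b n) = F b n.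
Hypothesis tl_lin : forall (U : lmodType K) (F : B -> N -> U),
  (forall n, linear (F^~ n)) -> (forall b, linear (F b)) -> linear (tl F).
Hypotheses (tm_lin : forall f, linear f -> linear (tm f))
  (tm_pure : forall f b n, linear f -> tm f (tp b n) = tp (f b) n).

(** [R h n n'] prescribes that the letter [h] maps [n] to [n'] in the module
    from which one induces. *)
Variable R : H -> N -> N -> Prop.
Variable rel : set T.
Hypotheses (relE : forall z, rel z -> exists a h n n', R h n n' /\
    z = tp (wmul a (ew [:: h])) n - tp a n')
  (rel_R : forall a h n n', R h n n' -> rel (tp (wmul a (ew [:: h])) n - tp a n')).

Local Notation Y := (quotby rel).
Definition ip (b : B) (n : N) : Y := cls rel (tp b n).
Definition ia (a : B) (x : Y) : Y := cls rel (tm (wmul a) (rep x)).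

Let lc := @cls_lin _ _ rel.

Lemma ip_linl n : linear (ip^~ n). Proof. exact: (lin_comp (tp_linl n) lc). Qed.
Lemma ip_linr b : linear (ip b). Proof. exact: (lin_comp (tp_linr b) lc). Qed.

Lemma ip_R a h n n' : R h n n' -> ip (wmul a (ew [:: h])) n = ip a n'.
Proof. by move=> r; apply/clsP; apply: span_gen; exact: rel_R. Qed.

Lemma ind_indP (P : set Y) : is_subspace P -> (forall u n, P (ip (ew u) n)) ->
  forall x, P x.
Proof.
move=> sP Pp; apply: cls_ind; apply: (T_ind (sub_preim lc sP)) => b n.
by move: b; apply: (B_ind (sub_preim (ip_linl n) sP)) => u; exact: Pp.
Qed.

Let tma_lin a : linear (fun z => cls rel (tm (wmul a) z)).
Proof. exact: (lin_comp (tm_lin (wmul_linr a)) lc). Qed.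

Let tma_kill a z : rel z -> cls rel (tm (wmul a) z) = 0.
Proof.
move=> /relE[b [h [n [n' [r ->]]]]].
rewrite (linB (tma_lin a)) !(tm_pure _ _ (wmul_linr a)) wmul_assoc.
by apply/eqP; rewrite subr_eq0; apply/eqP; exact: ip_R.
Qed.

Lemma ia_pure a b n : ia a (ip b n) = ip (wmul a b) n.
Proof.
by rewrite /ia /ip (qlift_cls (tma_lin a) (@tma_kill a)) (tm_pure _ _ (wmul_linr a)).
Qed.

Lemma ia_linr a : linear (ia a).
Proof. exact: (qlift_lin (tma_lin a) (@tma_kill a)). Qed.

Lemma ia_linl x : linear (ia^~ x).
Proof.
move=> k a b; move: x; apply: (ind_indP (sub_eq (ia_linr _)
  (lin_add (lin_scale k (ia_linr a)) (ia_linr b)))) => u n.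
rewrite /mkset !ia_pure; exact: (lin_comp (wmul_linl (ew u)) (ip_linl n)).
Qed.

Lemma ia_mul a b x : ia (wmul a b) x = ia a (ia b x).
Proof.
move: x; apply: (ind_indP (sub_eq (ia_linr _) (lin_comp (ia_linr b) (ia_linr a)))) => u n.
by rewrite /mkset /comp !ia_pure wmul_assoc.
Qed.

Definition iact (h : H) (x : Y) : Y := ia (ew [:: h]) x.
Definition itop (n : N) : Y := ip (ew [::]) n.

Lemma iact_linl x : linear (iact^~ x).
Proof. exact: (lin_comp (ew_lin [::] [::]) (ia_linl x)). Qed.

Lemma iact_com x y b v : com x y b -> iact x (iact y v) = iact y (iact x v) + iact b v.
Proof.
move=> c; rewrite /iact -!ia_mul !wmul_word /=.
have := ew_com [::] [::] c; rewrite /= => ->; exact: (linD (ia_linl v)).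
Qed.

Lemma iact_top h n n' : R h n n' -> iact h (itop n) = itop n'.
Proof.
move=> r; rewrite /itop -(ip_R (ew [::]) r) /iact ia_pure; congr ip.
by rewrite !wmul_word.
Qed.

Lemma ia_nil x : ia (ew [::]) x = x.
Proof.
move: x; apply: (ind_indP (sub_eq (ia_linr _) (@lin_id _ _))) => u n.
by rewrite /mkset ia_pure wmul_word.
Qed.

Lemma ia_word u x : ia (ew u) x = foldr iact x u.
Proof.
elim: u => [|h u IH]; first exact: ia_nil.
rewrite /= -IH /iact -ia_mul; congr (ia _ _); exact/esym/(wmul_word [:: h] u).
Qed.

Lemma ip_word u n : ip (ew u) n = foldr iact (itop n) u.
Proof. by rewrite -ia_word /itop ia_pure wmul_word cats0. Qed.

Section InducedLift.
Variables (U : lmodType K) (v : seq H -> N -> U).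
Hypotheses (v_linr : forall u, linear (v u))
  (v_linl : forall n, word_linear (v^~ n)) (v_com : forall n, word_commutes (v^~ n))
  (v_R : forall u h n n', R h n n' -> v (rcons u h) n = v u n').

Let vl n : linear (lift (v^~ n)). Proof. exact: lift_lin. Qed.

Let vr b : linear (fun n => lift (v^~ n) b).
Proof.
move=> k n n'; move: b; apply: (B_ind (sub_eq (vl _)
  (lin_add (lin_scale k (vl n)) (vl n')))) => u.
by rewrite /mkset !lift_gen//; exact: v_linr.
Qed.

Let tv := tl (fun b n => lift (v^~ n) b).
Let tv_lin : linear tv. Proof. exact: tl_lin. Qed.

Let tv_kill z : rel z -> tv z = 0.
Proof.
move=> /relE[b [h [n [n' [r ->]]]]]; rewrite (linB tv_lin) /tv !tl_pure//.
apply/eqP; rewrite subr_eq0; apply/eqP; move: b.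
apply: (B_ind (sub_eq (lin_comp (wmul_linl (ew [:: h])) (vl n)) (vl n'))) => u.
by rewrite /mkset /comp wmul_word !lift_gen// cats1 (v_R _ r).
Qed.

Definition ilift (x : Y) : U := tv (rep x).

Lemma ilift_lin : linear ilift. Proof. exact: (qlift_lin tv_lin tv_kill). Qed.

(** A function of words and vectors that respects the relations of the algebra,
    and those at the last letter, is a map out of the induced module. *)
Lemma ilift_word u n : ilift (foldr iact (itop n) u) = v u n.
Proof.
by rewrite -ip_word /ilift (qlift_cls tv_lin tv_kill) /tv tl_pure// lift_gen.
Qed.

End InducedLift.
End InducedModule.
End WordAlgebra.

(** * The irreducible quotient and its grading *)

Section TopModule.
Variables (K : numFieldType) (H N Y : lmodType K) (br : H -> H -> H).
Variables (G : int -> set H) (z : H -> N -> N).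
Variables (act : H -> Y -> Y) (wd : seq H -> N -> Y) (E : Y -> N).
Local Notation top := (wd [::]).
Hypotheses (G_ind : forall P : set H, is_subspace P ->
     (forall d x, G d x -> P x) -> forall x, P x)
  (G_br : forall d e x y, G d x -> G e y -> G (d + e) (br x y))
  (act_linl : forall y, linear (act^~ y)) (act_linr : forall h, linear (act h))
  (act_com : forall x y v, act x (act y v) = act y (act x v) + act (br x y) v)
  (wd_cons : forall h u n, wd (h :: u) n = act h (wd u n))
  (wd_linr : linear top)
  (act_top0 : forall h n, G 0 h -> act h (top n) = top (z h n))
  (act_topN : forall d h n, d < 0 -> G d h -> act h (top n) = 0)
  (Y_ind : forall P : set Y, is_subspace P -> (forall u n, P (wd u n)) -> forall x, P x)
  (E_lin : linear E) (E_top : forall n, E (top n) = n)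
  (E_deg : forall (hs : seq (H * int)) n, (forall h, h \in hs -> G h.2 h.1) ->
     \sum_(h <- hs) h.2 != 0 -> E (wd [seq h.1 | h <- hs] n) = 0).

Definition word_grade (d : int) : set Y :=
  span [set x | exists (hs : seq (H * int)) (n : N),
          [/\ forall h, h \in hs -> G h.2 h.1, \sum_(h <- hs) h.2 = d &
              x = wd [seq h.1 | h <- hs] n]].

Lemma word_grade_ss d : is_subspace (word_grade d). Proof. exact: span_ss. Qed.

Lemma word_grade_gen (hs : seq (H * int)) n : (forall h, h \in hs -> G h.2 h.1) ->
  word_grade (\sum_(h <- hs) h.2) (wd [seq h.1 | h <- hs] n).
Proof. by move=> Ghs; apply: span_gen; exists hs, n. Qed.

Lemma word_grade_act d e h y : G e h -> word_grade d y -> word_grade (e + d) (act h y).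
Proof.
move=> Gh; apply: (span_lin (act_linr h) (word_grade_ss _)) => _ [hs [n [Ghs <- ->]]].
have := @word_grade_gen ((h, e) :: hs) n; rewrite big_cons /= wd_cons; apply.
by move=> x; rewrite inE => /orP[/eqP ->|/Ghs].
Qed.

Lemma word_grade_top n : word_grade 0 (top n).
Proof. by have := @word_grade_gen [::] n; rewrite big_nil; exact. Qed.

Lemma word_grade_ind (P : set Y) : is_subspace P ->
  (forall d y, word_grade d y -> P y) -> forall y, P y.
Proof.
move=> sP GP y; pose S := span (\bigcup_d word_grade d).
have sS : is_subspace S := @span_ss _ _ _.
apply: (span_sub sP (S := \bigcup_d word_grade d)) => [x [d _]|]; first exact: GP.
have SG d x : word_grade d x -> S x by move=> Gx; apply: span_gen; exists d.
apply: (Y_ind sS) => u n; elim: u => [|h u]; first exact: SG (word_grade_top n).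
rewrite wd_cons; apply: (span_lin (act_linr h) sS) => x [d _ Gx].
move: h; apply: (G_ind (sub_preim (act_linl x) sS)) => e h Gh.
exact: SG (word_grade_act Gh Gx).
Qed.

Lemma E_grade d y : d != 0 -> word_grade d y -> E y = 0.
Proof.
move=> d0; apply: (span_sub (sub_ker E_lin)) => _ [hs [n [Ghs e ->]]].
by apply: E_deg => //; rewrite e.
Qed.

(** Moving a letter from the left end of a word to its right end brackets it
    with every other letter once. *)
Lemma act_word h u n : act h (wd u n) = dsum br (wd^~ n) h u +
  foldr act (act h (top n)) u.
Proof.
elim: u => [|x u IH] /=; first by rewrite dsum_nil add0r.
rewrite wd_cons act_com IH dsum_cons wd_cons (linD (act_linr x)) .
have -> : dsum br (fun v => wd (x :: v) n) h u = act x (dsum br (wd^~ n) h u).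
  by rewrite [RHS](lin_sum (act_linr x)); apply: eq_bigr => v _; rewrite wd_cons.
by rewrite addrC addrA.
Qed.

Lemma foldr_act0 u : foldr act 0 u = 0.
Proof. by elim: u => //= h u ->; exact: (lin0 (act_linr h)). Qed.

(** A letter of negative degree can be commuted to the right, where it kills
    the top; so words of negative degree vanish and those of degree $0$ reduce
    to the top. *)
Lemma word_nonpos (hs : seq (H * int)) n : (forall h, h \in hs -> G h.2 h.1) ->
  (\sum_(h <- hs) h.2 < 0 -> wd [seq h.1 | h <- hs] n = 0) /\
  (\sum_(h <- hs) h.2 = 0 -> range top (wd [seq h.1 | h <- hs] n)).
Proof.
have sT : is_subspace (range top) := sub_im wd_linr (@sub_setT _ _).
have [k] := ubnP (size hs); elim: k hs n => // k IH hs n; rewrite ltnS => hk.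
case: hs hk => [|[h e] hs] /= hk Ghs; first by rewrite big_nil ltxx; split=> // _; exists n.
have Gh : G e h by apply: (Ghs (h, e)); exact: mem_head.
have Ghs' : forall y, y \in hs -> G y.2 y.1 by move=> y yhs; apply: Ghs; rewrite inE yhs orbT.
have [IHn IHz] := IH hs n hk Ghs'.
rewrite big_cons wd_cons /=; set d := \sum_(h <- hs) h.2 in IHn IHz *.
have [d0|d0|d0] := ltgtP d 0.
- by rewrite (IHn d0) (lin0 (act_linr h)); split=> // _; exact: ss0 sT.
- have sizeP (ks : seq (H * int)) : size ks = size hs -> (size ks < k)%N by move=> ->.
  have step S : is_subspace S -> (forall ks : seq (H * int),
      (forall x, x \in ks -> G x.2 x.1) -> \sum_(x <- ks) x.2 = d + e ->
      size ks = size hs -> S (wd [seq x.1 | x <- ks] n)) -> e < 0 ->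
      S (act h (wd [seq x.1 | x <- hs] n)).
    move=> sS S0 e0; rewrite act_word (act_topN _ e0 Gh) foldr_act0 addr0.
    exact: (dsum_degree (F := wd^~ n) G_br sS erefl S0 Gh Ghs').
  split=> ed.
    apply: (step [set 0] (sub_set0 _)); last lia.
    move=> ks Gks ks0 sk; have [IH1 _] := IH ks n (sizeP ks sk) Gks.
    by apply: IH1; rewrite ks0; lia.
  apply: (step _ sT); last lia.
  move=> ks Gks ks0 sk; have [_ IH2] := IH ks n (sizeP ks sk) Gks.
  by apply: IH2; rewrite ks0; lia.
have [n' _ <-] := IHz d0; rewrite d0 addr0; split=> e0; first exact: act_topN e0 Gh.
by rewrite e0 in Gh; rewrite (act_top0 _ Gh); exists (z h n').
Qed.

Lemma word_grade_neg d y : d < 0 -> word_grade d y -> y = 0.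
Proof.
move=> d0; apply: (span_sub (sub_set0 _)) => _ [hs [n [Ghs e ->]]].
by have [+ _] := word_nonpos n Ghs; apply; rewrite e.
Qed.

Lemma word_grade0 y : word_grade 0 y -> range top y.
Proof.
apply: (span_sub (sub_im wd_linr (@sub_setT _ _))) => _ [hs [n [Ghs e ->]]].
by have [_] := word_nonpos n Ghs; apply.
Qed.

Section RadicalQuotient.
Variable rad : set Y.
Hypothesis radP : forall y, rad y <-> forall u, E (foldr act y u) = 0.

Lemma foldr_act_lin u : linear (fun y => foldr act y u).
Proof. by elim: u => [//|h u IH]; exact: (lin_comp IH (act_linr h)). Qed.

Lemma rad_ss : is_subspace rad.
Proof.
split=> [|a x y /radP x0 /radP y0]; apply/radP => u.
  by rewrite foldr_act0 (lin0 E_lin).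
by rewrite foldr_act_lin E_lin x0 y0 scaler0 addr0.
Qed.

(** The radical only involves words applied to a vector, so it is a submodule. *)
Lemma rad_act h y : rad y -> rad (act h y).
Proof.
by move=> /radP y0; apply/radP => u; have := y0 (rcons u h); rewrite foldr_rcons.
Qed.

Local Notation X := (quotby rad).
Let lc := @cls_lin _ _ rad.

Lemma rad_cls y : cls rad y = 0 <-> rad y.
Proof. by rewrite cls0P span_id//; exact: rad_ss. Qed.

Definition qact (h : H) (x : X) : X := cls rad (act h (rep x)).
Definition qtop (n : N) : X := cls rad (top n).
Definition qgrade (t : nat) : set X := cls rad @` word_grade t%:Z.
Definition qE (x : X) : N := E (rep x).

Let qa_kill h y : rad y -> cls rad (act h y) = 0.
Proof. by move=> ry; apply/rad_cls; exact: rad_act. Qed.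

Lemma qact_cls h y : qact h (cls rad y) = cls rad (act h y).
Proof. exact: (qlift_cls (lin_comp (act_linr h) lc) (@qa_kill h)). Qed.

Lemma qact_linr h : linear (qact h).
Proof. exact: (qlift_lin (lin_comp (act_linr h) lc) (@qa_kill h)). Qed.

Lemma qact_linl x : linear (qact^~ x).
Proof. exact: (lin_comp (act_linl (rep x)) lc). Qed.

Lemma qact_com x y v : qact x (qact y v) = qact y (qact x v) + qact (br x y) v.
Proof.
move: v; apply: cls_ind => v; rewrite !qact_cls act_com; exact: (linD lc).
Qed.

Let E_kill y : rad y -> E y = 0.
Proof. by move=> /radP /(_ [::]). Qed.

Lemma qE_cls y : qE (cls rad y) = E y.
Proof. exact: (qlift_cls E_lin E_kill). Qed.

Lemma qE_lin : linear qE.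
Proof. exact: (qlift_lin E_lin E_kill). Qed.

Lemma qtop_lin : linear qtop. Proof. exact: (lin_comp wd_linr lc). Qed.

Lemma qE_top n : qE (qtop n) = n.
Proof. by rewrite qE_cls E_top. Qed.

Lemma qact_top0 h n : G 0 h -> qact h (qtop n) = qtop (z h n).
Proof. by move=> Gh; rewrite qact_cls act_top0. Qed.

Lemma foldr_qact u y : foldr qact (cls rad y) u = cls rad (foldr act y u).
Proof. by elim: u => //= h u ->; exact: qact_cls. Qed.

Lemma q_ind (P : set X) : is_subspace P -> (forall n, P (qtop n)) ->
  (forall h x, P x -> P (qact h x)) -> forall x, P x.
Proof.
move=> sP Pt Pa; apply: cls_ind; apply: (Y_ind (sub_preim lc sP)) => u n.
elim: u => [|h u IH]; first exact: Pt.
by rewrite /mkset wd_cons -qact_cls; exact: Pa.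
Qed.

Lemma q_sep x : (forall u, qE (foldr qact x u) = 0) -> x = 0.
Proof.
move: x; apply: cls_ind => y y0; apply/rad_cls/radP => u.
by rewrite -qE_cls -foldr_qact.
Qed.

Lemma qgrade_ss t : is_subspace (qgrade t).
Proof. exact: sub_im lc (word_grade_ss _). Qed.

Lemma qgrade_act (t t' : nat) e h x : t%:Z + e = t' -> G e h -> qgrade t x ->
  qgrade t' (qact h x).
Proof.
move=> te Gh [y Gy <-]; rewrite qact_cls; exists (act h y) => //.
by rewrite -te addrC; exact: word_grade_act.
Qed.

Lemma qgrade_act0 (t : nat) e h x : t%:Z + e < 0 -> G e h -> qgrade t x ->
  qact h x = 0.
Proof.
move=> te Gh [y Gy <-]; rewrite qact_cls (@word_grade_neg (t%:Z + e) (act h y))//.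
  exact: (lin0 lc).
by rewrite addrC; exact: word_grade_act.
Qed.

Lemma qgrade0P x : qgrade 0 x <-> range qtop x.
Proof.
split=> [[y /word_grade0 [n _ <-] <-]|[n _ <-]]; first by exists n.
by exists (top n) => //; exact: word_grade_top.
Qed.

Lemma qE_grade t x : t != 0%N -> qgrade t x -> qE x = 0.
Proof.
move=> t0 [y Gy <-]; rewrite qE_cls; by apply: E_grade Gy.
Qed.

Lemma qgrade_ind (P : set X) : is_subspace P -> (forall t x, qgrade t x -> P x) ->
  forall x, P x.
Proof.
move=> sP GP; apply: cls_ind; apply: (word_grade_ind (sub_preim lc sP)) => d y Gy.
have [d0|d0] := ltP d 0.
  by rewrite /mkset (word_grade_neg d0 Gy) (lin0 lc); exact: ss0.
by apply: (GP `|d|%N); exists y => //; rewrite gez0_abs.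
Qed.

Local Notation homog hs := (forall h, h \in hs -> G h.2 h.1).

(** An arbitrary letter is a sum of homogeneous ones. *)
Lemma q_sep_homog x :
  (forall hs : seq (H * int), homog hs -> qE (foldr qact x [seq h.1 | h <- hs]) = 0) ->
  x = 0.
Proof.
move=> x0; pose S := [set y | forall hs : seq (H * int), homog hs ->
  qE (foldr qact y [seq h.1 | h <- hs]) = 0].
have lf u : linear (fun y => foldr qact y u).
  by elim: u => [//|h u IH]; exact: (lin_comp IH (qact_linr h)).
have sS : is_subspace S.
  split=> [hs _|a y v Sy Sv hs Ghs]; first by rewrite (lin0 (lf _)) (lin0 qE_lin).
  by rewrite lf qE_lin Sy// Sv// scaler0 addr0.
have Sa h y : S y -> S (qact h y).
  move=> Sy; move: h; apply: (G_ind (sub_preim (qact_linl y) sS)) => d h Gh hs Ghs.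
  have := Sy (rcons hs (h, d)); rewrite map_rcons foldr_rcons; apply => k.
  by rewrite mem_rcons inE => /orP[/eqP ->|/Ghs].
have Su u : S (foldr qact x u) by elim: u => //= h u; exact: Sa.
by apply: q_sep => u; exact: (Su u [::]).
Qed.

Lemma foldr_qact_grade (hs : seq (H * int)) (t : nat) x : homog hs -> qgrade t x ->
  t%:Z + \sum_(h <- hs) h.2 != 0 -> qE (foldr qact x [seq h.1 | h <- hs]) = 0.
Proof.
move=> Ghs [y Gy <-] d0; rewrite foldr_qact qE_cls; apply: (E_grade d0).
elim: hs Ghs {d0} => [|h hs IH] Ghs; first by rewrite big_nil addr0.
rewrite big_cons /= addrCA; apply: word_grade_act; first by apply: Ghs; exact: mem_head.
by apply: IH => k khs; apply: Ghs; rewrite inE khs orbT.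
Qed.

(** The maps [qE] composed with homogeneous words of degree $-t$ separate the
    points of degree $t$ and kill the other degrees. *)
Lemma qgrade_ds : direct_sum qgrade.
Proof.
have lf u : linear (fun y => foldr qact y u).
  by elim: u => [//|h u IH]; exact: (lin_comp IH (qact_linr h)).
apply: (direct_sum_sep (W := N) (Phi := fun t => [set phi | exists hs : seq (H * int),
  [/\ homog hs, t%:Z + \sum_(h <- hs) h.2 = 0 &
      phi = fun x => qE (foldr qact x [seq h.1 | h <- hs])]])).
- exact: qgrade_ss.
- by apply: (qgrade_ind (@span_ss _ _ _)) => t x Gx; apply: span_gen; exists t.
- move=> t _ [hs [Ghs e ->]]; split; first exact: (lin_comp (lf _) qE_lin).
  by move=> r v rt Gv; apply: foldr_qact_grade Gv _ => //; apply: contra rt => /eqP e'; apply/eqP; lia.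
move=> t x Gx x0; apply: q_sep_homog => hs Ghs.
have [e|e] := eqVneq (t%:Z + \sum_(h <- hs) h.2) 0; last exact: foldr_qact_grade Gx e.
by apply: (x0 (fun x => qE (foldr qact x [seq h.1 | h <- hs]))); exists hs.
Qed.

End RadicalQuotient.
End TopModule.

(** * The Jacobi identity on the irreducible quotient *)

Section BorcherdsLinear.
Variables (K : numFieldType) (V : gvoc K) (Y : lmodType K).
Local Notation D := (dualV V).
Variable act : D -> int -> Y -> Y.
Hypothesis rY : restricted act.

Lemma borch_linl l m n g y : linear (fun f => borch act l m n f g y).
Proof.
move=> a f f'.
have /evt_ex [N [-> [-> ->]]] := evt_and (borchE rY l m n (a *: f + f') g y)
  (evt_and (borchE rY l m n f g y) (borchE rY l m n f' g y)).
move: a f f'; rewrite /borch_cut; apply: lin_sub; first apply: lin_sub.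
- by apply: lin_sumf => i _; apply: lin_scale; exact: act_linl.
- apply: lin_sumf => i _; apply: lin_scale.
  exact: (lin_comp (act_linl rY _ y) (act_linr rY g _)).
- apply: lin_sumf => i _; apply: lin_scale.
  exact: (lin_comp (@vprod_linl _ V _ g) (act_linl rY _ y)).
Qed.

Lemma borch_linm l m n f y : linear (fun g => borch act l m n f g y).
Proof.
move=> a g g'.
have /evt_ex [N [-> [-> ->]]] := evt_and (borchE rY l m n f (a *: g + g') y)
  (evt_and (borchE rY l m n f g y) (borchE rY l m n f g' y)).
move: a g g'; rewrite /borch_cut; apply: lin_sub; first apply: lin_sub.
- apply: lin_sumf => i _; apply: lin_scale.
  exact: (lin_comp (act_linl rY _ y) (act_linr rY f _)).
- by apply: lin_sumf => i _; apply: lin_scale; exact: act_linl.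
- apply: lin_sumf => i _; apply: lin_scale.
  by move=> b u u'; rewrite vprod_linr (act_linl rY).
Qed.

Lemma borch_linr l m n f g : linear (borch act l m n f g).
Proof.
move=> a y y'.
have /evt_ex [N [-> [-> ->]]] := evt_and (borchE rY l m n f g (a *: y + y'))
  (evt_and (borchE rY l m n f g y) (borchE rY l m n f g y')).
move: a y y'; rewrite /borch_cut; apply: lin_sub; first apply: lin_sub.
- apply: lin_sumf => i _; apply: lin_scale.
  exact: (lin_comp (act_linr rY g _) (act_linr rY f _)).
- apply: lin_sumf => i _; apply: lin_scale.
  exact: (lin_comp (act_linr rY f _) (act_linr rY g _)).
- by apply: lin_sumf => i _; apply: lin_scale; exact: act_linr.
Qed.

End BorcherdsLinear.

Section IrreducibleQuotient.
Variables (K : numFieldType) (V : gvoc K) (N X : lmodType K).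
Local Notation D := (dualV V).
Local Notation zb := (@zbin K).
Local Notation vp := (@vprod K V).
Variables (act : D -> int -> X -> X) (top : N -> X) (E : X -> N).
Variables (gr : nat -> set X) (da : D -> N -> N).
Hypotheses (a_linl : forall k y, linear (fun f => act f k y))
  (a_linr : forall f k, linear (act f k))
  (a_com : forall f m g n, evt (fun J => forall y, act f m (act g n y) =
     act g n (act f m y) + \sum_(i < J) zb m i *: act (vp f i%:Z g) (m + n - i%:Z) y))
  (a_der : forall f k y, act (vtrans f) k y = - k%:~R *: act f (k - 1) y)
  (a_gr : forall s f k t t' x, wt_space s f -> gr t x ->
     t%:Z + (s - k - 1) = t'%:Z -> gr t' (act f k x))
  (a_gr0 : forall s f k t x, wt_space s f -> gr t x -> t%:Z + (s - k - 1) < 0 ->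
     act f k x = 0)
  (a_top : forall s f n, wt_space s f -> act f (s - 1) (top n) = top (da f n))
  (gr_ind : forall P : set X, is_subspace P -> (forall t x, gr t x -> P x) ->
     forall x, P x)
  (gr_top : forall n, gr 0 (top n)) (top_lin : linear top)
  (a_ind : forall P : set X, is_subspace P -> (forall n, P (top n)) ->
     (forall f k x, P x -> P (act f k x)) -> forall x, P x)
  (a_sep : forall S : set X, is_subspace S -> (forall x, S x -> E x = 0) ->
     (forall f k x, S x -> S (act f k x)) -> forall x, S x -> x = 0)
  (E_lin : linear E) (E_gr : forall t x, t != 0%N -> gr t x -> E x = 0)
  (da_star : forall s t f g, wt_space s f -> wt_space t g ->
    evt (fun J => forall n, da f (da g n) =
      \sum_(i < J) zb s i *: da (vp f (i%:Z - 1) g) n))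
  (da_vac : forall n, da (vac V) n = n).

(** A mode of large index lowers the degree below zero. *)
Lemma mode_restricted : restricted act.
Proof.
split=> // f x.
pose Q f x := exists J : int, forall k, J <= k -> act f k x = 0.
have Qf x' : is_subspace [set f | Q f x'].
  split=> [|a g h [J HJ] [J' HJ']]; first by exists 0 => k _; exact: (lin0 (a_linl _ _)).
  exists (Num.max J J') => k; rewrite ge_max => /andP[/HJ e /HJ' e'].
  by rewrite (a_linl k x') e e' scaler0 addr0.
have Qx g : is_subspace [set x | Q g x].
  split=> [|a y y' [J HJ] [J' HJ']]; first by exists 0 => k _; exact: (lin0 (a_linr _ _)).
  exists (Num.max J J') => k; rewrite ge_max => /andP[/HJ e /HJ' e'].
  by rewrite a_linr e e' scaler0 addr0.
rewrite -/(Q f x); move: f; apply: (grade_ind (@wt_ds _ V) (Qf x)) => s f fs.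
move: x; apply: (gr_ind (Qx f)) => t x Gx.
by exists (t%:Z + s) => k tk; apply: (a_gr0 fs Gx); lia.
Qed.

Local Notation rX := mode_restricted.

Lemma mode_commutator m n f g y : borch act 0 m n f g y = 0.
Proof.
have /evt_ex [J [-> ->]] := evt_and (borch0E rX m n f g y) (a_com f m g n).
by rewrite (addrC (act g _ _)) addrK subrr.
Qed.

Lemma mode_nonneg_gr s f k t x : wt_space s f -> gr t x -> 0 <= s - k - 1 ->
  gr (t + absz (s - k - 1)%R)%N (act f k x).
Proof. by move=> fs Gx d0; apply: (a_gr fs Gx); rewrite PoszD gez0_abs. Qed.

(** Operators of nonpositive degree can be commuted to the right, where they
    preserve the top; so the subspace generated by those of positive degree is
    stable under all of them. *)
Lemma creation_ind (P : set X) : is_subspace P -> (forall n, P (top n)) ->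
  (forall s f k x, wt_space s f -> 0 < s - k - 1 -> P x -> P (act f k x)) ->
  forall x, P x.
Proof.
move=> sP Pt Pa.
pose S := [set x | forall Q : set X, is_subspace Q -> (forall n, Q (top n)) ->
  (forall s f k x, wt_space s f -> 0 < s - k - 1 -> Q x -> Q (act f k x)) -> Q x].
have sS : is_subspace S.
  split=> [Q sQ _ _|a x y Sx Sy Q sQ Qt Qa]; first exact: ss0.
  by case: (sQ) => _; apply; [exact: Sx|exact: Sy].
have St n : S (top n) by move=> Q _ Qt _; exact: Qt.
have Sa s f k x : wt_space s f -> 0 < s - k - 1 -> S x -> S (act f k x).
  by move=> fs d0 Sx Q sQ Qt Qa; apply: (Qa s) => //; exact: Sx.
suff ST x : S x -> forall f k, S (act f k x).
  by apply: (a_ind sP Pt) => f k x Px; apply: (a_ind sS St (fun f k x Sx => ST x Sx f k)).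
move=> Sx; suff [] : S x /\ forall f k, S (act f k x) by [].
apply: (Sx (fun x => S x /\ forall f k, S (act f k x))).
- split=> [|a y y' [Sy Ty] [Sy' Ty']].
    by split=> [|f k]; [exact: ss0|rewrite (lin0 (a_linr f k)); exact: ss0].
  split=> [|f k]; first by case: (sS) => _; exact.
  by rewrite a_linr; case: (sS) => _; apply.
- move=> n; split=> // f k; move: f.
  apply: (grade_ind (@wt_ds _ V) (sub_preim (a_linl k (top n)) sS)) => s f fs.
  have [d0|d0|d0] := ltgtP (s - k - 1) 0.
  + by rewrite /mkset (a_gr0 fs (gr_top n)) ?add0r//; exact: ss0.
  + exact: Sa fs d0 (St n).
  + by rewrite /mkset (_ : k = s - 1) ?(a_top n fs)//; lia.
move=> s f k y fs d0 [Sy Ty]; split=> [|g l]; first exact: Sa fs d0 Sy.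
have /evt_ex [J ->] := a_com g l f k.
apply: (ssD sS); [exact: Sa fs d0 (Ty _ _)|by apply: (ss_sum sS) => i _; apply: (ssZ sS); exact: Ty].
Qed.

(** The associator is homogeneous, and [E] is supported in degree $0$. *)
Lemma assoc_grade s s' t f g p x : wt_space s f -> wt_space s' g -> gr t x ->
  t%:Z + s + s' - p - 1 != 0 -> E (borch act (-1) 0 p f g x) = 0.
Proof.
move=> fs gs' Gx d0; have /evt_ex [J ->] := assocE rX p f g x.
have K0 f' k t' x' s1 : wt_space s1 f' -> gr t' x' -> t'%:Z + (s1 - k - 1) != 0 ->
    E (act f' k x') = 0.
  move=> f's Gx' e; have [lt|le] := ltP (t'%:Z + (s1 - k - 1)) 0.
    by rewrite (a_gr0 f's Gx' lt) (lin0 E_lin).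
  apply: (E_gr (t := absz (t'%:Z + (s1 - k - 1)))); first by rewrite absz_eq0.
  by apply: (a_gr f's Gx'); rewrite gez0_abs.
have K2 f' g' k l s1 s2 : wt_space s1 f' -> wt_space s2 g' ->
    t%:Z + (s2 - l - 1) + (s1 - k - 1) != 0 -> E (act f' k (act g' l x)) = 0.
  move=> f's g's e; have [lt|le] := ltP (t%:Z + (s2 - l - 1)) 0.
    by rewrite (a_gr0 g's Gx lt) (lin0 (a_linr _ _)) (lin0 E_lin).
  apply: (K0 _ _ (absz (t%:Z + (s2 - l - 1))) _ s1) => //; last by rewrite gez0_abs.
  by apply: (a_gr g's Gx); rewrite gez0_abs.
rewrite (linB E_lin) (linD E_lin) !(lin_sum E_lin) !big1 ?add0r.
- rewrite (K0 _ _ t _ (s + s' - -1 - 1)) ?oppr0//; first exact: wt_vprod.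
  by apply: contra d0 => /eqP e; apply/eqP; lia.
- move=> i _; apply: K2 gs' fs _; apply: contra d0 => /eqP e; apply/eqP; lia.
- move=> i _; apply: K2 fs gs' _; apply: contra d0 => /eqP e; apply/eqP; lia.
Qed.

(** On the top, the only component is the compatibility of the action with the
    product of the Zhu algebra. *)
Lemma assoc_top s s' f g n : wt_space s f -> wt_space s' g ->
  borch act (-1) 0 (s + s' - 1) f g (top n) = 0.
Proof.
move=> fs gs'; (* with these indices all terms of both sums but one have negative degree *)
have := evt_and (evt_le 1) (evt_and (borchN1E rX s (s' - 1) f g (top n)) (da_star fs gs')).
move/evt_ex => [[|J] [// _ [e D]]].
have -> : s + s' - 1 = s + (s' - 1) by lia.
rewrite -(assoc_shift rX mode_commutator s (s' - 1)) e big_ord_recl /=.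
have -> : s - 1 - 0%:Z = s - 1 by lia.
have -> : s' - 1 + 0%:Z = s' - 1 by lia.
rewrite big1 => [|i _]; last first.
  rewrite (a_gr0 gs' (gr_top n)) ?(lin0 (a_linr _ _))// /bump /=; lia.
rewrite [X in _ + X - _]big1 => [|i _]; last first.
  by rewrite (a_gr0 fs (gr_top n)) ?(lin0 (a_linr _ _))//; lia.
rewrite !addr0 (a_top n gs') (a_top _ fs) D (lin_sum top_lin); apply/eqP; rewrite subr_eq0; apply/eqP.
apply: eq_bigr => i _; rewrite (linZ top_lin); congr (_ *: _).
have w := wt_vprod (k := i%:Z - 1) fs gs'; rewrite -(a_top n w).
have -> : -1 + i%:Z = i%:Z - 1 by lia.
by have -> : s + s' - (i%:Z - 1) - 1 - 1 = s + (s' - 1) - i%:Z by lia.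
Qed.

(** A creation operator never reaches degree $0$, so by [assoc_adjoint] the claim
    propagates from the top to the whole module. *)
Lemma assoc_E f g p x : E (borch act (-1) 0 p f g x) = 0.
Proof.
have lB f' g' p' := lin_comp (borch_linr rX (-1) 0 p' f' g') E_lin.
suff : forall f g p, E (borch act (-1) 0 p f g x) = 0 by exact.
move: x; apply: (creation_ind
  (P := [set x | forall f g p, E (borch act (-1) 0 p f g x) = 0])).
- split=> [f' g' p'|a y y' Py Py' f' g' p']; first exact: (lin0 (lB _ _ _)).
  by have := lB f' g' p' a y y'; rewrite /= Py Py' scaler0 addr0.
- move=> n f' g' p'; move: f'; apply: (grade_ind (@wt_ds _ V)
    (sub_ker (lin_comp (borch_linl rX (-1) 0 p' g' (top n)) E_lin))) => s f' fs; rewrite /mkset /=; move: g'.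
  apply: (grade_ind (@wt_ds _ V)
    (sub_ker (lin_comp (borch_linm rX (-1) 0 p' f' (top n)) E_lin))) => s' g' gs'.
  rewrite /mkset /=; have [e|e] := eqVneq p' (s + s' - 1).
    by rewrite e assoc_top// (lin0 E_lin).
  apply: (assoc_grade fs gs' (gr_top n)); apply: contra e => /eqP e; apply/eqP; lia.
move=> s h k y hs d0 Py f' g' p'.
have Eh z : E (act h k z) = 0.
  move: z; apply: (gr_ind (sub_ker (lin_comp (a_linr h k) E_lin))) => t z Gz.
  by apply: E_gr (mode_nonneg_gr hs Gz _); [rewrite addn_eq0 absz_eq0; lia|lia].
have [J /(congr1 E)] := assoc_adjoint rX mode_commutator h k f' g' p' y.
rewrite Eh (linD E_lin) (lin_sum E_lin) big1 ?addr0 => [<- //|i _].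
by rewrite (linZ E_lin) (linD E_lin) !Py addr0 scaler0.
Qed.

(** The span of the associators is a submodule on which [E] vanishes, and the
    module has no such submodule but zero. *)
Lemma assoc_eq0 p f g x : borch act (-1) 0 p f g x = 0.
Proof.
pose S := span [set z | exists f g p x, z = borch act (-1) 0 p f g x].
have sS : is_subspace S := @span_ss _ _ _.
have SB f' g' p' x' : S (borch act (-1) 0 p' f' g' x').
  by apply: span_gen; exists f', g', p', x'.
apply: (a_sep sS _ _ (SB f g p x)).
  by apply: (span_sub (sub_ker E_lin)) => _ [f' [g' [p' [x' ->]]]]; exact: assoc_E.
move=> h k z; apply: (span_lin (a_linr h k) sS) => _ [f' [g' [p' [x' ->]]]].
have [J ->] := assoc_adjoint rX mode_commutator h k f' g' p' x'.
apply: (ssD sS) => //; apply: (ss_sum sS) => i _; apply: (ssZ sS).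
exact: (ssD sS).
Qed.

Lemma mode_borch l m n f g x : borch act l m n f g x = 0.
Proof. exact: (borch_all rX mode_commutator a_der assoc_eq0). Qed.

Lemma vtrans_vac : vtrans (vac V) = 0.
Proof. by rewrite -omg0 vprod_vacr. Qed.

(** $D \mathbf 1 = 0$ kills the modes other than $\mathbf 1_{-1}$; this one
    commutes with all modes and is the identity on the top. *)
Lemma mode_vac k x : act (vac V) k x = if k == -1 then x else 0.
Proof.
have [->|k1] := eqVneq k (-1); last first.
  have := a_der (vac V) (k + 1) x; rewrite vtrans_vac (lin0 (a_linl _ _)) addrK.
  move/esym/eqP; rewrite scaler_eq0 oppr_eq0 intr_eq0 => /orP[/eqP e|/eqP //].
  by move/eqP: k1; lia.
move: x; apply: (a_ind (sub_eq (a_linr _ _) (@lin_id _ _))).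
  by move=> n; have := a_top n (@wt_vac _ V); rewrite da_vac sub0r.
move=> f l y e; rewrite /mkset; have /evt_ex [J ->] := a_com (vac V) (-1) f l.
rewrite e big1 ?addr0// => i _; rewrite vprod_vacl.
by rewrite (_ : (i%:Z == -1) = false) ?(lin0 (a_linl _ _)) ?scaler0.
Qed.

Lemma mode_omg0 f k x :
  act (omg V) 0 (act f k x) = act f k (act (omg V) 0 x) - k%:~R *: act f (k - 1) x.
Proof.
have /evt_ex [[|J] [// _ ->]] := evt_and (evt_le 1) (a_com (omg V) 0 f k).
rewrite big_ord_recl big1 ?addr0 => [|i _]; last by rewrite zbin0S scale0r.
by rewrite zbin0 scale1r omg0 add0r a_der scaleNr.
Qed.

(** The commutator of $\omega_{1-j}$ and $\omega_{1-k}$ has four terms, given by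
    [vprod_omg]. *)
Lemma mode_virasoro k j x :
  act (omg V) (1 - j) (act (omg V) (1 - k) x) =
  act (omg V) (1 - k) (act (omg V) (1 - j) x)
  + ((k - j)%:~R *: act (omg V) (1 - (k + j)) x
     + (if k + j == 0 then (k ^+ 3 - k)%:~R / 12%:R * charge V else 0) *: x).
Proof.
have z3 : zb (1 - j) 3 * (charge V / 2%:R) = (j - j ^+ 3)%:~R / 12%:R * charge V.
  have e1 := zbinS K (1 - j) 1; have e2 := zbinS K (1 - j) 2.
  rewrite zbin1 in e1.
  have -> : zb (1 - j) 3 = (j - j ^+ 3)%:~R / 6%:R.
    apply: (mulfI (natS_neq0 K 2)); rewrite e2; apply: (mulfI (natS_neq0 K 1)).
    rewrite mulrCA e1 !(intrB, rmorphXn) /=.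
    by field.
  by field.
have /evt_ex [J [J4 ->]] := evt_and (evt_le 4) (a_com (omg V) (1 - j) (omg V) (1 - k)).
congr (_ + _).
rewrite (@sum_widen _ _ 4 J (fun i => zb (1 - j) i *:
  act (vp (omg V) i%:Z (omg V)) (1 - j + (1 - k) - i%:Z) x))//; last first.
  move=> [|[|[|[|i]]]] // _.
  by rewrite vprod_omg (lin0 (a_linl _ _)) scaler0.
rewrite !big_ord_recr big_ord0 /= add0r !vprod_omg /= zbin0 zbin1 scale1r.
rewrite (lin0 (a_linl _ _)) scaler0 addr0 a_der.
rewrite (linZ (a_linl _ _)) (linZ (a_linl _ _)) mode_vac.
rewrite (_ : 1 - j + (1 - k) - 0%:Z - 1 = 1 - (k + j)); last by lia.
rewrite (_ : 1 - j + (1 - k) - 1%:Z = 1 - (k + j)); last by lia.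
rewrite !scalerA z3 -scalerDl; congr (_ + _).
  congr (_ *: _); rewrite !(intrB, intrD) /=; ring.
have [e|ne] := eqVneq (k + j) 0; last first.
  rewrite ifF ?scaler0 ?scale0r//; apply/negP => /eqP e; move/eqP: ne; lia.
rewrite ifT; last by apply/eqP; lia.
congr (_%:~R / _ * _ *: _); rewrite (_ : k = - j); last by lia.
ring.
Qed.

End IrreducibleQuotient.

(** * The induced module and its irreducible quotient *)

Lemma flift_relation (K : numFieldType) (X : choiceType) (U : lmodType K)
    (F : X -> U) (c : K) p q r : F p = c *: F q + F r ->
  flift F (fgen K p - c *: fgen K q - fgen K r) = 0.
Proof.
move=> e; have lf := flift_linear F.
by rewrite !(linB lf) (linZ lf) !flift_gen e (addrC (c *: _)) addrK subrr.
Qed.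

Lemma flift_relation1 (K : numFieldType) (X : choiceType) (U : lmodType K)
    (F : X -> U) p q r : F p = F q + F r ->
  flift F (fgen K p - fgen K q - fgen K r) = 0.
Proof.
move=> e; have := @flift_relation K X U F 1 p q r; rewrite !scale1r; exact.
Qed.

Section EnvelopingAlgebra.
Variables (K : numFieldType) (V : gvoc K).
Local Notation D := (dualV V).
Local Notation H := (hatV V).
Local Notation hg := (@hgen K V).

Definition gen_bracket (x y b : H) : Prop :=
  exists f m g n, [/\ x = hg f m, y = hg g n & b = hbracket f m g n].

Definition elift (U : lmodType K) (F : seq H -> U) (b : env V) : U := flift F (rep b).

Let lc := @cls_lin _ _ (@env_rel K V).

Lemma eword_linear : word_linear (@eword K V).
Proof.
move=> u w a x y; apply/eqP; rewrite -subr_eq0 opprD addrA; apply/eqP.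
transitivity (cls (@env_rel K V) (fgen K (u ++ a *: x + y :: w)
    - a *: fgen K (u ++ x :: w) - fgen K (u ++ y :: w))).
  by rewrite !(linB lc) (linZ lc).
by apply/cls0P; apply: span_gen; left; exists u, w, a, x, y.
Qed.

Lemma eword_commutes : word_commutes gen_bracket (@eword K V).
Proof.
move=> u w _ _ _ [f [m [g [n [-> -> ->]]]]].
apply/eqP; rewrite -subr_eq0 opprD addrA; apply/eqP.
transitivity (cls (@env_rel K V) (fgen K (u ++ hgen f m :: hgen g n :: w)
         - fgen K (u ++ hgen g n :: hgen f m :: w)
         - fgen K (u ++ hbracket f m g n :: w))); first by rewrite !(linB lc).
by apply/cls0P; apply: span_gen; right; exists u, w, f, g, m, n.
Qed.

Lemma env_ind (P : set (env V)) : is_subspace P -> (forall u, P (@eword K V u)) ->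
  forall b, P b.
Proof.
move=> sP Pw; apply: cls_ind => b; rewrite [b]malg_sum.
apply: (ss_sum (sub_preim lc sP)) => u _; apply: (ssZ (sub_preim lc sP)); exact: Pw.
Qed.

Section Lift.
Variables (U : lmodType K) (F : seq H -> U).
Hypotheses (Fl : word_linear F) (Fc : word_commutes gen_bracket F).

Let kill z : @env_rel K V z -> flift F z = 0.
Proof.
case=> [[u [w [a [x [y ->]]]]]|[u [w [f [g [m [n ->]]]]]]].
  by apply: flift_relation; exact: Fl.
by apply: flift_relation1; apply: Fc; exists f, m, g, n.
Qed.

Lemma elift_word u : elift F (eword u) = F u.
Proof. by rewrite /elift (qlift_cls (flift_linear F) kill) flift_gen. Qed.

Lemma elift_lin : linear (elift F).
Proof. exact: (qlift_lin (flift_linear F) kill). Qed.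

End Lift.
End EnvelopingAlgebra.

Section InducedFromDual.
Variables (K : numFieldType) (V : gvoc K) (M : ccomod V).
Local Notation D := (dualV V).
Local Notation H := (hatV V).
Local Notation N := (dualM M).
Local Notation hg := (@hgen K V).
Local Notation Y := (indM M).

(** A letter of degree $0$ acts through $A(V^\prime)$ and letters of negative
    degree act by zero. *)
Definition top_action (h : H) (n n' : N) : Prop :=
  (exists s f, [/\ wt_space s f, h = hg f (s - 1) & n' = dact f n]) \/
  (exists s k f, [/\ wt_space s f, s - k - 1 < 0, h = hg f k & n' = 0]).

Lemma ind_relE (z : tens (env V) N) : ind_rel z -> exists a h n n',
  top_action h n n' /\ z = tpure (emul a (eword [:: h])) n - tpure a n'.
Proof.
case=> [[a [s [f [mu [fs ->]]]]]|[a [s [k [f [mu [fs d0 ->]]]]]]].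
  by exists a, (hg f (s - 1)), mu, (dact f mu); split=> //; left; exists s, f.
exists a, (hg f k), mu, 0; split; first by right; exists s, k, f.
by apply/esym; rewrite (tpure0r N a); exact: subr0.
Qed.

Lemma top_action_rel (a : env V) h (n n' : N) : top_action h n n' ->
  ind_rel (tpure (emul a (eword [:: h])) n - tpure a n').
Proof.
case=> [[s [f [fs -> ->]]]|[s [k [f [fs d0 -> ->]]]]]; first by left; exists a, s, f, n.
right; exists a, s, k, f, n; split=> //; rewrite (tpure0r N a); exact: subr0.
Qed.

Let tl (U : lmodType K) (F : env V -> N -> U) (z : tens (env V) N) : U := tlift F z.
Let tm (f : env V -> env V) (z : tens (env V) N) := tmap f id z.

Let tm_lin f : linear f -> linear (tm f).
Proof. by move=> lf; exact: tmap_linear. Qed.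

Let tm_pure f b n : linear f -> tm f (tpure b n) = tpure (f b) n.
Proof. by move=> lf; exact: tmap_pure. Qed.

Definition hact (h : H) (x : Y) : Y := eact (eword [:: h]) x.
Definition wordM (u : seq H) (n : N) : Y := ipure (eword u) n.

Let G1 := @eword_linear K V.
Let G2 := @eword_commutes K V.
Let G3 := @env_ind K V.
Let G4 := @elift_word K V.
Let G5 := @elift_lin K V.
Let G6 := @tpure_linearl K (env V) N.
Let G7 := @tpure_linearr K (env V) N.
Let G8 := @tens_ind K (env V) N.

Lemma eact_pure a b n : eact a (ipure b n) = ipure (emul a b) n :> Y.
Proof. exact: (ia_pure G1 G2 G3 G4 G5 tm_lin tm_pure ind_relE top_action_rel). Qed.

Lemma eact_linr a : linear (@eact _ _ M a).
Proof. exact: (ia_linr G1 G2 G3 G4 G5 tm_lin tm_pure ind_relE top_action_rel). Qed.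

Lemma eact_word u x : eact (eword u) x = foldr hact x u :> Y.
Proof. exact: (ia_word G1 G2 G3 G4 G5 G6 G8 tm_lin tm_pure ind_relE top_action_rel). Qed.

Lemma eact_linl x : linear (fun a => eact a x : Y).
Proof. exact: (ia_linl G1 G2 G3 G4 G5 G6 G8 tm_lin tm_pure ind_relE top_action_rel). Qed.

Lemma ipure_linr a : linear (fun n => ipure a n : Y).
Proof. exact: (ip_linr G7). Qed.

Lemma indM_ind (P : set Y) : is_subspace P -> (forall u n, P (wordM u n)) -> forall x, P x.
Proof. exact: (ind_indP G3 G6 G8). Qed.

Lemma hact_linl x : linear (hact^~ x).
Proof. exact: (iact_linl G1 G2 G3 G4 G5 G6 G8 tm_lin tm_pure ind_relE top_action_rel). Qed.

Lemma hact_linr h : linear (hact h).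
Proof. exact: eact_linr. Qed.

Lemma hact_com x y b v : gen_bracket x y b ->
  hact x (hact y v) = hact y (hact x v) + hact b v.
Proof. exact: (iact_com G1 G2 G3 G4 G5 G6 G8 tm_lin tm_pure ind_relE top_action_rel). Qed.

Lemma hact_top h n n' : top_action h n n' -> hact h (wordM [::] n) = wordM [::] n'.
Proof. exact: (iact_top G1 G2 G3 G4 G5 tm_lin tm_pure ind_relE top_action_rel). Qed.

Lemma wordM_foldr u n : wordM u n = foldr hact (wordM [::] n) u.
Proof. exact: (ip_word G1 G2 G3 G4 G5 G6 G8 tm_lin tm_pure ind_relE top_action_rel). Qed.

Local Notation B1 := (@hg_lin K V).
Local Notation B2 := (@hg_vtrans K V).
Local Notation B3 := (@hat_ind K V).
Local Notation B4 := (@hlift_gen K V).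
Local Notation B5 := (@hlift_lin K V).

Definition hbrM : H -> H -> H := hbr hg (@hlift K V).
Definition hnegM : H -> H := hneg hg (@hlift K V).
Definition hzeroM : H -> N -> N := hzero (@hlift K V) (@dact K V M).
Definition vevM : seq H -> N -> N := vev hbrM hnegM hzeroM.

Let C1 : forall y, linear (hbrM^~ y) := hbr_linl B1 B2 B3 B4 B5.
Let C2 : forall x, linear (hbrM x) := hbr_linr B1 B2 B3 B4 B5.
Let C3 : forall x y, hbrM x y = - hbrM y x := hbr_anti B1 B2 B3 B4 B5.
Let C4 : forall x y z, hbrM x (hbrM y z) = hbrM (hbrM x y) z + hbrM y (hbrM x z) :=
  hbr_jacobi B1 B2 B3 B4 B5.
Let C5 : forall P : set H, is_subspace P ->
  (forall d x, hat_grade d x -> P x) -> forall x, P x := hdeg_ind B1 B3.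
Let C6 : forall d e x y, hat_grade d x -> hat_grade e y -> hat_grade (d + e) (hbrM x y) :=
  hdeg_br B1 B2 B3 B4 B5.
Let C7 : linear hnegM := hneg_lin B1 B2 B5.
Let C8 : forall d x, d < 0 -> hat_grade d x -> hnegM x = x := hneg_id B1 B2 B4 B5.
Let C9 : forall d x, 0 <= d -> hat_grade d x -> hnegM x = 0 := hneg_0 B1 B2 B4 B5.
Let A1 := @dact_linl K V M.
Let A2 := @dact_linr K V M.
Let A3 := @dact_vtrans K V M.
Let A4 := @dact_commutator K V M.
Let Z1 : forall n, linear (fun x => hzeroM x n) := hzero_linl B5 A1 A3.
Let Z2 : forall x, linear (hzeroM x) := hzero_linr B1 B3 B4 B5 A1 A2 A3.
Let Z3 : forall d x n, d != 0 -> hat_grade d x -> hzeroM x n = 0 :=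
  hzero_0 B4 B5 A1 A3.
Let Z4 : forall x y n, hat_grade 0 x -> hat_grade 0 y ->
  hzeroM x (hzeroM y n) = hzeroM y (hzeroM x n) + hzeroM (hbrM x y) n :=
  hzero_br B1 B2 B3 B4 B5 A1 A2 A3 A4.

Lemma hzeroM_gen s f k n : wt_space s f ->
  hzeroM (hg f k) n = if s == k + 1 then dact f n else 0.
Proof. exact: (hzero_gen B4 A1 A3). Qed.

Lemma hbrM_gen f m g n : hbrM (hg f m) (hg g n) = hbracket f m g n.
Proof. exact: (hbr_gen B1 B2 B3 B4 B5). Qed.

Let vevM_linr u : linear (vevM u) := vev_linear hbrM hnegM Z2 u.

Let vevM_linl n : word_linear (vevM^~ n).
Proof. by move=> u w; exact: (vev_lin C1 C2 C7 Z1 Z2 u w n). Qed.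

Let vevM_com n : word_commutes (@gen_bracket K V) (vevM^~ n).
Proof.
move=> u w _ _ _ [f [m [g [l [-> -> ->]]]]]; rewrite -hbrM_gen.
exact: (vev_commutator C1 C2 C3 C4 C5 C6 C7 C8 C9 Z1 Z2 Z3 Z4).
Qed.

Let vevM_top u h n n' : top_action h n n' -> vevM (rcons u h) n = vevM u n'.
Proof.
case=> [[s [f [fs -> ->]]]|[s [k [f [fs d0 -> ->]]]]].
  have G0 : hat_grade 0 (hg f (s - 1)).
    by apply: span_gen; exists s, f, (s - 1); split=> //; lia.
  have e : hzeroM (hg f (s - 1)) n = dact f n by rewrite (hzeroM_gen _ _ fs) ifT//; apply/eqP; lia.
  by rewrite -e; exact: (vev_rcons_zero C1 C2 C5 C6 C7 C8 C9 Z1 Z2 Z3 u n G0).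
have Gd : hat_grade (s - k - 1) (hg f k) by apply: span_gen; exists s, f, k.
transitivity (0 : N); first exact: (vev_rcons_neg C1 C2 C5 C6 C7 C8 C9 Z1 Z2 Z3 u n d0 Gd).
exact/esym/(lin0 (vevM_linr u)).
Qed.

(** The projection of the induced module onto its degree $0$ component. *)
Definition evM : Y -> N := ilift (@elift K V) tl vevM (rel := @ind_rel K V M).

Let TL1 (U : lmodType K) (F : env V -> N -> U) : (forall n, linear (F^~ n)) ->
  (forall b, linear (F b)) -> forall b n, tl F (tpure b n) = F b n.
Proof. exact: tlift_pure. Qed.

Let TL2 (U : lmodType K) (F : env V -> N -> U) : (forall n, linear (F^~ n)) ->
  (forall b, linear (F b)) -> linear (tl F).
Proof. exact: tlift_linear. Qed.

Lemma evM_lin : linear evM.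
Proof.
exact: (ilift_lin G1 G2 G3 G4 G5 TL1 TL2 ind_relE vevM_linr vevM_linl vevM_com vevM_top).
Qed.

Lemma evM_word u n : evM (wordM u n) = vevM u n.
Proof.
rewrite wordM_foldr.
exact: (ilift_word G1 G2 G3 G4 G5 G6 G8 TL1 TL2 tm_lin tm_pure ind_relE top_action_rel
  vevM_linr vevM_linl vevM_com vevM_top).
Qed.

Let Y1 := hact_linl.
Let Y2 := hact_linr.

Let Y3 x y v : hact x (hact y v) = hact y (hact x v) + hact (hbrM x y) v.
Proof.
move: x; apply: (B3 (sub_eq (Y1 (hact y v))
  (lin_add (lin_comp (Y1 v) (Y2 y)) (lin_comp (C1 y) (Y1 v))))) => f m.
move: y; apply: (B3 (sub_eq (lin_comp (Y1 v) (Y2 (hg f m)))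
  (lin_add (Y1 (hact (hg f m) v)) (lin_comp (C2 (hg f m)) (Y1 v))))) => g n.
rewrite /mkset /comp hbrM_gen; apply: hact_com; by exists f, m, g, n.
Qed.

Let Y4 h u n : wordM (h :: u) n = hact h (wordM u n).
Proof.
transitivity (foldr hact (wordM [::] n) (h :: u)); first exact: wordM_foldr.
exact/esym/(congr1 (hact h))/wordM_foldr.
Qed.

Let Y5 : linear (wordM [::]) := ipure_linr (eword [::]).

Let Y6 h n : hat_grade 0 h -> hact h (wordM [::] n) = wordM [::] (hzeroM h n).
Proof.
apply: (span_sub (sub_eq (Y1 (wordM [::] n)) (lin_comp (Z1 n) Y5))).
move=> _ [s [f [k [fs e ->]]]]; rewrite /mkset /comp (hzeroM_gen _ _ fs).
have -> : s == k + 1 by apply/eqP; lia.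
have ek : k = s - 1 by lia.
by subst k; apply: hact_top; left; exists s, f; exact: (And3 fs erefl erefl).
Qed.

Let Y7 d h n : d < 0 -> hat_grade d h -> hact h (wordM [::] n) = 0.
Proof.
move=> d0; apply: (span_sub (sub_ker (Y1 (wordM [::] n)))).
move=> _ [s [f [k [fs e ->]]]]; rewrite /mkset.
transitivity (wordM [::] (0 : N)); last exact: (lin0 Y5).
have d1 : s - k - 1 < 0 by rewrite e.
by apply: hact_top; right; exists s, k, f; exact: (And4 fs d1 erefl erefl).
Qed.

Let Y8 := @indM_ind.

Let E2 n : evM (wordM [::] n) = n. Proof. exact: evM_word. Qed.

Let E3 (hs : seq (H * int)) n : (forall h, h \in hs -> hat_grade h.2 h.1) ->
  \sum_(h <- hs) h.2 != 0 -> evM (wordM [seq h.1 | h <- hs] n) = 0.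
Proof.
move=> Ghs d0; rewrite evM_word.
exact: (vev_degree C1 C2 C6 C7 C8 C9 Z1 Z2 Z3 n Ghs d0).
Qed.

(** A functional vanishing in positive degrees factors through the projection to
    degree $0$, since there is nothing in negative degrees. *)
Lemma ind_radP y : @ind_rad K V M y <-> forall u, evM (foldr hact y u) = 0.
Proof.
split=> [ry u|y0 phi sphi phi0].
  apply: dualM_eq => m; rewrite -eact_word.
  have sc : scalar (fun x => subval (evM x) m).
    by move=> a x x'; rewrite evM_lin.
  have := ry _ sc _ (eword u); rewrite /= => ->//.
  move=> d d0 x Gx; have := @E_grade _ _ _ _ _ _ _ evM_lin E3 d x _ Gx.
  by move=> ->//; rewrite gt_eqF.
have P x : phi x = phi (wordM [::] (evM x)).
  move: x; apply: (word_grade_ind C5 Y1 Y2 Y4 Y8 (sub_eq (sc_lin sphi)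
    (lin_comp evM_lin (lin_comp Y5 (sc_lin sphi))))) => d x Gx.
  rewrite /mkset /comp; have [d0|d0|d0] := ltgtP d 0.
  - rewrite (word_grade_neg C6 Y2 Y3 Y4 Y5 Y6 Y7 d0 Gx).
    by rewrite (lin0 evM_lin) (lin0 Y5).
  - rewrite (phi0 d d0 x Gx) (@E_grade _ _ _ _ _ _ _ evM_lin E3 d x _ Gx) ?gt_eqF//.
    by rewrite (lin0 Y5) (lin0 (sc_lin sphi)).
  by rewrite d0 in Gx; have [n _ <-] := word_grade0 C6 Y2 Y3 Y4 Y5 Y6 Y7 Gx; rewrite E2.
move=> a; move: a; apply: (env_ind (sub_ker (lin_comp (eact_linl y) (sc_lin sphi)))) => u.
by rewrite /mkset /comp P eact_word y0 (lin0 Y5) (lin0 (sc_lin sphi)).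
Qed.

Local Notation X := (LM M).
Local Notation mode := (@LM_mode K V M).
Let R := ind_radP.

Definition LM_ev (x : X) : N := evM (rep x).

Lemma LM_modeE f k x : mode f k x = qact hact (hg f k) x.
Proof. by []. Qed.

Lemma LM_ev_lin : linear LM_ev. Proof. exact: (qE_lin evM_lin R). Qed.

Lemma LM_ev_top n : LM_ev (LM_top n) = n. Proof. exact: (qE_top evM_lin E2 R). Qed.

Lemma LM_top_lin : linear (@LM_top K V M). Proof. exact: (qtop_lin Y5). Qed.

Lemma LM_ev_grade t x : t != 0%N -> LM_grade t x -> LM_ev x = 0.
Proof. exact: (qE_grade evM_lin E3 R). Qed.

Lemma LM_mode_linl k x : linear (fun f => mode f k x).
Proof. exact: (lin_comp (B1 k) (qact_linl Y1 x)). Qed.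

Lemma LM_mode_linr f k : linear (mode f k).
Proof. exact: (qact_linr Y2 evM_lin R (hg f k)). Qed.

Lemma LM_mode_cls f k y : mode f k (cls _ y) = cls _ (hact (hg f k) y).
Proof. exact: (qact_cls Y2 evM_lin R (hg f k)). Qed.

Lemma LM_mode_com f m g n : evt (fun J => forall x, mode f m (mode g n x) =
  mode g n (mode f m x) +
  \sum_(i < J) zbin m i *: mode (vprod f i%:Z g) (m + n - i%:Z) x).
Proof.
apply: evt_mono (vprod_nat_evt f g) => J J0 x.
transitivity (mode g n (mode f m x) + qact hact (hbrM (hg f m) (hg g n)) x).
  exact: (qact_com Y2 Y3 evM_lin R).
congr (_ + _); rewrite hbrM_gen.
transitivity (qact hact (hb hg f m g n) x); first by [].
by rewrite (hbE B1 m n J0) (lin_sum (qact_linl Y1 x)); apply: eq_bigr => i _;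
  exact: (linZ (qact_linl Y1 x)).
Qed.

Lemma LM_mode_vtrans f k x : mode (vtrans f) k x = - k%:~R *: mode f (k - 1) x.
Proof.
transitivity (qact hact (- k%:~R *: hg f (k - 1)) x); last exact: (linZ (qact_linl Y1 x)).
by rewrite LM_modeE B2.
Qed.

Lemma LM_grade_act s f k (t t' : nat) x : wt_space s f -> LM_grade t x ->
  t%:Z + (s - k - 1) = t'%:Z -> LM_grade t' (mode f k x).
Proof.
move=> fs Gx e; have Gf : hat_grade (s - k - 1) (hg f k) by apply: span_gen; exists s, f, k.
exact: (qgrade_act Y2 Y4 evM_lin R e Gf Gx).
Qed.

Lemma LM_grade_act0 s f k (t : nat) x : wt_space s f -> LM_grade t x ->
  t%:Z + (s - k - 1) < 0 -> mode f k x = 0.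
Proof.
move=> fs Gx e; have Gf : hat_grade (s - k - 1) (hg f k) by apply: span_gen; exists s, f, k.
exact: (qgrade_act0 C6 Y2 Y3 Y4 Y5 Y6 Y7 evM_lin R e Gf Gx).
Qed.

Lemma LM_mode_top s f n : wt_space s f -> mode f (s - 1) (LM_top n) = LM_top (dact f n).
Proof.
move=> fs; have Gf : hat_grade 0 (hg f (s - 1)).
  by apply: span_gen; exists s, f, (s - 1); split=> //; lia.
transitivity (LM_top (hzeroM (hg f (s - 1)) n)); first exact: (qact_top0 Y2 Y6 evM_lin R n Gf).
by rewrite (hzeroM_gen _ _ fs) ifT//; apply/eqP; lia.
Qed.

Lemma LM_grade_ind (P : set X) : is_subspace P -> (forall t x, LM_grade t x -> P x) ->
  forall x, P x.
Proof. exact: (qgrade_ind C5 C6 Y1 Y2 Y3 Y4 Y5 Y6 Y7 Y8). Qed.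

Lemma LM_grade0P x : LM_grade 0 x <-> range (@LM_top K V M) x.
Proof. exact: (qgrade0P C6 Y2 Y3 Y4 Y5 Y6 Y7). Qed.

Lemma LM_ds : direct_sum (@LM_grade K V M).
Proof. exact: (qgrade_ds C5 C6 Y1 Y2 Y3 Y4 Y5 Y6 Y7 Y8 evM_lin E3 R). Qed.

Lemma LM_ind (P : set X) : is_subspace P -> (forall n, P (LM_top n)) ->
  (forall f k x, P x -> P (mode f k x)) -> forall x, P x.
Proof.
move=> sP Pt Pa; apply: (q_ind Y2 Y4 Y8 evM_lin R sP Pt) => h x Px.
move: h; apply: (B3 (sub_preim (qact_linl Y1 x) sP)) => f k; exact: Pa.
Qed.

Lemma LM_sep (S : set X) : is_subspace S -> (forall x, S x -> LM_ev x = 0) ->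
  (forall f k x, S x -> S (mode f k x)) -> forall x, S x -> x = 0.
Proof.
move=> sS S0 Sa x Sx; apply: (q_sep Y2 evM_lin R) => u; apply: S0.
elim: u => //= h u IH.
move: (foldr _ x u) IH => x' Sx'.
move: h; apply: (B3 (sub_preim (qact_linl Y1 x') sS)) => f k; exact: Sa.
Qed.

Lemma LM_grade_top n : LM_grade 0 (LM_top n : X).
Proof. by apply/LM_grade0P; exists n. Qed.

Definition LM_word (u : seq H) (n : N) : X := cls (@ind_rad K V M) (wordM u n).

Lemma LM_word_cons f k u n : LM_word (hg f k :: u) n = mode f k (LM_word u n).
Proof.
by apply/esym; apply: (etrans (LM_mode_cls _ _ _)); apply: congr1; apply/esym; exact: Y4.
Qed.

Lemma LM_ev_word u n : LM_ev (LM_word u n) = vevM u n.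
Proof. exact: (etrans (qE_cls evM_lin R _) (evM_word u n)). Qed.

Lemma LM_word_grade (hs : seq (H * int)) (d : int) n :
  (forall h, h \in hs -> hat_grade h.2 h.1) -> \sum_(h <- hs) h.2 = d ->
  if 0 <= d then LM_grade (absz d) (LM_word [seq h.1 | h <- hs] n)
  else LM_word [seq h.1 | h <- hs] n = 0.
Proof.
move=> Ghs e; have Gw : ind_grade d (wordM [seq h.1 | h <- hs] n).
  by apply: span_gen; exists hs, n.
have [d0|d0] := leP 0 d; first by exists (wordM [seq h.1 | h <- hs] n) => //; rewrite gez0_abs.
rewrite /LM_word (word_grade_neg C6 Y2 Y3 Y4 Y5 Y6 Y7 d0 Gw); exact: (lin0 (@cls_lin _ _ _)).
Qed.

(** The operators on the dual of $M$ that arise from words are transposes of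
    operators on $M$, because those of the coalgebra are. *)
Lemma vevM_transpose u m : exists m' : M, forall mu : N, subval (vevM u mu) m = subval mu m'.
Proof.
pose P := [set F : N -> N | forall m : M, exists m' : M,
  forall mu : N, subval (F mu) m = subval mu m'].
suff : P (vevM u) by exact.
have Padd (F F' : N -> N) : P F -> P F' -> P (fun n => F n + F' n).
  move=> PF PF' m1; have [a aP] := PF m1; have [b bP] := PF' m1.
  exists (a + b) => mu; rewrite (scD (dualM_sc mu)) -aP -bP; by [].
have P0 : P (fun=> 0).
  by move=> m1; exists 0 => mu; rewrite (sc0 (dualM_sc mu)).
apply: vev_closed => //.
- by move=> m1; exists m1.
- move=> F F' PF PF' m1; have [a aP] := PF m1; have [b bP] := PF' a.
  by exists b => mu; rewrite /= aP bP.
move=> x m1; pose Q := [set x : H | exists m' : M, forall mu : N,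
  subval (hzeroM x mu) m1 = subval mu m'].
have sQ : is_subspace Q.
  split=> [|c y y' [a aP] [b bP]].
    by exists 0 => mu; rewrite (lin0 (Z1 mu)) (sc0 (dualM_sc mu)).
  exists (c *: a + b) => mu; rewrite (Z1 mu) (dualM_sc mu) -aP -bP; by [].
suff : Q x by exact.
move: x; apply: (C5 sQ) => d; apply: (span_sub sQ) => _ [s [f [k [fs e ->]]]].
have [es|ne] := eqVneq s (k + 1).
  exists (tcontrl (subval f) (cc_coact m1)) => mu.
  rewrite (hzeroM_gen _ _ fs) es eqxx dactE; apply: tpairEl; [exact: rdual_sc|exact: dualM_sc].
exists 0 => mu; rewrite (hzeroM_gen _ _ fs) (negPf ne) (sc0 (dualM_sc mu)); by [].
Qed.

Lemma LM_restricted : restricted mode.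
Proof. exact: (mode_restricted LM_mode_linl LM_mode_linr LM_grade_act0 LM_grade_ind). Qed.

Lemma LM_borch l m n f g x : borch mode l m n f g x = 0.
Proof.
exact: (mode_borch LM_mode_linl LM_mode_linr LM_mode_com LM_mode_vtrans LM_grade_act
  LM_grade_act0 LM_mode_top LM_grade_ind LM_grade_top LM_top_lin LM_ind LM_sep LM_ev_lin
  LM_ev_grade (@dact_star K V M)).
Qed.

Lemma LM_mode_vac k x : mode (vac V) k x = if k == -1 then x else 0.
Proof.
exact: (mode_vac LM_mode_linl LM_mode_linr LM_mode_com LM_mode_vtrans LM_mode_top
  LM_ind (@dact_vac K V M)).
Qed.

Lemma LM_mode_omg0 f k x : mode (omg V) 0 (mode f k x) =
  mode f k (mode (omg V) 0 x) - k%:~R *: mode f (k - 1) x.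
Proof. exact: (mode_omg0 LM_mode_com LM_mode_vtrans). Qed.

Lemma LM_virasoro k j x :
  mode (omg V) (1 - j) (mode (omg V) (1 - k) x) =
  mode (omg V) (1 - k) (mode (omg V) (1 - j) x)
  + ((k - j)%:~R *: mode (omg V) (1 - (k + j)) x
     + (if k + j == 0 then (k ^+ 3 - k)%:~R / 12%:R * charge V else 0) *: x).
Proof.
exact: (mode_virasoro LM_mode_linl LM_mode_linr LM_mode_com LM_mode_vtrans LM_mode_top
  LM_ind (@dact_vac K V M)).
Qed.

End InducedFromDual.

(** * The comodule structure on the restricted dual *)

Section RestrictedDualComodule.
Variables (K : numFieldType) (V : gvoc K) (X : lmodType K).
Local Notation D := (dualV V).
Variables (gr : nat -> set X) (act : D -> int -> X -> X).
Hypotheses (ds : direct_sum gr)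
  (a_linl : forall k y, linear (fun f => act f k y))
  (a_linr : forall f k, linear (act f k))
  (a_gr : forall s f k (t t' : nat) x, wt_space s f -> gr t x ->
     t%:Z + (s - k - 1) = t'%:Z -> gr t' (act f k x))
  (a_gr0 : forall s f k (t : nat) x, wt_space s f -> gr t x ->
     t%:Z + (s - k - 1) < 0 -> act f k x = 0).
Local Notation XD := (rdual gr).
Local Notation ev := (fun y : X => fun phi : XD => subval phi y).

Definition rd_spec (k : int) (n : XD) : set (tens V XD) :=
  [set z | forall (f : D) y, tpair (subval f) (ev y) z = subval n (act f k y)].

Definition rd_coact (k : int) (n : XD) : tens V XD := xget 0 (rd_spec k n).

Lemma rd_bound (n : XD) : exists T : nat, forall t y, (T < t)%N -> gr t y -> subval n y = 0.
Proof.
have [r [_ r0]] := rdual_seq n; exists (\max_(t <- r) t)%N => t y Tt Gy.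
apply: (r0 t) => //; apply: contraL Tt => tr; rewrite -leqNgt.
exact: leq_bigmax_seq.
Qed.

(** Every component of the coaction is determined by finitely many weights:
    the operator $f_k$ with $f$ of high weight raises the degree too much, and
    weights are bounded below. *)
Lemma rd_act0 (n : XD) T s f k t y : (forall t y, (T < t)%N -> gr t y -> subval n y = 0) ->
  wt_space s f -> gr t y -> T%:Z < t%:Z + (s - k - 1) -> subval n (act f k y) = 0.
Proof.
move=> nT fs Gy lt.
apply: (nT (absz (t%:Z + (s - k - 1)))); first lia.
by apply: (a_gr fs Gy); rewrite gez0_abs//; lia.
Qed.

Definition rd_mode (f : D) (k : int) (n : XD) : XD :=
  mkrdual gr (fun y => subval n (act f k y)).

Lemma rd_modeE s f k n y : wt_space s f ->
  subval (rd_mode f k n) y = subval n (act f k y).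
Proof.
move=> fs; have [T nT] := rd_bound n; rewrite /rd_mode mkrdualE//.
apply: (@rfunctional_seq _ _ _ _ _ (iota 0 (absz (T%:Z - (s - k - 1))%R).+1)).
  by move=> a x x'; rewrite a_linr rdual_sc.
move=> t v; rewrite mem_iota => tr Gv; apply: (rd_act0 nT fs Gv); lia.
Qed.

(** Sum over the relevant weights of the tensors of a basis of $V_s$ with the
    transposed modes of the dual basis. *)
Lemma rd_spec_ex k n : exists z, rd_spec k n z.
Proof.
have [T nT] := rd_bound n; have [low lowP] := low_ex V.
(* from the lowest weight of [V] to the bound of [rd_act0] for $t = 0$ *)
pose r : seq int := [seq low + i%:Z | i <- iota 0 (absz (T%:Z + k + 1 - low)%R).+1].
have ur : uniq r by rewrite map_inj_uniq ?iota_uniq// => i j /addrI [].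
have notr s f t y : s \notin r -> wt_space s f -> gr t y -> subval n (act f k y) = 0.
  move=> sr fs Gy; have [slow|slow] := ltP s low.
    have -> : f = 0.
      apply: dual_ext => s' v Gv; have [e|ne] := eqVneq s' s.
        rewrite (lowP s' v _ Gv) ?e//.
        by rewrite (lin0 (sc_lin (rdual_sc f))).
      by rewrite (fs s' ne v Gv).
    by rewrite (lin0 (a_linl k y)) (lin0 (sc_lin (rdual_sc n))).
  apply: (rd_act0 nT fs Gy); have [//|le] := ltP; exfalso; move/negP: sr; apply.
  by apply/mapP; exists (absz (s - low)); rewrite ?mem_iota; lia.
have basis s : exists b : seq (D * V), (forall p, p \in b -> wt_space s p.1 /\ grade V s p.2) /\
    forall f, wt_space s f -> f = \sum_(p <- b) subval f p.2 *: p.1.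
  have [b [b1 b2 b3]] := dual_basis (grade_ss (dsV V) s) (gr_fin_dim (voc_graded V) s).
  pose F (p : (V -> K) * V) : D := mkrdual (@grade K V) (fun v => p.1 (gproj (@grade K V) s v)).
  have FE p v : p \in b -> subval (F p) v = p.1 (gproj (@grade K V) s v).
    move=> pb; rewrite mkrdualE//; apply: (@rfunctional_seq _ _ _ _ _ [:: s]).
      by move=> a x x'; rewrite (gproj_lin (dsV V)) b1.
    move=> s' x; rewrite inE => ss' Gx; rewrite (gproj_0 (dsV V) Gx)//.
    exact: (lin0 (sc_lin (b1 p pb))).
  exists [seq (F p, p.2) | p <- b]; split.
    move=> _ /mapP[p pb ->] /=; split; last exact: b2.
    move=> s' ss' x Gx; rewrite FE// (gproj_0 (dsV V) Gx)//.
    exact: (lin0 (sc_lin (b1 p pb))).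
  move=> f fs; rewrite big_map; apply: dual_ext => s' v Gv.
  rewrite rdual_sumE; have [e|ne] := eqVneq s' s; last first.
    rewrite (fs s' ne v Gv) big_seq big1// => p pb.
    rewrite -[_ *: _]addr0 rdual_linE (FE p v pb) (gproj_0 (dsV V) Gv)//.
    by rewrite (lin0 (sc_lin (b1 p pb))) mulr0 add0r.
  rewrite e in Gv; rewrite {1}(b3 v Gv) (sc_sum (rdual_sc f)).
  apply: eq_big_seq => p pb; rewrite (scZ (rdual_sc f)) /=.
  by rewrite -[RHS]/(subval f p.2 * subval (F p) v) (FE p v pb) (gproj_id (dsV V) Gv) mulrC.
have [b bP] := boolp.choice basis.
exists (\sum_(s <- r) \sum_(p <- b s) tpure p.2 (rd_mode p.1 k n)).
have ssf (f : D) y := tpair_scalar (rdual_sc f) (@rdual_ev_sc _ _ _ gr y).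
have lL y : linear (fun f : D => tpair (subval f) (ev y)
    (\sum_(s <- r) \sum_(p <- b s) tpure p.2 (rd_mode p.1 k n)) : K^o).
  move=> a f g; rewrite !(tpairEr _ (rdual_sc _) (@rdual_ev_sc _ _ _ gr y)).
  by rewrite rdual_linE.
have lR y : linear (fun f : D => subval n (act f k y) : K^o).
  by move=> a f g; rewrite (a_linl k y) (rdual_sc n).
move=> f y; move: f; apply: (grade_ext (W := K^o) (@wt_ds _ V) (lL y) (lR y)) => s f fs.
move: y; have lL' : linear (fun y => tpair (subval f) (ev y)
    (\sum_(s <- r) \sum_(p <- b s) tpure p.2 (rd_mode p.1 k n)) : K^o).
  move=> a y y'; rewrite !(tpairEl _ (rdual_sc f) (@rdual_ev_sc _ _ _ gr _)).
  exact: rdual_sc.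
have lR' : linear (fun y => subval n (act f k y) : K^o).
  by move=> a y y'; rewrite (a_linr f k) (rdual_sc n).
apply: (grade_ext (W := K^o) ds lL' lR') => t y Gy.
rewrite (sc_sum (ssf f y)).
have E s' : tpair (subval f) (ev y) (\sum_(p <- b s') tpure p.2 (rd_mode p.1 k n)) =
    if s' == s then subval n (act f k y) else 0.
  rewrite (sc_sum (ssf f y)); have [e|ne] := eqVneq s' s; last first.
    rewrite big_seq big1// => p /(bP s').1 [_ Gp].
    by rewrite (tpair_pure _ _ (rdual_sc f) (@rdual_ev_sc _ _ _ gr y)) (fs s' ne _ Gp) mul0r.
  rewrite e {2}((bP s).2 f fs) (lin_sum (a_linl k y)) (sc_sum (rdual_sc n)).
  apply: eq_big_seq => p /(bP s).1 [ps _].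
  rewrite (tpair_pure _ _ (rdual_sc f) (@rdual_ev_sc _ _ _ gr y)) (rd_modeE _ _ _ ps).
  by rewrite (linZ (a_linl k y)) (scZ (rdual_sc n)).
rewrite (eq_bigr _ (fun s' _ => E s')) -big_mkcond /=.
have [sr|sr] := boolP (s \in r).
  by rewrite -big_filter filter_pred1_uniq// big_seq1.
rewrite (notr _ _ _ _ sr fs Gy) big_seq_cond big1// => s' /andP[s'r /eqP e].
Qed.

Lemma rd_coactE k n (f : D) y :
  tpair (subval f) (ev y) (rd_coact k n) = subval n (act f k y).
Proof. by case: (rd_spec_ex k n) => z zP; move: f y; exact: (xgetI 0 zP). Qed.

Lemma rd_sep (n : XD) : (forall y, subval n y = 0) -> n = 0.
Proof. by move=> n0; apply: rdual_eq => y; rewrite n0. Qed.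

Lemma rd_pair_eq (z z' : tens V XD) :
  (forall (f : D) y, tpair (subval f) (ev y) z = tpair (subval f) (ev y) z') -> z = z'.
Proof. exact: (tens_pair_eq (@rdual_ev_sc _ _ _ gr) rd_sep). Qed.

Lemma rd_coact_lin k : linear (rd_coact k).
Proof.
move=> a n n'; apply: rd_pair_eq => f y.
rewrite (tpair_scalar (rdual_sc f) (@rdual_ev_sc _ _ _ gr y)) !rd_coactE; exact: rdual_linE.
Qed.

Lemma rd_coact_trunc n : exists N : int, forall k, k < N -> rd_coact k n = 0.
Proof.
have [T nT] := rd_bound n; have [low lowP] := low_ex V.
exists (low - 1 - T%:Z) => k kN; apply: rd_pair_eq => f y.
rewrite rd_coactE (lin0 (sc_lin (tpair_scalar (rdual_sc f) (@rdual_ev_sc _ _ _ gr y)))).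
have lR y' : linear (fun f : D => subval n (act f k y') : K^o).
  by move=> a g g'; rewrite (a_linl k y') (rdual_sc n).
move: f; apply: (grade_ind (@wt_ds _ V) (sub_ker (lR y))) => s f fs; rewrite /mkset.
have [slow|slow] := ltP s low.
  have -> : f = 0.
    apply: dual_ext => s' v Gv; have [e|ne] := eqVneq s' s.
      by rewrite (lowP s' v _ Gv) ?e// (lin0 (sc_lin (rdual_sc f))).
    by rewrite (fs s' ne v Gv).
  by rewrite (lin0 (a_linl k y)) (lin0 (sc_lin (rdual_sc n))).
have lR' : linear (fun y => subval n (act f k y) : K^o).
  by move=> a y1 y'; rewrite (a_linr f k) (rdual_sc n).
move: y; apply: (grade_ind ds (sub_ker lR')) => t y Gy.
by apply: (rd_act0 nT fs Gy); lia.
Qed.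

(** Components are detected by pairing with homogeneous functionals and
    vectors, where the statement is that modes are homogeneous. *)
Lemma rd_coact_degree k t n : rdual_grade t n ->
  tens_grade (@grade K V) Posz (@rdual_grade _ _ _ gr) (t%:Z + k + 1) (rd_coact k n).
Proof.
move=> nt; apply/(tens_gradeP _ (dsV V) (rdual_direct_sum ds)) => s r sr.
apply: rd_pair_eq => f y.
rewrite (lin0 (sc_lin (tpair_scalar (rdual_sc f) (@rdual_ev_sc _ _ _ gr y)))).
rewrite (tpair_tmap _ (rdual_sc f) (@rdual_ev_sc _ _ _ gr y) (gproj_lin (dsV V) s)
  (gproj_lin (rdual_direct_sum ds) r)).
have -> : (fun v => subval f (gproj (@grade K V) s v)) = subval (rcomp s f) :> (V -> K).
  by apply/funext => v; rewrite (rcompE (dsV V)).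
have -> : (fun w : XD => subval (gproj (@rdual_grade _ _ _ gr) r w) y) = ev (gproj gr r y).
  by apply/funext => w; rewrite (rdual_gprojE ds).
rewrite rd_coactE; have fs : wt_space s (rcomp s f) by exact: (rcomp_grade (dsV V)).
have Gy := gproj_in ds r y.
have [lt|le] := ltP (r%:Z + (s - k - 1)) 0.
  by rewrite (a_gr0 fs Gy lt) (lin0 (sc_lin (rdual_sc n))).
apply: (nt (absz (r%:Z + (s - k - 1)))).
  by apply: contra_neq sr => e; lia.
by apply: (a_gr fs Gy); rewrite gez0_abs.
Qed.

Hypotheses (rX : restricted act)
  (a_borch : forall l m n f g x, borch act l m n f g x = 0)
  (a_der : forall f k y, act (vtrans f) k y = - k%:~R *: act f (k - 1) y)
  (a_vac : forall k x, act (vac V) k x = if k == -1 then x else 0)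
  (a_omg0 : forall f k x, act (omg V) 0 (act f k x) =
     act f k (act (omg V) 0 x) - k%:~R *: act f (k - 1) x)
  (a_vir : forall k j x, act (omg V) (1 - j) (act (omg V) (1 - k) x) =
     act (omg V) (1 - k) (act (omg V) (1 - j) x)
     + ((k - j)%:~R *: act (omg V) (1 - (k + j)) x
     + (if k + j == 0 then (k ^+ 3 - k)%:~R / 12%:R * charge V else 0) *: x)).

Lemma rd_counit k n : tcontrl (@counit K V) (rd_coact k n) = if k == -1 then n else 0.
Proof.
apply: rdual_eq => y; rewrite -(tpairEl _ (@counit_sc _ V) (@rdual_ev_sc _ _ _ gr y)).
rewrite -vac_fun rd_coactE a_vac; case: ifP => // _.
exact: (lin0 (sc_lin (rdual_sc n))).
Qed.

Lemma rd_virE k n y : subval (vir (@rho K V) rd_coact k n) y = subval n (act (omg V) (1 - k) y).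
Proof.
rewrite /vir -(tpairEl _ (@rho_sc _ V) (@rdual_ev_sc _ _ _ gr y)).
by rewrite -omg_fun rd_coactE.
Qed.

Lemma rd_vir_lin k : linear (vir (@rho K V) rd_coact k).
Proof. by move=> a n n'; apply: rdual_eq => y; rewrite rdual_linE !rd_virE. Qed.

(** Each axiom is the transpose of an identity between modes, detected by the
    pairing with all $f \otimes y$. *)
Lemma rd_weak : is_weak_comodule (V := V) rd_coact.
Proof.
have sp (f : D) y := tpair_scalar (rdual_sc f) (@rdual_ev_sc _ _ _ gr y).
split.
- exact: rd_coact_lin.
- exact: rd_coact_trunc.
- exact: rd_counit.
- apply: (jacobi_of_borch (act := act) rd_coact_lin rd_coact_trunc rX (pr := ev)).
  + exact: rdual_ev_sc.
  + exact: rdual_sc.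
  + by move=> *; exact/esym/rd_coactE.
  + exact: rd_sep.
  + exact: a_borch.
- move=> k j n; apply: rdual_eq => y.
  have L := rd_virE.
  transitivity (subval (vir (@rho K V) rd_coact k (vir (@rho K V) rd_coact j n)) y
    - subval (vir (@rho K V) rd_coact j (vir (@rho K V) rd_coact k n)) y); first by [].
  transitivity ((k - j)%:~R * subval (vir (@rho K V) rd_coact (k + j) n) y
    + (if k + j == 0 then (k ^+ 3 - k)%:~R / 12%:R * charge V else 0) * subval n y);
    last by [].
  transitivity (subval n (act (omg V) (1 - j) (act (omg V) (1 - k) y))
    - subval n (act (omg V) (1 - k) (act (omg V) (1 - j) y)));
    first exact: (congr2 (fun u v => u - v) (etrans (L k _ y) (L j n _))
                  (etrans (L j _ y) (L k n _))).
  rewrite (L (k + j) n y).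
  rewrite a_vir (scD (rdual_sc n)) (scD (rdual_sc n)) !(scZ (rdual_sc n)).
  by rewrite addrC addKr.
- move=> k n; apply: rd_pair_eq => f y; rewrite (scZ (sp f y)) rd_coactE.
  rewrite (tpair_tmap _ (rdual_sc f) (@rdual_ev_sc _ _ _ gr y) (@vir_linear _ V 1) (@lin_id _ _)).
  have -> : (fun v => subval f (vir (@rho K V) (@comode K V) 1 v)) = subval (vtrans f) :> (V -> K).
    by apply/funext => v; rewrite vtransE.
  by rewrite rd_coactE a_der (scZ (rdual_sc n)).
move=> k n; apply: rd_pair_eq => f y.
rewrite (scZ (sp f y)) (scD (sp f y)) (scN (sp f y)) !rd_coactE rd_virE.
rewrite (tpair_tmap _ (rdual_sc f) (@rdual_ev_sc _ _ _ gr y) (@lin_id _ _) (rd_vir_lin 1)).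
have -> : (fun w : XD => subval (vir (@rho K V) rd_coact 1 w) y) = ev (act (omg V) 0 y).
  by apply/funext => w; rewrite rd_virE.
rewrite rd_coactE subrr a_omg0 (scD (rdual_sc n)) (scN (rdual_sc n)) (scZ (rdual_sc n)).
by rewrite mulNr addrAC subrr add0r.
Qed.

Definition rd_precomod : precomod V :=
  @Precomod K V XD rd_coact (fun t => @rdual_grade _ _ _ gr t).

Lemma rd_admissible : is_admissible rd_precomod.
Proof.
split; [exact: rd_weak|exact: rdual_direct_sum|].
by move=> k t n; exact: rd_coact_degree.
Qed.

End RestrictedDualComodule.

(** * Sub comodules and quotients *)

Section GradedMaps.
Variables (K : numFieldType) (I : choiceType) (U W : lmodType K).
Variables (G1 : I -> set U) (G2 : I -> set W) (psi : U -> W).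
Hypotheses (lpsi : linear psi) (gpsi : forall s x, G1 s x -> G2 s (psi x))
  (d1 : direct_sum G1) (d2 : direct_sum G2).

Lemma gproj_morph s x : psi (gproj G1 s x) = gproj G2 s (psi x).
Proof.
move: x; apply: (grade_ext d1 (lin_comp (gproj_lin d1 s) lpsi)
  (lin_comp lpsi (gproj_lin d2 s))) => r x Gx /=.
have [e|ne] := eqVneq r s.
  by rewrite -e (gproj_id d1 Gx) (gproj_id d2 (gpsi Gx)).
by rewrite (gproj_0 d1 Gx ne) (gproj_0 d2 (gpsi Gx) ne) (lin0 lpsi).
Qed.

End GradedMaps.

(** Commuting squares tensor to commuting squares. *)
Lemma tmap_square (K : numFieldType) (A A1 A2 A' B B1 B2 B' : lmodType K)
    (z : tens A B) (f : A -> A1) (f' : A1 -> A') (h : A -> A2) (h' : A2 -> A')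
    (g : B -> B1) (g' : B1 -> B') (i : B -> B2) (i' : B2 -> B') :
  linear f -> linear f' -> linear h -> linear h' ->
  linear g -> linear g' -> linear i -> linear i' ->
  (forall x, f' (f x) = h' (h x)) -> (forall y, g' (g y) = i' (i y)) ->
  tmap f' g' (tmap f g z) = tmap h' i' (tmap h i z).
Proof.
move=> lf lf' lh lh' lg lg' li li' e e'.
rewrite (tmap_comp z lf lf' lg lg') (tmap_comp z lh lh' li li').
have -> : f' \o f = h' \o h by apply/funext.
by have -> : g' \o g = i' \o i by apply/funext.
Qed.

Section Naturality.
Variables (K : numFieldType) (A B M1 M2 : lmodType K) (psi : M1 -> M2).
Hypothesis lpsi : linear psi.
Let l2 (C : lmodType K) : linear (tmap (@id C) psi) := tmap_linear (@lin_id _ C) lpsi.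

Lemma tmap3_pure a b c : tmap (@id A) (tmap (@id B) psi) (tpure a (tpure b c)) =
  tpure a (tpure b (psi c)).
Proof.
transitivity (tpure a (tmap (@id B) psi (tpure b c))).
  exact: (tmap_pure a (tpure b c) (@lin_id _ A) (@l2 B)).
by apply: congr1; exact: tmap_pure.
Qed.

End Naturality.

Section Naturality3.
Variables (K : numFieldType) (A B M1 M2 : lmodType K) (psi : M1 -> M2).
Hypothesis lpsi : linear psi.
Let l2 (C : lmodType K) : linear (tmap (@id C) psi) := tmap_linear (@lin_id _ C) lpsi.

Lemma tflip12_natural (z : tens A (tens B M1)) :
  tmap (@id B) (tmap (@id A) psi) (tflip12 z) = tflip12 (tmap (@id A) (tmap (@id B) psi) z).
Proof.
have la := tmap_linear (@lin_id _ A) (@l2 B); have lb := tmap_linear (@lin_id _ B) (@l2 A).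
move: z; apply: (tens3_ext (lin_comp (@tflip12_lin _ _ _ _) lb)
  (lin_comp la (@tflip12_lin _ _ _ _))) => a b c.
transitivity (tpure b (tpure a (psi c))).
  exact: (etrans (congr1 _ (tflip12_pure _ _ _)) (tmap3_pure lpsi _ _ _)).
exact/esym/(etrans (congr1 _ (tmap3_pure lpsi _ _ _)) (tflip12_pure _ _ _)).
Qed.

Lemma tassoc_natural (z : tens (tens A B) M1) :
  tmap (@id A) (tmap (@id B) psi) (tassoc z) = tassoc (tmap (@id (tens A B)) psi z).
Proof.
have la := tmap_linear (@lin_id _ A) (@l2 B).
move: z; apply: (tens3l_ext (lin_comp (@tassoc_lin _ _ _ _) la)
  (lin_comp (@l2 _) (@tassoc_lin _ _ _ _))) => a b c.
transitivity (tpure a (tpure b (psi c))).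
  exact: (etrans (congr1 _ (tassoc_pure _ _ _)) (tmap3_pure lpsi _ _ _)).
exact/esym/(etrans (congr1 _ (tmap_pure (tpure a b) c (@lin_id _ _) lpsi))
  (tassoc_pure _ _ _)).
Qed.

End Naturality3.

Lemma lin_jac_cut (K : numFieldType) (U W : lmodType K) (h : U -> W) N
    (c1 c2 c3 : nat -> K) (u1 u2 u3 : nat -> U) (w1 w2 w3 : nat -> W) : linear h ->
  (forall i, h (u1 i) = w1 i) -> (forall i, h (u2 i) = w2 i) -> (forall i, h (u3 i) = w3 i) ->
  h (\sum_(i < N) c1 i *: u1 i - \sum_(i < N) c2 i *: u2 i - \sum_(i < N) c3 i *: u3 i) =
  \sum_(i < N) c1 i *: w1 i - \sum_(i < N) c2 i *: w2 i - \sum_(i < N) c3 i *: w3 i.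
Proof.
move=> lh e1 e2 e3; rewrite !(linB lh) !(lin_sum lh).
by congr (_ - _ - _); apply: eq_bigr => i _; rewrite (linZ lh) ?e1 ?e2 ?e3.
Qed.

Section ComoduleMaps.
Variables (K : numFieldType) (V : gvoc K) (M1 M2 : lmodType K).
Variables (D1 : int -> M1 -> tens V M1) (D2 : int -> M2 -> tens V M2) (psi : M1 -> M2).
Hypotheses (lpsi : linear psi)
  (hpsi : forall k x, tmap id psi (D1 k x) = D2 k (psi x))
  (l1 : forall k, linear (D1 k)) (l2 : forall k, linear (D2 k)).

Let lid := @lin_id K V.
Let lt := tmap_linear lid lpsi.

Lemma tcontrl_morph f k x : scalar f -> psi (tcontrl f (D1 k x)) = tcontrl f (D2 k (psi x)).
Proof. by move=> sf; rewrite -hpsi (tcontrl_tmap _ sf lid lpsi). Qed.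

Lemma vir_morph k x : psi (vir (@rho K V) D1 k x) = vir (@rho K V) D2 k (psi x).
Proof. exact: tcontrl_morph (@rho_sc _ V). Qed.

Lemma vir_linear1 k : linear (vir (@rho K V) D1 k).
Proof. exact: (lin_comp (l1 _) (tcontrl_linear (@rho_sc _ V))). Qed.

Lemma vir_linear2 k : linear (vir (@rho K V) D2 k).
Proof. exact: (lin_comp (l2 _) (tcontrl_linear (@rho_sc _ V))). Qed.

Lemma der_morph (h : V -> V) (z : tens V M1) : linear h ->
  tmap id psi (tmap h id z) = tmap h id (tmap id psi z).
Proof. by move=> lh; apply: tmap_square. Qed.

Lemma vir_tmap_morph k z : tmap id psi (tmap id (vir (@rho K V) D1 k) z) =
  tmap id (vir (@rho K V) D2 k) (tmap id psi z) :> tens V M2.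
Proof.
apply: (tmap_square z lid lid lid lid (vir_linear1 k) lpsi lpsi (vir_linear2 k)) => // x.
exact: vir_morph.
Qed.

Let mode_morph k z : tmap id (tmap id psi) (tmap id (D1 k) z) =
  tmap id (D2 k) (tmap id psi z) :> tens V (tens V M2).
Proof. exact: (tmap_square z lid lid lid lid (l1 k) lt lpsi (l2 k) (fun=> erefl) (hpsi k)). Qed.

Let comode_morph k z : tmap id psi (tmap (@comode K V k) id z) =
  tmap (@comode K V k) id (tmap id psi z) :> tens (tens V V) M2.
Proof.
have lc := @comode_lin K V k.
exact: (tmap_square z lc (@lin_id _ _) lid lc (@lin_id _ _) lpsi lpsi (@lin_id _ _)).
Qed.

Lemma jac_cut_morph N l m n x :
  tmap id (tmap id psi) (jac_cut D1 N l m n x) = jac_cut D2 N l m n (psi x).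
Proof.
have l3 := tmap_linear lid lt.
have s1 i : tmap id (tmap id psi) (tmap id (D1 (n + i%:Z)) (D1 (m + l - i%:Z) x)) =
    tmap id (D2 (n + i%:Z)) (D2 (m + l - i%:Z) (psi x)).
  exact: (etrans (mode_morph _ _) (congr1 _ (hpsi _ _))).
have s2 i : tmap id (tmap id psi) (tflip12 (tmap id (D1 (m + i%:Z)) (D1 (n + l - i%:Z) x))) =
    tflip12 (tmap id (D2 (m + i%:Z)) (D2 (n + l - i%:Z) (psi x))).
  apply: (etrans (tflip12_natural lpsi _)); apply: congr1.
  exact: (etrans (mode_morph _ _) (congr1 _ (hpsi _ _))).
have s3 i : tmap id (tmap id psi)
      (tassoc (tmap (@comode K V (l + i%:Z)) id (D1 (m + n - i%:Z) x))) =
    tassoc (tmap (@comode K V (l + i%:Z)) id (D2 (m + n - i%:Z) (psi x))).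
  apply: (etrans (tassoc_natural lpsi _)); apply: congr1.
  exact: (etrans (comode_morph _ _) (congr1 _ (hpsi _ _))).
exact: (@lin_jac_cut K _ _ _ N (fun i => (-1) ^+ i * zbin l i)
  (fun i => (-1) ^ (l + i%:Z) * zbin l i) (fun i => zbin m i) _ _ _ _ _ _ l3 s1 s2 s3).
Qed.

End ComoduleMaps.

Section Transfer.
Variables (K : numFieldType) (V : gvoc K) (N1 N2 : precomod V) (psi : N1 -> N2).
Hypothesis hom : is_comod_hom psi.
Let lpsi : linear psi. Proof. by case: hom. Qed.
Let hpsi : forall k x, tmap id psi (pc_mode k x) = pc_mode k (psi x).
Proof. by case: hom. Qed.
Let lt := tmap_linear (@lin_id _ V) lpsi.

(** Every axiom is an equality that an injective map of comodules reflects. *)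
Lemma weak_of_injective : injective psi -> is_weak_comodule (@pc_mode _ _ N2) ->
  is_weak_comodule (@pc_mode _ _ N1).
Proof.
move=> inj [w1 w2 w3 w4 w5 w6 w7].
have tinj := tmap_inj lpsi inj (V := V).
have l1 k : linear (@pc_mode _ _ N1 k).
  by move=> a x y; apply: tinj; rewrite lt !hpsi lpsi w1.
have tr1 x : exists N : int, forall k, k < N -> @pc_mode _ _ N1 k x = 0.
  have [N HN] := w2 (psi x); exists N => k kN; apply: tinj.
  by rewrite hpsi HN// (lin0 lt).
split=> //.
- move=> k x; apply: inj; rewrite (tcontrl_morph lpsi hpsi _ _ (@counit_sc _ V)) w3.
  by case: ifP => // _; rewrite (lin0 lpsi).
- move=> x; apply/(jac_cutP l1 tr1) => l m n.
  have /(jac_cutP w1 w2)/(_ l m n) := w4 (psi x); apply: evt_mono => N.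
  rewrite -(jac_cut_morph lpsi hpsi l1 w1) => e.
  apply: (tmap_inj lt tinj); rewrite e.
  by rewrite (lin0 (tmap_linear (@lin_id _ V) lt)).
- move=> k j x; apply: inj; rewrite (linB lpsi) (linD lpsi) !(linZ lpsi).
  by rewrite !(vir_morph lpsi hpsi); exact: w5.
- move=> k x; apply: tinj; rewrite (der_morph lpsi _ (@vir_linear _ V 1)) hpsi w6.
  by rewrite (linZ lt) hpsi.
move=> k x; apply: tinj.
rewrite (linZ lt) (linB lt) !hpsi w7 (vir_morph lpsi hpsi).
by rewrite (vir_tmap_morph lpsi hpsi l1 w1) hpsi.
Qed.

Lemma weak_of_surjective : (forall y, exists x, psi x = y) ->
  is_weak_comodule (@pc_mode _ _ N1) -> is_weak_comodule (@pc_mode _ _ N2).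
Proof.
move=> surj [w1 w2 w3 w4 w5 w6 w7].
have l2 k : linear (@pc_mode _ _ N2 k).
  move=> a y y'; have [x <-] := surj y; have [x' <-] := surj y'.
  by rewrite -lpsi -!hpsi w1 lt.
have tr2 y : exists N : int, forall k, k < N -> @pc_mode _ _ N2 k y = 0.
  have [x <-] := surj y; have [N HN] := w2 x; exists N => k kN.
  by rewrite -hpsi HN// (lin0 lt).
split=> //.
- move=> k y; have [x <-] := surj y.
  rewrite -(tcontrl_morph lpsi hpsi _ _ (@counit_sc _ V)) w3.
  by case: ifP => // _; rewrite (lin0 lpsi).
- move=> y; have [x <-] := surj y; apply/(jac_cutP l2 tr2) => l m n.
  have /(jac_cutP w1 w2)/(_ l m n) := w4 x; apply: evt_mono => N e.
  rewrite -(jac_cut_morph lpsi hpsi w1 l2) e.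
  by rewrite (lin0 (tmap_linear (@lin_id _ V) lt)).
- move=> k j y; have [x <-] := surj y; rewrite -!(vir_morph lpsi hpsi).
  rewrite -(linB lpsi) w5 (linD lpsi) !(linZ lpsi); congr (_ + _).
- move=> k y; have [x <-] := surj y.
  by rewrite -!hpsi -(der_morph lpsi _ (@vir_linear _ V 1)) w6 (linZ lt).
move=> k y; have [x <-] := surj y.
rewrite -(vir_morph lpsi hpsi) -!hpsi -(vir_tmap_morph lpsi hpsi w1 l2).
by rewrite -(linB lt) -(linZ lt) w7.
Qed.

(** The hypothesis on projections says that the image is a graded subspace. *)
Lemma admissible_of_injective : injective psi -> is_admissible N2 ->
  (forall t, pc_grade t = [set x | pc_grade t (psi x)]) ->
  (forall t x, exists x', psi x' = gproj (@pc_grade _ _ N2) t (psi x)) ->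
  is_admissible N1.
Proof.
move=> inj [w ds deg] gE gcl.
have gE' t x : @pc_grade _ _ N1 t x -> pc_grade t (psi x) by rewrite gE.
have d1 : direct_sum (@pc_grade _ _ N1).
  apply: (direct_sum_sep (W := N2)
    (Phi := fun t => [set fun x => gproj (@pc_grade _ _ N2) t (psi x)])).
  - by move=> t; rewrite gE; exact: sub_preim lpsi (grade_ss ds t).
  - move=> v; have [r [ur _ e]] := gproj_seq ds (psi v).
    have [g gP] := boolp.choice (fun t => gcl t v).
    have -> : v = \sum_(t <- r) g t.
      by apply: inj; rewrite e (lin_sum lpsi); apply: eq_bigr => t _; rewrite gP.
    apply: (ss_sum (@span_ss _ _ _)) => t _; apply: span_gen; exists t => //.
    by rewrite gE /= gP; exact: gproj_in.
  - move=> t _ ->; split; first exact: (lin_comp lpsi (gproj_lin ds t)).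
    by move=> r v rt /gE' Gv; exact: gproj_0 ds _ _ _ Gv rt.
  move=> t v /gE' Gv /(_ _ erefl); rewrite (gproj_id ds Gv) => v0.
  by apply: inj; rewrite v0 (lin0 lpsi).
have w1 := weak_of_injective inj w.
split=> // k t x /gE' Gx.
apply/(tens_gradeP _ (dsV V) d1) => s r sr; apply: (tmap_inj lpsi inj).
rewrite (lin0 lt) (@tmap_comp _ _ _ _ _ _ _ _ _ _ _ _ (gproj_lin (dsV V) s) (@lin_id _ _)
  (gproj_lin d1 r) lpsi).
have -> : psi \o gproj (@pc_grade _ _ N1) r = gproj (@pc_grade _ _ N2) r \o psi.
  by apply/funext => y /=; exact: (gproj_morph lpsi gE' d1 ds).
have := (tens_gradeP _ (dsV V) ds _ _).1 (deg k t (psi x) Gx) s r sr.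
rewrite -hpsi (@tmap_comp _ _ _ _ _ _ _ _ _ _ _ _ (@lin_id _ _) (gproj_lin (dsV V) s)
  lpsi (gproj_lin ds r)); exact.
Qed.

(** The projections descend because the kernel is graded. *)
Lemma admissible_of_surjective : (forall y, exists x, psi x = y) -> is_admissible N1 ->
  (forall t, pc_grade t = psi @` pc_grade t) ->
  (forall t x, psi x = 0 -> psi (gproj (@pc_grade _ _ N1) t x) = 0) ->
  is_admissible N2.
Proof.
move=> surj [w ds deg] gE kgr.
have [sec secP] := boolp.choice surj.
pose Q t y := psi (gproj (@pc_grade _ _ N1) t (sec y)).
have lP t := lin_comp (gproj_lin ds t) lpsi.
have QE t x : Q t (psi x) = psi (gproj (@pc_grade _ _ N1) t x).
  apply/eqP; rewrite -subr_eq0 -(linB (lP t)); apply/eqP; apply: kgr.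
  by rewrite (linB lpsi) secP subrr.
have lQ t : linear (Q t).
  by move=> a y y'; rewrite -[y]secP -[y']secP -lpsi !QE; exact: lP.
have d2 : direct_sum (@pc_grade _ _ N2).
  apply: (direct_sum_sep (W := N2) (Phi := fun t => [set Q t])).
  - by move=> t; rewrite gE; exact: sub_im lpsi (grade_ss ds t).
  - move=> v; rewrite -[v]secP; have [r [ur _ ->]] := gproj_seq ds (sec v).
    rewrite (lin_sum lpsi); apply: (ss_sum (@span_ss _ _ _)) => t _; apply: span_gen.
    exists t => //; rewrite gE; exists (gproj (@pc_grade _ _ N1) t (sec v)) => //.
    exact: gproj_in.
  - move=> t _ ->; split=> // r v rt; rewrite gE => -[x Gx <-].
    by rewrite QE (gproj_0 ds Gx rt) (lin0 lpsi).
  move=> t v; rewrite gE => -[x Gx <-] /(_ _ erefl).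
  by rewrite QE (gproj_id ds Gx).
split=> //; first exact: weak_of_surjective.
move=> k t y; rewrite {1}gE => -[x Gx <-]; rewrite -hpsi.
apply: (span_lin lt (@span_ss _ _ _)) (deg k t x Gx) => _ [s [v [z [Gv Gz ->]]]].
rewrite (tmap_pure _ _ (@lin_id _ V) lpsi); apply: span_gen; exists s, v, (psi z).
by split=> //; rewrite gE; exists z.
Qed.

End Transfer.

Section SubComodules.
Variables (K : numFieldType) (V : gvoc K) (N : precomod V).
Hypothesis aN : is_admissible N.
Local Notation D := (dualV V).
Local Notation gr := (@pc_grade K V N).
Local Notation md := (@pc_mode K V N).

(** Sub comodules, in terms of the operators on [N] given by the functionals. *)
Definition stable (A : set N) : Prop :=
  [/\ is_subspace A,
      forall (f : D) k x, A x -> A (tcontrl (subval f) (md k x)) &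
      forall t x, A x -> A (gproj gr t x)].

Let dN : direct_sum gr. Proof. by case: aN. Qed.
Let wN : is_weak_comodule md. Proof. by case: aN. Qed.

Lemma stable_ss A : stable A -> is_subspace A. Proof. by case. Qed.

Lemma stable_tsub A k x : stable A -> A x -> tsub setT A (md k x).
Proof.
by move=> [sA cA _] Ax; apply/(tsubT_dual _ sA) => f; exact: cA.
Qed.

Lemma sub_mode A k (x : subsp A) : stable A ->
  tmap id (@subval _ _ A) (@pc_mode _ _ (sub_precomod A) k x) = md k (subval x).
Proof.
move=> sA; have [y yP] := tmap_subval_ex (stable_ss sA)
  (stable_tsub k sA (subvalA x (stable_ss sA))).
exact: (xgetI 0 (yP : [set y | tmap id (@subval _ _ A) y = md k (subval x)] y)).
Qed.

Lemma subval_hom A : stable A -> @is_comod_hom K V (sub_precomod A) N (@subval _ _ A).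
Proof. by move=> sA; split=> // k x; exact: sub_mode. Qed.

Lemma sub_admissible A : stable A -> is_admissible (sub_precomod A).
Proof.
move=> sA; apply: (admissible_of_injective (subval_hom sA) (@subval_inj _ _ A) aN) => //.
move=> t x; have [ss _ gA] := sA; exists (tosub A (gproj gr t (subval x))).
rewrite tosubK// span_id//; apply: gA; exact: subvalA.
Qed.

(** The axioms of a sub comodule reduce to stability under the coaction and
    under the projections, since all the others are inherited. *)
Lemma admissible_subP A : is_admissible_sub A <-> stable A.
Proof.
split=> [[sA cA aA]|sA]; last first.
  by split; [exact: stable_ss|move=> k x; exact: stable_tsub|exact: sub_admissible].
split=> // [f k x Ax|t x Ax]; first exact: ((tsubT_dual _ sA).1 (cA k x Ax)).
have [_ dA _] := aA.
have gs : forall s (y : subsp A), @pc_grade _ _ (sub_precomod A) s y -> gr s (subval y) by [].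
have := gproj_morph (@subval_lin _ _ A) gs dA dN t (tosub A x).
rewrite tosubK ?span_id// => <-; exact: subvalA.
Qed.

Lemma stable_bigcap (F : set (set N)) : (forall A, F A -> stable A) ->
  stable (\bigcap_(A in F) A).
Proof.
move=> HF; split.
- by apply: sub_bigcap => A /HF [].
- by move=> f k x Ax A FA; have [_ cA _] := HF A FA; apply: cA; exact: Ax.
- by move=> t x Ax A FA; have [_ _ gA] := HF A FA; apply: gA; exact: Ax.
Qed.

Lemma stable_smallest (S : set N) : stable (smallest (@is_admissible_sub K V N) S).
Proof. by apply: stable_bigcap => A [/admissible_subP]. Qed.

Lemma stable_span (F : set (set N)) : (forall A, F A -> stable A) ->
  stable (span (\bigcup_(A in F) A)).
Proof.
move=> HF; have ss := @span_ss _ _ (\bigcup_(A in F) A); split=> //.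
- move=> f k; apply: (span_lin (lin_comp (wc_linear wN k) (tcontrl_linear (rdual_sc f))) ss).
  move=> x [A FA Ax]; apply: span_gen; exists A => //.
  by have [_ cA _] := HF A FA; exact: cA.
- move=> t; apply: (span_lin (gproj_lin dN t) ss) => x [A FA Ax].
  apply: span_gen; exists A => //; by have [_ _ gA] := HF A FA; exact: gA.
Qed.

Lemma stable_tmap0 A k x : stable A -> A x -> tmap id (cls A) (md k x) = 0.
Proof. by move=> sA Ax; apply/(tmap_cls_eq0 _ (stable_ss sA)); exact: stable_tsub. Qed.

Lemma cls_hom A : stable A -> @is_comod_hom K V N (quot_precomod A) (cls A).
Proof.
move=> sA; split=> [|k x]; first exact: cls_lin.
have l := lin_comp (wc_linear wN k) (tmap_linear (@lin_id _ V) (@cls_lin _ _ A)).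
by apply/esym; exact: (qlift_cls l (fun x => stable_tmap0 k sA)).
Qed.

Lemma cls_kernel (A : set N) x : is_subspace A -> cls A x = 0 <-> A x.
Proof. by move=> sA; rewrite cls0P span_id. Qed.

Lemma quot_admissible A : stable A -> is_admissible (quot_precomod A).
Proof.
move=> sA; apply: (admissible_of_surjective (cls_hom sA) _ aN) => //.
  by move=> y; exists (rep y); exact: repK.
have [ss _ gA] := sA.
by move=> t x /(cls_kernel _ ss) Ax; apply/(cls_kernel _ ss); exact: gA.
Qed.

End SubComodules.

Section StableMaps.
Variables (K : numFieldType) (V : gvoc K) (N1 N2 : precomod V) (psi : N1 -> N2).
Hypotheses (a1 : is_admissible N1) (a2 : is_admissible N2) (hom : is_comod_hom psi)
  (gpsi : forall t x, pc_grade t x -> pc_grade t (psi x)).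

Let lpsi : linear psi. Proof. by case: hom. Qed.
Let hpsi : forall k x, tmap id psi (pc_mode k x) = pc_mode k (psi x).
Proof. by case: hom. Qed.
Let pp t x : psi (gproj (@pc_grade _ _ N1) t x) = gproj (@pc_grade _ _ N2) t (psi x).
Proof. by case: a1 => _ d1 _; case: a2 => _ d2 _; exact: gproj_morph. Qed.

Lemma stable_preim A : stable A -> stable [set x | A (psi x)].
Proof.
move=> [sA cA gA]; split; first exact: sub_preim.
- move=> f k x /= Ax; rewrite (tcontrl_morph lpsi hpsi _ _ (rdual_sc f)); exact: cA.
- by move=> t x /= Ax; rewrite pp; exact: gA.
Qed.

Lemma stable_im A : stable A -> stable (psi @` A).
Proof.
move=> [sA cA gA]; split; first exact: sub_im.
- move=> f k _ [x Ax <-]; rewrite -(tcontrl_morph lpsi hpsi _ _ (rdual_sc f)).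
  by exists (tcontrl (subval f) (pc_mode k x)) => //; exact: cA.
- by move=> t _ [x Ax <-]; rewrite -pp; exists (gproj (@pc_grade _ _ N1) t x) => //; exact: gA.
Qed.

End StableMaps.

(** * The comodules generated by a comodule over the Zhu coalgebra *)

Section HomProjections.
Variables (K : numFieldType) (V : gvoc K) (N1 N2 : precomod V) (psi : N1 -> N2).
Hypotheses (d1 : direct_sum (@pc_grade _ _ N1)) (d2 : direct_sum (@pc_grade _ _ N2))
  (lpsi : linear psi) (gpsi : forall t x, pc_grade t x -> pc_grade t (psi x)).

Lemma bihomogeneous_morph s t (z : tens V N1) :
  tmap id psi (tmap (gproj (@grade K V) s) (gproj (@pc_grade _ _ N1) t) z) =
  tmap (gproj (@grade K V) s) (gproj (@pc_grade _ _ N2) t) (tmap id psi z).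
Proof.
have lp := gproj_lin (dsV V) s; have lid := @lin_id K V.
exact: (tmap_square z lp lid lid lp (gproj_lin d1 t) lpsi lpsi (gproj_lin d2 t)
  (fun=> erefl) (gproj_morph lpsi gpsi d1 d2 t)).
Qed.

End HomProjections.

Section Functor.
Variables (K : numFieldType) (V : gvoc K) (M : ccomod V).
Local Notation D := (dualV V).
Local Notation N := (dualM M).
Local Notation X := (LM M).
Local Notation XD := (LMd M).
Local Notation P := (LMd_precomod M).
Local Notation ev := (fun y : X => fun phi : XD => subval phi y).

Lemma LMd_coactE k (n : XD) (f : D) y :
  tpair (subval f) (ev y) (@pc_mode _ _ P k n) = subval n (LM_mode f k y).
Proof.
have e := rd_coactE (@LM_ds K V M) (@LM_mode_linl K V M) (@LM_mode_linr K V M)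
  (@LM_grade_act K V M).
exact: (e k n f y).
Qed.

Lemma LMd_admissible : is_admissible P.
Proof.
exact: (rd_admissible (@LM_ds K V M) (@LM_mode_linl K V M) (@LM_mode_linr K V M)
  (@LM_grade_act K V M) (@LM_grade_act0 K V M) (@LM_restricted K V M) (@LM_borch K V M)
  (@LM_mode_vtrans K V M) (@LM_mode_vac K V M) (@LM_mode_omg0 K V M) (@LM_virasoro K V M)).
Qed.

Let aP := LMd_admissible.
Let dP : direct_sum (@pc_grade _ _ P). Proof. by case: aP. Qed.
Lemma LMd_transposeE (f : D) k (n : XD) y :
  subval (tcontrl (subval f) (@pc_mode _ _ P k n)) y = subval n (LM_mode f k y).
Proof. by rewrite -LMd_coactE tpairEl; [|exact: rdual_sc|exact: rdual_ev_sc]. Qed.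

Lemma M_emb_fun (m : M) : rfunctional (@LM_grade K V M)
  ((fun x : X => subval (LM_ev x) m) : X -> K^o).
Proof.
apply: (@rfunctional_seq _ _ _ _ _ [:: 0%N]).
  by move=> a x y; rewrite LM_ev_lin.
move=> t v; rewrite inE => t0 Gv; rewrite (LM_ev_grade t0 Gv); by [].
Qed.

Lemma M_emb_specE (m : M) (phi : XD) : M_emb_spec m phi ->
  forall x, subval phi x = subval (LM_ev x) m.
Proof.
move=> [phi0 phig]; apply: (grade_ext (W := K^o) (@LM_ds K V M)).
- exact: rdual_sc.
- by move=> a x y; rewrite LM_ev_lin.
move=> t x Gx; have [t0|t0] := eqVneq t 0%N.
  by rewrite t0 in Gx; have [mu _ <-] := (LM_grade0P x).1 Gx; rewrite phi0 LM_ev_top.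
by rewrite (phig t t0 x Gx) (LM_ev_grade t0 Gx).
Qed.

Lemma M_emb_ex (m : M) : exists phi, M_emb_spec m phi.
Proof.
exists (mkrdual (@LM_grade K V M) (fun x => subval (LM_ev x) m)); split.
  by move=> mu; rewrite mkrdualE ?LM_ev_top//; exact: M_emb_fun.
move=> t t0 x Gx; rewrite mkrdualE; last exact: M_emb_fun.
by rewrite (LM_ev_grade t0 Gx).
Qed.

Lemma M_embP (m : M) : M_emb_spec m (M_emb m).
Proof. by have [phi phiP] := M_emb_ex m; exact: (xgetI 0 phiP). Qed.

Lemma M_embE (m : M) x : subval (M_emb m) x = subval (LM_ev x) m.
Proof. exact: (M_emb_specE (M_embP m)). Qed.

Lemma M_emb_uniq (m : M) phi : M_emb_spec m phi -> phi = M_emb m.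
Proof. by move=> s; apply: rdual_eq => x; rewrite M_embE; exact: M_emb_specE. Qed.

Lemma M_emb_lin : linear (@M_emb K V M).
Proof.
move=> a m m'; apply: rdual_eq => x.
rewrite -[RHS]/(a * subval (M_emb m) x + subval (M_emb m') x) !M_embE.
exact: (dualM_sc (LM_ev x)).
Qed.

Lemma M_emb_inj : injective (@M_emb K V M).
Proof.
move=> m m' e; apply: functional_eq => f sf.
pose mu : N := mkdual f.
have muE x : subval mu x = f x by rewrite /mu /mkdual tosubK//; apply: span_gen.
have := congr1 (fun phi : XD => subval phi (LM_top mu)) e.
by rewrite /= !M_embE !LM_ev_top !muE.
Qed.

Lemma M_emb_grade (m : M) : @pc_grade _ _ P 0 (M_emb m).
Proof. by case: (M_embP m). Qed.

(** The functionals all of whose transposed words restrict, in degree $0$, to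
    elements of $M$. *)
Definition word_stable : set P := [set n | forall hs : seq (hatV V * int),
  (forall h, h \in hs -> hat_grade h.2 h.1) ->
  exists m : M, forall mu : N, subval n (LM_word [seq h.1 | h <- hs] mu) = subval mu m].

Lemma word_stable_ss : is_subspace word_stable.
Proof.
split=> [hs _|a x y Sx Sy hs Ghs].
  by exists 0 => mu; rewrite (sc0 (dualM_sc mu)).
have [b bP] := Sx hs Ghs; have [c cP] := Sy hs Ghs.
by exists (a *: b + c) => mu; rewrite (dualM_sc mu) -bP -cP.
Qed.

(** A transposed mode prolongs the words by one letter, and the projection to a
    degree keeps or kills a homogeneous word. *)
Lemma word_stableP : stable word_stable.
Proof.
split; first exact: word_stable_ss.
- move=> f k x Sx; move: f.
  have lf : linear (fun f : D => tcontrl (subval f) (@pc_mode _ _ P k x)).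
    move=> a f g; apply: rdual_eq => y; rewrite LMd_transposeE.
    rewrite -[RHS]/(a * subval (tcontrl (subval f) (@pc_mode _ _ P k x)) y
      + subval (tcontrl (subval g) (@pc_mode _ _ P k x)) y) !LMd_transposeE.
    by rewrite (LM_mode_linl k y) (rdual_sc x).
  apply: (grade_ind (@wt_ds _ V) (sub_preim lf word_stable_ss)) => s f fs hs Ghs.
  have [|m mP] := Sx ((hgen f k, s - k - 1) :: hs).
    move=> h; rewrite inE => /orP[/eqP ->|/Ghs //] /=.
    by apply: span_gen; exists s, f, k.
  exists m => mu; rewrite -mP; apply: (etrans (LMd_transposeE f k x _)).
  apply: congr1; exact/esym/LM_word_cons.
- move=> t x Sx hs Ghs.
  have e0 := @LM_word_grade K V M hs _ _ Ghs erefl.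
  have [d0|d0] := boolP (0 <= \sum_(h <- hs) h.2); last first.
    exists 0 => mu; have := e0 mu; rewrite (negPf d0) => ->.
    by rewrite (sc0 (rdual_sc _)) (sc0 (dualM_sc mu)).
  have [et|nt] := eqVneq (absz (\sum_(h <- hs) h.2)) t.
    have [m mP] := Sx hs Ghs; exists m => mu; rewrite -mP (rdual_gprojE (@LM_ds K V M)).
    have := e0 mu; rewrite d0 et => Gw; by rewrite (gproj_id (@LM_ds K V M) Gw).
  exists 0 => mu; rewrite (rdual_gprojE (@LM_ds K V M)) (sc0 (dualM_sc mu)).
  have := e0 mu; rewrite d0 => Gw; rewrite (gproj_0 (@LM_ds K V M) Gw nt).
  exact: (sc0 (rdual_sc x)).
Qed.

Lemma word_stable_emb m : word_stable (M_emb m).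
Proof.
move=> hs Ghs; have [m' mP] := vevM_transpose [seq h.1 | h <- hs] m.
by exists m' => mu; rewrite M_embE LM_ev_word mP.
Qed.

Lemma calW_stable : stable (@calW K V M : set P).
Proof. exact: (stable_smallest aP). Qed.

Lemma calW_emb m : @calW K V M (M_emb m).
Proof. by move=> A [_ MA]; apply: MA; exists m. Qed.

Lemma calW_min (A : set P) : stable A -> (forall m, A (M_emb m)) -> @calW K V M `<=` A.
Proof.
move=> sA MA n Wn; apply: Wn; split; first exact/(admissible_subP aP).
by move=> _ [m _ <-].
Qed.

(** The functionals of [word_stable] form a sub comodule containing $M$, so they
    contain $\mathcal W(M)$; the empty word then gives an element of $M$. *)
Lemma calW_grade0 (n : XD) : calW n -> @pc_grade _ _ P 0 n -> range (@M_emb K V M) n.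
Proof.
move=> Wn n0; have /(_ [::]) [//|m mP] := calW_min word_stableP word_stable_emb Wn.
exists m => //; apply/esym/M_emb_uniq; split=> // mu; exact: mP.
Qed.

Local Notation W := (calW_precomod M).

Lemma calW_admissible : is_admissible W.
Proof. exact: (sub_admissible aP calW_stable). Qed.

Let aW := calW_admissible.
Let dW : direct_sum (@pc_grade _ _ W). Proof. by case: aW. Qed.

Definition W_emb (m : M) : W := tosub (@calW K V M) (M_emb m).

Lemma W_embE m : subval (W_emb m) = M_emb m.
Proof. by rewrite /W_emb tosubK// span_id; [exact: calW_emb|exact: stable_ss calW_stable]. Qed.

Lemma W_emb_lin : linear W_emb.
Proof.
move=> a m m'; apply: subval_inj.
rewrite -[RHS]/(a *: subval (W_emb m) + subval (W_emb m')) !W_embE; exact: M_emb_lin.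
Qed.

Lemma W_emb_inj : injective W_emb.
Proof. by move=> m m' e; apply: M_emb_inj; rewrite -!W_embE e. Qed.

Lemma W_grade0P (x : W) : @pc_grade _ _ W 0 x <-> range W_emb x.
Proof.
split=> [Gx|[m _ <-]]; last by rewrite /pc_grade /= W_embE; exact: M_emb_grade.
have [m _ e] := calW_grade0 (subvalA x (stable_ss calW_stable)) Gx.
by exists m => //; apply: subval_inj; rewrite W_embE.
Qed.

Definition no_top : set (set W) := [set A : set W | is_admissible_sub A /\
      forall x, A x -> range (@M_emb K V M) (subval x) -> x = 0].

Lemma no_top_grade0 A x : no_top A -> A x -> gproj (@pc_grade _ _ W) 0%N x = 0.
Proof.
move=> [/(admissible_subP aW) [_ _ gA] A0] Ax; apply: A0; first exact: gA.
have [m _ <-] := (W_grade0P _).1 (gproj_in dW 0%N x).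
by rewrite W_embE; exists m.
Qed.

Lemma calJ_stable : stable (@calJ K V M).
Proof. by apply: (stable_span aW) => A [/(admissible_subP aW)]. Qed.

(** A sub comodule is graded and its degree $0$ part lies in $M$, so those that
    meet $M$ trivially have no degree $0$ part, and neither has their sum. *)
Lemma calJ_grade0 x : calJ x -> gproj (@pc_grade _ _ W) 0%N x = 0.
Proof.
apply: (span_sub (sub_ker (gproj_lin dW 0%N))) => y [A nA Ay]; exact: no_top_grade0 nA Ay.
Qed.

Lemma calJ_cap x : calJ x -> range (@M_emb K V M) (subval x) -> x = 0.
Proof.
move=> Jx [m _ e]; rewrite -(calJ_grade0 Jx) (gproj_id dW)//.
by rewrite /pc_grade /= -e; exact: M_emb_grade.
Qed.

(** In $\mathcal W(M)$, meeting $M$ trivially means having no degree $0$ part. *)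
Lemma calJ_max (A : set W) : stable A ->
  (forall x, A x -> @pc_grade _ _ W 0 x -> x = 0) -> A `<=` @calJ K V M.
Proof.
move=> sA A0 x Ax; apply: span_gen; exists A => //; split; first exact/(admissible_subP aW).
move=> y Ay [m _ e]; apply: A0 => //; rewrite /pc_grade /= -e; exact: M_emb_grade.
Qed.

Local Notation L := (calL M).

Lemma calL_admissible : is_admissible L.
Proof. exact: (quot_admissible aW calJ_stable). Qed.

Let aL := calL_admissible.
Let dL : direct_sum (@pc_grade _ _ L). Proof. by case: aL. Qed.

Lemma calL_cls_hom : @is_comod_hom K V W L (cls (@calJ K V M)).
Proof. exact: (cls_hom aW calJ_stable). Qed.

Lemma calL_unit_lin : linear (@calL_unit K V M).
Proof. exact: (lin_comp W_emb_lin (@cls_lin _ _ _)). Qed.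

Lemma calL_unit_inj : injective (@calL_unit K V M).
Proof.
move=> m m' e; apply: W_emb_inj; apply/eqP; rewrite -subr_eq0; apply/eqP.
have /(cls_kernel _ (stable_ss calJ_stable)) J : cls (@calJ K V M) (W_emb m - W_emb m') = 0.
  by rewrite (linB (@cls_lin _ _ _)); apply/eqP; rewrite subr_eq0; apply/eqP; exact: e.
apply: (calJ_cap J); exists (m - m') => //.
by rewrite -W_embE; apply: congr1; exact: (linB W_emb_lin).
Qed.

Lemma calL_unit_range : range (@calL_unit K V M) = @pc_grade _ _ L 0.
Proof.
apply/seteqP; split=> [_ [m _ <-]|_ [x /W_grade0P [m _ <-] <-]]; last by exists m.
by exists (W_emb m) => //; apply/W_grade0P; exists m.
Qed.

(** In degrees $t > 0$ both sides vanish; in degree $0$ both transpose the action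
    of the component of weight $s$ of a functional on the top. *)
Lemma M_emb_omega (m : M) s t :
  tmap (gproj (@grade K V) s) (gproj (@pc_grade _ _ P) t) (tmap id (@M_emb K V M) (cc_coact m)) =
  tmap (gproj (@grade K V) s) (gproj (@pc_grade _ _ P) t) (pc_mode (s - 1) (M_emb m : P)).
Proof.
have ls := gproj_lin (dsV V) s; have lt := gproj_lin dP t.
apply: (@rd_pair_eq K V X (@LM_grade K V M)) => f y.
have sf := rdual_sc f; have sy := @rdual_ev_sc _ _ _ (@LM_grade K V M) y.
apply: (etrans (tpair_tmap _ sf sy ls lt)).
apply/esym; apply: (etrans (tpair_tmap _ sf sy ls lt)); apply/esym.
have -> : (fun v => subval f (gproj (@grade K V) s v)) = subval (rcomp s f) :> (V -> K).
  by apply/funext => v; rewrite (rcompE (dsV V)).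
have -> : (fun w : XD => subval (gproj (@pc_grade _ _ P) t w) y) = ev (gproj (@LM_grade K V M) t y).
  by apply/funext => w; exact: (rdual_gprojE (@LM_ds K V M)).
have fs : wt_space s (rcomp s f) by exact: (rcomp_grade (dsV V)).
rewrite LMd_coactE (tpair_tmap _ (rdual_sc _) (@rdual_ev_sc _ _ _ (@LM_grade K V M) _)
  (@lin_id _ V) M_emb_lin).
have -> : (fun w : M => subval (M_emb w) (gproj (@LM_grade K V M) t y)) =
    subval (LM_ev (gproj (@LM_grade K V M) t y)).
  by apply/funext => w; rewrite M_embE.
rewrite -dactE M_embE.
have [t0|t0] := eqVneq t 0%N.
  have [mu _ e] := (LM_grade0P _).1 (gproj_in (@LM_ds K V M) 0%N y); rewrite t0 -e.
  transitivity (subval (dact (rcomp s f) mu) m).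
    exact: (congr1 (fun nu => subval (dact (rcomp s f) nu) m) (LM_ev_top mu)).
  exact/esym/(congr1 (fun nu : N => subval nu m)
    (etrans (congr1 (@LM_ev K V M) (LM_mode_top mu fs)) (LM_ev_top _))).
have Gy := gproj_in (@LM_ds K V M) t y.
rewrite (LM_ev_grade t0 Gy) (lin0 (dact_linr _)).
rewrite (LM_ev_grade t0 (LM_grade_act (k := s - 1) (t' := t) fs Gy _))//; lia.
Qed.

Lemma calL_Omega : is_Omega (@calL_unit K V M).
Proof.
split; [exact: calL_unit_lin|exact: calL_unit_inj|exact: calL_unit_range|].
move=> m s t.
have gs r (y : W) : @pc_grade _ _ W r y -> @pc_grade _ _ P r (subval y) by [].
have gc r (y : W) : @pc_grade _ _ W r y -> @pc_grade _ _ L r (cls (@calJ K V M) y).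
  by move=> Gy; exists y.
have hW : tmap (gproj (@grade K V) s) (gproj (@pc_grade _ _ W) t) (tmap id W_emb (cc_coact m)) =
    tmap (gproj (@grade K V) s) (gproj (@pc_grade _ _ W) t) (@pc_mode _ _ W (s - 1) (W_emb m)).
  apply: (tmap_inj (@subval_lin K XD (@calW K V M)) (@subval_inj K XD (@calW K V M))).
  have b := @bihomogeneous_morph K V W P (@subval K XD (@calW K V M)) dW dP
    (@subval_lin K XD (@calW K V M)) gs s t.
  apply: (etrans (b _)); apply/esym; apply: (etrans (b _)); apply/esym.
  transitivity (tmap (gproj (@grade K V) s) (gproj (@pc_grade _ _ P) t)
    (tmap id (@M_emb K V M) (cc_coact m))).
    apply: congr1; rewrite (tmap_comp _ (@lin_id _ V) (@lin_id _ V) W_emb_lin (@subval_lin _ _ _)).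
    have -> : @subval K XD (@calW K V M) \o W_emb = @M_emb K V M.
      by apply/funext => w; exact: W_embE.
    by [].
  apply: (etrans (M_emb_omega m s t)); apply: congr1.
  apply: (etrans _ (esym (sub_mode (s - 1) (W_emb m) calW_stable))).
  exact/esym/(congr1 (@pc_mode _ _ P (s - 1)) (W_embE m)).
have b := @bihomogeneous_morph K V W L (cls (@calJ K V M)) dW dL (@cls_lin _ _ _) gc s t.
transitivity (tmap id (cls (@calJ K V M)) (tmap (gproj (@grade K V) s)
  (gproj (@pc_grade _ _ W) t) (tmap id W_emb (cc_coact m)))).
  apply/esym; apply: (etrans (b _)); apply: congr1.
  exact: (tmap_comp _ (@lin_id _ V) (@lin_id _ V) W_emb_lin (@cls_lin _ _ _)).
rewrite hW; apply: (etrans (b _)); apply: congr1.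
by case: calL_cls_hom => _; exact.
Qed.

End Functor.

(** * Functoriality *)

Section MorphismMaps.
Variables (K : numFieldType) (V : gvoc K) (M1 M2 : ccomod V) (psi : M1 -> M2).
Hypothesis hom : is_ccomod_hom psi.
Local Notation D := (dualV V).
Local Notation dm := (@dual_map K V M1 M2 psi).
Local Notation im := (@ind_map K V M1 M2 psi).
Local Notation lm := (@LM_map K V M1 M2 psi).
Local Notation P1 := (LMd_precomod M1).
Local Notation P2 := (LMd_precomod M2).

Let lpsi : linear psi. Proof. by case: hom. Qed.

Lemma dual_map_lin : linear dm.
Proof.
move=> a mu nu; apply: dualM_eq => m.
rewrite -[RHS]/(a * subval (dm mu) m + subval (dm nu) m).
by rewrite !(dual_mapE _ _ lpsi).
Qed.

Lemma dual_map_dact f mu : dm (dact f mu) = dact f (dm mu).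
Proof.
apply: dualM_eq => m; rewrite (dual_mapE _ _ lpsi) !dactE; case: hom => _ <-.
rewrite (tpair_tmap _ (rdual_sc f) (dualM_sc mu) (@lin_id _ V) lpsi).
have -> // : (fun w => subval mu (psi w)) = subval (dm mu) :> (M1 -> K).
by apply/funext => w; rewrite (dual_mapE _ _ lpsi).
Qed.

Lemma top_action_dual h n n' : top_action h n n' -> top_action h (dm n) (dm n').
Proof.
case=> [[s [f [fs -> ->]]]|[s [k [f [fs d0 -> ->]]]]].
  by left; exists s, f; split=> //; exact: dual_map_dact.
right; exists s, k, f; split=> //; exact: (lin0 dual_map_lin).
Qed.

Let tl : linear (tmap (@id (env V)) dm) := tmap_linear (@lin_id _ _) dual_map_lin.
Let cl := lin_comp tl (@cls_lin _ _ (@ind_rel K V M1)).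

Let ind_kill z : @ind_rel K V M2 z -> cls (@ind_rel K V M1) (tmap id dm z) = 0.
Proof.
move=> /ind_relE [a [h [n [n' [ta ->]]]]]; apply/cls0P; apply: span_gen.
have e b mu : tmap (@id (env V)) dm (tpure b mu) = tpure b (dm mu).
  exact: (tmap_pure _ _ (@lin_id _ _) dual_map_lin).
have := top_action_rel a (top_action_dual ta).
have -> // : tmap id dm (tpure (emul a (eword [:: h])) n - tpure a n') =
  tpure (emul a (eword [:: h])) (dm n) - tpure a (dm n').
exact: (etrans (linB tl _ _) (congr2 (fun u v => u - v) (e _ _) (e _ _))).
Qed.

Lemma ind_map_lin : linear im.
Proof. exact: (qlift_lin cl ind_kill). Qed.

Lemma ind_map_pure a mu : im (ipure a mu) = ipure a (dm mu).
Proof.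
apply: (etrans (qlift_cls cl ind_kill (tpure a mu))).
exact: (congr1 (cls _) (tmap_pure _ _ (@lin_id _ _) dual_map_lin)).
Qed.

Lemma ind_map_eact a x : im (eact a x) = eact a (im x).
Proof.
move: x; apply: (indM_ind (sub_eq (lin_comp (@eact_linr K V M2 a) ind_map_lin)
  (lin_comp ind_map_lin (@eact_linr K V M1 a)))) => u mu.
apply: (etrans (congr1 im (eact_pure a (eword u) mu))).
apply: (etrans (ind_map_pure _ _)); apply/esym.
exact: (etrans (congr1 (eact a) (ind_map_pure _ _)) (eact_pure _ _ _)).
Qed.

Lemma ind_map_grade d x : ind_grade d x -> ind_grade d (im x).
Proof.
apply: (span_lin ind_map_lin (@span_ss _ _ _)) => _ [hs [mu [Ghs e ->]]].
apply: span_gen; exists hs, (dm mu); split=> //; exact: ind_map_pure.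
Qed.

Let LM_kill x : @ind_rad K V M2 x -> cls (@ind_rad K V M1) (im x) = 0.
Proof.
move=> rx; apply/cls0P; apply: span_gen => phi sphi phi0 a.
rewrite -ind_map_eact; apply: (rx (fun y => phi (im y))).
  by move=> c y y'; rewrite ind_map_lin sphi.
by move=> d d0 y Gy; apply: (phi0 d d0); exact: ind_map_grade.
Qed.

Lemma LM_map_cls x : lm (cls _ x) = cls _ (im x).
Proof. exact: (qlift_cls (lin_comp ind_map_lin (@cls_lin _ _ _)) LM_kill). Qed.

Lemma LM_map_lin : linear lm.
Proof. exact: (qlift_lin (lin_comp ind_map_lin (@cls_lin _ _ _)) LM_kill). Qed.

Lemma LM_map_word u mu : lm (LM_word u mu) = LM_word u (dm mu).
Proof. exact: (etrans (LM_map_cls _) (congr1 _ (ind_map_pure _ _))). Qed.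

Lemma LM_map_mode f k x : lm (LM_mode f k x) = LM_mode f k (lm x).
Proof.
move: x; apply: cls_ind => x.
apply: (etrans (congr1 lm (LM_mode_cls f k x))); apply: (etrans (LM_map_cls _)).
apply/esym; apply: (etrans (congr1 (LM_mode f k) (LM_map_cls x))).
apply: (etrans (LM_mode_cls f k (im x))); apply: congr1.
exact/esym/ind_map_eact.
Qed.

Lemma LM_map_grade t x : LM_grade t x -> LM_grade t (lm x).
Proof.
by move=> [y Gy <-]; rewrite LM_map_cls; exists (im y) => //; exact: ind_map_grade.
Qed.

Lemma LMd_mapE n y : subval (LMd_map psi n) y = subval n (lm y).
Proof.
have [r [_ r0]] := rdual_seq n; rewrite /LMd_map mkrdualE//.
apply: (@rfunctional_seq _ _ _ _ _ r) => [a x x'|t v tr Gv].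
  by rewrite LM_map_lin rdual_sc.
exact: r0 tr (LM_map_grade Gv).
Qed.

Lemma LMd_map_lin : linear (@LMd_map K V M1 M2 psi).
Proof.
move=> a n n'; apply: rdual_eq => y.
rewrite -[RHS]/(a * subval (LMd_map psi n) y + subval (LMd_map psi n') y).
by rewrite !LMd_mapE.
Qed.

Lemma LMd_map_hom : @is_comod_hom K V P1 P2 (@LMd_map K V M1 M2 psi).
Proof.
split=> [|k n]; first exact: LMd_map_lin.
apply: (@rd_pair_eq K V (LM M2) (@LM_grade K V M2)) => f y.
have sf := rdual_sc f; have sy := @rdual_ev_sc _ _ _ (@LM_grade K V M2) y.
apply: (etrans (tpair_tmap _ sf sy (@lin_id _ V) LMd_map_lin)).
have -> : (fun w : LMd M1 => subval (LMd_map psi w) y) = fun w : LMd M1 => subval w (lm y).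
  by apply/funext => w; rewrite LMd_mapE.
apply: (etrans (LMd_coactE k n f (lm y))).
apply/esym; apply: (etrans (LMd_coactE k (LMd_map psi n) f y)).
by rewrite LMd_mapE LM_map_mode.
Qed.

Lemma LMd_map_grade t (n : P1) : pc_grade t n -> @pc_grade _ _ P2 t (LMd_map psi n).
Proof. by move=> nt r rt y Gy; rewrite LMd_mapE; apply: (nt r rt); exact: LM_map_grade. Qed.

Lemma LMd_map_emb m : LMd_map psi (M_emb m) = M_emb (psi m).
Proof.
apply: M_emb_uniq; split; last exact: LMd_map_grade (M_emb_grade m).
move=> mu; rewrite LMd_mapE -(dual_mapE mu m lpsi).
have [<- _] := M_embP m; apply: congr1; exact: (LM_map_word [::] mu).
Qed.

(** The preimage of $\mathcal W(M_2)$ is a sub comodule containing $M_1$. *)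
Lemma LMd_map_W n : calW n -> calW (LMd_map psi n).
Proof.
have sW := stable_preim (LMd_admissible M1) (LMd_admissible M2) LMd_map_hom
  LMd_map_grade (calW_stable M2).
by apply: (calW_min sW) => m; rewrite /mkset LMd_map_emb; exact: calW_emb.
Qed.

Local Notation W1 := (calW_precomod M1).
Local Notation W2 := (calW_precomod M2).

Definition W_map (x : W1) : W2 := tosub (@calW K V M2) (LMd_map psi (subval x)).

Lemma W_mapE x : subval (W_map x) = LMd_map psi (subval x).
Proof.
have sW := stable_ss (calW_stable M2).
rewrite /W_map tosubK// span_id//; apply: LMd_map_W.
exact: (subvalA x (stable_ss (calW_stable M1))).
Qed.

Lemma W_map_lin : linear W_map.
Proof.
move=> a x y; apply: subval_inj.
apply: (etrans (W_mapE _)); apply: (etrans (LMd_map_lin a (subval x) (subval y))).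
exact/esym/(congr2 (fun u v => a *: u + v) (W_mapE x) (W_mapE y)).
Qed.

Lemma W_map_hom : is_comod_hom W_map.
Proof.
split=> [|k x]; first exact: W_map_lin.
have s1 := calW_stable M1; have s2 := calW_stable M2.
apply: (tmap_inj (@subval_lin K (LMd M2) (@calW K V M2)) (@subval_inj K (LMd M2) (@calW K V M2))).
have [_ h] := LMd_map_hom.
apply: (etrans (tmap_square _ (@lin_id _ V) (@lin_id _ V) (@lin_id _ V) (@lin_id _ V)
  W_map_lin (@subval_lin K (LMd M2) (@calW K V M2)) (@subval_lin K (LMd M1) (@calW K V M1))
  LMd_map_lin (fun=> erefl) W_mapE)).
apply: (etrans (congr1 _ (sub_mode k x s1))); apply: (etrans (h _ _)).
by rewrite -W_mapE; apply/esym; exact: (sub_mode k (W_map x) s2).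
Qed.

Lemma W_map_grade t x : @pc_grade _ _ W1 t x -> @pc_grade _ _ W2 t (W_map x).
Proof. by move=> Gx; rewrite /pc_grade /= W_mapE; exact: LMd_map_grade. Qed.

Lemma W_map_emb m : W_map (W_emb m) = W_emb (psi m).
Proof. by apply: subval_inj; rewrite W_mapE !W_embE LMd_map_emb. Qed.

Let dW1 : direct_sum (@pc_grade _ _ W1). Proof. by case: (calW_admissible M1). Qed.
Let dW2 : direct_sum (@pc_grade _ _ W2). Proof. by case: (calW_admissible M2). Qed.

(** The image of the kernel in degree $0$ vanishes since homomorphisms are
    graded; so it lies in the kernel by maximality. *)
Lemma W_map_J x : calJ x -> calJ (W_map x).
Proof.
move=> Jx; have sI := stable_im (calW_admissible M1) (calW_admissible M2) W_map_hom
  W_map_grade (calJ_stable M1).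
have I0 y : (W_map @` @calJ K V M1) y -> @pc_grade _ _ W2 0 y -> y = 0.
  move=> [w Jw <-] G0; rewrite -(gproj_id dW2 G0).
  rewrite -(gproj_morph W_map_lin W_map_grade dW1 dW2) (calJ_grade0 Jw).
  exact: (lin0 W_map_lin).
exact: (calJ_max sI I0 (ex_intro2 _ _ x Jx erefl)).
Qed.

Local Notation L1 := (calL M1).
Local Notation L2 := (calL M2).

Let J_kill x : @calJ K V M1 x -> cls (@calJ K V M2) (W_map x) = 0.
Proof. by move=> Jx; apply/(cls_kernel _ (stable_ss (calJ_stable M2))); exact: W_map_J. Qed.

Lemma calL_map_cls x : calL_map psi (cls _ x) = cls _ (W_map x).
Proof. exact: (qlift_cls (lin_comp W_map_lin (@cls_lin _ _ _)) J_kill). Qed.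

Lemma calL_map_lin : linear (@calL_map K V M1 M2 psi).
Proof. exact: (qlift_lin (lin_comp W_map_lin (@cls_lin _ _ _)) J_kill). Qed.

Lemma calL_map_hom : is_comod_hom (@calL_map K V M1 M2 psi).
Proof.
split=> [|k x]; first exact: calL_map_lin.
move: x; apply: cls_ind => x.
have [_ h1] := calL_cls_hom M1; have [_ h2] := calL_cls_hom M2; have [_ hw] := W_map_hom.
have lid := @lin_id _ V.
apply: (etrans (congr1 _ (esym (h1 k x)))).
apply: (etrans (tmap_square _ lid lid lid lid (@cls_lin _ _ _) calL_map_lin W_map_lin
  (@cls_lin _ _ _) (fun=> erefl) calL_map_cls)).
apply: (etrans (congr1 _ (hw k x))); apply: (etrans (h2 k (W_map x))).
exact: (congr1 _ (esym (calL_map_cls x))).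
Qed.

Lemma calL_map_unit m : calL_map psi (calL_unit m) = calL_unit (psi m).
Proof. exact: (etrans (calL_map_cls _) (congr1 _ (W_map_emb m))). Qed.

End MorphismMaps.

Section Functoriality.
Variables (K : numFieldType) (V : gvoc K).

Lemma LM_word_ind (M : ccomod V) (P : set (LM M)) : is_subspace P ->
  (forall u mu, P (LM_word u mu)) -> forall x, P x.
Proof.
move=> sP Pw; apply: cls_ind; exact: (indM_ind (sub_preim (@cls_lin _ _ _) sP) Pw).
Qed.

Lemma ccomod_hom_id (M : ccomod V) : @is_ccomod_hom K V M M id.
Proof. by split=> // m; rewrite tmap_id. Qed.

Lemma ccomod_hom_comp (M1 M2 M3 : ccomod V) (psi : M1 -> M2) (phi : M2 -> M3) :
  is_ccomod_hom psi -> is_ccomod_hom phi -> is_ccomod_hom (phi \o psi).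
Proof.
move=> [l1 h1] [l2 h2]; split=> [|m]; first exact: lin_comp.
rewrite -(tmap_comp _ (@lin_id _ V) (@lin_id _ V) l1 l2) h1 h2; by [].
Qed.

Lemma LM_map_id (M : ccomod V) x : LM_map (@id M) x = x.
Proof.
have hid := ccomod_hom_id M.
move: x; apply: (LM_word_ind (sub_eq (LM_map_lin hid) (@lin_id _ _))) => u mu.
apply: (etrans (LM_map_word hid u mu)); apply: congr1.
by apply: dualM_eq => m; rewrite dual_mapE.
Qed.

Lemma LM_map_comp (M1 M2 M3 : ccomod V) (psi : M1 -> M2) (phi : M2 -> M3) :
  is_ccomod_hom psi -> is_ccomod_hom phi ->
  forall x, LM_map (phi \o psi) x = LM_map psi (LM_map phi x).
Proof.
move=> h1 h2; have h := ccomod_hom_comp h1 h2; have [l1 _] := h1; have [l2 _] := h2.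
apply: (LM_word_ind (sub_eq (LM_map_lin h) (lin_comp (LM_map_lin h2) (LM_map_lin h1)))) => u mu.
apply: (etrans (LM_map_word h u mu)).
apply: (etrans _ (esym (etrans (congr1 (LM_map psi) (LM_map_word h2 u mu)) (LM_map_word h1 u _)))).
apply: congr1; apply: dualM_eq => m.
by rewrite (dual_mapE _ _ (lin_comp l1 l2)) (dual_mapE _ _ l1) (dual_mapE _ _ l2).
Qed.

Lemma calL_map_id (M : ccomod V) x : calL_map (@id M) x = x.
Proof.
move: x; apply: cls_ind => x; apply: (etrans (calL_map_cls (ccomod_hom_id M) x)).
apply: congr1; apply: subval_inj; rewrite (W_mapE (ccomod_hom_id M)); apply: rdual_eq => y.
by rewrite (LMd_mapE (ccomod_hom_id M)) LM_map_id.
Qed.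

Lemma calL_map_comp (M1 M2 M3 : ccomod V) (psi : M1 -> M2) (phi : M2 -> M3) :
  is_ccomod_hom psi -> is_ccomod_hom phi ->
  forall x, calL_map (phi \o psi) x = calL_map phi (calL_map psi x).
Proof.
move=> h1 h2; have h := ccomod_hom_comp h1 h2; apply: cls_ind => x.
apply: (etrans (calL_map_cls h x)).
apply: (etrans _ (esym (etrans (congr1 (calL_map phi) (calL_map_cls h1 x)) (calL_map_cls h2 _)))).
apply: congr1; apply: subval_inj; rewrite (W_mapE h) (W_mapE h2) (W_mapE h1).
apply: rdual_eq => y.
by rewrite (LMd_mapE h) (LMd_mapE h2) (LMd_mapE h1) (LM_map_comp h1 h2).
Qed.

Lemma construction_well_defined : calL_well_defined V.
Proof.
split.
- by move=> M k n f y; exact: LMd_coactE.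
- exact: M_embP.
- move=> M; exact/(admissible_subP (LMd_admissible M))/calW_stable.
- move=> M; exact/(admissible_subP (calW_admissible M))/calJ_stable.
- exact: calJ_cap.
- by move=> M1 M2 psi hom a mu; exact: ind_map_pure.
- by move=> M1 M2 psi hom x; exact: LM_map_cls.
- by move=> M1 M2 psi hom n y; exact: LMd_mapE.
- by move=> M1 M2 psi hom n; exact: LMd_map_W.
- by move=> M1 M2 psi hom x; exact: W_map_J.
Qed.

End Functoriality.

(** * Simple objects *)

Section Simplicity.
Variables (K : numFieldType) (V : gvoc K) (M : ccomod V).
Local Notation P := (LMd_precomod M).
Local Notation W := (calW_precomod M).
Local Notation L := (calL M).

Let dW : direct_sum (@pc_grade _ _ W). Proof. by case: (calW_admissible M). Qed.
Let dL : direct_sum (@pc_grade _ _ L). Proof. by case: (calL_admissible M). Qed.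

Section Sub.
Variable A : set L.
Hypothesis sA : stable A.

(** By the description of $\Omega$ the components of the coaction of [m] are
    components of modes of its image, whose right factors stay in [A]. *)
Lemma top_subcomodule m : A (calL_unit m) ->
  tsub (CV V) [set m : M | A (calL_unit m)] (cc_coact m).
Proof.
move=> Am; have [ssA cA gA] := sA.
apply: (tsub_crit (sub_preim (@calL_unit_lin K V M) ssA) (cc_range m)) => f sf.
rewrite /mkset; have -> : calL_unit (tcontrl f (cc_coact m)) =
    tcontrl f (tmap id (@calL_unit K V M) (cc_coact m)).
  exact/esym/(tcontrl_tmap _ sf (@lin_id _ V) (@calL_unit_lin K V M)).
have [S [T ->]] := tens_proj_sum (dsV V) dL (tmap id (@calL_unit K V M) (cc_coact m)).
rewrite (lin_sum (tcontrl_linear sf)); apply: (ss_sum ssA) => s _.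
rewrite (lin_sum (tcontrl_linear sf)); apply: (ss_sum ssA) => t _.
have [_ _ _ ->] := calL_Omega M.
have ls := gproj_lin (dsV V) s.
rewrite (tcontrl_tmap _ sf ls (gproj_lin dL t)); apply: gA.
have Am' := stable_tsub (s - 1) sA Am.
by apply: ((tsubTP _ ssA).1 Am') => a x y; rewrite ls sf.
Qed.

Let pre_stable : stable [set w : W | A (cls (@calJ K V M) w)].
Proof.
apply: (stable_preim (calW_admissible M) (calL_admissible M) (calL_cls_hom M) _ sA).
by move=> t x Gx; exists x.
Qed.

(** The preimage of [A] in $\mathcal W(M)$ contains the generators. *)
Lemma full_of_top : (forall m, A (calL_unit m)) -> A = setT.
Proof.
move=> AT; apply/seteqP; split=> // x _; move: x; apply: cls_ind => w.
have sI := stable_im (calW_admissible M) (LMd_admissible M) (subval_hom (calW_stable M))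
  (fun t x (Gx : @pc_grade _ _ W t x) => Gx) pre_stable.
have MI m : ((@subval K (LMd M) (@calW K V M)) @` [set w : W | A (cls (@calJ K V M) w)]) (M_emb m).
  by exists (W_emb m); [exact: AT|exact: W_embE].
have [w' Aw' e] := calW_min sI MI (subvalA w (stable_ss (calW_stable M))).
by rewrite -(subval_inj e).
Qed.

(** The preimage of [A] in $\mathcal W(M)$ has no degree $0$ part, so it lies in
    the kernel. *)
Lemma zero_of_top : (forall m, A (calL_unit m) -> m = 0) -> A = [set 0].
Proof.
move=> A0; apply/seteqP; split=> [x|_ ->]; last exact: (ss0 (stable_ss sA)).
move: x; apply: cls_ind => w Aw; apply/(cls_kernel _ (stable_ss (calJ_stable M))).
apply: (calJ_max pre_stable) Aw => x Ax /W_grade0P [m _ e].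
rewrite -e (A0 m) ?(lin0 (@W_emb_lin K V M))//.
by move: Ax; rewrite /mkset -e.
Qed.

End Sub.

Lemma calL_simple : is_simple_ccomod M -> is_simple_comod L.
Proof.
move=> simM A /(admissible_subP (calL_admissible M)) sA.
have ss := sub_preim (@calL_unit_lin K V M) (stable_ss sA).
have [e|e] := simM _ ss (fun m => @top_subcomodule A sA m).
  left; apply: (zero_of_top sA) => m Am.
  have : [set m : M | A (calL_unit m)] m by [].
  by rewrite e.
right; apply: (full_of_top sA) => m.
have : [set: M] m by []; by rewrite -e.
Qed.

End Simplicity.

Theorem proposition6p3 (R : realType) (V : gvoc R[i])
    (Hc : ~ (grade V 0 `<=` [set v | counit V v = 0]))
    (Hrho : ~ (grade V 2 `<=` [set v | rho V v = 0]))
    (HCV : fin_dim (CV V)) :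
  [/\ (* the construction makes sense, and yields admissible comodules *)
      calL_well_defined V /\
        (forall M : ccomod V, is_admissible (calL M)),
      (* functoriality *)
      [/\ (forall (M1 M2 : ccomod V) (psi : M1 -> M2),
            is_ccomod_hom psi -> is_comod_hom (calL_map psi)),
          (forall (M : ccomod V) (x : calL M), calL_map (@id M) x = x) &
          (forall (M1 M2 M3 : ccomod V) (psi : M1 -> M2) (phi : M2 -> M3),
            is_ccomod_hom psi -> is_ccomod_hom phi ->
            forall x, calL_map (phi \o psi) x = calL_map phi (calL_map psi x))],
      (* Omega \o L = Id, on objects and on morphisms *)
      (forall M : ccomod V, is_Omega (@calL_unit _ V M)) /\
        (forall (M1 M2 : ccomod V) (psi : M1 -> M2), is_ccomod_hom psi ->
          forall m, calL_map psi (calL_unit m) = calL_unit (psi m)) &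
      (forall M : ccomod V, is_simple_ccomod M -> is_simple_comod (calL M))].
Proof.
split.
- by split; [exact: construction_well_defined|exact: calL_admissible].
- split; [by move=> M1 M2 psi hom; exact: calL_map_hom|exact: calL_map_id|].
  by move=> M1 M2 M3 psi phi h1 h2; exact: calL_map_comp.
- split; first exact: calL_Omega.
  by move=> M1 M2 psi hom m; exact: calL_map_unit.
- exact: calL_simple.
Qed.
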